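(* Let $\gamma,\omega\in\mathbb R$, $\beta\in\mathbb C$ and $L\in\mathbb R$, and consider $$\partial_t u=(1+i\gamma)\partial_x^2u+\beta u-(1+i\omega)u|u|^2+L\partial_x^3u$$ for complex-valued $u$ on $\mathbb R$, $2\pi$-periodic in $x$. This equation is well-posed in every $H^s$, $s\ge0$, and its solutions satisfy the dissipative estimate $$\|u(t)\|_{H^s}\le Q_s(\|u_0\|_{H^s})e^{-\kappa t}+C_*,$$ where the monotone function $Q_s$ and positive constants $\kappa,C_*$ depend on $s$ but are independent of $L$ as $L\to\infty$. Moreover, the smoothing property $$\|u(t)\|_{H^s}\le (1+t^{-N_s})\tilde Q_s(\|u_0\|_H),\quad t>0,$$ holds with a monotone function $\tilde Q_s$ and constant $N_s$ uniform with respect to $L$ as $L\to\infty$. Finally, for any two solutions $u_1,u_2$, $$\|u_1(t)-u_2(t)\|_H\le e^{Kt}\|u_1(0)-u_2(0)\|_H,$$ where $K$ depends on the $H$-norms of $u_i(0)$ but is independent of $L$ and $t$.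
   Context: $H=L^2_{per}(-\pi,\pi)$ is the space of complex-valued $2\pi$-periodic square-integrable functions, $H^s$ the periodic Sobolev spaces with $\|v\|_{H^s}^2=\sum_n(|n|^2+1)^s|v_n|^2$ for $v=\sum_n v_ne^{inx}$ (so $\|v\|_H^2=\sum_n|v_n|^2$). *)

(* Defs.v *)
From Stdlib Require Import Reals ZArith.
From Coquelicot Require Import Coquelicot.
Open Scope R_scope.

(** Elements of H^s are represented by their Fourier coefficient sequences
    v : Z -> C  (v = sum_n v_n e^{inx}). *)

Definition zfold (a : Z -> R) (k : nat) : R :=
  match k with
  | O => a 0%Z
  | S _ => a (Z.of_nat k) + a (- Z.of_nat k)%Z
  end.

Definition Hs_weight (s : R) (n : Z) : R := Rpower (IZR n ^ 2 + 1) s.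

Definition Hs_terms (s : R) (v : Z -> C) : Z -> R :=
  fun n => Hs_weight s n * (Cmod (v n)) ^ 2.

Definition in_Hs (s : R) (v : Z -> C) : Prop := ex_series (zfold (Hs_terms s v)).

(** ||v||_{H^s} (meaningful only when in_Hs s v) *)
Definition Hs_norm (s : R) (v : Z -> C) : R := sqrt (Series (zfold (Hs_terms s v))).

Definition seq_sub (a b : Z -> C) : Z -> C := fun n => Cminus (a n) (b n).

Definition fcoef (f : R -> C) (n : Z) : C :=
  scal (V := C_R_NormedModule) (/ (2 * PI)) (RInt (V := C_R_CompleteNormedModule) (fun x => Cmult (f x) (cos (IZR n * x), - sin (IZR n * x))) (- PI) PI).

Definition classical_solution (gamma omega : R) (beta : C) (L : R)
    (u : R -> R -> C) : Prop :=
  exists ut ux uxx uxxx : R -> R -> C,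
  forall t x, 0 < t ->
    u t (x + 2 * PI) = u t x /\
    is_derive (V := C_R_NormedModule) (fun s => u s x) t (ut t x) /\
    is_derive (V := C_R_NormedModule) (fun y => u t y) x (ux t x) /\
    is_derive (V := C_R_NormedModule) (fun y => ux t y) x (uxx t x) /\
    is_derive (V := C_R_NormedModule) (fun y => uxx t y) x (uxxx t x) /\
    continuous (fun p : R * R => u (fst p) (snd p)) (t, x) /\
    continuous (fun p : R * R => ut (fst p) (snd p)) (t, x) /\
    continuous (fun p : R * R => ux (fst p) (snd p)) (t, x) /\
    continuous (fun p : R * R => uxx (fst p) (snd p)) (t, x) /\
    continuous (fun p : R * R => uxxx (fst p) (snd p)) (t, x) /\
    ut t x =
      Cplus (Cplus (Cplus
        (Cmult (1, gamma) (uxx t x))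
        (Cmult beta (u t x)))
        (Copp (Cmult (1, omega) (Cmult (u t x) (RtoC (Cmod (u t x) ^ 2))))))
        (Cmult (RtoC L) (uxxx t x)).

Definition traj (u : R -> R -> C) (u0 : Z -> C) (t : R) : Z -> C :=
  if Rle_dec t 0 then u0 else fcoef (u t).

Definition H_trace (u : R -> R -> C) (u0 : Z -> C) : Prop :=
  forall eps, 0 < eps -> exists delta, 0 < delta /\
    forall t, 0 < t < delta ->
      in_Hs 0 (seq_sub (fcoef (u t)) u0) /\
      Hs_norm 0 (seq_sub (fcoef (u t)) u0) < eps.

Definition solution (gamma omega : R) (beta : C) (L : R)
    (u : R -> R -> C) (u0 : Z -> C) : Prop :=
  in_Hs 0 u0 /\ classical_solution gamma omega beta L u /\ H_trace u u0.

Definition cont_Hs (s : R) (u : R -> R -> C) (u0 : Z -> C) : Prop :=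
  forall t0, 0 <= t0 -> forall eps, 0 < eps -> exists delta, 0 < delta /\
    forall t, 0 <= t -> Rabs (t - t0) < delta ->
      in_Hs s (seq_sub (traj u u0 t) (traj u u0 t0)) /\
      Hs_norm s (seq_sub (traj u u0 t) (traj u u0 t0)) < eps.

Definition nondecr (Q : R -> R) : Prop := forall a b, 0 <= a <= b -> Q a <= Q b.

(* Main.v *)
(** All estimates are made on Fourier coefficients a_n(t). There the dispersive term only adds the
    imaginary number - i L n^3 to the symbol, so it drops out of every energy identity and every
    constant is uniform in L.

    In H the cubic term is dissipative up to its imaginary part: its real pairing with u is the mean
    of |u|^4, at least |u|_H^4, which gives an absorbing ball. With E_s the squared H^s norm, the tame
    product estimate |(|u|^2 u)|_s <= C |u|_s |a|_(l^1)^2, the bound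
    |a|_(l^1)^2 <= 5 (E_0 / h + h E_1) for 0 < h <= 1 and the pointwise interpolation
    E_1 E_s <= 2 E_0 E_(s+1) combine, for a suitable h, into
    E_s' <= - E_(s+1) + C(s, sup E_0) E_s. This yields growth at most exponential on bounded times,
    and, applied to (t - t0)^k E_s, smoothing from H to H^s; together with the absorbing ball it gives
    the dissipative estimate. The difference of two solutions is controlled in H in the same way,
    since the pairing of the cubic difference with v is at most C (|u|_H^2 + |w|_H^2) |v|_(l^1)^2.

    Solutions with finitely many nonzero initial coefficients come from a Picard iteration for an
    equation with clamped coefficients, made unclamped by the a priori bounds; data in H are reached
    by the Lipschitz estimate. A general solution takes its data only in the sense of H, so its H^s
    bounds down to t = 0 are transferred from the constructed solution by uniqueness. *)

Require Import Defs.
From Stdlib Require Import Reals ZArith Lra Lia FunctionalExtensionality ClassicalEpsilon.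
From Coquelicot Require Import Coquelicot.
Open Scope R_scope.

(** * Sums over the integers *)

(** Infinite sums are never differentiated in the energy estimates. Each estimate is made for the
    sum over |n| <= K, where the missing modes cause an error; spare decay of the coefficients makes
    this error tend to 0 uniformly in time, and K goes to infinity only after Gronwall. Hence
    regularity must precede the estimates, and [decay2], boundedness of (n^2 + 1) a_n, is its entry
    point: it holds locally in t > 0 for a classical solution, whose u and u_xx are bounded on
    rectangles; it is stable under convolution, so the Picard iteration can run in it; and the
    damping of the n-th equation upgrades it to every H^s. A second obstacle is continuity in H^s at
    t = 0, where smoothing gives nothing uniform. There the exponential growth factor tends to 1, so
    the norm cannot jump upwards, and together with convergence of each coefficient this forces
    strong convergence (the Radon-Riesz property). *)

Fixpoint zsum (K : nat) (f : Z -> R) : R :=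
  match K with
  | O => f 0%Z
  | S k => zsum k f + (f (Z.of_nat (S k)) + f (- Z.of_nat (S k))%Z)
  end.

Definition zseries (f : Z -> R) : R := Series (zfold f).
(** For nonnegative terms, bounding all symmetric partial sums gives convergence and the estimate of
    the sum at once, so inequalities need no separate summability hypotheses. *)
Definition sum_bound (f : Z -> R) (B : R) : Prop := forall K, zsum K f <= B.
Definition nonneg (f : Z -> R) : Prop := forall n, 0 <= f n.

Lemma zsum_sum_n f K : sum_n (zfold f) K = zsum K f.
Proof.
  induction K as [|K IH]; [now rewrite sum_O|].
  rewrite sum_Sn, IH. reflexivity.
Qed.

Lemma zsum_ext_le K f g :
  (forall n, (Z.abs n <= Z.of_nat K)%Z -> f n = g n) -> zsum K f = zsum K g.
Proof.
  induction K as [|K IH]; intros H; cbn [zsum]; [apply H; lia|].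
  rewrite IH by (intros; apply H; lia). rewrite !H by lia. reflexivity.
Qed.

Lemma zsum_ext K f g : (forall n, f n = g n) -> zsum K f = zsum K g.
Proof. intros H; apply zsum_ext_le; auto. Qed.

Lemma zsum_plus K f g : zsum K (fun n => f n + g n) = zsum K f + zsum K g.
Proof. induction K as [|K IH]; simpl; [ring|rewrite IH; ring]. Qed.

Lemma zsum_minus K f g : zsum K (fun n => f n - g n) = zsum K f - zsum K g.
Proof. induction K as [|K IH]; simpl; [ring|rewrite IH; ring]. Qed.

Lemma zsum_scal K c f : zsum K (fun n => c * f n) = c * zsum K f.
Proof. induction K as [|K IH]; simpl; [ring|rewrite IH; ring]. Qed.

Lemma zsum_opp K f : zsum K (fun n => - f n) = - zsum K f.
Proof. induction K as [|K IH]; simpl; [ring|rewrite IH; ring]. Qed.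

Lemma zsum_zero K : zsum K (fun _ => 0) = 0.
Proof. induction K as [|K IH]; simpl; [ring|rewrite IH; ring]. Qed.

Lemma zsum_le_in K f g :
  (forall n, (Z.abs n <= Z.of_nat K)%Z -> f n <= g n) -> zsum K f <= zsum K g.
Proof.
  induction K as [|K IH]; intros H; cbn [zsum]; [apply H; lia|].
  assert (zsum K f <= zsum K g) by (apply IH; intros; apply H; lia).
  pose proof (H (Z.of_nat (S K)) ltac:(lia)).
  pose proof (H (- Z.of_nat (S K))%Z ltac:(lia)). lra.
Qed.

Lemma zsum_le K f g : (forall n, f n <= g n) -> zsum K f <= zsum K g.
Proof. intros; apply zsum_le_in; auto. Qed.

Lemma zsum_nonneg K f : nonneg f -> 0 <= zsum K f.
Proof. intros H. rewrite <- (zsum_zero K). apply zsum_le, H. Qed.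

Lemma zsum_mono K K' f : nonneg f -> (K <= K')%nat -> zsum K f <= zsum K' f.
Proof.
  intros H. induction 1 as [|K' _ IH]; [lra|].
  cbn [zsum]. pose proof (H (Z.of_nat (S K'))). pose proof (H (- Z.of_nat (S K'))%Z). lra.
Qed.

Lemma zsum_term K f n : nonneg f -> (Z.abs n <= Z.of_nat K)%Z -> f n <= zsum K f.
Proof.
  intros H Hn. apply Rle_trans with (zsum (Z.abs_nat n) f).
  - destruct (Z.abs_nat n) eqn:energy; [replace n with 0%Z by lia; simpl; lra|].
    pose proof (zsum_nonneg n0 f H).
    cbn [zsum]. pose proof (H (Z.of_nat (S n0))). pose proof (H (- Z.of_nat (S n0))%Z).
    destruct (Z.le_ge_cases 0 n).
    + replace n with (Z.of_nat (S n0)) in * by lia. lra.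
    + replace n with (- Z.of_nat (S n0))%Z in * by lia. lra.
  - apply zsum_mono; [exact H|lia].
Qed.

Lemma zsum_swap K L (f : Z -> Z -> R) :
  zsum K (fun n => zsum L (fun i => f n i)) = zsum L (fun i => zsum K (fun n => f n i)).
Proof.
  induction K as [|K IH]; [reflexivity|].
  cbn [zsum]. rewrite IH, <- !zsum_plus. reflexivity.
Qed.

Lemma zsum_reflect K f : zsum K (fun n => f (- n)%Z) = zsum K f.
Proof.
  induction K as [|K IH]; [reflexivity|].
  cbn [zsum]. rewrite IH. rewrite Z.opp_involutive. ring.
Qed.

Lemma zsum_succ_shift K f :
  zsum K (fun n => f (n + 1)%Z) = zsum K f + f (Z.of_nat K + 1)%Z - f (- Z.of_nat K)%Z.
Proof.
  induction K as [|K IH]; [simpl; ring|].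
  cbn [zsum]. rewrite IH.
  replace (Z.of_nat (S K)) with (Z.of_nat K + 1)%Z by lia.
  replace (- (Z.of_nat K + 1) + 1)%Z with (- Z.of_nat K)%Z by lia. ring.
Qed.

(** The shifted window [j - K, j + K] lies inside the symmetric window of radius K + j, and the
    surplus terms are nonnegative. *)
Lemma zsum_shift_nat K f j : nonneg f -> zsum K (fun n => f (n + Z.of_nat j)%Z) <= zsum (K + j) f.
Proof.
  revert K f. induction j as [|j IH]; intros K f H.
  - right. rewrite Nat.add_0_r. apply zsum_ext. intros; f_equal; lia.
  - rewrite (zsum_ext K _ (fun n => (fun m => f (m + 1)%Z) (n + Z.of_nat j)%Z))
      by (intros; f_equal; lia).
    eapply Rle_trans; [apply (IH K (fun m => f (m+1)%Z)); intro; apply H|].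
    rewrite zsum_succ_shift. replace (K + S j)%nat with (S (K + j)) by lia. cbn [zsum].
    replace (Z.of_nat (S (K + j))) with (Z.of_nat (K + j) + 1)%Z by lia.
    pose proof (H (- Z.of_nat (K + j))%Z). pose proof (H (- (Z.of_nat (K + j) + 1))%Z). lra.
Qed.

Lemma zsum_shift K f j : nonneg f -> zsum K (fun n => f (n + j)%Z) <= zsum (K + Z.abs_nat j) f.
Proof.
  intros H. destruct (Z.le_ge_cases 0 j) as [Hj|Hj].
  - rewrite (zsum_ext K _ (fun n => f (n + Z.of_nat (Z.abs_nat j))%Z)) by (intros; f_equal; lia).
    now apply zsum_shift_nat.
  - rewrite <- zsum_reflect.
    rewrite (zsum_ext K _ (fun n => (fun m => f (- m)%Z) (n + Z.of_nat (Z.abs_nat j))%Z))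
      by (intros; f_equal; lia).
    eapply Rle_trans; [apply (zsum_shift_nat K (fun m => f (- m)%Z)); intro; apply H|].
    right; apply zsum_reflect.
Qed.

Lemma sum_bound_shift f B j : nonneg f -> sum_bound f B -> sum_bound (fun n => f (n + j)%Z) B.
Proof. intros H Hb K. eapply Rle_trans; [now apply zsum_shift|apply Hb]. Qed.

Lemma sum_bound_sub_shift f B j : nonneg f -> sum_bound f B -> sum_bound (fun i => f (j - i)%Z) B.
Proof.
  intros H Hb K. rewrite <- zsum_reflect.
  rewrite (zsum_ext K _ (fun n => f (n + j)%Z)) by (intros; f_equal; lia).
  now apply sum_bound_shift.
Qed.

Lemma sum_bound_ge0 f B : nonneg f -> sum_bound f B -> 0 <= B.
Proof. intros H Hb. eapply Rle_trans; [apply (zsum_nonneg 0 f H)|apply Hb]. Qed.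

Lemma sum_bound_le f g B : (forall n, f n <= g n) -> sum_bound g B -> sum_bound f B.
Proof. intros H Hb K. eapply Rle_trans; [now apply zsum_le|apply Hb]. Qed.

Lemma sum_bound_term f B n : nonneg f -> sum_bound f B -> f n <= B.
Proof.
  intros H Hb. eapply Rle_trans; [apply (zsum_term (Z.abs_nat n)); [exact H|lia]|apply Hb].
Qed.

Lemma sum_bound_weaken f B B' : sum_bound f B -> B <= B' -> sum_bound f B'.
Proof. intros H HB K. specialize (H K). lra. Qed.

Lemma sum_bound_plus f g B B' : sum_bound f B -> sum_bound g B' -> sum_bound (fun n => f n + g n) (B + B').
Proof. intros H H' K. rewrite zsum_plus. specialize (H K). specialize (H' K). lra. Qed.

Lemma sum_bound_scal f c B : 0 <= c -> sum_bound f B -> sum_bound (fun n => c * f n) (c * B).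
Proof. intros Hc H K. rewrite zsum_scal. apply Rmult_le_compat_l; auto. Qed.

Lemma is_lim_zsum_series f : ex_series (zfold f) -> is_lim_seq (fun K => zsum K f) (zseries f).
Proof.
  intros H. eapply is_lim_seq_ext; [intros; apply zsum_sum_n|]. apply Series_correct in H. exact H.
Qed.

Lemma sum_bound_ex_series f B : nonneg f -> sum_bound f B -> ex_series (zfold f).
Proof.
  intros H Hb.
  destruct (ex_finite_lim_seq_incr (fun K => zsum K f) B) as [l Hl].
  - intros K. apply zsum_mono; auto.
  - intros K. apply Hb.
  - exists l. unfold is_series.
    apply (is_lim_seq_ext _ _ l) with (2 := Hl). intros; symmetry; apply zsum_sum_n.
Qed.

Lemma zseries_le_sum_bound f B : nonneg f -> sum_bound f B -> zseries f <= B.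
Proof.
  intros H Hb. pose proof (is_lim_zsum_series f (sum_bound_ex_series f B H Hb)) as L.
  apply (is_lim_seq_le (fun K => zsum K f) (fun _ => B) (zseries f) B Hb L (is_lim_seq_const B)).
Qed.

Lemma ex_series_sum_bound f : nonneg f -> ex_series (zfold f) -> sum_bound f (zseries f).
Proof.
  intros H He K. pose proof (is_lim_zsum_series f He) as L.
  apply (is_lim_seq_incr_compare (fun K => zsum K f)); [exact L|].
  intros; apply zsum_mono; auto.
Qed.

Lemma sum_bound_zseries f B : nonneg f -> sum_bound f B -> sum_bound f (zseries f).
Proof. intros H Hb. apply ex_series_sum_bound; [exact H|eapply sum_bound_ex_series; eauto]. Qed.

Lemma is_lim_zsum f B : nonneg f -> sum_bound f B -> is_lim_seq (fun K => zsum K f) (zseries f).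
Proof. intros H Hb. apply is_lim_zsum_series. eapply sum_bound_ex_series; eauto. Qed.

Lemma ex_series_zfold_abs f g B :
  (forall n, Rabs (f n) <= g n) -> sum_bound g B -> ex_series (zfold f).
Proof.
  intros H Hb.
  assert (Hg : nonneg g) by (intro n; eapply Rle_trans; [apply Rabs_pos|apply H]).
  apply (ex_series_le (zfold f) (zfold g)); [|eapply sum_bound_ex_series; eauto].
  intros [|n]; simpl; [apply H|].
  eapply Rle_trans; [apply Rabs_triang|]. apply Rplus_le_compat; apply H.
Qed.

(** Domination of tails holds between partial sums by induction and survives the limit. With a fixed
    majorant it gives convergence uniform in a parameter. *)
Lemma zseries_tail f g B K :
  (forall n, Rabs (f n) <= g n) -> sum_bound g B -> Rabs (zseries f - zsum K f) <= zseries g - zsum K g.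
Proof.
  intros H Hb.
  assert (Hg : nonneg g) by (intro n; eapply Rle_trans; [apply Rabs_pos|apply H]).
  pose proof (is_lim_zsum_series f (ex_series_zfold_abs f g B H Hb)) as L.
  pose proof (is_lim_zsum g B Hg Hb) as L'.
  assert (HK : forall K', (K <= K')%nat -> Rabs (zsum K' f - zsum K f) <= zsum K' g - zsum K g).
  { induction 1 as [|K' _ IH]; [rewrite !Rminus_diag, Rabs_R0; lra|].
    cbn [zsum]. pose proof (H (Z.of_nat (S K'))). pose proof (H (- Z.of_nat (S K'))%Z).
    set (x := f (Z.of_nat (S K'))) in *. set (y := f (- Z.of_nat (S K'))%Z) in *.
    replace (zsum K' f + (x + y) - zsum K f) with ((zsum K' f - zsum K f) + (x + y)) by ring.
    pose proof (Rabs_triang (zsum K' f - zsum K f) (x + y)). pose proof (Rabs_triang x y). lra. }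
  apply Rabs_le_between. split.
  - assert (Q : Rbar_le (zsum K f - (zseries g - zsum K g)) (zseries f)).
    { apply (is_lim_seq_le_loc (fun K' => zsum K f - (zsum K' g - zsum K g)) (fun K' => zsum K' f)).
      - exists K. intros K' HK'. pose proof (HK K' HK') as Q. apply Rabs_le_between in Q. lra.
      - apply is_lim_seq_minus'; [apply is_lim_seq_const|].
        apply is_lim_seq_minus'; [exact L'|apply is_lim_seq_const].
      - exact L. }
    simpl in Q. lra.
  - assert (Q : Rbar_le (zseries f) (zsum K f + (zseries g - zsum K g))).
    { apply (is_lim_seq_le_loc (fun K' => zsum K' f) (fun K' => zsum K f + (zsum K' g - zsum K g))).
      - exists K. intros K' HK'. pose proof (HK K' HK') as Q. apply Rabs_le_between in Q. lra.
      - exact L.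
      - apply is_lim_seq_plus'; [apply is_lim_seq_const|].
        apply is_lim_seq_minus'; [exact L'|apply is_lim_seq_const]. }
    simpl in Q. lra.
Qed.

Lemma zsum_CS K f g :
  (zsum K (fun n => f n * g n))² <= zsum K (fun n => (f n)²) * zsum K (fun n => (g n)²).
Proof.
  set (a := zsum K (fun n => (f n)²)). set (b := zsum K (fun n => f n * g n)).
  set (c := zsum K (fun n => (g n)²)).
  assert (Hq : forall x, 0 <= a * x² + 2 * b * x + c).
  { intros x. replace (a * x² + 2 * b * x + c) with (zsum K (fun n => (f n * x + g n)²)).
    - apply zsum_nonneg. intro; apply Rle_0_sqr.
    - unfold a, b, c. rewrite (Rmult_comm _ (x²)), <- zsum_scal.
      replace (2 * zsum K (fun n => f n * g n) * x) with (2 * x * zsum K (fun n => f n * g n)) by ring.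
      rewrite <- zsum_scal, <- !zsum_plus. apply zsum_ext. intros; unfold Rsqr; ring. }
  assert (Ha : 0 <= a) by (apply zsum_nonneg; intro; apply Rle_0_sqr).
  assert (Hc : 0 <= c) by (apply zsum_nonneg; intro; apply Rle_0_sqr).
  (* When a = 0 the quadratic is affine and stays nonnegative only if b = 0: the chosen point would
     give it the value -1. Otherwise it is evaluated at its minimum -b / a. *)
  destruct (Req_dec a 0) as [energy|energy].
  - destruct (Req_dec b 0) as [Eb|Eb]; [rewrite Eb; unfold Rsqr; nra|].
    pose proof (Hq (- (c + 1) / (2 * b))) as H. rewrite energy in H.
    replace (0 * (- (c + 1) / (2 * b))² + 2 * b * (- (c + 1) / (2 * b)) + c) with (-1) in H
      by (field; exact Eb). lra.
  - pose proof (Hq (- b / a)) as H.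
    replace (a * (- b / a)² + 2 * b * (- b / a) + c) with ((a * c - b²) / a) in H
      by (unfold Rsqr; field; exact energy).
    apply Rnot_lt_le; intro Hn.
    assert (0 < a) by lra.
    assert ((a * c - b²) / a < 0) by (apply Rdiv_neg_pos; lra). lra.
Qed.

(** Cauchy-Schwarz for the measure with masses f n: split f g into sqrt f and sqrt f g. *)
Lemma zsum_CS_weight K f g :
  nonneg f -> (zsum K (fun n => f n * g n))² <= zsum K f * zsum K (fun n => f n * (g n)²).
Proof.
  intros Hf.
  rewrite (zsum_ext K (fun n => f n * g n) (fun n => sqrt (f n) * (sqrt (f n) * g n))).
  - eapply Rle_trans; [apply zsum_CS|]. right. f_equal; apply zsum_ext; intro n.
    + apply Rsqr_sqrt, Hf.
    + unfold Rsqr. replace (sqrt (f n) * g n * (sqrt (f n) * g n))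
        with (sqrt (f n) * sqrt (f n) * (g n * g n)) by ring. rewrite sqrt_sqrt by apply Hf. ring.
  - intro n. rewrite <- Rmult_assoc, sqrt_sqrt by apply Hf. reflexivity.
Qed.

(** Cauchy-Schwarz with masses x i inside, then exchange of the sums and translation invariance of
    the norm of y. The cutoffs K and I are independent, so that I can tend to infinity while K is
    fixed. *)
Lemma young_l1_l2 x y X Y K I :
  nonneg x -> nonneg y -> sum_bound x X -> sum_bound (fun n => (y n)²) Y ->
  zsum K (fun n => (zsum I (fun i => x i * y (n - i)%Z))²) <= X² * Y.
Proof.
  intros Hx Hy HX HY.
  pose proof (sum_bound_ge0 x X Hx HX) as X0.
  assert (Y0 : 0 <= Y) by (eapply sum_bound_ge0; [|exact HY]; intro; apply Rle_0_sqr).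
  apply Rle_trans with (zsum K (fun n => X * zsum I (fun i => x i * (y (n - i)%Z)²))).
  - apply zsum_le. intro n. eapply Rle_trans; [apply zsum_CS_weight, Hx|].
    apply Rmult_le_compat_r; [|apply HX].
    apply zsum_nonneg; intro; apply Rmult_le_pos; [apply Hx|apply Rle_0_sqr].
  - rewrite zsum_scal, zsum_swap.
    apply Rle_trans with (X * zsum I (fun i => Y * x i)).
    + apply Rmult_le_compat_l; [exact X0|]. apply zsum_le. intro i.
      rewrite zsum_scal, Rmult_comm. apply Rmult_le_compat_r; [apply Hx|].
      apply (sum_bound_shift (fun n => (y n)²) Y (- i)); [intro; apply Rle_0_sqr|exact HY].
    + rewrite zsum_scal. unfold Rsqr. rewrite Rmult_assoc. apply Rmult_le_compat_l; [exact X0|].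
      rewrite Rmult_comm. apply Rmult_le_compat_r; [exact Y0|apply HX].
Qed.

(** This is not the previous lemma with x and y exchanged: the inner cutoff is on i, and i -> n - i
    would move it. Here the masses are y (n - i). *)
Lemma young_l2_l1 x y X Y K I :
  nonneg x -> nonneg y -> sum_bound (fun n => (x n)²) X -> sum_bound y Y ->
  zsum K (fun n => (zsum I (fun i => x i * y (n - i)%Z))²) <= X * Y².
Proof.
  intros Hx Hy HX HY.
  pose proof (sum_bound_ge0 y Y Hy HY) as Y0.
  assert (X0 : 0 <= X) by (eapply sum_bound_ge0; [|exact HX]; intro; apply Rle_0_sqr).
  apply Rle_trans with (zsum K (fun n => Y * zsum I (fun i => (x i)² * y (n - i)%Z))).
  - apply zsum_le. intro n.
    rewrite (zsum_ext I (fun i => x i * y (n - i)%Z) (fun i => y (n - i)%Z * x i)) by (intros; ring).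
    eapply Rle_trans; [apply (zsum_CS_weight I (fun i => y (n - i)%Z) x); intro; apply Hy|].
    rewrite (zsum_ext I (fun i => y (n - i)%Z * (x i)²) (fun i => (x i)² * y (n - i)%Z))
      by (intros; ring).
    apply Rmult_le_compat_r; [|apply sum_bound_sub_shift; auto].
    apply zsum_nonneg; intro; apply Rmult_le_pos; [apply Rle_0_sqr|apply Hy].
  - rewrite zsum_scal, zsum_swap.
    apply Rle_trans with (Y * zsum I (fun i => Y * (x i)²)).
    + apply Rmult_le_compat_l; [exact Y0|]. apply zsum_le. intro i.
      rewrite zsum_scal, Rmult_comm. apply Rmult_le_compat_r; [apply Rle_0_sqr|].
      apply (sum_bound_shift y Y (- i)); auto.
    + rewrite zsum_scal. unfold Rsqr at 2.
      replace (X * (Y * Y)) with (Y * (Y * X)) by ring.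
      apply Rmult_le_compat_l; [exact Y0|]. apply Rmult_le_compat_l; [exact Y0|apply HX].
Qed.

Lemma young_l1_l1 x y X Y K I :
  nonneg x -> nonneg y -> sum_bound x X -> sum_bound y Y ->
  zsum K (fun n => zsum I (fun i => x i * y (n - i)%Z)) <= X * Y.
Proof.
  intros Hx Hy HX HY.
  rewrite zsum_swap. apply Rle_trans with (zsum I (fun i => Y * x i)).
  - apply zsum_le. intro i. rewrite zsum_scal, Rmult_comm.
    apply Rmult_le_compat_r; [apply Hx|]. apply (sum_bound_shift y Y (- i)); auto.
  - rewrite zsum_scal, Rmult_comm. apply Rmult_le_compat_r; [eapply sum_bound_ge0; eauto|apply HX].
Qed.

(** * Weights and the summability of their inverses *)

Definition W (n : Z) : R := IZR n ^ 2 + 1.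

Lemma W_ge1 n : 1 <= W n.
Proof. unfold W. pose proof (pow2_ge_0 (IZR n)). lra. Qed.

Lemma W_pos n : 0 < W n.
Proof. pose proof (W_ge1 n); lra. Qed.

Lemma W_opp n : W (- n) = W n.
Proof. unfold W. rewrite opp_IZR. ring. Qed.

Lemma W_split n i : W n <= 2 * (W i + W (n - i)).
Proof.
  unfold W. rewrite minus_IZR. pose proof (pow2_ge_0 (2 * IZR i - IZR n)).
  nra.
Qed.

(** Comparison with the integral of 1 / (1 + h^2 x^2), whose primitive is atan (h x) / h; each term
    is one mean value theorem. The constant comes from h + 2 atan < 1 + pi <= 5. Keeping h free
    later lets the derivative part of the l1 norm be made small. *)
Lemma sum_bound_resolvent h : 0 < h <= 1 -> sum_bound (fun n => / (1 + h² * IZR n ^ 2)) (5 / h).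
Proof.
  intros [h0 h1] K.
  assert (P : forall n, 0 < 1 + h² * IZR n ^ 2).
  { intros n. pose proof (pow2_ge_0 (IZR n)). pose proof (Rle_0_sqr h). nra. }
  assert (H : zsum K (fun n => / (1 + h² * IZR n ^ 2)) <= 1 + 2 * (atan (h * INR K) / h)).
  { induction K as [|K IH].
    - simpl. rewrite Rmult_0_r, atan_0. right. field. lra.
    - cbn [zsum].
      assert (D : / (1 + h² * IZR (Z.of_nat (S K)) ^ 2) <= (atan (h * INR (S K)) - atan (h * INR K)) / h).
      { destruct (MVT_gen (fun x => atan (h * x)) (INR K) (INR (S K)) (fun x => h / (1 + (h * x)²)))
          as [c [Hc energy]].
        - intros x _. auto_derive; [exact I|]. unfold Rsqr. field.
          pose proof (Rle_0_sqr (h * x)). unfold Rsqr in *. nra.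
        - intros x _. apply continuity_pt_filterlim.
          apply (ex_derive_continuous (fun x => atan (h * x))). auto_derive. exact I.
        - rewrite Rmin_left, Rmax_right in Hc by (rewrite S_INR; lra).
          rewrite energy, S_INR. rewrite <- INR_IZR_INZ.
          pose proof (pos_INR K).
          replace (h / (1 + (h * c)²) * (INR K + 1 - INR K) / h) with (/ (1 + (h * c)²))
            by (field; split; [unfold Rsqr; nra|lra]).
          apply Rinv_le_contravar; [unfold Rsqr; nra|].
          rewrite S_INR in *. unfold Rsqr.
          assert (c ^ 2 <= (INR K + 1) ^ 2) by (apply pow_incr; lra).
          pose proof (Rle_0_sqr h). unfold Rsqr in *. nra. }
      rewrite opp_IZR. replace ((- IZR (Z.of_nat (S K))) ^ 2) with (IZR (Z.of_nat (S K)) ^ 2) by ring.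
      unfold Rdiv in *. lra. }
  pose proof (atan_bound (h * INR K)) as [_ Hb].
  pose proof PI_4.
  eapply Rle_trans; [exact H|].
  apply Rmult_le_reg_r with h; [lra|].
  replace ((1 + 2 * (atan (h * INR K) / h)) * h) with (h + 2 * atan (h * INR K)) by (field; lra).
  replace (5 / h * h) with 5 by (field; lra). lra.
Qed.

Lemma sum_bound_invW : sum_bound (fun n => / W n) 5.
Proof.
  intros K. replace 5 with (5 / 1) by field.
  eapply Rle_trans; [|apply (sum_bound_resolvent 1); lra].
  right. apply zsum_ext. intro n. unfold W. f_equal. unfold Rsqr. ring.
Qed.

(** * Averages over a period and Fourier coefficients *)

Definition rcont (f : R -> R) : Prop := forall x, continuous f x.
(** Continuity, integration and differentiation of complex functions are kept componentwise, which
    reduces them to the real theory; the normed-module versions are met only in bridging lemmas. *)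
Definition ccont (f : R -> C) : Prop := rcont (fun x => fst (f x)) /\ rcont (fun x => snd (f x)).

Lemma rcont_const c : rcont (fun _ => c).
Proof. intro; apply continuous_const. Qed.
Lemma rcont_id : rcont (fun x => x).
Proof. intro; apply continuous_id. Qed.
Lemma rcont_plus f g : rcont f -> rcont g -> rcont (fun x => f x + g x).
Proof. intros H H' x. apply (continuous_plus f g); auto. Qed.
Lemma rcont_opp f : rcont f -> rcont (fun x => - f x).
Proof. intros H x. apply (continuous_opp f); auto. Qed.
Lemma rcont_minus f g : rcont f -> rcont g -> rcont (fun x => f x - g x).
Proof. intros H H' x. apply (continuous_minus f g); auto. Qed.
Lemma rcont_mult f g : rcont f -> rcont g -> rcont (fun x => f x * g x).
Proof. intros H H' x. apply (continuous_mult f g); auto. Qed.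
Lemma rcont_comp f g : rcont f -> rcont g -> rcont (fun x => g (f x)).
Proof. intros H H' x. apply (continuous_comp f g); auto. Qed.
Lemma rcont_pow f n : rcont f -> rcont (fun x => f x ^ n).
Proof.
  intros H. induction n as [|n IH]; simpl; [apply rcont_const|now apply rcont_mult].
Qed.
Lemma rcont_cos : rcont cos.
Proof. intro. apply continuous_cos. Qed.
Lemma rcont_sin : rcont sin.
Proof. intro. apply continuous_sin. Qed.
Lemma rcont_sqrt : rcont sqrt.
Proof. intro. apply continuous_sqrt. Qed.
Lemma rcont_zsum K (f : Z -> R -> R) : (forall n, rcont (f n)) -> rcont (fun x => zsum K (fun n => f n x)).
Proof.
  intros H. induction K as [|K IH]; cbn [zsum]; [apply H|].
  apply rcont_plus; [exact IH|]. apply rcont_plus; apply H.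
Qed.
Lemma rcont_ext f g : (forall x, f x = g x) -> rcont f -> rcont g.
Proof. intros H Hf x. eapply continuous_ext; [exact H|apply Hf]. Qed.

Create HintDb contdb.
#[local] Hint Resolve rcont_const rcont_id rcont_plus rcont_opp rcont_minus rcont_mult rcont_pow rcont_zsum : contdb.

Lemma ccont_const c : ccont (fun _ => c).
Proof. split; apply rcont_const. Qed.
Lemma ccont_plus f g : ccont f -> ccont g -> ccont (fun x => Cplus (f x) (g x)).
Proof. intros [] []; split; simpl; auto with contdb. Qed.
Lemma ccont_minus f g : ccont f -> ccont g -> ccont (fun x => Cminus (f x) (g x)).
Proof. intros [] []; split; unfold Cminus; simpl; auto with contdb. Qed.
Lemma ccont_opp f : ccont f -> ccont (fun x => Copp (f x)).
Proof. intros []; split; simpl; auto with contdb. Qed.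
Lemma ccont_mult f g : ccont f -> ccont g -> ccont (fun x => Cmult (f x) (g x)).
Proof. intros [] []; split; simpl; auto with contdb. Qed.
Lemma ccont_conj f : ccont f -> ccont (fun x => Cconj (f x)).
Proof. intros []; split; simpl; auto with contdb. Qed.
Lemma ccont_RtoC f : rcont f -> ccont (fun x => RtoC (f x)).
Proof. intros; split; simpl; auto with contdb. Qed.
Lemma rcont_Cmod f : ccont f -> rcont (fun x => Cmod (f x)).
Proof.
  intros []. unfold Cmod.
  apply (rcont_comp (fun x => fst (f x) ^ 2 + snd (f x) ^ 2) sqrt); [|apply rcont_sqrt].
  auto with contdb.
Qed.

Definition czsum (K : nat) (f : Z -> C) : C := (zsum K (fun n => fst (f n)), zsum K (fun n => snd (f n))).

Lemma ccont_czsum K (f : Z -> R -> C) : (forall n, ccont (f n)) -> ccont (fun x => czsum K (fun n => f n x)).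
Proof.
  intros H; split; [apply (rcont_zsum K (fun n x => fst (f n x)))|apply (rcont_zsum K (fun n x => snd (f n x)))];
    intro n; [exact (proj1 (H n))|exact (proj2 (H n))].
Qed.

#[local] Hint Resolve ccont_const ccont_plus ccont_minus ccont_opp ccont_mult ccont_conj ccont_RtoC rcont_Cmod ccont_czsum : contdb.

Lemma czsum_0 f : czsum 0 f = f 0%Z.
Proof. unfold czsum; cbn [zsum]. now destruct (f 0%Z). Qed.

Lemma czsum_S K f :
  czsum (S K) f = Cplus (czsum K f) (Cplus (f (Z.of_nat (S K))) (f (- Z.of_nat (S K))%Z)).
Proof. reflexivity. Qed.

Lemma czsum_ext_le K f g :
  (forall n, (Z.abs n <= Z.of_nat K)%Z -> f n = g n) -> czsum K f = czsum K g.
Proof. intros H. unfold czsum. f_equal; apply zsum_ext_le; intros; now rewrite H. Qed.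

Lemma czsum_ext K f g : (forall n, f n = g n) -> czsum K f = czsum K g.
Proof. intros; apply czsum_ext_le; auto. Qed.

Lemma czsum_mult_l K c f : czsum K (fun n => Cmult c (f n)) = Cmult c (czsum K f).
Proof.
  induction K as [|K IH]; [now rewrite !czsum_0|]. rewrite !czsum_S, IH. ring.
Qed.

Lemma czsum_plus K f g : czsum K (fun n => Cplus (f n) (g n)) = Cplus (czsum K f) (czsum K g).
Proof. induction K as [|K IH]; [now rewrite !czsum_0|]. rewrite !czsum_S, IH. ring. Qed.

Lemma czsum_minus K f g : czsum K (fun n => Cminus (f n) (g n)) = Cminus (czsum K f) (czsum K g).
Proof. induction K as [|K IH]; [now rewrite !czsum_0|]. rewrite !czsum_S, IH. ring. Qed.

Lemma czsum_conj K f : Cconj (czsum K f) = czsum K (fun n => Cconj (f n)).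
Proof. unfold czsum, Cconj; simpl. now rewrite zsum_opp. Qed.

Lemma Cmod_czsum K f : Cmod (czsum K f) <= zsum K (fun n => Cmod (f n)).
Proof.
  induction K as [|K IH]; [rewrite czsum_0; apply Rle_refl|].
  rewrite czsum_S. cbn [zsum]. eapply Rle_trans; [apply Cmod_triangle|].
  apply Rplus_le_compat; [exact IH|apply Cmod_triangle].
Qed.

Lemma Cmod_sq z : Cmod z ^ 2 = fst z ^ 2 + snd z ^ 2.
Proof. apply Cmod2_alt. Qed.

Lemma Cmod_le_abs z : Cmod z <= Rabs (fst z) + Rabs (snd z).
Proof.
  pose proof (Cmod_ge_0 z). pose proof (Rabs_pos (fst z)). pose proof (Rabs_pos (snd z)).
  apply Rsqr_incr_0; try lra. rewrite !Rsqr_pow2, Cmod_sq, <- (pow2_abs (fst z)), <- (pow2_abs (snd z)).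
  nra.
Qed.

Lemma Rabs_fst_le z : Rabs (fst z) <= Cmod z.
Proof. apply re_le_Cmod. Qed.
Lemma Rabs_snd_le z : Rabs (snd z) <= Cmod z.
Proof. eapply Rle_trans; [apply Rmax_r|apply Rmax_Cmod]. Qed.

(** * Means over a period, exponentials and Bessel's inequality *)

Definition avg (f : R -> R) : R := / (2 * PI) * RInt f (- PI) PI.
Definition cavg (f : R -> C) : C := (avg (fun x => fst (f x)), avg (fun x => snd (f x))).

Lemma rcont_ex_RInt f a b : rcont f -> ex_RInt f a b.
Proof. intros H. apply (ex_RInt_continuous (V := R_CompleteNormedModule)). intros; apply H. Qed.

Lemma inv2PI_pos : 0 < / (2 * PI).
Proof. pose proof PI_RGT_0. apply Rinv_0_lt_compat. lra. Qed.

Lemma avg_ext_in f g : (forall x, - PI <= x <= PI -> f x = g x) -> avg f = avg g.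
Proof.
  intros H. unfold avg. f_equal. apply RInt_ext. intros x Hx.
  pose proof PI_RGT_0. rewrite Rmin_left, Rmax_right in Hx by lra. apply H; lra.
Qed.

Lemma avg_ext f g : (forall x, f x = g x) -> avg f = avg g.
Proof. intros; apply avg_ext_in; auto. Qed.

Lemma avg_const c : avg (fun _ => c) = c.
Proof.
  unfold avg. rewrite RInt_const. unfold scal; simpl; unfold mult; simpl.
  pose proof PI_RGT_0. field. lra.
Qed.

Lemma avg_plus f g : rcont f -> rcont g -> avg (fun x => f x + g x) = avg f + avg g.
Proof.
  intros Hf Hg. unfold avg. rewrite <- Rmult_plus_distr_l. f_equal.
  apply (RInt_plus (V := R_CompleteNormedModule) f g); now apply rcont_ex_RInt.
Qed.

Lemma avg_scal c f : rcont f -> avg (fun x => c * f x) = c * avg f.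
Proof.
  intros Hf. unfold avg.
  assert (energy : RInt (fun x => c * f x) (- PI) PI = c * RInt f (- PI) PI)
    by (apply (RInt_scal (V := R_CompleteNormedModule) f); now apply rcont_ex_RInt).
  rewrite energy. ring.
Qed.

Lemma avg_opp f : rcont f -> avg (fun x => - f x) = - avg f.
Proof.
  intros Hf. rewrite (avg_ext _ (fun x => -1 * f x)) by (intros; ring).
  rewrite avg_scal by exact Hf. ring.
Qed.

Lemma avg_minus f g : rcont f -> rcont g -> avg (fun x => f x - g x) = avg f - avg g.
Proof.
  intros Hf Hg. unfold Rminus. rewrite avg_plus, avg_opp; auto with contdb.
Qed.

Lemma avg_le f g : rcont f -> rcont g -> (forall x, - PI <= x <= PI -> f x <= g x) -> avg f <= avg g.
Proof.
  intros Hf Hg H. unfold avg. apply Rmult_le_compat_l; [left; apply inv2PI_pos|].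
  pose proof PI_RGT_0.
  apply RInt_le; [lra|now apply rcont_ex_RInt|now apply rcont_ex_RInt|]. intros; apply H; lra.
Qed.

Lemma avg_nonneg f : rcont f -> (forall x, 0 <= f x) -> 0 <= avg f.
Proof.
  intros Hf H. rewrite <- (avg_const 0). apply avg_le; auto with contdb.
Qed.

Lemma avg_zsum K (f : Z -> R -> R) :
  (forall n, rcont (f n)) -> avg (fun x => zsum K (fun n => f n x)) = zsum K (fun n => avg (f n)).
Proof.
  intros H. induction K as [|K IH]; cbn [zsum]; [reflexivity|].
  rewrite avg_plus, IH; [|now apply rcont_zsum|now apply rcont_plus]. now rewrite avg_plus.
Qed.

Lemma cavg_ext f g : (forall x, f x = g x) -> cavg f = cavg g.
Proof. intros H. unfold cavg. f_equal; apply avg_ext; intros; now rewrite H. Qed.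

Lemma cavg_plus f g : ccont f -> ccont g -> cavg (fun x => Cplus (f x) (g x)) = Cplus (cavg f) (cavg g).
Proof. intros [] []. unfold cavg; simpl. rewrite !avg_plus; auto. Qed.

Lemma cavg_mult_l c f : ccont f -> cavg (fun x => Cmult c (f x)) = Cmult c (cavg f).
Proof.
  intros []. unfold cavg; simpl. rewrite avg_minus, avg_plus, !avg_scal; auto with contdb.
Qed.

Lemma cavg_minus f g : ccont f -> ccont g -> cavg (fun x => Cminus (f x) (g x)) = Cminus (cavg f) (cavg g).
Proof.
  intros [] []. unfold cavg, Cminus; simpl. rewrite !avg_plus, !avg_opp; auto with contdb.
Qed.

Lemma cavg_RtoC f : cavg (fun x => RtoC (f x)) = RtoC (avg f).
Proof. unfold cavg, RtoC; simpl. now rewrite avg_const. Qed.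

Lemma cavg_czsum K (f : Z -> R -> C) :
  (forall n, ccont (f n)) -> cavg (fun x => czsum K (fun n => f n x)) = czsum K (fun n => cavg (f n)).
Proof.
  intros H. unfold cavg, czsum; simpl.
  rewrite (avg_zsum K (fun n x => fst (f n x))), (avg_zsum K (fun n x => snd (f n x))).
  - reflexivity.
  - intro n; exact (proj2 (H n)).
  - intro n; exact (proj1 (H n)).
Qed.

(** Rotation: multiplying f by the conjugate of its mean c makes the mean equal to |c|^2, which is
    then the mean of a real part at most |c| |f|. *)
Lemma Cmod_cavg f : ccont f -> Cmod (cavg f) <= avg (fun x => Cmod (f x)).
Proof.
  intros Hf. set (c := cavg f).
  destruct (Req_dec (Cmod c) 0) as [energy|energy].
  { rewrite energy. apply avg_nonneg; auto with contdb. intro; apply Cmod_ge_0. }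
  assert (H : Cmod c * Cmod c <= Cmod c * avg (fun x => Cmod (f x))).
  { replace (Cmod c * Cmod c) with (fst (cavg (fun x => Cmult (Cconj c) (f x)))).
    - unfold cavg; simpl fst. rewrite <- avg_scal by auto with contdb.
      destruct Hf as [Hf1 Hf2].
      apply avg_le; auto 7 with contdb.
      { apply rcont_mult; [apply rcont_const|]. apply rcont_Cmod. split; auto. }
      intros x _. rewrite <- (Cmod_conj c), <- Cmod_mult.
      eapply Rle_trans; [apply Rle_abs|]. apply (Rabs_fst_le (Cmult (Cconj c) (f x))).
    - rewrite cavg_mult_l by exact Hf. fold c.
      replace (Cmod c * Cmod c) with (Cmod c ^ 2) by ring. rewrite Cmod_sq. simpl. ring. }
  pose proof (Cmod_ge_0 c). apply Rmult_le_reg_l with (Cmod c); lra.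
Qed.

Lemma Cmod_cavg_bound f B : ccont f -> (forall x, Cmod (f x) <= B) -> Cmod (cavg f) <= B.
Proof.
  intros Hf H. eapply Rle_trans; [now apply Cmod_cavg|]. rewrite <- (avg_const B).
  apply avg_le; auto with contdb.
Qed.

Definition expi (n : Z) (x : R) : C := (cos (IZR n * x), sin (IZR n * x)).

Lemma ccont_expi n : ccont (expi n).
Proof.
  split; simpl; [apply (rcont_comp (fun x => IZR n * x) cos)|apply (rcont_comp (fun x => IZR n * x) sin)];
    auto using rcont_cos, rcont_sin with contdb.
Qed.
#[local] Hint Resolve ccont_expi : contdb.

Lemma Cmod_expi n x : Cmod (expi n x) = 1.
Proof.
  unfold Cmod, expi; simpl fst; simpl snd. rewrite <- sqrt_1. f_equal.
  pose proof (sin2_cos2 (IZR n * x)). unfold Rsqr in *. simpl. lra.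
Qed.

Lemma expi_plus n m x : expi (n + m) x = Cmult (expi n x) (expi m x).
Proof.
  unfold expi, Cmult; simpl. rewrite plus_IZR, Rmult_plus_distr_r, cos_plus, sin_plus.
  f_equal; ring.
Qed.

Lemma expi_conj n x : Cconj (expi n x) = expi (- n) x.
Proof.
  unfold expi, Cconj; simpl. rewrite opp_IZR, Ropp_mult_distr_l_reverse, cos_neg, sin_neg. reflexivity.
Qed.

Lemma expi_0 x : expi 0 x = RtoC 1.
Proof. unfold expi, RtoC. now rewrite Rmult_0_l, cos_0, sin_0. Qed.

Lemma sin_kPI (n : Z) : sin (IZR n * PI) = 0.
Proof. apply sin_eq_0_1. now exists n. Qed.

Lemma cavg_expi n : n <> 0%Z -> cavg (expi n) = RtoC 0.
Proof.
  intros Hn. assert (Hn' : IZR n <> 0) by now apply not_0_IZR.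
  unfold cavg, RtoC, avg, expi; simpl. f_equal.
  - rewrite (is_RInt_unique (fun x => cos (IZR n * x)) (-PI) PI
      (minus (sin (IZR n * PI) / IZR n) (sin (IZR n * - PI) / IZR n))).
    + rewrite <- Ropp_mult_distr_r, sin_neg, sin_kPI.
      unfold minus, plus, opp; simpl. field. split; [exact Hn'|]. apply PI_neq0.
    + apply (is_RInt_derive (fun x => sin (IZR n * x) / IZR n)).
      * intros x _. auto_derive; [exact I|]. now field.
      * intros x _. exact (proj1 (ccont_expi n) x).
  - rewrite (is_RInt_unique (fun x => sin (IZR n * x)) (-PI) PI
      (minus (- cos (IZR n * PI) / IZR n) (- cos (IZR n * - PI) / IZR n))).
    + rewrite <- Ropp_mult_distr_r, cos_neg.
      unfold minus, plus, opp; simpl. field. split; [exact Hn'|]. apply PI_neq0.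
    + apply (is_RInt_derive (fun x => - cos (IZR n * x) / IZR n)).
      * intros x _. auto_derive; [exact I|]. now field.
      * intros x _. exact (proj2 (ccont_expi n) x).
Qed.

(** Bridge from the vector-valued integral in [fcoef] to componentwise real means. *)
Lemma fcoef_cavg f n : ccont f -> fcoef f n = cavg (fun x => Cmult (f x) (Cconj (expi n x))).
Proof.
  intros Hf. unfold fcoef.
  set (g := fun x : R => Cmult (f x) (Cconj (expi n x))).
  assert (Hg : ccont g) by (unfold g; auto with contdb).
  assert (energy : RInt (V := C_R_CompleteNormedModule) g (- PI) PI
    = (RInt (fun x => fst (g x)) (-PI) PI, RInt (fun x => snd (g x)) (-PI) PI)).
  { apply is_RInt_unique.
    apply (is_RInt_fct_extend_pair (U := R_NormedModule) (V := R_NormedModule) g).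
    - apply (RInt_correct (V := R_CompleteNormedModule)). apply rcont_ex_RInt, Hg.
    - apply (RInt_correct (V := R_CompleteNormedModule)). apply rcont_ex_RInt, Hg. }
  transitivity (scal (V := C_R_NormedModule) (/ (2 * PI)) (RInt (V := C_R_CompleteNormedModule) g (- PI) PI)).
  - reflexivity.
  - rewrite energy. reflexivity.
Qed.

Lemma fcoef_ext f g n : ccont f -> (forall x, f x = g x) -> fcoef f n = fcoef g n.
Proof.
  intros Hf H. assert (Hg : ccont g).
  { destruct Hf as [H1 H2]; split;
      [apply rcont_ext with (2 := H1)|apply rcont_ext with (2 := H2)]; intros; now rewrite H. }
  rewrite !fcoef_cavg by assumption. apply cavg_ext. intros; now rewrite H.
Qed.

Lemma fcoef_plus f g n : ccont f -> ccont g ->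
  fcoef (fun x => Cplus (f x) (g x)) n = Cplus (fcoef f n) (fcoef g n).
Proof.
  intros. rewrite !fcoef_cavg, <- cavg_plus; auto with contdb. apply cavg_ext. intros; ring.
Qed.

Lemma fcoef_minus f g n : ccont f -> ccont g ->
  fcoef (fun x => Cminus (f x) (g x)) n = Cminus (fcoef f n) (fcoef g n).
Proof.
  intros. rewrite !fcoef_cavg, <- cavg_minus; auto with contdb. apply cavg_ext. intros; ring.
Qed.

Lemma fcoef_mult_l c f n : ccont f -> fcoef (fun x => Cmult c (f x)) n = Cmult c (fcoef f n).
Proof.
  intros. rewrite !fcoef_cavg, <- cavg_mult_l; auto with contdb. apply cavg_ext. intros; ring.
Qed.

Lemma fcoef_expi_mult m f n : ccont f -> fcoef (fun x => Cmult (expi m x) (f x)) n = fcoef f (n - m).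
Proof.
  intros. rewrite !fcoef_cavg by auto with contdb. apply cavg_ext. intro x.
  rewrite !expi_conj. replace (- (n - m))%Z with (- n + m)%Z by lia. rewrite expi_plus. ring.
Qed.

Lemma fcoef_czsum K (f : Z -> R -> C) n : (forall i, ccont (f i)) ->
  fcoef (fun x => czsum K (fun i => f i x)) n = czsum K (fun i => fcoef (f i) n).
Proof.
  intros H. induction K as [|K IH].
  - rewrite czsum_0. apply fcoef_ext; [now apply ccont_czsum|]. intros; now rewrite czsum_0.
  - rewrite czsum_S. rewrite <- IH, <- !fcoef_plus; auto with contdb.
Qed.

Lemma Cmod_fcoef f n B : ccont f -> (forall x, Cmod (f x) <= B) -> Cmod (fcoef f n) <= B.
Proof.
  intros Hf H. rewrite fcoef_cavg by exact Hf. apply Cmod_cavg_bound; auto with contdb.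
  intro. rewrite Cmod_mult, Cmod_conj, Cmod_expi, Rmult_1_r. apply H.
Qed.

Definition trig (K : nat) (a : Z -> C) (x : R) : C := czsum K (fun n => Cmult (a n) (expi n x)).

Lemma ccont_trig K a : ccont (trig K a).
Proof. unfold trig. auto with contdb. Qed.
#[local] Hint Resolve ccont_trig : contdb.

Lemma cavg_conj_trig K a f : ccont f ->
  cavg (fun x => Cmult (f x) (Cconj (trig K a x))) = czsum K (fun n => Cmult (fcoef f n) (Cconj (a n))).
Proof.
  intros Hf.
  rewrite (cavg_ext _ (fun x => czsum K (fun n => Cmult (Cconj (a n)) (Cmult (f x) (Cconj (expi n x)))))).
  - rewrite cavg_czsum by auto with contdb. apply czsum_ext. intro n.
    rewrite cavg_mult_l, <- fcoef_cavg by auto with contdb. ring.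
  - intro x. unfold trig. rewrite czsum_conj, <- czsum_mult_l. apply czsum_ext. intro n.
    rewrite Cmult_conj. ring.
Qed.

Lemma fcoef_expi n m : fcoef (expi m) n = if Z.eq_dec n m then RtoC 1 else RtoC 0.
Proof.
  rewrite fcoef_cavg by auto with contdb.
  rewrite (cavg_ext _ (expi (m - n))).
  - destruct (Z.eq_dec n m) as [->|Hn]; [|apply cavg_expi; lia].
    rewrite Z.sub_diag, (cavg_ext _ (fun _ => RtoC 1)) by apply expi_0.
    unfold cavg; simpl. now rewrite !avg_const.
  - intro x. rewrite expi_conj. unfold Z.sub. now rewrite expi_plus.
Qed.

Lemma fcoef_trig K a n :
  fcoef (trig K a) n = if Z_le_dec (Z.abs n) (Z.of_nat K) then a n else RtoC 0.
Proof.
  transitivity (czsum K (fun i => Cmult (a i) (if Z.eq_dec n i then RtoC 1 else RtoC 0))).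
  { unfold trig. rewrite fcoef_czsum by auto with contdb. apply czsum_ext. intro i.
    now rewrite fcoef_mult_l, fcoef_expi by auto with contdb. }
  induction K as [|K IH].
  - rewrite czsum_0. destruct (Z.eq_dec n 0) as [energy|], (Z_le_dec (Z.abs n) (Z.of_nat 0));
      try (exfalso; lia); [rewrite energy|]; ring.
  - rewrite czsum_S, IH.
    destruct (Z.eq_dec n (Z.of_nat (S K))) as [energy|], (Z.eq_dec n (- Z.of_nat (S K))) as [E'|],
      (Z_le_dec (Z.abs n) (Z.of_nat K)), (Z_le_dec (Z.abs n) (Z.of_nat (S K)));
      try (exfalso; lia); try rewrite <- energy; try rewrite <- E'; ring.
Qed.

Lemma Cmult_conj_self z : Cmult z (Cconj z) = RtoC (Cmod z ^ 2).
Proof. symmetry. apply Cmod2_conj. Qed.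

(** The pairing of f with its partial sum and the square of that sum have the same mean. The
    equality is kept, not only Bessel's inequality, because [parseval] needs the gap to vanish in
    the limit. *)
Lemma bessel_gap f K : ccont f ->
  avg (fun x => Cmod (Cminus (f x) (trig K (fcoef f) x)) ^ 2)
  = avg (fun x => Cmod (f x) ^ 2) - zsum K (fun n => Cmod (fcoef f n) ^ 2).
Proof.
  intros Hf. set (p := trig K (fcoef f)).
  assert (Hp : ccont p) by (unfold p; auto with contdb).
  assert (S1 : fst (cavg (fun x => Cmult (f x) (Cconj (p x)))) = zsum K (fun n => Cmod (fcoef f n) ^ 2)).
  { unfold p. rewrite cavg_conj_trig by exact Hf. unfold czsum; cbn [fst]. apply zsum_ext. intro n.
    rewrite Cmod_sq. simpl. ring. }
  assert (S2 : fst (cavg (fun x => Cmult (p x) (Cconj (p x)))) = zsum K (fun n => Cmod (fcoef f n) ^ 2)).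
  { unfold p at 2. rewrite cavg_conj_trig by exact Hp.
    rewrite (czsum_ext_le K _ (fun n => Cmult (fcoef f n) (Cconj (fcoef f n)))).
    - unfold czsum; cbn [fst]. apply zsum_ext. intro n. rewrite Cmod_sq. simpl. ring.
    - intros n Hn. unfold p. rewrite fcoef_trig.
      destruct (Z_le_dec _ _); [reflexivity|lia]. }
  rewrite (avg_ext _ (fun x => Cmod (f x) ^ 2 - 2 * fst (Cmult (f x) (Cconj (p x)))
                        + fst (Cmult (p x) (Cconj (p x))))).
  - assert (ccont (fun x => Cmult (f x) (Cconj (p x)))) by auto with contdb.
    assert (ccont (fun x => Cmult (p x) (Cconj (p x)))) by auto with contdb.
    destruct H as [H _], H0 as [H0 _].
    rewrite avg_plus, avg_minus, avg_scal; auto with contdb.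
    unfold cavg in S1, S2; simpl fst in S1, S2. simpl fst. rewrite S1, S2. ring.
  - intro x. rewrite !Cmod_sq. unfold Cminus; simpl. ring.
Qed.

Lemma bessel f : ccont f -> sum_bound (fun n => Cmod (fcoef f n) ^ 2) (avg (fun x => Cmod (f x) ^ 2)).
Proof.
  intros Hf K. pose proof (bessel_gap f K Hf) as energy.
  assert (0 <= avg (fun x => Cmod (Cminus (f x) (trig K (fcoef f) x)) ^ 2)).
  { apply avg_nonneg; auto with contdb. intro. apply pow2_ge_0. }
  lra.
Qed.

Lemma nonneg_sq (f : Z -> R) : nonneg (fun n => f n ^ 2).
Proof. intro; apply pow2_ge_0. Qed.

Lemma is_lim_fcoef_sq f : ccont f -> is_lim_seq (fun K => Cmod (fcoef f (Z.of_nat K)) ^ 2) 0.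
Proof.
  intros Hf.
  pose proof (sum_bound_ex_series _ _ (nonneg_sq (fun n => Cmod (fcoef f n))) (bessel f Hf)) as energy.
  apply ex_series_lim_0 in energy.
  apply is_lim_seq_le_le with (fun _ => 0) (zfold (fun n => Cmod (fcoef f n) ^ 2));
    [|apply is_lim_seq_const|exact energy].
  intros K.
  pose proof (pow2_ge_0 (Cmod (fcoef f (- Z.of_nat K)%Z))).
  pose proof (pow2_ge_0 (Cmod (fcoef f (Z.of_nat K)))).
  destruct K as [|K]; cbn [zfold]; [simpl Z.of_nat in *|]; lra.
Qed.

Lemma is_lim_seq_sq_0 (u : nat -> R) : is_lim_seq (fun n => u n ^ 2) 0 -> is_lim_seq u 0.
Proof.
  intros H. apply is_lim_seq_abs_0. apply is_lim_seq_ext with (fun n => sqrt (u n ^ 2)).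
  - intro. rewrite <- Rsqr_pow2. apply sqrt_Rsqr_abs.
  - rewrite <- sqrt_0. apply (is_lim_seq_continuous sqrt); [|exact H].
    apply continuity_pt_sqrt. lra.
Qed.

(** The coefficients are square summable by Bessel, hence tend to 0; for real f the cosine and sine
    means are their real and imaginary parts up to sign. *)
Lemma riemann_lebesgue f : rcont f ->
  is_lim_seq (fun K => avg (fun x => f x * cos (INR K * x))) 0 /\
  is_lim_seq (fun K => avg (fun x => f x * sin (INR K * x))) 0.
Proof.
  intros Hf.
  assert (energy : forall K, fcoef (fun x => RtoC (f x)) (Z.of_nat K)
     = (avg (fun x => f x * cos (INR K * x)), - avg (fun x => f x * sin (INR K * x)))).
  { intro K. rewrite fcoef_cavg by auto with contdb. unfold cavg. f_equal.
    - apply avg_ext. intro; simpl. rewrite INR_IZR_INZ. ring.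
    - rewrite <- avg_opp.
      + apply avg_ext. intro; simpl. rewrite INR_IZR_INZ. ring.
      + apply rcont_mult; [exact Hf|]. apply (rcont_comp (fun x => INR K * x) sin); auto using rcont_sin with contdb. }
  pose proof (is_lim_fcoef_sq (fun x => RtoC (f x)) (ccont_RtoC f Hf)) as L.
  split; apply is_lim_seq_sq_0;
    (apply is_lim_seq_le_le with (2 := is_lim_seq_const 0) (3 := L)); intro K;
    rewrite energy, Cmod_sq; simpl fst; simpl snd; split; try apply pow2_ge_0;
    [pose proof (pow2_ge_0 (- avg (fun x => f x * sin (INR K * x))))
    |pose proof (pow2_ge_0 (avg (fun x => f x * cos (INR K * x))))]; nra.
Qed.

(** * Pointwise convergence of Fourier series *)

Definition periodic {T} (f : R -> T) : Prop := forall x, f (x + 2 * PI) = f x.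

Lemma avg_shift f a : rcont f -> periodic f -> avg (fun y => f (y + a)) = avg f.
Proof.
  intros Hf Hp. unfold avg. f_equal.
  assert (Hi : forall u v, ex_RInt f u v) by (intros; now apply rcont_ex_RInt).
  assert (S : forall c u v, RInt (fun y => f (y + c)) u v = RInt f (u + c) (v + c)).
  { intros c u v. pose proof (RInt_comp_lin f 1 c u v) as Q. rewrite !Rmult_1_l in Q.
    rewrite <- Q by apply Hi. apply RInt_ext. intros. unfold scal; simpl; unfold mult; simpl.
    rewrite !Rmult_1_l. reflexivity. }
  rewrite S.
  rewrite <- (RInt_Chasles f (- PI + a) (- PI) (PI + a)) by apply Hi.
  rewrite <- (RInt_Chasles f (- PI) PI (PI + a)) by apply Hi.
  assert (energy : RInt f PI (PI + a) = RInt f (- PI) (- PI + a)).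
  { replace PI with (- PI + 2 * PI) at 1 by ring.
    replace (PI + a) with (- PI + a + 2 * PI) by ring.
    rewrite <- S. apply RInt_ext. intros; apply Hp. }
  rewrite energy, <- (opp_RInt_swap f (- PI + a) (- PI)) by apply Hi.
  unfold plus, opp; simpl. ring.
Qed.

Definition dirichlet (K : nat) (y : R) : R := zsum K (fun n => cos (IZR n * y)).

(** The closed form of the kernel, multiplied out so that it also holds where sin (y / 2)
    vanishes. *)
Lemma dirichlet_kernel K y : dirichlet K y * sin (y / 2) = sin (INR K * y + y / 2).
Proof.
  induction K as [|K IH].
  - unfold dirichlet; simpl. rewrite !Rmult_0_l, cos_0. rewrite Rplus_0_l. ring.
  - unfold dirichlet in *. cbn [zsum]. rewrite Rmult_plus_distr_r, IH.
    rewrite opp_IZR, <- INR_IZR_INZ, Ropp_mult_distr_l_reverse, cos_neg.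
    rewrite S_INR.
    replace ((INR K + 1) * y + y / 2) with ((INR K * y + y) + y / 2) by ring.
    replace (INR K * y + y / 2) with ((INR K * y + y) - y / 2) by field.
    replace ((INR K + 1) * y) with (INR K * y + y) by ring.
    rewrite sin_plus, sin_minus. ring.
Qed.

Lemma rcont_dirichlet K : rcont (dirichlet K).
Proof.
  apply rcont_zsum. intro n. apply (rcont_comp (fun x => IZR n * x) cos); auto using rcont_cos with contdb.
Qed.

Lemma avg_dirichlet K : avg (dirichlet K) = 1.
Proof.
  unfold dirichlet. rewrite (avg_zsum K (fun n x => cos (IZR n * x))).
  2: { intro n. exact (proj1 (ccont_expi n)). }
  assert (energy : forall n, avg (fun x => cos (IZR n * x)) = if Z.eq_dec n 0 then 1 else 0).
  { intro n. destruct (Z.eq_dec n 0) as [->|Hn].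
    - rewrite (avg_ext _ (fun _ => 1)); [apply avg_const|]. intro. now rewrite Rmult_0_l, cos_0.
    - exact (f_equal fst (cavg_expi n Hn)). }
  induction K as [|K IH]; cbn [zsum].
  - rewrite energy. reflexivity.
  - rewrite IH, !energy.
    destruct (Z.eq_dec (Z.of_nat (S K)) 0), (Z.eq_dec (- Z.of_nat (S K)) 0); try lia. ring.
Qed.

Lemma zsum_odd K f : (forall n, f (- n)%Z = - f n) -> zsum K f = 0.
Proof.
  intros H. pose proof (zsum_reflect K f) as energy.
  rewrite (zsum_ext K (fun n => f (- n)%Z) (fun n => - f n)) in energy by exact H.
  rewrite zsum_opp in energy. lra.
Qed.

(** Precomposing with the projection onto [a, b] turns continuity on an interval into continuity on
    the line, the form that [rcont] requires. *)
Lemma clamp_rcont (f : R -> R) a b : a <= b ->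
  (forall x, a <= x <= b -> continuous f x) -> rcont (fun x => f (Rmax a (Rmin b x))).
Proof.
  intros Hab H x.
  assert (C : rcont (fun x => Rmax a (Rmin b x))).
  { apply rcont_ext with (fun x => ((a + (b + x - Rabs (b - x)) / 2) + Rabs (a - (b + x - Rabs (b - x)) / 2)) / 2).
    - intro y. unfold Rmax, Rmin, Rabs. repeat destruct (Rle_dec _ _); repeat destruct (Rcase_abs _); lra.
    - assert (A : rcont Rabs) by (intro; apply continuous_Rabs).
      unfold Rdiv.
      assert (Q : rcont (fun x => (b + x - Rabs (b - x)) * / 2)).
      { apply rcont_mult; auto with contdb. apply rcont_minus; auto with contdb.
        apply (rcont_comp (fun x => b - x) Rabs); auto with contdb. }
      apply rcont_mult; auto with contdb. apply rcont_plus; auto with contdb.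
      apply (rcont_comp (fun x => a - (b + x - Rabs (b - x)) * / 2) Rabs); auto with contdb. }
  apply (continuous_comp (fun x => Rmax a (Rmin b x)) f); [apply C|].
  apply H. unfold Rmax, Rmin; repeat destruct (Rle_dec _ _); lra.
Qed.

(** Dirichlet's argument. The kernel has mean 1, so the error is the mean of (phi (y + x) - phi x)
    times the kernel; by the closed form this is k y times sin (K y + y / 2), and Riemann-Lebesgue
    applies because differentiability at x makes k continuous at 0. *)
Lemma fourier_inversion_real phi x l :
  rcont phi -> periodic phi -> is_derive phi x l ->
  is_lim_seq (fun K => avg (fun y => phi (y + x) * dirichlet K y)) (phi x).
Proof.
  intros Hc Hp Hd.
  (* At 0 the quotient tends to 2 l, since sin (y / 2) behaves like y / 2. *)
  set (k := fun y => if Req_EM_T y 0 then 2 * l else (phi (y + x) - phi x) / sin (y / 2)).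
  assert (Hs : forall y, - PI <= y <= PI -> y <> 0 -> sin (y / 2) <> 0).
  { intros y Hy H0. destruct (Rle_lt_dec y 0).
    - apply Rlt_not_eq. apply sin_lt_0_var; pose proof PI_RGT_0; lra.
    - apply Rgt_not_eq. apply sin_gt_0; pose proof PI_RGT_0; lra. }
  assert (Hk : forall y, - PI <= y <= PI -> continuous k y).
  { intros y Hy. destruct (Req_dec y 0) as [->|H0].
    - assert (D1 : is_lim (fun h => (phi (h + x) - phi x) / h) 0 l).
      { apply is_derive_Reals in Hd. intros P [eps HP].
        destruct (Hd eps (cond_pos eps)) as [d Hd'].
        exists d. intros h Hh H0. apply HP.
        rewrite Rplus_comm. apply Hd'; [exact H0|].
        unfold ball in Hh; simpl in Hh; unfold AbsRing_ball, abs, minus, plus, opp in Hh; simpl in Hh.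
        now rewrite Ropp_0, Rplus_0_r in Hh. }
      assert (D2 : is_lim (fun h => sin (h / 2) / h) 0 (/ 2)).
      { assert (D : is_derive (fun y => sin (y / 2)) 0 (/ 2)).
        { auto_derive; [exact I|]. unfold Rdiv. rewrite Rmult_0_l, cos_0. field. }
        apply is_derive_Reals in D. intros P [eps HP].
        destruct (D eps (cond_pos eps)) as [d Hd'].
        exists d. intros h Hh H0. apply HP.
        unfold ball in Hh; simpl in Hh; unfold AbsRing_ball, abs, minus, plus, opp in Hh; simpl in Hh.
        rewrite Ropp_0, Rplus_0_r in Hh.
        specialize (Hd' h H0 Hh). rewrite Rplus_0_l in Hd'.
        replace (0 / 2) with 0 in Hd' by field. rewrite sin_0, Rminus_0_r in Hd'. exact Hd'. }
      assert (D3 : is_lim k 0 (2 * l)).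
      { replace (2 * l) with (l / / 2) by field.
        apply (is_lim_ext_loc (fun h => (phi (h + x) - phi x) / h / (sin (h / 2) / h))).
        - exists (mkposreal PI PI_RGT_0). intros h Hh H0.
          unfold ball in Hh; simpl in Hh; unfold AbsRing_ball, abs, minus, plus, opp in Hh; simpl in Hh.
          rewrite Ropp_0, Rplus_0_r in Hh. apply Rabs_lt_between in Hh.
          unfold k. destruct (Req_EM_T h 0) as [|_]; [contradiction|].
          assert (sin (h / 2) <> 0) by (apply Hs; [lra|exact H0]).
          field. split; assumption.
        - apply (is_lim_div _ _ 0 l (/ 2)); [exact D1|exact D2| |exact I].
          intro energy. injection energy. lra. }
      intros P HP. unfold k in HP at 1.
      destruct (Req_EM_T 0 0) as [_|]; [|lra].
      destruct (D3 P HP) as [d Hd']. exists d. intros h Hh.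
      destruct (Req_dec h 0) as [->|H0]; [|now apply Hd'].
      unfold k. destruct (Req_EM_T 0 0); [|lra]. destruct HP as [eps HP]. apply HP, ball_center.
    - apply (continuous_ext_loc _ (fun y => (phi (y + x) - phi x) / sin (y / 2))).
      + assert (P : 0 < Rabs y) by now apply Rabs_pos_lt.
        exists (mkposreal _ P). intros h Hh.
        unfold ball in Hh; simpl in Hh; unfold AbsRing_ball, abs, minus, plus, opp in Hh; simpl in Hh.
        unfold k. destruct (Req_EM_T h 0) as [->|_]; [|reflexivity].
        rewrite Rplus_0_l, Rabs_Ropp in Hh. lra.
      + apply (continuous_mult (fun y => phi (y + x) - phi x) (fun y => / sin (y / 2))).
        * apply (rcont_minus (fun y => phi (y + x)) (fun _ => phi x)); auto with contdb.
          apply (rcont_comp (fun y => y + x) phi); auto with contdb.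
        * apply continuous_comp; [|apply continuous_Rinv, Hs; auto].
          apply (rcont_comp (fun y => y / 2) sin); [|apply rcont_sin]. unfold Rdiv. auto with contdb. }
  (* k may be singular at other multiples of 2 pi; only its values on [-pi, pi] enter the mean, and
     clamping makes it continuous everywhere. *)
  set (q := fun y => k (Rmax (- PI) (Rmin PI y))).
  assert (Hq : rcont q) by (apply clamp_rcont; [pose proof PI_RGT_0; lra|exact Hk]).
  assert (Hh : rcont (fun y => y / 2)) by (unfold Rdiv; auto with contdb).
  assert (H1 : rcont (fun y => q y * cos (y / 2))).
  { apply rcont_mult; [exact Hq|]. apply (rcont_comp (fun y => y / 2) cos); auto using rcont_cos. }
  assert (H2 : rcont (fun y => q y * sin (y / 2))).
  { apply rcont_mult; [exact Hq|]. apply (rcont_comp (fun y => y / 2) sin); auto using rcont_sin. }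
  destruct (riemann_lebesgue _ H1) as [_ l1_bound]. destruct (riemann_lebesgue _ H2) as [L2 _].
  pose proof (is_lim_seq_plus' _ _ _ _ l1_bound L2) as L. rewrite Rplus_0_r in L.
  pose proof (is_lim_seq_plus' _ _ _ _ (is_lim_seq_const (phi x)) L) as L'.
  rewrite Rplus_0_r in L'. eapply is_lim_seq_ext; [|exact L'].
  intro K. cbv beta.
  assert (HK : forall g, rcont g -> rcont (fun y => g (INR K * y))).
  { intros g Hg. apply (rcont_comp (fun y => INR K * y) g); auto with contdb. }
  rewrite <- avg_plus by (apply rcont_mult; auto using rcont_sin, rcont_cos).
  transitivity (avg (fun y => phi x * dirichlet K y) + avg (fun y => (phi (y + x) - phi x) * dirichlet K y)).
  - rewrite avg_scal, avg_dirichlet, Rmult_1_r by apply rcont_dirichlet. f_equal.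
    apply avg_ext_in. intros y Hy.
    assert (energy : q y = k y) by (unfold q; f_equal; unfold Rmax, Rmin; repeat destruct (Rle_dec _ _); lra).
    rewrite energy. unfold k. destruct (Req_EM_T y 0) as [->|H0].
    + unfold Rdiv. rewrite Rmult_0_r, Rmult_0_l, sin_0, Rplus_0_l. ring.
    + pose proof (Hs y Hy H0). pose proof (dirichlet_kernel K y) as DK.
      rewrite sin_plus in DK.
      apply Rmult_eq_reg_r with (sin (y / 2)); [|assumption].
      rewrite (Rmult_assoc (phi (y + x) - phi x)), DK. field. assumption.
  - rewrite <- avg_plus.
    + apply avg_ext. intro; ring.
    + apply rcont_mult; auto using rcont_dirichlet with contdb.
    + apply rcont_mult; auto using rcont_dirichlet with contdb.
      apply rcont_minus; auto with contdb. apply (rcont_comp (fun y => y + x) phi); auto with contdb.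
Qed.

(** Exchanging sum and mean gives a convolution with the kernel. Its sine part cancels because it is
    odd in n, and periodicity moves the shift from the kernel to f. *)
Lemma trig_fcoef_dirichlet f K x : ccont f -> periodic f ->
  trig K (fcoef f) x
  = (avg (fun y => fst (f (y + x)) * dirichlet K y), avg (fun y => snd (f (y + x)) * dirichlet K y)).
Proof.
  intros Hf Hp.
  assert (energy : trig K (fcoef f) x = cavg (fun y => Cmult (f y) (RtoC (dirichlet K (y - x))))).
  { unfold trig.
    rewrite (czsum_ext K _ (fun n => cavg (fun y => Cmult (expi n x) (Cmult (f y) (Cconj (expi n y)))))).
    2: { intro n. rewrite cavg_mult_l, fcoef_cavg by auto with contdb. ring. }
    rewrite <- (cavg_czsum K (fun n y => Cmult (expi n x) (Cmult (f y) (Cconj (expi n y))))) by auto with contdb.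
    apply cavg_ext. intro y.
    transitivity (Cmult (f y) (czsum K (fun n => Cconj (expi n (y - x))))).
    - rewrite <- czsum_mult_l. apply czsum_ext. intro n.
      assert (Q : Cconj (expi n (y - x)) = Cmult (expi n x) (Cconj (expi n y))).
      { unfold expi, Cconj, Cmult; simpl. rewrite Rmult_minus_distr_l, cos_minus, sin_minus.
        f_equal; ring. }
      rewrite Q. ring.
    - f_equal. unfold czsum, RtoC, dirichlet; simpl. f_equal. apply zsum_odd.
      intro n. rewrite opp_IZR, Ropp_mult_distr_l_reverse, sin_neg. reflexivity. }
  rewrite energy. unfold cavg.
  assert (Hd : periodic (fun y => dirichlet K (y - x))).
  { intro y. unfold dirichlet. apply zsum_ext. intro n.
    replace (IZR n * (y + 2 * PI - x)) with (IZR n * (y - x) + 2 * IZR n * PI) by ring.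
    (* [cos_period] takes a natural number of periods, so for negative n the shift is read
       backwards. *)
    destruct n as [|p|p].
    - f_equal; ring.
    - rewrite <- (INR_IPR p : INR (Pos.to_nat p) = IZR (Z.pos p)). apply cos_period.
    - rewrite <- (cos_period (IZR (Z.neg p) * (y - x) + 2 * IZR (Z.neg p) * PI) (Pos.to_nat p)).
      f_equal. rewrite INR_IPR. change (IZR (Z.neg p)) with (- IPR p). ring. }
  assert (Hx : rcont (fun y => dirichlet K (y - x))).
  { apply (rcont_comp (fun y => y - x) (dirichlet K)); auto using rcont_dirichlet with contdb. }
  destruct Hf as [Hf1 Hf2].
  f_equal.
  - rewrite (avg_ext _ (fun y => fst (f y) * dirichlet K (y - x))) by (intro; simpl; ring).
    rewrite <- (avg_shift (fun y => fst (f y) * dirichlet K (y - x)) x); auto with contdb.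
    + apply avg_ext. intro y. do 2 f_equal. ring.
    + intro y. rewrite Hp, (Hd y). reflexivity.
  - rewrite (avg_ext _ (fun y => snd (f y) * dirichlet K (y - x))) by (intro; simpl; ring).
    rewrite <- (avg_shift (fun y => snd (f y) * dirichlet K (y - x)) x); auto with contdb.
    + apply avg_ext. intro y. do 2 f_equal. ring.
    + intro y. rewrite Hp, (Hd y). reflexivity.
Qed.

Lemma fourier_inversion f x l1 l2 : ccont f -> periodic f ->
  is_derive (fun y => fst (f y)) x l1 -> is_derive (fun y => snd (f y)) x l2 ->
  is_lim_seq (fun K => fst (trig K (fcoef f) x)) (fst (f x)) /\
  is_lim_seq (fun K => snd (trig K (fcoef f) x)) (snd (f x)).
Proof.
  intros Hf Hp H1 H2. split.
  - apply is_lim_seq_ext with (fun K => avg (fun y => fst (f (y + x)) * dirichlet K y)).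
    + intro K. now rewrite trig_fcoef_dirichlet.
    + apply (fourier_inversion_real (fun y => fst (f y)) x l1); auto; [apply Hf|].
      intro y. now rewrite Hp.
  - apply is_lim_seq_ext with (fun K => avg (fun y => snd (f (y + x)) * dirichlet K y)).
    + intro K. now rewrite trig_fcoef_dirichlet.
    + apply (fourier_inversion_real (fun y => snd (f y)) x l2); auto; [apply Hf|].
      intro y. now rewrite Hp.
Qed.

(** * Absolutely convergent Fourier series *)

Definition cmod_seq (a : Z -> C) : Z -> R := fun n => Cmod (a n).
Definition l1_bound (a : Z -> C) (X : R) : Prop := sum_bound (cmod_seq a) X.
Definition hs_bound (s : R) (a : Z -> C) (B : R) : Prop := sum_bound (Hs_terms s a) B.
(** The class in which the fixed point argument runs: since 1 / W is summable it embeds in l1, is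
    stable under convolution ([prod_Y]), and has tails controlled by the fixed sequence [W_tail]. *)
Definition decay2 (a : Z -> C) (A : R) : Prop := forall n, Cmod (a n) * W n <= A.
Definition l1norm (a : Z -> C) : R := zseries (cmod_seq a).
Definition l1_tail (a : Z -> C) (K : nat) : R := l1norm a - zsum K (cmod_seq a).
(** A total definition: the two series are formed componentwise and are meaningful under an
    [l1_bound]. *)
Definition synth (a : Z -> C) (x : R) : C :=
  (zseries (fun n => fst (Cmult (a n) (expi n x))), zseries (fun n => snd (Cmult (a n) (expi n x)))).

Lemma nonneg_cmod_seq a : nonneg (cmod_seq a).
Proof. intro; apply Cmod_ge_0. Qed.

Lemma Hs_weight_pos s n : 0 < Hs_weight s n.
Proof. apply exp_pos. Qed.

Lemma nonneg_Hs s a : nonneg (Hs_terms s a).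
Proof.
  intro n. unfold Hs_terms. pose proof (Hs_weight_pos s n). pose proof (pow2_ge_0 (Cmod (a n))). nra.
Qed.
#[local] Hint Resolve nonneg_cmod_seq nonneg_Hs : core.

Lemma l1_bound_ge0 a X : l1_bound a X -> 0 <= X.
Proof. apply sum_bound_ge0, nonneg_cmod_seq. Qed.

Lemma hs_bound_ge0 s a X : hs_bound s a X -> 0 <= X.
Proof. apply sum_bound_ge0, nonneg_Hs. Qed.

Lemma l1_bound_l1norm a X : l1_bound a X -> l1_bound a (l1norm a).
Proof. apply sum_bound_zseries, nonneg_cmod_seq. Qed.

Lemma l1norm_le a X : l1_bound a X -> l1norm a <= X.
Proof. apply zseries_le_sum_bound, nonneg_cmod_seq. Qed.

Lemma l1norm_ge0 a X : l1_bound a X -> 0 <= l1norm a.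
Proof. intros H. eapply l1_bound_ge0, l1_bound_l1norm, H. Qed.

Lemma decay2_ge0 a A : decay2 a A -> 0 <= A.
Proof.
  intros H. specialize (H 0%Z). pose proof (Cmod_ge_0 (a 0%Z)). pose proof (W_pos 0). nra.
Qed.

Lemma decay2_le a A n : decay2 a A -> Cmod (a n) <= A * / W n.
Proof.
  intros H. specialize (H n). pose proof (W_pos n).
  apply Rmult_le_reg_r with (W n); [assumption|]. rewrite Rmult_assoc, Rinv_l by lra. lra.
Qed.

Lemma decay2_l1_bound a A : decay2 a A -> l1_bound a (A * 5).
Proof.
  intros H. eapply sum_bound_le; [intro n; apply decay2_le, H|].
  apply sum_bound_scal; [eapply decay2_ge0; eauto|apply sum_bound_invW].
Qed.

Lemma l1_tail_lim a X : l1_bound a X -> is_lim_seq (l1_tail a) 0.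
Proof.
  intros H. unfold l1_tail. replace (Finite 0) with (Finite (l1norm a - l1norm a)) by (f_equal; ring).
  apply is_lim_seq_minus'; [apply is_lim_seq_const|]. eapply is_lim_zsum; [apply nonneg_cmod_seq|exact H].
Qed.

Lemma l1_tail_ge0 a X K : l1_bound a X -> 0 <= l1_tail a K.
Proof. intros H. pose proof (l1_bound_l1norm a X H K). unfold l1_tail. lra. Qed.

(** Each component is dominated by |a n|; adding the two tails costs the factor 2. *)
Lemma synth_tail a X K x : l1_bound a X -> Cmod (Cminus (synth a x) (trig K a x)) <= 2 * l1_tail a K.
Proof.
  intros H. eapply Rle_trans; [apply Cmod_le_abs|].
  unfold synth, trig, czsum, Cminus; simpl fst; simpl snd.
  replace (2 * l1_tail a K) with (l1_tail a K + l1_tail a K) by ring.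
  apply Rplus_le_compat.
  - apply (zseries_tail _ _ X K) with (2 := H).
    intro n. eapply Rle_trans; [apply (Rabs_fst_le (Cmult (a n) (expi n x)))|].
    rewrite Cmod_mult, Cmod_expi, Rmult_1_r. apply Rle_refl.
  - apply (zseries_tail _ _ X K) with (2 := H).
    intro n. eapply Rle_trans; [apply (Rabs_snd_le (Cmult (a n) (expi n x)))|].
    rewrite Cmod_mult, Cmod_expi, Rmult_1_r. apply Rle_refl.
Qed.

Lemma le_lim (u : nat -> R) (x l : R) : (forall K, x <= u K) -> is_lim_seq u l -> x <= l.
Proof.
  intros H L. apply (is_lim_seq_le (fun _ => x) u x l H (is_lim_seq_const x) L).
Qed.

Lemma le_lim_loc (u : nat -> R) (x l : R) : (exists N, forall K, (N <= K)%nat -> x <= u K) -> is_lim_seq u l -> x <= l.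
Proof.
  intros H L. apply (is_lim_seq_le_loc (fun _ => x) u x l H (is_lim_seq_const x) L).
Qed.

Lemma lim_le (u : nat -> R) (x l : R) : (forall K, u K <= x) -> is_lim_seq u l -> l <= x.
Proof.
  intros H L. apply (is_lim_seq_le u (fun _ => x) l x H L (is_lim_seq_const x)).
Qed.

Lemma is_lim_seq_scal0 (u : nat -> R) c : is_lim_seq u 0 -> is_lim_seq (fun n => c * u n) 0.
Proof.
  intros H. replace (Finite 0) with (Finite (c * 0)) by (f_equal; ring).
  now apply (is_lim_seq_scal_l u c 0).
Qed.

Lemma is_lim_seq_0_eps (u : nat -> R) eps :
  is_lim_seq u 0 -> 0 < eps -> exists N, forall n, (N <= n)%nat -> Rabs (u n) < eps.
Proof.
  intros H He. apply is_lim_seq_spec in H. destruct (H (mkposreal eps He)) as [N HN].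
  exists N. intros n Hn. specialize (HN n Hn). simpl in HN. now rewrite Rminus_0_r in HN.
Qed.

Lemma rcont_unif f :
  (forall eps, 0 < eps -> exists g, rcont g /\ forall x, Rabs (f x - g x) <= eps) -> rcont f.
Proof.
  intros H x. apply filterlim_locally. intros eps.
  assert (He : 0 < eps / 4) by (destruct eps; simpl; lra).
  destruct (H _ He) as [g [Hg Hfg]].
  specialize (Hg x). apply (proj1 (filterlim_locally g (g x))) with (eps := mkposreal _ He) in Hg.
  revert Hg. apply filter_imp. intros y Hy.
  unfold ball in *; simpl in *; unfold AbsRing_ball, abs, minus, plus, opp in *; simpl in *.
  pose proof (Hfg x) as A1. pose proof (Hfg y) as A2.
  replace (f y + - f x) with ((f y - g y) + ((g y + - g x) - (f x - g x))) by ring.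
  pose proof (Rabs_triang (f y - g y) ((g y + - g x) - (f x - g x))).
  pose proof (Rabs_triang (g y + - g x) (- (f x - g x))) as A3. rewrite Rabs_Ropp in A3.
  unfold Rminus in *. destruct eps as [eps ?]; simpl in *. lra.
Qed.

Lemma ccont_synth a X : l1_bound a X -> ccont (synth a).
Proof.
  intros H. pose proof (l1_tail_lim a X H) as L.
  assert (Q : forall eps, 0 < eps -> exists K, 2 * l1_tail a K <= eps).
  { intros eps He. destruct (is_lim_seq_0_eps _ (eps / 2) L) as [N HN]; [lra|].
    exists N. specialize (HN N (le_n _)). apply Rabs_lt_between in HN. lra. }
  split; apply rcont_unif; intros eps He; destruct (Q eps He) as [K HK].
  - exists (fun x => fst (trig K a x)). split; [exact (proj1 (ccont_trig K a))|]. intro x.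
    eapply Rle_trans; [apply (Rabs_fst_le (Cminus (synth a x) (trig K a x)))|].
    eapply Rle_trans; [eapply synth_tail, H|exact HK].
  - exists (fun x => snd (trig K a x)). split; [exact (proj2 (ccont_trig K a))|]. intro x.
    eapply Rle_trans; [apply (Rabs_snd_le (Cminus (synth a x) (trig K a x)))|].
    eapply Rle_trans; [eapply synth_tail, H|exact HK].
Qed.

(** Passing through partial sums and letting the tail vanish avoids the factor 2 of a componentwise
    bound. *)
Lemma synth_bound a X x : l1_bound a X -> Cmod (synth a x) <= l1norm a.
Proof.
  intros H.
  apply (le_lim (fun K => l1norm a + 2 * l1_tail a K)).
  - intros K. replace (synth a x) with (Cplus (trig K a x) (Cminus (synth a x) (trig K a x))) by ring.
    eapply Rle_trans; [apply Cmod_triangle|]. apply Rplus_le_compat; [|eapply synth_tail, H].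
    unfold trig. eapply Rle_trans; [apply Cmod_czsum|].
    eapply Rle_trans; [|apply (l1_bound_l1norm a X H K)]. apply zsum_le. intro n.
    rewrite Cmod_mult, Cmod_expi, Rmult_1_r. apply Rle_refl.
  - pose proof (is_lim_seq_plus' _ _ _ _ (is_lim_seq_const (l1norm a)) (is_lim_seq_scal0 _ 2 (l1_tail_lim a X H))) as L.
    now rewrite Rplus_0_r in L.
Qed.

Lemma Cmod_eq0_lim z (u : nat -> R) :
  (exists N, forall K, (N <= K)%nat -> Cmod z <= u K) -> is_lim_seq u 0 -> z = RtoC 0.
Proof.
  intros H L. apply Cmod_eq_0. apply Rle_antisym; [|apply Cmod_ge_0]. eapply le_lim_loc; eauto.
Qed.

Lemma Cminus_eq0 a b : Cminus a b = RtoC 0 -> a = b.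
Proof. intros H. replace a with (Cplus (Cminus a b) b) by ring. rewrite H. ring. Qed.

(** For K >= |n| the partial sum has the exact coefficient a n, and the remainder is at most the
    uniform distance between the series and its partial sum. *)
Lemma fcoef_synth a X n : l1_bound a X -> fcoef (synth a) n = a n.
Proof.
  intros H. pose proof (ccont_synth a X H) as Hc. apply Cminus_eq0.
  apply (Cmod_eq0_lim _ (fun K => 2 * l1_tail a K)); [|apply is_lim_seq_scal0; eapply l1_tail_lim, H].
  exists (Z.abs_nat n). intros K HK.
  replace (a n) with (fcoef (trig K a) n).
  - rewrite <- fcoef_minus by auto with contdb. apply Cmod_fcoef; [auto with contdb|].
    intro; eapply synth_tail, H.
  - rewrite fcoef_trig. destruct (Z_le_dec _ _); [reflexivity|lia].
Qed.

Lemma zsum_Re_ex a X x : l1_bound a X ->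
  ex_series (zfold (fun n => fst (Cmult (a n) (expi n x)))) /\
  ex_series (zfold (fun n => snd (Cmult (a n) (expi n x)))).
Proof.
  intros H. split; apply (ex_series_zfold_abs _ _ X) with (2 := H); intro n.
  - eapply Rle_trans; [apply (Rabs_fst_le (Cmult (a n) (expi n x)))|].
    rewrite Cmod_mult, Cmod_expi, Rmult_1_r. apply Rle_refl.
  - eapply Rle_trans; [apply (Rabs_snd_le (Cmult (a n) (expi n x)))|].
    rewrite Cmod_mult, Cmod_expi, Rmult_1_r. apply Rle_refl.
Qed.

Lemma synth_lim a X x : l1_bound a X ->
  is_lim_seq (fun K => fst (trig K a x)) (fst (synth a x)) /\
  is_lim_seq (fun K => snd (trig K a x)) (snd (synth a x)).
Proof.
  intros H. destruct (zsum_Re_ex a X x H). split; now apply is_lim_zsum_series.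
Qed.

Lemma is_lim_eq (u v : nat -> R) (l l' : R) :
  (forall n, u n = v n) -> is_lim_seq u l -> is_lim_seq v l' -> l = l'.
Proof.
  intros energy L L'. apply (is_lim_seq_ext _ _ _ energy) in L.
  apply is_lim_seq_unique in L. apply is_lim_seq_unique in L'. rewrite L in L'. now injection L'.
Qed.

Lemma trig_minus K a b x :
  trig K (seq_sub a b) x = Cminus (trig K a x) (trig K b x).
Proof.
  unfold trig. rewrite <- czsum_minus. apply czsum_ext. intro; unfold seq_sub; ring.
Qed.

Lemma l1_bound_sub a b X Y : l1_bound a X -> l1_bound b Y -> l1_bound (seq_sub a b) (X + Y).
Proof.
  intros H H'. eapply sum_bound_le; [|apply (sum_bound_plus _ _ _ _ H H')]. intro n.
  unfold cmod_seq, seq_sub, Cminus. eapply Rle_trans; [apply Cmod_triangle|].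
  rewrite Cmod_opp. apply Rle_refl.
Qed.

Lemma synth_minus a b X Y x : l1_bound a X -> l1_bound b Y -> synth (seq_sub a b) x = Cminus (synth a x) (synth b x).
Proof.
  intros H H'. destruct (synth_lim _ _ x (l1_bound_sub _ _ _ _ H H')) as [l1_bound L2].
  destruct (synth_lim _ _ x H) as [A1 A2]. destruct (synth_lim _ _ x H') as [B1 B2].
  apply injective_projections.
  - eapply is_lim_eq; [|exact l1_bound|exact (is_lim_seq_minus' _ _ _ _ A1 B1)].
    intro K. cbv beta. rewrite trig_minus. reflexivity.
  - eapply is_lim_eq; [|exact L2|exact (is_lim_seq_minus' _ _ _ _ A2 B2)].
    intro K. cbv beta. rewrite trig_minus. reflexivity.
Qed.

(** * Conjugates, products and convolutions *)

Definition conj_seq (a : Z -> C) : Z -> C := fun n => Cconj (a (- n)%Z).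

Lemma l1_bound_conj_seq a X : l1_bound a X -> l1_bound (conj_seq a) X.
Proof.
  intros H K. rewrite (zsum_ext K _ (fun n => cmod_seq a (- n)%Z)).
  - rewrite zsum_reflect. apply H.
  - intro n. unfold cmod_seq, conj_seq. apply Cmod_conj.
Qed.

Lemma Hs_weight_W s n : Hs_weight s n = Rpower (W n) s.
Proof. reflexivity. Qed.

Lemma hs_bound_conj_seq s a X : hs_bound s a X -> hs_bound s (conj_seq a) X.
Proof.
  intros H K. rewrite (zsum_ext K _ (fun n => Hs_terms s a (- n)%Z)).
  - rewrite zsum_reflect. apply H.
  - intro n. unfold Hs_terms, conj_seq. now rewrite Cmod_conj, !Hs_weight_W, W_opp.
Qed.

Lemma decay2_conj_seq a A : decay2 a A -> decay2 (conj_seq a) A.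
Proof. intros H n. unfold conj_seq. rewrite Cmod_conj, <- W_opp. apply H. Qed.

Lemma trig_conj_seq K a x : trig K (conj_seq a) x = Cconj (trig K a x).
Proof.
  unfold trig. rewrite czsum_conj. unfold czsum. f_equal; rewrite <- zsum_reflect; apply zsum_ext; intro n;
    unfold conj_seq; rewrite Z.opp_involutive, Cmult_conj, expi_conj; reflexivity.
Qed.

Lemma synth_conj_seq a X x : l1_bound a X -> synth (conj_seq a) x = Cconj (synth a x).
Proof.
  intros H. destruct (synth_lim _ _ x (l1_bound_conj_seq _ _ H)) as [A1 A2]. destruct (synth_lim _ _ x H) as [B1 B2].
  apply injective_projections.
  - eapply is_lim_eq; [|exact A1|exact B1]. intro K. cbv beta. now rewrite trig_conj_seq.
  - eapply is_lim_eq; [|exact A2|]. 2: { simpl. apply is_lim_seq_opp in B2. exact B2. }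
    intro K. cbv beta. now rewrite trig_conj_seq.
Qed.

Definition convol (I : nat) (a b : Z -> C) (n : Z) : C := czsum I (fun i => Cmult (a i) (b (n - i)%Z)).

(** Only the first factor is expanded into its series; the second is any continuous function, so
    products can be nested without a convolution formula for infinite sums. *)
Lemma fcoef_product_tail a X g n I : l1_bound a X -> ccont g ->
  Cmod (Cminus (fcoef (fun x => Cmult (synth a x) (g x)) n) (convol I a (fcoef g) n))
  <= 2 * l1_tail a I * avg (fun x => Cmod (g x)).
Proof.
  intros H Hg. pose proof (ccont_synth a X H) as Hc.
  replace (convol I a (fcoef g) n) with (fcoef (fun x => Cmult (trig I a x) (g x)) n).
  - rewrite <- fcoef_minus by auto with contdb.
    rewrite fcoef_cavg by auto with contdb.
    eapply Rle_trans; [apply Cmod_cavg; auto 6 with contdb|].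
    rewrite <- avg_scal by auto with contdb.
    apply avg_le; auto 8 with contdb. intros x _.
    rewrite Cmod_mult, Cmod_conj, Cmod_expi, Rmult_1_r.
    replace (Cminus (Cmult (synth a x) (g x)) (Cmult (trig I a x) (g x)))
      with (Cmult (Cminus (synth a x) (trig I a x)) (g x)) by ring.
    rewrite Cmod_mult. apply Rmult_le_compat_r; [apply Cmod_ge_0|]. eapply synth_tail, H.
  - unfold convol.
    rewrite (fcoef_ext _ (fun x => czsum I (fun i => Cmult (a i) (Cmult (expi i x) (g x))))); auto with contdb.
    + rewrite (fcoef_czsum I (fun i x => Cmult (a i) (Cmult (expi i x) (g x)))) by auto with contdb.
      apply czsum_ext. intro i.
      rewrite fcoef_mult_l, fcoef_expi_mult by auto with contdb. reflexivity.
    + intro x. unfold trig. rewrite Cmult_comm, <- czsum_mult_l. apply czsum_ext. intro; ring.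
Qed.

Lemma is_lim_Cmod (u : nat -> C) (z : C) (t : nat -> R) :
  (forall I, Cmod (Cminus z (u I)) <= t I) -> is_lim_seq t 0 -> is_lim_seq (fun I => Cmod (u I)) (Cmod z).
Proof.
  intros H L.
  assert (L' : is_lim_seq (fun I => Cmod (u I) - Cmod z) 0).
  { apply is_lim_seq_abs_0.
    apply is_lim_seq_le_le with (fun _ => 0) t; [|apply is_lim_seq_const|exact L].
    intro I. split; [apply Rabs_pos|]. specialize (H I).
    apply Rabs_le_between. split.
    - pose proof (Cmod_triangle (Cminus z (u I)) (u I)) as Q.
      replace (Cplus (Cminus z (u I)) (u I)) with z in Q by ring. lra.
    - pose proof (Cmod_triangle (Copp (Cminus z (u I))) z) as Q.
      replace (Cplus (Copp (Cminus z (u I))) z) with (u I) in Q by ring. rewrite Cmod_opp in Q. lra. }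
  pose proof (is_lim_seq_plus' _ _ _ _ L' (is_lim_seq_const (Cmod z))) as Q.
  rewrite Rplus_0_l in Q. eapply is_lim_seq_ext; [|exact Q]. intro; simpl; ring.
Qed.

Lemma is_lim_convol a X g n : l1_bound a X -> ccont g ->
  is_lim_seq (fun I => Cmod (convol I a (fcoef g) n)) (Cmod (fcoef (fun x => Cmult (synth a x) (g x)) n)).
Proof.
  intros H Hg. eapply is_lim_Cmod; [intro I; eapply fcoef_product_tail; eauto|].
  apply is_lim_seq_ext with (fun I => (2 * avg (fun x => Cmod (g x))) * l1_tail a I); [intro; ring|].
  apply is_lim_seq_scal0. eapply l1_tail_lim, H.
Qed.

Lemma is_lim_zsum_pointwise K (f : nat -> Z -> R) (g : Z -> R) :
  (forall n, is_lim_seq (fun I => f I n) (g n)) -> is_lim_seq (fun I => zsum K (f I)) (zsum K g).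
Proof.
  intros H. induction K as [|K IH]; cbn [zsum]; [apply H|].
  apply is_lim_seq_plus'; [exact IH|]. apply is_lim_seq_plus'; apply H.
Qed.

Lemma Cmod_convol I a b n : Cmod (convol I a b n) <= zsum I (fun i => cmod_seq a i * cmod_seq b (n - i)%Z).
Proof.
  unfold convol. eapply Rle_trans; [apply Cmod_czsum|]. right. apply zsum_ext. intro; apply Cmod_mult.
Qed.

Lemma prod_l1_bound a X g Y : l1_bound a X -> ccont g -> l1_bound (fcoef g) Y ->
  l1_bound (fcoef (fun x => Cmult (synth a x) (g x))) (X * Y).
Proof.
  intros H Hg HY K.
  apply (lim_le (fun I => zsum K (fun n => Cmod (convol I a (fcoef g) n)))).
  - intro I. eapply Rle_trans; [apply zsum_le; intro; apply Cmod_convol|].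
    apply young_l1_l1; auto.
  - apply (is_lim_zsum_pointwise K (fun I n => Cmod (convol I a (fcoef g) n))).
    intro n. eapply is_lim_convol; eauto.
Qed.

(** W n <= 2 (W i + W (n - i)) spends the decay of one factor and leaves 1 / W of the other to be
    summed, which gives 2 A B (5 + 5). *)
Lemma prod_Y a A g B : decay2 a A -> ccont g -> decay2 (fcoef g) B ->
  decay2 (fcoef (fun x => Cmult (synth a x) (g x))) (20 * (A * B)).
Proof.
  intros H Hg HB n.
  pose proof (decay2_ge0 _ _ H) as A0. pose proof (decay2_ge0 _ _ HB) as B0.
  apply (lim_le (fun I => Cmod (convol I a (fcoef g) n) * W n)).
  - intro I. pose proof (W_pos n).
    eapply Rle_trans; [apply Rmult_le_compat_r; [lra|apply Cmod_convol]|].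
    rewrite Rmult_comm, <- zsum_scal.
    apply Rle_trans with (zsum I (fun i => 2 * (A * B) * (/ W (n - i)%Z + / W i))).
    + apply zsum_le. intro i. unfold cmod_seq.
      pose proof (decay2_le _ _ i H) as Q1. pose proof (decay2_le _ _ (n - i)%Z HB) as Q2.
      pose proof (W_split n i) as Q3. pose proof (W_pos i) as P1. pose proof (W_pos (n - i)) as P2.
      apply Rle_trans with (2 * (W i + W (n - i)) * ((A * / W i) * (B * / W (n - i)))).
      * apply Rmult_le_compat; try lra.
        -- apply Rmult_le_pos; apply Cmod_ge_0.
        -- apply Rmult_le_compat; auto; apply Cmod_ge_0.
      * right. field. lra.
    + rewrite zsum_scal, zsum_plus.
      pose proof (sum_bound_invW I) as Q1.
      assert (Q2 : zsum I (fun i => / W (n - i)) <= 5).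
      { apply (sum_bound_sub_shift (fun n => / W n) 5 n); [|apply sum_bound_invW].
        intro m. left. apply Rinv_0_lt_compat, W_pos. }
      pose proof (Rmult_le_pos _ _ A0 B0). nra.
  - pose proof (is_lim_seq_scal_r _ (W n) _ (is_lim_convol a _ g n (decay2_l1_bound _ _ H) Hg)) as L.
    exact L.
Qed.

Definition prod_cst (s : R) : R := 2 * Rpower 4 s.

Lemma prod_cst_pos s : 0 < prod_cst s.
Proof. unfold prod_cst. pose proof (exp_pos (s * ln 4)). unfold Rpower. lra. Qed.

(** The exponent is s / 2 because amplitudes, not squares, are split; the larger of W i and W (n -
    i) is at least W n / 4. *)
Lemma weight_split s n i : 0 <= s ->
  Rpower (W n) (s / 2) <= Rpower 4 (s / 2) * (Rpower (W i) (s / 2) + Rpower (W (n - i)) (s / 2)).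
Proof.
  intros Hs. pose proof (W_split n i) as Q. pose proof (W_pos n). pose proof (W_pos i). pose proof (W_pos (n - i)).
  assert (P : forall x, 0 < Rpower x (s / 2)) by (intro; apply exp_pos).
  destruct (Rle_dec (W i) (W (n - i))).
  - apply Rle_trans with (Rpower (4 * W (n - i)) (s / 2)).
    + apply Rle_Rpower_l; lra.
    + rewrite <- Rpower_mult_distr by lra.
      pose proof (P (W i)). pose proof (P 4). nra.
  - apply Rle_trans with (Rpower (4 * W i) (s / 2)).
    + apply Rle_Rpower_l; lra.
    + rewrite <- Rpower_mult_distr by lra.
      pose proof (P (W (n - i)%Z)). pose proof (P 4). nra.
Qed.

Lemma Rpower_half_sq x s : 0 < x -> (Rpower x (s / 2))² = Rpower x s.
Proof. intros. unfold Rsqr. rewrite <- Rpower_plus. f_equal. field. Qed.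

(** The weight falls on one factor at a time, and Young's inequality takes the other in l1. Squaring
    the sum of the two parts gives the constant 2 times 4^s. *)
Lemma prod_Hs s a X1 X2 g Y1 Y2 : 0 <= s -> l1_bound a X1 -> hs_bound s a X2 -> ccont g ->
  l1_bound (fcoef g) Y1 -> hs_bound s (fcoef g) Y2 ->
  hs_bound s (fcoef (fun x => Cmult (synth a x) (g x))) (prod_cst s * (X1² * Y2 + X2 * Y1²)).
Proof.
  intros Hs H1 H2 Hg HY1 HY2 K.
  set (h := fun n => Rpower (W n) (s / 2)).
  assert (Hh : forall n, 0 < h n) by (intro; apply exp_pos).
  assert (Hh2 : forall n, h n * h n = Hs_weight s n).
  { intro n. rewrite Hs_weight_W. apply Rpower_half_sq, W_pos. }
  apply (lim_le (fun I => zsum K (fun n => Hs_weight s n * (Cmod (convol I a (fcoef g) n)) ^ 2))).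
  - intro I.
    set (p := fun n => zsum I (fun i => cmod_seq a i * (h (n - i)%Z * cmod_seq (fcoef g) (n - i)%Z))).
    set (q := fun n => zsum I (fun i => (h i * cmod_seq a i) * cmod_seq (fcoef g) (n - i)%Z)).
    apply Rle_trans with (zsum K (fun n => prod_cst s * ((p n)² + (q n)²))).
    + apply zsum_le. intro n. rewrite <- Hh2.
      assert (B1 : h n * Cmod (convol I a (fcoef g) n) <= Rpower 4 (s / 2) * (p n + q n)).
      { apply Rle_trans with (h n * zsum I (fun i => cmod_seq a i * cmod_seq (fcoef g) (n - i)%Z)).
        - apply Rmult_le_compat_l; [left; apply Hh|apply Cmod_convol].
        - unfold p, q. rewrite <- zsum_plus, <- !zsum_scal. apply zsum_le. intro i.
          pose proof (weight_split s n i Hs) as Q. fold (h n) (h i) (h (n - i)%Z) in Q.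
          pose proof (Rmult_le_pos _ _ (nonneg_cmod_seq a i) (nonneg_cmod_seq (fcoef g) (n - i)%Z)) as P.
          apply (Rmult_le_compat_r _ _ _ P) in Q. eapply Rle_trans; [exact Q|].
          right; ring. }
      assert (B0 : 0 <= h n * Cmod (convol I a (fcoef g) n)).
      { apply Rmult_le_pos; [left; apply Hh|apply Cmod_ge_0]. }
      apply Rle_trans with ((Rpower 4 (s / 2) * (p n + q n))²).
      * replace (h n * h n * Cmod (convol I a (fcoef g) n) ^ 2) with ((h n * Cmod (convol I a (fcoef g) n))²)
          by (unfold Rsqr; ring).
        apply Rsqr_incr_1; lra.
      * rewrite Rsqr_mult, Rpower_half_sq by lra. unfold prod_cst.
        pose proof (exp_pos (s * ln 4)) as P. fold (Rpower 4 s) in P.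
        pose proof (Rle_0_sqr (p n - q n)). unfold Rsqr in *. nra.
    + rewrite zsum_scal, zsum_plus. apply Rmult_le_compat_l; [left; apply prod_cst_pos|].
      apply Rplus_le_compat.
      * unfold p.
        apply (young_l1_l2 (cmod_seq a) (fun m => h m * cmod_seq (fcoef g) m)); auto.
        -- intro; apply Rmult_le_pos; [left; apply Hh|apply nonneg_cmod_seq].
        -- eapply sum_bound_le; [|exact HY2]. intro n. right. unfold Hs_terms. rewrite <- Hh2.
           unfold Rsqr, cmod_seq. ring.
      * unfold q.
        apply (young_l2_l1 (fun i => h i * cmod_seq a i) (cmod_seq (fcoef g))); auto.
        -- intro; apply Rmult_le_pos; [left; apply Hh|apply nonneg_cmod_seq].
        -- eapply sum_bound_le; [|exact H2]. intro n. right. unfold Hs_terms. rewrite <- Hh2.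
           unfold Rsqr, cmod_seq. ring.
  - apply (is_lim_zsum_pointwise K (fun I n => Hs_weight s n * Cmod (convol I a (fcoef g) n) ^ 2)).
    intro n. unfold Hs_terms.
    apply (is_lim_seq_scal_l _ _ (Cmod (fcoef (fun x => Cmult (synth a x) (g x)) n) ^ 2)).
    apply (is_lim_seq_continuous (fun x => x ^ 2)).
    + apply continuity_pt_filterlim, (rcont_pow (fun x => x) 2 rcont_id).
    + eapply is_lim_convol; eauto.
Qed.

(** * The cubic nonlinearity *)

Definition cubic (z : C) : C := Cmult z (RtoC (Cmod z ^ 2)).
Definition cubic_coef (a : Z -> C) (n : Z) : C := fcoef (fun x => cubic (synth a x)) n.

Lemma cubic_alt z : cubic z = Cmult z (Cmult (Cconj z) z).
Proof. unfold cubic. rewrite (Cmult_comm (Cconj z)), Cmult_conj_self. reflexivity. Qed.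

Lemma ccont_cubic f : ccont f -> ccont (fun x => cubic (f x)).
Proof. intros H. unfold cubic. apply ccont_mult; [exact H|]. apply ccont_RtoC. auto with contdb. Qed.
#[local] Hint Resolve ccont_cubic : contdb.

Lemma Cmod_cubic z : Cmod (cubic z) = Cmod z ^ 3.
Proof.
  unfold cubic. rewrite Cmod_mult, Cmod_R, Rabs_pos_eq by apply pow2_ge_0. ring.
Qed.

(** Split as (z - w) |z|^2 + w (|z|^2 - |w|^2); the cross term |z| |w| is absorbed in |z|^2 + |w|^2,
    which costs the factor 2. *)
Lemma cubic_lip z w : Cmod (Cminus (cubic z) (cubic w)) <= 2 * (Cmod z ^ 2 + Cmod w ^ 2) * Cmod (Cminus z w).
Proof.
  assert (energy : Cminus (cubic z) (cubic w)
    = Cplus (Cmult (Cminus z w) (RtoC (Cmod z ^ 2))) (Cmult w (RtoC (Cmod z ^ 2 - Cmod w ^ 2)))).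
  { unfold cubic. rewrite RtoC_minus. ring. }
  rewrite energy. eapply Rle_trans; [apply Cmod_triangle|].
  rewrite !Cmod_mult, !Cmod_R, (Rabs_pos_eq (Cmod z ^ 2)) by apply pow2_ge_0.
  pose proof (Cmod_ge_0 z) as Hz. pose proof (Cmod_ge_0 w) as Hw. pose proof (Cmod_ge_0 (Cminus z w)) as Hd.
  assert (T1 : Rabs (Cmod z - Cmod w) <= Cmod (Cminus z w)).
  { apply Rabs_le_between. split.
    - pose proof (Cmod_triangle (Copp (Cminus z w)) z) as Q.
      replace (Cplus (Copp (Cminus z w)) z) with w in Q by ring. rewrite Cmod_opp in Q. lra.
    - pose proof (Cmod_triangle (Cminus z w) w) as Q.
      replace (Cplus (Cminus z w) w) with z in Q by ring. lra. }
  assert (T2 : Rabs (Cmod z ^ 2 - Cmod w ^ 2) <= (Cmod z + Cmod w) * Cmod (Cminus z w)).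
  { replace (Cmod z ^ 2 - Cmod w ^ 2) with ((Cmod z + Cmod w) * (Cmod z - Cmod w)) by ring.
    rewrite Rabs_mult, (Rabs_pos_eq (Cmod z + Cmod w)) by lra.
    apply Rmult_le_compat_l; lra. }
  apply (Rmult_le_compat_l _ _ _ Hw) in T2.
  pose proof (pow2_ge_0 (Cmod z - Cmod w)).
  assert (0 <= (Cmod z ^ 2 + Cmod w ^ 2 - Cmod w * Cmod z) * Cmod (Cminus z w)).
  { apply Rmult_le_pos; [nra|lra]. }
  nra.
Qed.

(** The real-trilinear polarisation of the cubic term, so that differences can be telescoped. Two
    applications of [prod_Y] produce the factor 20^2 = 400 below. *)
Definition trilinear (a b c : Z -> C) (n : Z) : C :=
  fcoef (fun x => Cmult (synth a x) (Cmult (Cconj (synth b x)) (synth c x))) n.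

Lemma trilinear_Y a b c A B C : decay2 a A -> decay2 b B -> decay2 c C -> decay2 (trilinear a b c) (400 * (A * (B * C))).
Proof.
  intros Ha Hb Hc. pose proof (decay2_l1_bound _ _ Ha) as La. pose proof (decay2_l1_bound _ _ Hb) as Lb.
  pose proof (decay2_l1_bound _ _ Hc) as Lc.
  pose proof (ccont_synth _ _ La). pose proof (ccont_synth _ _ Lb). pose proof (ccont_synth _ _ Lc).
  replace (400 * (A * (B * C))) with (20 * (A * (20 * (B * C)))) by ring.
  apply prod_Y; auto with contdb.
  intro n. rewrite (fcoef_ext _ (fun x => Cmult (synth (conj_seq b) x) (synth c x))).
  - apply (prod_Y (conj_seq b) B (synth c) C); auto with contdb; [now apply decay2_conj_seq|].
    intro m. rewrite (fcoef_synth c _ m Lc). apply Hc.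
  - auto with contdb.
  - intro x. now rewrite (synth_conj_seq b _ x Lb).
Qed.

Lemma decay2_sub a b A B : decay2 a A -> decay2 b B -> decay2 (seq_sub a b) (A + B).
Proof.
  intros H H' n. unfold seq_sub, Cminus. pose proof (Cmod_triangle (a n) (- b n)).
  rewrite Cmod_opp in H0. specialize (H n). specialize (H' n). pose proof (W_pos n). nra.
Qed.

Lemma cubic_coef_trilinear a X n : l1_bound a X -> cubic_coef a n = trilinear a a a n.
Proof.
  intros H. pose proof (ccont_synth _ _ H). apply fcoef_ext; auto with contdb.
  intro x. apply cubic_alt.
Qed.

Lemma cubic_coef_Y a A : decay2 a A -> decay2 (cubic_coef a) (400 * A ^ 3).
Proof.
  intros H n. rewrite (cubic_coef_trilinear a _ n (decay2_l1_bound _ _ H)).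
  replace (400 * A ^ 3) with (400 * (A * (A * A))) by ring. now apply trilinear_Y.
Qed.

(** Telescoping replaces one argument at a time and leaves three trilinear terms of size 400 A^2 D
    each. *)
Lemma cubic_coef_lip_Y a b A D : decay2 a A -> decay2 b A -> decay2 (seq_sub a b) D ->
  decay2 (seq_sub (cubic_coef a) (cubic_coef b)) (1200 * A ^ 2 * D).
Proof.
  intros Ha Hb Hd n. set (d := seq_sub a b) in *.
  pose proof (decay2_l1_bound _ _ Ha) as La. pose proof (decay2_l1_bound _ _ Hb) as Lb. pose proof (decay2_l1_bound _ _ Hd) as Ld.
  pose proof (ccont_synth _ _ La). pose proof (ccont_synth _ _ Lb). pose proof (ccont_synth _ _ Ld).
  assert (energy : seq_sub (cubic_coef a) (cubic_coef b) n = Cplus (trilinear d a a n) (Cplus (trilinear b d a n) (trilinear b b d n))).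
  { unfold seq_sub, cubic_coef, trilinear. rewrite <- fcoef_minus, <- !fcoef_plus by auto 7 with contdb.
    apply fcoef_ext; auto with contdb.
    intro x. unfold d. rewrite (synth_minus a b _ _ x La Lb), !cubic_alt.
    unfold Cminus. rewrite Cplus_conj, Copp_conj. ring. }
  rewrite energy.
  pose proof (trilinear_Y _ _ _ _ _ _ Hd Ha Ha n). pose proof (trilinear_Y _ _ _ _ _ _ Hb Hd Ha n).
  pose proof (trilinear_Y _ _ _ _ _ _ Hb Hb Hd n).
  pose proof (Cmod_triangle (trilinear d a a n) (Cplus (trilinear b d a n) (trilinear b b d n))).
  pose proof (Cmod_triangle (trilinear b d a n) (trilinear b b d n)). pose proof (W_pos n). nra.
Qed.

Lemma l1_bound_ext a b X : (forall n, a n = b n) -> l1_bound a X -> l1_bound b X.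
Proof.
  intros H Ha K. rewrite (zsum_ext K _ (cmod_seq a)); [apply Ha|]. intro n. unfold cmod_seq. now rewrite H.
Qed.

Lemma hs_bound_ext s a b X : (forall n, a n = b n) -> hs_bound s a X -> hs_bound s b X.
Proof.
  intros H Ha K. rewrite (zsum_ext K _ (Hs_terms s a)); [apply Ha|]. intro n. unfold Hs_terms. now rewrite H.
Qed.

Definition cubic_cst (s : R) : R := prod_cst s * (2 * prod_cst s + 1).

Lemma cubic_cst_pos s : 0 < cubic_cst s.
Proof. unfold cubic_cst. pose proof (prod_cst_pos s). nra. Qed.

(** [prod_Hs] twice: with c = [prod_cst s], the function |u|^2 has H^s bound 2 c X^2 Y and l1 bound
    X^2, and multiplication by u gives c (2 c + 1) X^4 Y. *)
Lemma cubic_coef_Hs s a X Y : 0 <= s -> l1_bound a X -> hs_bound s a Y -> hs_bound s (cubic_coef a) (cubic_cst s * X ^ 4 * Y).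
Proof.
  intros Hs HX HY. pose proof (ccont_synth _ _ HX) as Hc.
  assert (G : ccont (fun x => Cmult (synth (conj_seq a) x) (synth a x))).
  { apply ccont_mult; [|exact Hc]. eapply ccont_synth, l1_bound_conj_seq, HX. }
  assert (HF : forall n, fcoef (synth a) n = a n) by (intro; eapply fcoef_synth, HX).
  assert (HF1 : l1_bound (fcoef (synth a)) X) by (apply (l1_bound_ext a); auto).
  assert (HF2 : hs_bound s (fcoef (synth a)) Y) by (apply (hs_bound_ext s a); auto).
  pose proof (prod_l1_bound (conj_seq a) X (synth a) X (l1_bound_conj_seq _ _ HX) Hc HF1) as P1.
  pose proof (prod_Hs s (conj_seq a) X Y (synth a) X Y Hs (l1_bound_conj_seq _ _ HX) (hs_bound_conj_seq _ _ _ HY) Hc HF1 HF2) as P2.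
  pose proof (prod_Hs s a X Y _ _ _ Hs HX HY G P1 P2) as P3.
  apply (hs_bound_ext s) with (b := cubic_coef a) in P3.
  - eapply sum_bound_weaken; [exact P3|]. right. unfold cubic_cst, Rsqr. ring.
  - intro n. apply fcoef_ext; [auto with contdb|].
    intro x. now rewrite (synth_conj_seq a X x HX), cubic_alt.
Qed.

(** The mean in [bessel_gap] is at most the square of twice the l1 tail, which tends to 0. *)
Lemma parseval a X : l1_bound a X -> avg (fun x => Cmod (synth a x) ^ 2) = zseries (fun n => cmod_seq a n ^ 2).
Proof.
  intros H. pose proof (ccont_synth _ _ H) as Hc.
  assert (L : is_lim_seq (fun K => zsum K (fun n => cmod_seq a n ^ 2)) (avg (fun x => Cmod (synth a x) ^ 2))).
  { apply is_lim_seq_le_le with (fun K => avg (fun x => Cmod (synth a x) ^ 2) - 4 * (l1_tail a K * l1_tail a K)) (fun _ => avg (fun x => Cmod (synth a x) ^ 2)).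
    - intro K. pose proof (bessel_gap (synth a) K Hc) as G.
      rewrite (zsum_ext K (fun n => Cmod (fcoef (synth a) n) ^ 2) (fun n => cmod_seq a n ^ 2)) in G
        by (intro; now rewrite (fcoef_synth a X _ H)).
      assert (energy : forall x, trig K (fcoef (synth a)) x = trig K a x).
      { intro x. unfold trig. apply czsum_ext. intro; now rewrite (fcoef_synth a X _ H). }
      assert (G1 : 0 <= avg (fun x => Cmod (Cminus (synth a x) (trig K (fcoef (synth a)) x)) ^ 2)).
      { apply avg_nonneg; auto with contdb. intro; apply pow2_ge_0. }
      assert (G2 : avg (fun x => Cmod (Cminus (synth a x) (trig K (fcoef (synth a)) x)) ^ 2) <= 4 * (l1_tail a K * l1_tail a K)).
      { rewrite <- (avg_const (4 * _)). apply avg_le; auto with contdb. intros x _. rewrite energy.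
        pose proof (synth_tail a X K x H). pose proof (Cmod_ge_0 (Cminus (synth a x) (trig K a x))).
        pose proof (l1_tail_ge0 a X K H). nra. }
      lra.
    - replace (Finite (avg (fun x => Cmod (synth a x) ^ 2)))
        with (Finite (avg (fun x => Cmod (synth a x) ^ 2) - 4 * (0 * 0))) by (f_equal; ring).
      apply is_lim_seq_minus'; [apply is_lim_seq_const|].
      apply (is_lim_seq_scal_l _ 4 (0 * 0)). apply is_lim_seq_mult'; eapply l1_tail_lim, H.
    - apply is_lim_seq_const. }
  assert (B : sum_bound (fun n => cmod_seq a n ^ 2) (avg (fun x => Cmod (synth a x) ^ 2))).
  { intro K. apply (is_lim_seq_incr_compare _ _ L). intro n. apply zsum_mono; [|lia].
    intro; apply pow2_ge_0. }
  eapply is_lim_eq; [reflexivity|exact L|].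
  eapply is_lim_zsum; [|exact B]. intro; apply pow2_ge_0.
Qed.

(** Both sides are limits of the same partial sums, one by summability and the other by
    differentiability. This identifies a classical solution with the series of its coefficients. *)
Lemma synth_inversion f X : ccont f -> periodic f -> l1_bound (fcoef f) X ->
  (forall x, ex_derive (fun y => fst (f y)) x /\ ex_derive (fun y => snd (f y)) x) ->
  forall x, synth (fcoef f) x = f x.
Proof.
  intros Hf Hp H Hd x. destruct (Hd x) as [[l1 D1] [l2 D2]].
  destruct (fourier_inversion f x l1 l2 Hf Hp D1 D2) as [A1 A2].
  destruct (synth_lim _ _ x H) as [B1 B2].
  apply injective_projections; eapply is_lim_eq; try eassumption; reflexivity.
Qed.

(** Cauchy-Schwarz against the summable weights 1 / (1 + h^2 n^2), with h free to trade size for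
    regularity. *)
Lemma l1_bound_sq_interp h a K : 0 < h <= 1 ->
  (zsum K (cmod_seq a))² <= 5 / h * zsum K (fun n => cmod_seq a n ^ 2) + 5 * h * zsum K (fun n => IZR n ^ 2 * cmod_seq a n ^ 2).
Proof.
  intros Hh.
  set (r := fun n => 1 + h² * IZR n ^ 2).
  assert (Hr : forall n, 0 < r n).
  { intro n. unfold r. pose proof (pow2_ge_0 (IZR n)). pose proof (Rle_0_sqr h). nra. }
  rewrite (zsum_ext K (cmod_seq a) (fun n => / r n * (r n * cmod_seq a n)))
    by (intro n; specialize (Hr n); field; lra).
  eapply Rle_trans; [apply zsum_CS_weight; intro; left; apply Rinv_0_lt_compat, Hr|].
  apply Rle_trans with (5 / h * zsum K (fun n => r n * cmod_seq a n ^ 2)).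
  - rewrite (zsum_ext K (fun n => / r n * (r n * cmod_seq a n)²) (fun n => r n * cmod_seq a n ^ 2))
      by (intro n; specialize (Hr n); unfold Rsqr; field; lra).
    apply Rmult_le_compat_r; [|apply sum_bound_resolvent, Hh].
    apply zsum_nonneg. intro n. specialize (Hr n). pose proof (pow2_ge_0 (cmod_seq a n)). nra.
  - right. unfold r.
    rewrite (zsum_ext K (fun n => (1 + h² * IZR n ^ 2) * cmod_seq a n ^ 2)
      (fun n => cmod_seq a n ^ 2 + h² * (IZR n ^ 2 * cmod_seq a n ^ 2))) by (intro; ring).
    rewrite zsum_plus, zsum_scal. unfold Rsqr. field. lra.
Qed.

(** * A priori estimates *)

Lemma exp_mono x y : x <= y -> exp x <= exp y.
Proof. intros [H|H]; [left; now apply exp_increasing|subst; apply Rle_refl]. Qed.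

Lemma is_derive_exp_mult p x d c t0 : is_derive p x d ->
  is_derive (fun t => exp (c * (t - t0)) * p t) x (exp (c * (x - t0)) * (c * p x + d)).
Proof.
  intros D. auto_derive; [exists d; exact D|].
  replace (Derive (fun y => p y) x) with d by (symmetry; apply is_derive_unique; exact D).
  unfold Rminus. ring.
Qed.

Lemma nonincreasing_of_derive (p dp : R -> R) t0 T :
  (forall t, t0 <= t <= T -> is_derive p t (dp t)) -> (forall t, t0 <= t <= T -> dp t <= 0) ->
  forall t, t0 <= t <= T -> p t <= p t0.
Proof.
  intros H H' t Ht. destruct (MVT_gen p t0 t dp) as [c [Hc energy]].
  - intros x Hx. rewrite Rmin_left, Rmax_right in Hx by lra. apply H; lra.
  - intros x Hx. rewrite Rmin_left, Rmax_right in Hx by lra.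
    apply continuity_pt_filterlim, (ex_derive_continuous p). exists (dp x). apply H; lra.
  - rewrite Rmin_left, Rmax_right in Hc by lra. assert (dp c <= 0) by (apply H'; lra). nra.
Qed.

(** The quantity exp (k (t - t0)) (p - g / k) is nonincreasing. *)
Lemma gronwall_decay (p dp : R -> R) t0 T k g : 0 < k -> 0 <= g ->
  (forall t, t0 <= t <= T -> is_derive p t (dp t)) ->
  (forall t, t0 <= t <= T -> dp t <= - k * p t + g) ->
  forall t, t0 <= t <= T -> p t <= exp (- k * (t - t0)) * p t0 + g / k.
Proof.
  intros Hk Hg H H' t Ht.
  pose proof (nonincreasing_of_derive (fun t => exp (k * (t - t0)) * (p t - g / k))
    (fun t => exp (k * (t - t0)) * (k * p t - g + dp t)) t0 T) as Q.
  assert (Q1 : exp (k * (t - t0)) * (p t - g / k) <= exp (k * (t0 - t0)) * (p t0 - g / k)).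
  { apply Q; [| |exact Ht].
    - intros x Hx.
      replace (k * p x - g + dp x) with (k * (p x - g / k) + (dp x - 0)) by (field; lra).
      apply (is_derive_exp_mult (fun t => p t - g / k)).
      apply (is_derive_minus p (fun _ => g / k)); [now apply H|apply (is_derive_const (g / k))].
    - intros x Hx. pose proof (H' x Hx). pose proof (exp_pos (k * (x - t0))). nra. }
  rewrite Rminus_diag, Rmult_0_r, exp_0 in Q1.
  rewrite Ropp_mult_distr_l_reverse, exp_Ropp.
  pose proof (exp_pos (k * (t - t0))) as P.
  assert (0 <= g / k) by (apply Rdiv_le_0_compat; lra).
  assert (Q2 : p t - g / k <= / exp (k * (t - t0)) * (p t0 - g / k)).
  { apply Rmult_le_reg_l with (1 := P). rewrite <- Rmult_assoc, Rinv_r by lra. lra. }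
  pose proof (Rinv_0_lt_compat _ P). nra.
Qed.

(** The inhomogeneity enters only through g (t - t0), so that a truncation error used as g
    disappears in the limit. *)
Lemma gronwall_growth (p dp : R -> R) t0 T k g : 0 <= k -> 0 <= g ->
  (forall t, t0 <= t <= T -> is_derive p t (dp t)) ->
  (forall t, t0 <= t <= T -> dp t <= k * p t + g) ->
  forall t, t0 <= t <= T -> p t <= exp (k * (t - t0)) * (p t0 + g * (t - t0)).
Proof.
  intros Hk Hg H H' t Ht.
  assert (Q1 : exp (- (k * (t - t0))) * p t - g * (t - t0) <= exp (- (k * (t0 - t0))) * p t0 - g * (t0 - t0)).
  { apply (nonincreasing_of_derive (fun t => exp (- (k * (t - t0))) * p t - g * (t - t0))
      (fun t => exp (- (k * (t - t0))) * (dp t - k * p t) - g) t0 T); [| |exact Ht].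
    - intros x Hx.
      apply (is_derive_minus (fun t => exp (- (k * (t - t0))) * p t) (fun t => g * (t - t0)) x
               (exp (- (k * (x - t0))) * (dp x - k * p x)) g).
      + apply (is_derive_ext (fun t => exp (- k * (t - t0)) * p t)); [intro; do 2 f_equal; ring|].
        replace (exp (- (k * (x - t0))) * (dp x - k * p x))
          with (exp (- k * (x - t0)) * (- k * p x + dp x))
          by (replace (- (k * (x - t0))) with (- k * (x - t0)) by ring; ring).
        apply is_derive_exp_mult. now apply H.
      + auto_derive; [exact I|ring].
    - intros x Hx. pose proof (H' x Hx).
      assert (exp (- (k * (x - t0))) <= 1).
      { rewrite <- exp_0. apply exp_mono. nra. }
      pose proof (exp_pos (- (k * (x - t0)))). nra. }
  rewrite Rminus_diag, !Rmult_0_r, Ropp_0, exp_0, exp_Ropp in Q1.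
  pose proof (exp_pos (k * (t - t0))) as P.
  apply Rmult_le_reg_l with (/ exp (k * (t - t0))); [now apply Rinv_0_lt_compat|].
  rewrite <- Rmult_assoc, Rinv_l by lra. lra.
Qed.

Definition cderive (f : R -> C) (t : R) (l : C) : Prop :=
  is_derive (fun s => fst (f s)) t (fst l) /\ is_derive (fun s => snd (f s)) t (snd l).

Lemma cderive_Cmod_sq f t l : cderive f t l ->
  is_derive (fun s => Cmod (f s) ^ 2) t (2 * fst (Cmult l (Cconj (f t)))).
Proof.
  intros [H1 H2].
  apply (is_derive_ext (fun s => fst (f s) ^ 2 + snd (f s) ^ 2)).
  { intro s. symmetry. apply Cmod_sq. }
  replace (2 * fst (Cmult l (Cconj (f t))))
    with (2 * fst (f t) * fst l + 2 * snd (f t) * snd l) by (simpl; ring).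
  assert (S : forall (h : R -> R) d, is_derive h t d -> is_derive (fun s => h s ^ 2) t (2 * h t * d)).
  { intros h d Hd. replace (2 * h t * d) with (d * (2 * h t)) by ring.
    apply (is_derive_comp (fun y => y ^ 2) h); [|exact Hd]. auto_derive; [exact I|ring]. }
  apply (is_derive_plus (fun s => fst (f s) ^ 2) (fun s => snd (f s) ^ 2)).
  - now apply (S (fun s => fst (f s))).
  - now apply (S (fun s => snd (f s))).
Qed.

Lemma is_derive_zsum K (f : Z -> R -> R) (df : Z -> R) t :
  (forall n, is_derive (f n) t (df n)) -> is_derive (fun s => zsum K (fun n => f n s)) t (zsum K df).
Proof.
  intros H. induction K as [|K IH]; cbn [zsum]; [apply H|].
  apply (is_derive_plus (fun s => zsum K (fun n => f n s)) _ t (zsum K df)); [exact IH|].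
  apply (is_derive_plus (f _) (f _)); apply H.
Qed.

(** The estimate is made for |f|^2 exp (-2 mu (t - t0)), which sees only the real part of l. The
    forcing may grow at the rate mu because the Picard iterates are compared in a norm with that
    exponential weight. *)
Lemma linear_ode_bound (f : R -> C) (l : C) (g : R -> C) t0 T mu G : fst l < mu -> 0 <= G ->
  (forall t, t0 <= t <= T -> cderive f t (Cplus (Cmult l (f t)) (g t))) ->
  (forall t, t0 <= t <= T -> Cmod (g t) <= G * exp (mu * (t - t0))) ->
  forall t, t0 <= t <= T ->
    Cmod (f t) ^ 2 <= exp (2 * mu * (t - t0)) *
      (exp (- (mu - fst l) * (t - t0)) * Cmod (f t0) ^ 2 + (G / (mu - fst l)) ^ 2).
Proof.
  intros Hmu HG H Hg t Ht. set (c := mu - fst l). assert (Hc : 0 < c) by (unfold c; lra).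
  set (p := fun s => exp (- (2 * mu) * (s - t0)) * Cmod (f s) ^ 2).
  set (dp := fun s => exp (- (2 * mu) * (s - t0)) *
    (2 * fst (Cmult (Cplus (Cmult l (f s)) (g s)) (Cconj (f s))) - 2 * mu * Cmod (f s) ^ 2)).
  assert (Q : p t <= exp (- c * (t - t0)) * p t0 + (G ^ 2 / c) / c).
  { apply (gronwall_decay p dp t0 T c (G ^ 2 / c)); auto.
    - apply Rdiv_le_0_compat; [apply pow2_ge_0|lra].
    - intros s Hs. pose proof (cderive_Cmod_sq _ _ _ (H s Hs)) as D. unfold p, dp.
      replace (2 * fst (Cmult (Cplus (Cmult l (f s)) (g s)) (Cconj (f s))) - 2 * mu * Cmod (f s) ^ 2)
        with (- (2 * mu) * Cmod (f s) ^ 2 + 2 * fst (Cmult (Cplus (Cmult l (f s)) (g s)) (Cconj (f s)))) by ring.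
      exact (is_derive_exp_mult (fun s => Cmod (f s) ^ 2) _ _ _ _ D).
    - intros s Hs. unfold p, dp. pose proof (Hg s Hs) as B.
      set (energy := exp (- (2 * mu) * (s - t0))).
      assert (PE : 0 < energy) by apply exp_pos.
      assert (EE : energy * (exp (mu * (s - t0)) * exp (mu * (s - t0))) = 1).
      { unfold energy. rewrite <- !exp_plus, <- exp_0. f_equal. ring. }
      set (m := Cmod (f s)) in *. assert (Hm : 0 <= m) by apply Cmod_ge_0.
      assert (I1 : fst (Cmult (Cplus (Cmult l (f s)) (g s)) (Cconj (f s))) <= fst l * m ^ 2 + Cmod (g s) * m).
      { replace (Cmult (Cplus (Cmult l (f s)) (g s)) (Cconj (f s)))
          with (Cplus (Cmult l (Cmult (f s) (Cconj (f s)))) (Cmult (g s) (Cconj (f s)))) by ring.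
        rewrite Cmult_conj_self. simpl fst.
        assert (I2 : fst (Cmult (g s) (Cconj (f s))) <= Cmod (g s) * m).
        { eapply Rle_trans; [apply Rle_abs|]. eapply Rle_trans; [apply Rabs_fst_le|].
          rewrite Cmod_mult, Cmod_conj. apply Rle_refl. }
        simpl fst in I2. fold m. simpl. simpl in I2. lra. }
      assert (I3 : Cmod (g s) ^ 2 <= G ^ 2 * (exp (mu * (s - t0)) * exp (mu * (s - t0)))).
      { replace (G ^ 2 * (exp (mu * (s - t0)) * exp (mu * (s - t0)))) with ((G * exp (mu * (s - t0))) ^ 2) by ring.
        apply pow_incr. split; [apply Cmod_ge_0|exact B]. }
      (* Young's inequality spends half of the damping 2 c on the forcing. *)
      assert (I4 : 2 * (Cmod (g s) * m) <= c * m ^ 2 + Cmod (g s) ^ 2 / c).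
      { apply Rmult_le_reg_r with c; [exact Hc|].
        replace ((c * m ^ 2 + Cmod (g s) ^ 2 / c) * c) with ((c * m) ^ 2 + Cmod (g s) ^ 2) by (field; lra).
        pose proof (pow2_ge_0 (c * m - Cmod (g s))). nra. }
      apply Rle_trans with (energy * (- c * m ^ 2 + Cmod (g s) ^ 2 / c)).
      + apply Rmult_le_compat_l; [lra|]. unfold c in *. lra.
      + rewrite Rmult_plus_distr_l. apply Rplus_le_compat; [right; ring|].
        apply Rle_trans with (energy * (G ^ 2 * (exp (mu * (s - t0)) * exp (mu * (s - t0))) / c)).
        * apply Rmult_le_compat_l; [lra|]. apply Rmult_le_compat_r; [left; now apply Rinv_0_lt_compat|exact I3].
        * right. unfold Rdiv. rewrite <- (Rmult_1_r (G ^ 2 * / c)), <- EE. ring. }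
  unfold p in Q. rewrite Rminus_diag, Rmult_0_r, exp_0, Rmult_1_l in Q.
  rewrite Ropp_mult_distr_l_reverse, exp_Ropp in Q. pose proof (exp_pos (2 * mu * (t - t0))) as P.
  apply Rmult_le_reg_l with (/ exp (2 * mu * (t - t0))); [now apply Rinv_0_lt_compat|].
  rewrite <- Rmult_assoc, Rinv_l, Rmult_1_l by lra.
  replace ((G / c) ^ 2) with (G ^ 2 / c / c) by (field; lra). exact Q.
Qed.

(** * Sobolev energies: embeddings, tails and interpolation *)

Definition energy (s : R) (a : Z -> C) : R := zseries (Hs_terms s a).

Lemma Hs_terms_0 a n : Hs_terms 0 a n = cmod_seq a n ^ 2.
Proof. unfold Hs_terms, cmod_seq. rewrite Hs_weight_W, Rpower_O by apply W_pos. ring. Qed.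

Lemma Hs_terms_1 a n : Hs_terms 1 a n = W n * cmod_seq a n ^ 2.
Proof. unfold Hs_terms, cmod_seq. now rewrite Hs_weight_W, Rpower_1 by apply W_pos. Qed.

Lemma Hs_weight_S s n : Hs_weight (s + 1) n = W n * Hs_weight s n.
Proof. rewrite !Hs_weight_W, Rpower_plus, Rpower_1 by apply W_pos. ring. Qed.

Lemma Hs_terms_S s a n : Hs_terms (s + 1) a n = W n * Hs_terms s a n.
Proof. unfold Hs_terms. rewrite Hs_weight_S. ring. Qed.

Lemma Hs_terms_le s s' a n : s <= s' -> Hs_terms s a n <= Hs_terms s' a n.
Proof.
  intros H. unfold Hs_terms. apply Rmult_le_compat_r; [apply pow2_ge_0|].
  rewrite !Hs_weight_W. apply Rle_Rpower; [apply W_ge1|exact H].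
Qed.

Lemma hs_bound_le s s' a B : s <= s' -> hs_bound s' a B -> hs_bound s a B.
Proof. intros H. apply sum_bound_le. intro n. now apply Hs_terms_le. Qed.

Lemma hs_bound_energy s a B : hs_bound s a B -> hs_bound s a (energy s a).
Proof. apply sum_bound_zseries, nonneg_Hs. Qed.

Lemma energy_le s a B : hs_bound s a B -> energy s a <= B.
Proof. apply zseries_le_sum_bound, nonneg_Hs. Qed.

Lemma energy_ge0 s a B : hs_bound s a B -> 0 <= energy s a.
Proof. intros H. eapply hs_bound_ge0, hs_bound_energy, H. Qed.

Lemma energy_lim s a B : hs_bound s a B -> is_lim_seq (fun K => zsum K (Hs_terms s a)) (energy s a).
Proof. intros H. eapply is_lim_zsum; [apply nonneg_Hs|exact H]. Qed.

Lemma energy_mono s s' a B : s <= s' -> hs_bound s' a B -> energy s a <= energy s' a.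
Proof. intros H HB. apply energy_le. eapply hs_bound_le; [exact H|]. eapply hs_bound_energy, HB. Qed.

Lemma decay2_hs0 a A : decay2 a A -> hs_bound 0 a (A * A * 5).
Proof.
  intros H. pose proof (decay2_ge0 _ _ H) as A0.
  eapply sum_bound_le; [|apply (sum_bound_scal (fun n => / W n) (A * A) 5); [nra|apply sum_bound_invW]].
  intro n. rewrite Hs_terms_0. pose proof (decay2_le _ _ n H) as Q. fold (cmod_seq a n) in Q.
  pose proof (nonneg_cmod_seq a n). pose proof (W_ge1 n).
  assert (/ W n <= 1) by (rewrite <- Rinv_1; apply Rinv_le_contravar; lra).
  assert (0 < / W n) by (apply Rinv_0_lt_compat; lra).
  assert (cmod_seq a n ^ 2 <= (A * / W n) ^ 2) by (apply pow_incr; lra). nra.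
Qed.

Lemma hs_bound_decay2 a B : hs_bound 2 a B -> decay2 a (sqrt B).
Proof.
  intros H n. pose proof (sum_bound_term _ _ n (nonneg_Hs 2 a) H) as Q.
  pose proof (hs_bound_ge0 _ _ _ H).
  unfold Hs_terms in Q. rewrite Hs_weight_W in Q.
  replace 2 with (1 + 1) in Q at 1 by ring. rewrite Rpower_plus, Rpower_1 in Q by apply W_pos.
  apply Rsqr_incr_0_var; [|apply sqrt_pos]. rewrite Rsqr_sqrt by assumption.
  unfold Rsqr. replace (Cmod (a n) * W n * (Cmod (a n) * W n)) with (W n * W n * Cmod (a n) ^ 2) by ring.
  exact Q.
Qed.

Lemma hs_bound_l1_bound a B : hs_bound 1 a B -> l1_bound a (sqrt (5 * B)).
Proof.
  intros H K. pose proof (hs_bound_ge0 _ _ _ H).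
  apply Rsqr_incr_0_var; [|apply sqrt_pos]. rewrite Rsqr_sqrt by lra.
  rewrite (zsum_ext K (cmod_seq a) (fun n => / W n * (W n * cmod_seq a n)))
    by (intro n; pose proof (W_pos n); field; lra).
  eapply Rle_trans; [apply zsum_CS_weight; intro n; left; apply Rinv_0_lt_compat, W_pos|].
  apply Rmult_le_compat.
  - apply zsum_nonneg; intro n; left; apply Rinv_0_lt_compat, W_pos.
  - apply zsum_nonneg; intro n. apply Rmult_le_pos; [left; apply Rinv_0_lt_compat, W_pos|apply Rle_0_sqr].
  - apply sum_bound_invW.
  - eapply Rle_trans; [|apply (H K)]. right. apply zsum_ext. intro n. rewrite Hs_terms_1.
    pose proof (W_pos n). unfold Rsqr. field. lra.
Qed.

(** One spare power of W pays for the modes beyond K. The error depends on a only through B, so it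
    vanishes uniformly in time along a solution with a uniform bound. *)
Lemma energy_tail s a B K : hs_bound (s + 1) a B -> energy s a <= zsum K (Hs_terms s a) + B / W (Z.of_nat K).
Proof.
  intros H. assert (H0 : hs_bound s a B) by (apply hs_bound_le with (2 := H); lra).
  pose proof (hs_bound_ge0 _ _ _ H) as HB. pose proof (W_pos (Z.of_nat K)) as PW.
  assert (Q : forall K', (K <= K')%nat ->
    W (Z.of_nat K) * (zsum K' (Hs_terms s a) - zsum K (Hs_terms s a)) <= zsum K' (Hs_terms (s + 1) a)).
  { induction 1 as [|K' HK IH].
    - rewrite Rminus_diag, Rmult_0_r. apply zsum_nonneg; auto.
    - cbn [zsum]. rewrite !Hs_terms_S, W_opp.
      assert (HW : W (Z.of_nat K) <= W (Z.of_nat (S K'))).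
      { unfold W. rewrite <- !INR_IZR_INZ. apply Rplus_le_compat_r, pow_incr.
        split; [apply pos_INR|apply le_INR; lia]. }
      pose proof (nonneg_Hs s a (Z.of_nat (S K'))). pose proof (nonneg_Hs s a (- Z.of_nat (S K'))%Z). nra. }
  apply (lim_le (fun J => zsum (K + J) (Hs_terms s a))).
  - intro J. specialize (Q (K + J)%nat ltac:(lia)). pose proof (H (K + J)%nat) as Q2.
    apply Rmult_le_reg_l with (1 := PW).
    replace (W (Z.of_nat K) * (zsum K (Hs_terms s a) + B / W (Z.of_nat K)))
      with (W (Z.of_nat K) * zsum K (Hs_terms s a) + B) by (field; lra). lra.
  - pose proof (energy_lim s a B H0) as L. apply (is_lim_seq_incr_n _ K) in L.
    eapply is_lim_seq_ext; [|exact L]. intro J. simpl. f_equal. lia.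
Qed.

Lemma is_lim_inv_W B : is_lim_seq (fun K => B / W (Z.of_nat K)) 0.
Proof.
  apply (is_lim_seq_scal0 (fun K => / W (Z.of_nat K)) B).
  apply is_lim_seq_le_le with (fun _ => 0) (fun K => / (INR K + 1)).
  - intro K. split; [left; apply Rinv_0_lt_compat, W_pos|].
    apply Rinv_le_contravar; [pose proof (pos_INR K); lra|].
    unfold W. rewrite <- INR_IZR_INZ. destruct K as [|K]; [simpl; lra|].
    rewrite S_INR. pose proof (pos_INR K). nra.
  - apply is_lim_seq_const.
  - assert (L : is_lim_seq (fun K => INR K + 1) p_infty).
    { apply is_lim_seq_plus with p_infty 1; [apply is_lim_seq_INR|apply is_lim_seq_const|reflexivity]. }
    apply is_lim_seq_inv with (l := p_infty) in L; [exact L|discriminate].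
Qed.

Lemma l1norm_interp h a B : 0 < h <= 1 -> hs_bound 1 a B -> (l1norm a)² <= 5 / h * energy 0 a + 5 * h * energy 1 a.
Proof.
  intros Hh H. pose proof (hs_bound_l1_bound _ _ H) as HL.
  assert (H0 : hs_bound 0 a B) by (apply hs_bound_le with (2 := H); lra).
  apply (lim_le (fun K => (zsum K (cmod_seq a))²)).
  - intro K. eapply Rle_trans; [apply l1_bound_sq_interp, Hh|]. apply Rplus_le_compat.
    + apply Rmult_le_compat_l; [left; apply Rdiv_lt_0_compat; lra|].
      eapply Rle_trans; [|apply (hs_bound_energy 0 a B H0 K)]. right. apply zsum_ext. intro; symmetry; apply Hs_terms_0.
    + apply Rmult_le_compat_l; [lra|].
      eapply Rle_trans; [|apply (hs_bound_energy 1 a B H K)]. apply zsum_le. intro n. rewrite Hs_terms_1.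
      unfold W. pose proof (pow2_ge_0 (cmod_seq a n)). lra.
  - unfold Rsqr. pose proof (is_lim_zsum _ _ (nonneg_cmod_seq a) HL) as L.
    apply is_lim_seq_mult'; exact L.
Qed.

(** Instead of Hölder, the product is expanded as a double sum in which W(m)^s W(n) <= W(n)^(s+1) +
    W(m)^(s+1) holds term by term; the two summands account for the factor 2. *)
Lemma energy_interp s a B : 0 <= s -> hs_bound (s + 1) a B -> energy 1 a * energy s a <= 2 * energy 0 a * energy (s + 1) a.
Proof.
  intros Hs H.
  assert (H0 : hs_bound 0 a B) by (apply hs_bound_le with (2 := H); lra).
  assert (H1 : hs_bound 1 a B) by (apply hs_bound_le with (2 := H); lra).
  assert (H2 : hs_bound s a B) by (apply hs_bound_le with (2 := H); lra).
  apply (lim_le (fun K => zsum K (Hs_terms 1 a) * zsum K (Hs_terms s a))).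
  - intro K. apply Rle_trans with (2 * zsum K (Hs_terms 0 a) * zsum K (Hs_terms (s + 1) a)).
    + rewrite <- zsum_scal.
      apply Rle_trans with (zsum K (fun m => zsum K (fun n => Hs_terms 0 a m * Hs_terms (s + 1) a n + Hs_terms (s + 1) a m * Hs_terms 0 a n))).
      * apply zsum_le. intro m. rewrite (Rmult_comm _ (Hs_terms s a m)), <- zsum_scal. apply zsum_le. intro n.
        assert (Q : Hs_weight s m * W n <= Hs_weight (s + 1) n + Hs_weight (s + 1) m).
        { rewrite !Hs_weight_S, !Hs_weight_W. pose proof (W_pos n). pose proof (W_pos m).
          assert (P : forall x, 0 < Rpower x s) by (intro; apply exp_pos).
          pose proof (P (W n)). pose proof (P (W m)).
          destruct (Rle_dec (W m) (W n)) as [L|L].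
          - assert (Rpower (W m) s <= Rpower (W n) s) by (apply Rle_Rpower_l; lra). nra.
          - nra. }
        rewrite Hs_terms_1, !Hs_terms_0. unfold Hs_terms, cmod_seq.
        pose proof (pow2_ge_0 (Cmod (a m))) as P1. pose proof (pow2_ge_0 (Cmod (a n))) as P2.
        pose proof (Rmult_le_pos _ _ P1 P2) as P.
        apply (Rmult_le_compat_r _ _ _ P) in Q. lra.
      * right.
        rewrite (zsum_ext K _ (fun m => zsum K (Hs_terms (s + 1) a) * Hs_terms 0 a m + zsum K (Hs_terms 0 a) * Hs_terms (s + 1) a m)).
        -- rewrite zsum_plus, !zsum_scal. ring.
        -- intro m. rewrite zsum_plus, !zsum_scal. ring.
    + rewrite !Rmult_assoc. apply Rmult_le_compat_l; [lra|].
      apply Rmult_le_compat; [apply zsum_nonneg; auto|apply zsum_nonneg; auto| |].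
      * eapply hs_bound_energy, H0.
      * eapply hs_bound_energy, H.
  - apply is_lim_seq_mult'; eapply energy_lim; eassumption.
Qed.

Definition W_tail (K : nat) : R := zseries (fun n => / W n) - zsum K (fun n => / W n).

Lemma nonneg_invW : nonneg (fun n => / W n).
Proof. intro n. left. apply Rinv_0_lt_compat, W_pos. Qed.

Lemma W_tail_lim : is_lim_seq W_tail 0.
Proof.
  unfold W_tail. replace (Finite 0) with (Finite (zseries (fun n => / W n) - zseries (fun n => / W n))) by (f_equal; ring).
  apply is_lim_seq_minus'; [apply is_lim_seq_const|]. eapply is_lim_zsum; [apply nonneg_invW|apply sum_bound_invW].
Qed.

Lemma l1_tail_Y a A K : decay2 a A -> l1_tail a K <= A * W_tail K.
Proof.
  intros H. pose proof (decay2_ge0 _ _ H) as A0.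
  eapply Rle_trans; [apply Rle_abs|].
  eapply Rle_trans.
  - apply (zseries_tail (cmod_seq a) (fun n => A * / W n) (A * 5) K).
    + intro n. rewrite Rabs_pos_eq by apply nonneg_cmod_seq. now apply decay2_le.
    + apply sum_bound_scal; [exact A0|apply sum_bound_invW].
  - right. rewrite zsum_scal. unfold W_tail.
    assert (Q : zseries (fun n => A * / W n) = A * zseries (fun n => / W n)).
    { unfold zseries. rewrite <- Series_scal_l. apply Series_ext. intros [|k]; cbn [zfold]; ring. }
    rewrite Q. ring.
Qed.

(** * The equation for the coefficients and the absorbing ball in H *)

Section Equation.
Variables (gamma omega : R) (beta : C) (L : R).

Definition symbol (n : Z) : C :=
  (- IZR n ^ 2 + fst beta, - gamma * IZR n ^ 2 + snd beta - L * IZR n ^ 3).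
Definition vfield (a : Z -> C) (n : Z) : C := Cminus (Cmult (symbol n) (a n)) (Cmult (1, omega) (cubic_coef a n)).
Definition re_beta : R := Rabs (fst beta).
Definition omega_bd : R := 1 + Rabs omega.

Definition seq_eq (a : R -> Z -> C) (t0 T : R) : Prop :=
  forall t n, t0 <= t <= T -> cderive (fun s => a s n) t (vfield (a t) n).
Definition smooth_on (a : R -> Z -> C) (t0 T : R) : Prop :=
  forall s, 0 <= s -> exists B, forall t, t0 <= t <= T -> hs_bound s (a t) B.

Lemma re_beta_ge0 : 0 <= re_beta.
Proof. apply Rabs_pos. Qed.
Lemma omega_bd_ge1 : 1 <= omega_bd.
Proof. unfold omega_bd. pose proof (Rabs_pos omega). lra. Qed.

Lemma Cmod_1omega : Cmod (1, omega) <= omega_bd.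
Proof.
  eapply Rle_trans; [apply Cmod_le_abs|]. simpl. unfold omega_bd. rewrite (Rabs_pos_eq 1) by lra. lra.
Qed.

Lemma seq_eq_sub a t0 T t1 T1 : t0 <= t1 -> T1 <= T -> seq_eq a t0 T -> seq_eq a t1 T1.
Proof. intros ? ? H t n Ht. apply H; lra. Qed.
Lemma smooth_on_sub a t0 T t1 T1 : t0 <= t1 -> T1 <= T -> smooth_on a t0 T -> smooth_on a t1 T1.
Proof. intros ? ? H s Hs. destruct (H s Hs) as [B HB]. exists B. intros; apply HB; lra. Qed.

Lemma smooth_decay2 a t0 T : smooth_on a t0 T -> exists A, forall t, t0 <= t <= T -> decay2 (a t) A.
Proof.
  intros H. destruct (H 2) as [B HB]; [lra|]. exists (sqrt B). intros t Ht. apply hs_bound_decay2, HB, Ht.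
Qed.

(** All that the energy estimates use of the symbol; neither [gamma] nor [L] survives on the
    right. *)
Lemma lam_re_le n : fst (symbol n) <= 1 + re_beta - W n.
Proof. unfold symbol, re_beta, W; simpl fst. pose proof (Rle_abs (fst beta)). lra. Qed.

Lemma is_derive_weighted a t0 T K (w : Z -> R) t : seq_eq a t0 T -> t0 <= t <= T ->
  is_derive (fun s => zsum K (fun n => w n * Cmod (a s n) ^ 2)) t
    (zsum K (fun n => w n * (2 * fst (Cmult (vfield (a t) n) (Cconj (a t n)))))).
Proof.
  intros H Ht. apply (is_derive_zsum K (fun n s => w n * Cmod (a s n) ^ 2)).
  intro n. apply (is_derive_scal (fun s => Cmod (a s n) ^ 2)).
  apply (cderive_Cmod_sq (fun s => a s n)), H, Ht.
Qed.

Lemma rhs_re a n : fst (Cmult (vfield a n) (Cconj (a n)))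
  = fst (symbol n) * Cmod (a n) ^ 2 - fst (Cmult (1, omega) (Cmult (cubic_coef a n) (Cconj (a n)))).
Proof. rewrite Cmod_sq. unfold vfield, Cminus. simpl. ring. Qed.

Lemma avg_sq_le g : rcont g -> (avg g)² <= avg (fun x => g x ^ 2).
Proof.
  intros Hg. assert (0 <= avg (fun x => (g x - avg g) ^ 2)).
  { apply avg_nonneg; auto with contdb. intro; apply pow2_ge_0. }
  rewrite (avg_ext _ (fun x => (g x ^ 2 - (2 * avg g) * g x) + (avg g)²)) in H
    by (intro; unfold Rsqr; ring).
  rewrite avg_plus, avg_minus, avg_scal, avg_const in H by auto with contdb. unfold Rsqr in *. lra.
Qed.

(* The untruncated pairing <(1 + i omega)|u|^2 u, u> has real part equal to the mean of |u|^4,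
   which is at least |u|_H^4; the left-hand side accounts for the truncation. *)
Lemma cubic_coef_energy a A K : decay2 a A ->
  - (4 * omega_bd * (5 * A) ^ 3 * (A * W_tail K)) <= 2 * fst (czsum K (fun n => Cmult (1, omega) (Cmult (cubic_coef a n) (Cconj (a n))))) - 2 * (energy 0 a)².
Proof.
  intros H. pose proof (decay2_l1_bound _ _ H) as HL. pose proof (ccont_synth _ _ HL) as Hc.
  pose proof (decay2_ge0 _ _ H) as A0.
  rewrite czsum_mult_l. unfold cubic_coef. rewrite <- (cavg_conj_trig K a (fun x => cubic (synth a x))) by auto with contdb.
  set (M4 := avg (fun x => Cmod (synth a x) ^ 4)).
  assert (HM : cavg (fun x => Cmult (cubic (synth a x)) (Cconj (synth a x))) = RtoC M4).
  { unfold M4. rewrite <- cavg_RtoC. apply cavg_ext. intro x. unfold cubic.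
    transitivity (Cmult (RtoC (Cmod (synth a x) ^ 2)) (Cmult (synth a x) (Cconj (synth a x)))); [ring|].
    rewrite Cmult_conj_self, <- RtoC_mult. f_equal. ring. }
  assert (HE : (energy 0 a)² <= M4).
  { assert (Q : energy 0 a = avg (fun x => Cmod (synth a x) ^ 2)).
    { rewrite (parseval a _ HL). unfold energy, zseries. apply Series_ext.
      intros [|k]; cbn [zfold]; now rewrite !Hs_terms_0. }
    rewrite Q. eapply Rle_trans; [apply avg_sq_le; auto with contdb|].
    right. apply avg_ext. intro; ring. }
  set (D := cavg (fun x => Cmult (cubic (synth a x)) (Cconj (trig K a x)))).
  (* The truncated pairing differs from the full one by at most |u|^3 times the uniform distance
     between the series and its partial sum. *)
  assert (HD : Cmod (Cminus D (RtoC M4)) <= (5 * A) ^ 3 * (2 * (A * W_tail K))).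
  { rewrite <- HM. unfold D. rewrite <- cavg_minus by auto with contdb.
    apply Cmod_cavg_bound; [auto 6 with contdb|]. intro x.
    replace (Cminus (Cmult (cubic (synth a x)) (Cconj (trig K a x))) (Cmult (cubic (synth a x)) (Cconj (synth a x))))
      with (Cmult (cubic (synth a x)) (Copp (Cconj (Cminus (synth a x) (trig K a x)))))
      by (unfold Cminus; rewrite Cplus_conj, Copp_conj; ring).
    rewrite Cmod_mult, Cmod_cubic, Cmod_opp, Cmod_conj.
    apply Rmult_le_compat; [apply pow_le, Cmod_ge_0|apply Cmod_ge_0| |].
    - apply pow_incr. split; [apply Cmod_ge_0|].
      eapply Rle_trans; [eapply synth_bound, HL|]. pose proof (l1norm_le _ _ HL). lra.
    - eapply Rle_trans; [eapply synth_tail, HL|]. pose proof (l1_tail_Y a A K H). lra. }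
  assert (Q : Rabs (fst (Cmult (1, omega) (Cminus D (RtoC M4)))) <= omega_bd * ((5 * A) ^ 3 * (2 * (A * W_tail K)))).
  { eapply Rle_trans; [apply Rabs_fst_le|]. rewrite Cmod_mult.
    apply Rmult_le_compat; try apply Cmod_ge_0; [apply Cmod_1omega|exact HD]. }
  apply Rabs_le_between in Q. unfold Cminus in Q. simpl fst in *. lra.
Qed.

(** The maximum over y of (2 b + 1) y - 2 y^2 with b = [re_beta], attained at y = (2 b + 1) / 4:
    what can remain of 2 b E - 2 E^2 once the decay -E has been taken out. *)
Definition absorb_cst : R := (2 * re_beta + 1) ^ 2 / 8.

Lemma absorb_cst_ge0 : 0 <= absorb_cst.
Proof. unfold absorb_cst. pose proof (pow2_ge_0 (2 * re_beta + 1)). lra. Qed.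

Lemma lim_le_eps (x y : R) (u v : nat -> R) :
  (forall K, u K <= y + v K) -> is_lim_seq u x -> is_lim_seq v 0 -> x <= y.
Proof.
  intros H Hu Hv. replace y with (y + 0) by ring.
  apply (is_lim_seq_le u (fun K => y + v K) x (y + 0) H Hu).
  apply is_lim_seq_plus'; [apply is_lim_seq_const|exact Hv].
Qed.

Lemma L2_decay_Y a t0 T A : seq_eq a t0 T -> (forall t, t0 <= t <= T -> decay2 (a t) A) ->
  forall t, t0 <= t <= T -> energy 0 (a t) <= exp (- (t - t0)) * energy 0 (a t0) + absorb_cst.
Proof.
  intros H HY t Ht.
  assert (HE : forall s, t0 <= s <= T -> hs_bound 0 (a s) (A * A * 5)).
  { intros s Hs. apply decay2_hs0, HY, Hs. }
  pose proof (decay2_ge0 _ _ (HY t Ht)) as A0.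
  set (eps := fun K => 4 * omega_bd * (5 * A) ^ 3 * (A * W_tail K)).
  assert (Leps : is_lim_seq eps 0).
  { unfold eps. apply is_lim_seq_ext with (fun K => (4 * omega_bd * (5 * A) ^ 3 * A) * W_tail K); [intro; ring|].
    apply is_lim_seq_scal0, W_tail_lim. }
  assert (eps0 : forall K, 0 <= eps K).
  { intro K. unfold eps. pose proof omega_bd_ge1. pose proof (l1_tail_Y _ _ K (HY t Ht)).
    pose proof (l1_tail_ge0 _ _ K (decay2_l1_bound _ _ (HY t Ht))).
    assert (0 <= (5 * A) ^ 3) by (apply pow_le; lra).
    apply Rmult_le_pos; [|lra]. apply Rmult_le_pos; lra. }
  assert (Q : forall K, zsum K (Hs_terms 0 (a t)) <= exp (- (t - t0)) * energy 0 (a t0) + absorb_cst + eps K).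
  { intro K.
    assert (SE : forall s, zsum K (Hs_terms 0 (a s)) = zsum K (fun n => 1 * Cmod (a s n) ^ 2)).
    { intro s. apply zsum_ext. intro n. rewrite Hs_terms_0. unfold cmod_seq. ring. }
    pose proof (gronwall_decay _ _ t0 T 1 (absorb_cst + eps K) Rlt_0_1 ltac:(pose proof absorb_cst_ge0; specialize (eps0 K); lra)
      (fun s Hs => is_derive_weighted a t0 T K (fun _ => 1) s H Hs)) as G.
    cbv beta in G.
    apply Rle_trans with (exp (- 1 * (t - t0)) * zsum K (fun n => 1 * Cmod (a t0 n) ^ 2) + (absorb_cst + eps K) / 1).
    - rewrite SE. apply G; [|exact Ht]. clear G. intros s Hs.
      pose proof (cubic_coef_energy (a s) A K (HY s Hs)) as N. fold (eps K) in N.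
      pose proof (hs_bound_energy _ _ _ (HE s Hs) K) as Y2. rewrite SE in Y2.
      assert (Y0 : 0 <= zsum K (fun n => 1 * Cmod (a s n) ^ 2)).
      { rewrite <- SE. apply zsum_nonneg; auto. }
      set (y := zsum K (fun n => 1 * Cmod (a s n) ^ 2)) in *.
      rewrite (zsum_ext K _ (fun n => 2 * (fst (symbol n) * Cmod (a s n) ^ 2) -
         2 * fst (Cmult (1, omega) (Cmult (cubic_coef (a s) n) (Cconj (a s n)))))) by (intro; rewrite rhs_re; ring).
      rewrite zsum_minus, zsum_scal, zsum_scal. unfold czsum in N; cbn [fst] in N.
      assert (Z1 : zsum K (fun n => fst (symbol n) * Cmod (a s n) ^ 2) <= re_beta * y).
      { unfold y. rewrite <- zsum_scal. apply zsum_le. intro n. rewrite Rmult_1_l.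
        apply Rmult_le_compat_r; [apply pow2_ge_0|]. pose proof (lam_re_le n). pose proof (W_ge1 n). lra. }
      (* The dissipation is quadratic in the full energy, which dominates the truncated y, so that
         -2 y^2 is available. *)
      pose proof re_beta_ge0. assert (y² <= (energy 0 (a s))²) by (apply Rsqr_incr_1; lra).
      unfold absorb_cst. unfold Rsqr in *.
      pose proof (pow2_ge_0 (4 * y - (2 * re_beta + 1))).
      nra.
    - rewrite <- SE. replace (-1 * (t - t0)) with (- (t - t0)) by ring.
      pose proof (hs_bound_energy _ _ _ (HE t0 ltac:(lra)) K). pose proof (exp_pos (- (t - t0))). nra. }
  eapply lim_le_eps; [exact Q|eapply energy_lim, HE, Ht|exact Leps].
Qed.
End Equation.

(** * Parabolic gain of regularity *)

Lemma ln_le_id y : 0 < y -> ln y <= y.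
Proof. intros H. pose proof (exp_ineq1_le (ln y)). rewrite exp_ln in H0 by exact H. lra. Qed.

(** x^p exp (- c x) is largest at x = p / c; using ln y <= y instead of y - 1 gives away only the
    factor exp (- p). *)
Lemma Rpower_exp_bound x p c : 0 < x -> 0 < p -> 0 < c ->
  Rpower x p * exp (- (c * x)) <= Rpower (p / c) p.
Proof.
  intros Hx Hp Hc. unfold Rpower. rewrite <- exp_plus. apply exp_mono.
  assert (Q : ln (x * c / p) <= x * c / p).
  { apply ln_le_id. apply Rdiv_lt_0_compat; [nra|exact Hp]. }
  replace (x * c / p) with (x * / (p / c)) in Q at 1 by (field; lra).
  assert (0 < p / c) by (apply Rdiv_lt_0_compat; lra).
  rewrite ln_mult, ln_Rinv in Q by (try apply Rinv_0_lt_compat; lra).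
  apply (Rmult_le_compat_l p) in Q; [|lra].
  replace (p * (x * c / p)) with (c * x) in Q by (field; lra). lra.
Qed.

(** Passing from a supremum to a sum costs one power of W, so the two powers of [parabolic_gain]
    leave a net gain of one. *)
Lemma sup_hs_bound s a M : (forall n, Hs_weight (s + 2) n * Cmod (a n) ^ 2 <= M) -> hs_bound (s + 1) a (M * 5).
Proof.
  intros H.
  assert (M0 : 0 <= M).
  { eapply Rle_trans; [|apply (H 0%Z)]. apply Rmult_le_pos; [left; apply Hs_weight_pos|apply pow2_ge_0]. }
  eapply sum_bound_le; [|apply (sum_bound_scal (fun n => / W n) M 5 M0 sum_bound_invW)].
  intro n. specialize (H n). replace (s + 2) with (s + 1 + 1) in H by ring.
  rewrite Hs_weight_S in H. unfold Hs_terms. pose proof (W_pos n).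
  apply Rmult_le_reg_l with (W n); [assumption|].
  replace (W n * (M * / W n)) with M by (field; lra). lra.
Qed.

Lemma hs_bound_sup s a B n : hs_bound s a B -> Hs_weight s n * Cmod (a n) ^ 2 <= B.
Proof. intros H. apply (sum_bound_term _ _ n (nonneg_Hs s a) H). Qed.

Section Equation.
Variables (gamma omega : R) (beta : C) (L : R).
Local Notation lam := (symbol gamma beta L).
Local Notation rhs := (vfield gamma omega beta L).
Local Notation seq_eq := (seq_eq gamma omega beta L).
Local Notation re_beta := (re_beta beta).
Local Notation omega_bd := (omega_bd omega).

(* In the n-th equation the forcing is damped at a rate of order W n, hence two more powers of W. *)
Lemma parabolic_gain a t0 T s B A : 0 <= s -> seq_eq a t0 T ->
  (forall t, t0 <= t <= T -> hs_bound s (a t) B) -> (forall t, t0 <= t <= T -> decay2 (a t) A) ->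
  exists M, forall t n, t0 <= t <= T ->
    Hs_weight (s + 2) n * Cmod (a t n) ^ 2
    <= Hs_weight (s + 2) n * exp (- (/ 2 * W n * (t - t0))) * Cmod (a t0 n) ^ 2 + M.
Proof.
  intros Hs H HB HY. set (G2 := cubic_cst s * (A * 5) ^ 4 * B).
  (* The first term is the forcing over the damping W n / 2, squared; the second bounds the low
     modes. *)
  exists (4 * omega_bd ^ 2 * G2 + Rpower (2 * (1 + re_beta)) (s + 2) * A ^ 2).
  intros t n Ht. pose proof (re_beta_ge0 beta) as Hb. pose proof (omega_bd_ge1 omega) as Ho.
  pose proof (decay2_ge0 _ _ (HY t Ht)) as A0.
  assert (HG : forall s', t0 <= s' <= T -> Hs_weight s n * Cmod (cubic_coef (a s') n) ^ 2 <= G2).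
  { intros s' Hs'. apply hs_bound_sup. apply cubic_coef_Hs; [exact Hs|apply decay2_l1_bound, HY, Hs'|apply HB, Hs']. }
  assert (G0 : 0 <= G2).
  { eapply Rle_trans; [|apply (HG t Ht)]. apply Rmult_le_pos; [left; apply Hs_weight_pos|apply pow2_ge_0]. }
  pose proof (W_ge1 n) as W1. pose proof (Hs_weight_pos s n) as Pw. pose proof (Hs_weight_pos (s + 2) n) as Pw2.
  assert (P1 : 0 <= Hs_weight (s + 2) n * exp (- (/ 2 * W n * (t - t0))) * Cmod (a t0 n) ^ 2).
  { apply Rmult_le_pos; [|apply pow2_ge_0]. apply Rmult_le_pos; [lra|left; apply exp_pos]. }
  assert (P2 : 0 <= 4 * omega_bd ^ 2 * G2).
  { pose proof (pow2_ge_0 omega_bd). nra. }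
  assert (P3 : 0 <= Rpower (2 * (1 + re_beta)) (s + 2) * A ^ 2).
  { apply Rmult_le_pos; [left; apply exp_pos|apply pow2_ge_0]. }
  (* In the high modes the symbol has real part at most - W n / 2; the low ones have a bounded
     weight and need only [decay2]. *)
  destruct (Rle_dec (2 * (1 + re_beta)) (W n)) as [Hn|Hn].
  - pose proof (lam_re_le gamma beta L n) as HL.
    set (G := omega_bd * sqrt (G2 / Hs_weight s n)).
    assert (Gp : 0 <= G) by (unfold G; apply Rmult_le_pos; [lra|apply sqrt_pos]).
    pose proof (linear_ode_bound (fun t => a t n) (lam n)
       (fun t => Copp (Cmult (1, omega) (cubic_coef (a t) n))) t0 T 0 G ltac:(lra) Gp) as Q.
    assert (Q' : Cmod (a t n) ^ 2 <= exp (2 * 0 * (t - t0)) *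
      (exp (- (0 - fst (lam n)) * (t - t0)) * Cmod (a t0 n) ^ 2 + (G / (0 - fst (lam n))) ^ 2)).
    { apply Q; [| |exact Ht].
      - intros s' Hs'. exact (H s' n Hs').
      - intros s' Hs'. rewrite Rmult_0_l, exp_0, Rmult_1_r, Cmod_opp, Cmod_mult.
        unfold G. apply Rmult_le_compat; [apply Cmod_ge_0|apply Cmod_ge_0|apply Cmod_1omega|].
        apply Rsqr_incr_0_var; [|apply sqrt_pos].
        rewrite Rsqr_sqrt by (apply Rdiv_le_0_compat; lra). rewrite Rsqr_pow2.
        apply Rmult_le_reg_l with (1 := Pw).
        replace (Hs_weight s n * (G2 / Hs_weight s n)) with G2 by (field; lra). apply HG, Hs'. }
    clear Q. rewrite Rmult_0_r, Rmult_0_l, exp_0, Rmult_1_l in Q'.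
    assert (Q2 : exp (- (0 - fst (lam n)) * (t - t0)) <= exp (- (/ 2 * W n * (t - t0)))).
    { apply exp_mono. nra. }
    assert (Q3 : (G / (0 - fst (lam n))) ^ 2 <= (G / (/ 2 * W n)) ^ 2).
    { apply pow_incr. split.
      - apply Rdiv_le_0_compat; lra.
      - apply Rmult_le_compat_l; [exact Gp|]. apply Rinv_le_contravar; lra. }
    assert (Q4 : Hs_weight (s + 2) n * (G / (/ 2 * W n)) ^ 2 = 4 * omega_bd ^ 2 * G2).
    { replace (s + 2) with (s + 1 + 1) by ring. rewrite !Hs_weight_S.
      replace ((G / (/ 2 * W n)) ^ 2) with (4 * omega_bd ^ 2 * (sqrt (G2 / Hs_weight s n) * sqrt (G2 / Hs_weight s n)) / (W n ^ 2))
        by (unfold G; field; lra).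
      rewrite sqrt_sqrt by (apply Rdiv_le_0_compat; lra). field. lra. }
    pose proof (pow2_ge_0 (Cmod (a t0 n))) as P4.
    apply (Rmult_le_compat_r _ _ _ P4) in Q2.
    assert (Q5 : Cmod (a t n) ^ 2 <= exp (- (/ 2 * W n * (t - t0))) * Cmod (a t0 n) ^ 2 + (G / (/ 2 * W n)) ^ 2) by lra.
    apply (Rmult_le_compat_l (Hs_weight (s + 2) n)) in Q5; [|lra]. lra.
  - assert (Q1 : Cmod (a t n) ^ 2 <= A ^ 2).
    { apply pow_incr. split; [apply Cmod_ge_0|]. pose proof (HY t Ht n). pose proof (Cmod_ge_0 (a t n)). nra. }
    assert (Q2 : Hs_weight (s + 2) n <= Rpower (2 * (1 + re_beta)) (s + 2)).
    { rewrite Hs_weight_W. apply Rle_Rpower_l; lra. }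
    pose proof (Rmult_le_compat _ _ _ _ (Rlt_le _ _ Pw2) (pow2_ge_0 _) Q2 Q1). lra.
Qed.

(** After a positive time the exponential absorbs all powers of W in front of the initial data, for
    which [decay2] then suffices. *)
Lemma gain_later a t0 T s B A t1 : 0 <= s -> t0 < t1 -> seq_eq a t0 T ->
  (forall t, t0 <= t <= T -> hs_bound s (a t) B) -> (forall t, t0 <= t <= T -> decay2 (a t) A) ->
  exists B', forall t, t1 <= t <= T -> hs_bound (s + 1) (a t) B'.
Proof.
  intros Hs Ht1 H HB HY. destruct (parabolic_gain a t0 T s B A Hs H HB HY) as [M HM].
  set (c := / 2 * (t1 - t0)).
  exists ((Rpower ((s + 2) / c) (s + 2) * A ^ 2 + M) * 5).
  intros t Ht. apply sup_hs_bound. intro n.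
  eapply Rle_trans; [apply HM; lra|]. apply Rplus_le_compat_r.
  pose proof (W_pos n) as PW.
  assert (Hc : 0 < c) by (unfold c; lra).
  apply Rmult_le_compat.
  - apply Rmult_le_pos; left; [apply Hs_weight_pos|apply exp_pos].
  - apply pow2_ge_0.
  - eapply Rle_trans; [|apply (Rpower_exp_bound (W n) (s + 2) c); lra].
    rewrite Hs_weight_W. apply Rmult_le_compat_l; [left; apply exp_pos|].
    apply exp_mono. unfold c. nra.
  - apply pow_incr. split; [apply Cmod_ge_0|].
    pose proof (HY t0 ltac:(lra) n). pose proof (W_ge1 n). pose proof (Cmod_ge_0 (a t0 n)). nra.
Qed.

(** Up to the initial time the exponential absorbs nothing, so the data must bring both powers of W
    themselves. *)
Lemma gain_closed a t0 T s B A B0 : 0 <= s -> seq_eq a t0 T ->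
  (forall t, t0 <= t <= T -> hs_bound s (a t) B) -> (forall t, t0 <= t <= T -> decay2 (a t) A) ->
  hs_bound (s + 2) (a t0) B0 ->
  exists B', forall t, t0 <= t <= T -> hs_bound (s + 1) (a t) B'.
Proof.
  intros Hs H HB HY H0. destruct (parabolic_gain a t0 T s B A Hs H HB HY) as [M HM].
  exists ((B0 + M) * 5). intros t Ht. apply sup_hs_bound. intro n.
  eapply Rle_trans; [apply HM; lra|]. apply Rplus_le_compat_r.
  pose proof (hs_bound_sup _ _ _ n H0) as Q. pose proof (Hs_weight_pos (s + 2) n).
  pose proof (pow2_ge_0 (Cmod (a t0 n))).
  assert (exp (- (/ 2 * W n * (t - t0))) <= 1).
  { rewrite <- exp_0. apply exp_mono. pose proof (W_pos n). nra. }
  pose proof (exp_pos (- (/ 2 * W n * (t - t0)))).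
  eapply Rle_trans; [|exact Q].
  apply Rmult_le_compat_r; [assumption|]. nra.
Qed.

Lemma nat_above s : exists k : nat, s <= INR k.
Proof. destruct (INR_unbounded s) as [k Hk]. exists k. lra. Qed.

Lemma smooth_of_nat a t0 T :
  (forall k : nat, exists B, forall t, t0 <= t <= T -> hs_bound (INR k) (a t) B) -> smooth_on a t0 T.
Proof.
  intros H s Hs. destruct (nat_above s) as [k Hk]. destruct (H k) as [B HB].
  exists B. intros t Ht. eapply hs_bound_le; [exact Hk|]. now apply HB.
Qed.

(** Each gain of one derivative costs some time after t0. The induction is over all t1 and bisects
    the remaining gap, so finitely many gains fit into any positive time. *)
Lemma smooth_later a t0 T A t1 : t0 < t1 -> seq_eq a t0 T ->
  (forall t, t0 <= t <= T -> decay2 (a t) A) -> smooth_on a t1 T.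
Proof.
  intros Ht1 H HY. apply smooth_of_nat. intro k. revert t1 Ht1.
  induction k as [|k IH]; intros t1 Ht1.
  - exists (A * A * 5). intros t Ht. apply decay2_hs0, HY. lra.
  - destruct (IH ((t0 + t1) / 2)) as [B HB]; [lra|].
    rewrite S_INR. apply (gain_later a ((t0 + t1) / 2) T (INR k) B A); auto.
    + apply pos_INR.
    + lra.
    + apply seq_eq_sub with t0 T; auto; lra.
    + intros t Ht. apply HY. lra.
Qed.

Lemma smooth_closed a t0 T A : seq_eq a t0 T ->
  (forall t, t0 <= t <= T -> decay2 (a t) A) -> (forall s, exists B, hs_bound s (a t0) B) -> smooth_on a t0 T.
Proof.
  intros H HY H0. apply smooth_of_nat. intro k. induction k as [|k [B HB]].
  - exists (A * A * 5). intros t Ht. now apply decay2_hs0, HY.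
  - destruct (H0 (INR k + 2)) as [B0 HB0].
    rewrite S_INR. eapply gain_closed; eauto. apply pos_INR.
Qed.

(** * Energy inequality, growth and smoothing in H^s *)

Lemma L2_decay a t0 T : seq_eq a t0 T -> smooth_on a t0 T ->
  forall t, t0 <= t <= T -> energy 0 (a t) <= exp (- (t - t0)) * energy 0 (a t0) + absorb_cst beta.
Proof.
  intros H HS. destruct (smooth_decay2 a t0 T HS) as [A HA]. eapply L2_decay_Y; eauto.
Qed.

(** With k = [omega_bd * sqrt (cubic_cst s)], the second summand is the coefficient 2 k (5 / h) R2
    left by the interpolated cubic term at h = 1 / (1 + 20 k R2). *)
Definition growth_rate (s R2 : R) : R :=
  2 * (1 + re_beta) + 10 * (omega_bd * sqrt (cubic_cst s)) * R2 * (1 + 20 * (omega_bd * sqrt (cubic_cst s)) * R2).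

Lemma ok_pos s : 0 < omega_bd * sqrt (cubic_cst s).
Proof.
  pose proof (omega_bd_ge1 omega). apply Rmult_lt_0_compat; [lra|]. apply sqrt_lt_R0, cubic_cst_pos.
Qed.

Lemma growth_rate_pos s R2 : 0 <= R2 -> 0 < growth_rate s R2.
Proof.
  intros H. unfold growth_rate. pose proof (ok_pos s) as P. pose proof (re_beta_ge0 beta).
  set (k := omega_bd * sqrt (cubic_cst s)) in *.
  assert (0 <= 10 * k * R2) by (apply Rmult_le_pos; lra).
  assert (0 <= 20 * k * R2) by (apply Rmult_le_pos; lra).
  assert (0 <= 10 * k * R2 * (1 + 20 * k * R2)) by (apply Rmult_le_pos; lra). lra.
Qed.

Lemma growth_rate_mono s r r' : 0 <= r <= r' -> growth_rate s r <= growth_rate s r'.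
Proof.
  intros H. unfold growth_rate. pose proof (ok_pos s) as P. set (k := omega_bd * sqrt (cubic_cst s)) in *.
  assert (k * r <= k * r') by (apply Rmult_le_compat_l; lra).
  assert (0 <= k * r) by (apply Rmult_le_pos; lra).
  nra.
Qed.

Lemma weighted_pairing s a K R2 B : 0 <= s -> 0 <= R2 -> hs_bound (s + 2) a B -> energy 0 a <= R2 ->
  2 * omega_bd * zsum K (fun n => Hs_weight s n * (Cmod (cubic_coef a n) * Cmod (a n)))
  <= (growth_rate s R2 - 2 * (1 + re_beta)) * energy s a + energy (s + 1) a.
Proof.
  intros Hs HR H HE0.
  assert (H1 : hs_bound 1 a B) by (apply hs_bound_le with (2 := H); lra).
  assert (HsS : hs_bound (s + 1) a B) by (apply hs_bound_le with (2 := H); lra).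
  assert (Hss : hs_bound s a B) by (apply hs_bound_le with (2 := H); lra).
  pose proof (hs_bound_l1_bound _ _ H1) as HL. pose proof (l1_bound_l1norm _ _ HL) as HN.
  pose proof (l1norm_ge0 _ _ HL) as N0. pose proof (energy_ge0 _ _ _ Hss) as Es0.
  pose proof (cubic_coef_Hs s a _ _ Hs HN (hs_bound_energy _ _ _ Hss)) as HNL.
  pose proof (ok_pos s) as Pk. unfold growth_rate. set (k := omega_bd * sqrt (cubic_cst s)) in *.
  pose proof (cubic_cst_pos s) as PK. pose proof (omega_bd_ge1 omega) as Ho.
  set (p := zsum K (fun n => Hs_weight s n * (Cmod (cubic_coef a n) * Cmod (a n)))).
  (* Cauchy-Schwarz with the weight split evenly between the cubic term and a; the tame estimate
     bounds the first factor. *)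
  assert (Hp : p <= sqrt (cubic_cst s) * (l1norm a)² * energy s a).
  { apply Rsqr_incr_0_var.
    2: { apply Rmult_le_pos; [apply Rmult_le_pos; [apply sqrt_pos|apply Rle_0_sqr]|exact Es0]. }
    set (h := fun n => Rpower (W n) (s / 2)).
    assert (Hh2 : forall n, h n * h n = Hs_weight s n).
    { intro n. rewrite Hs_weight_W. apply Rpower_half_sq, W_pos. }
    unfold p. rewrite (zsum_ext K _ (fun n => (h n * Cmod (cubic_coef a n)) * (h n * Cmod (a n))))
      by (intro n; rewrite <- Hh2; ring).
    eapply Rle_trans; [apply zsum_CS|].
    rewrite !Rsqr_mult, Rsqr_sqrt by lra.
    apply Rle_trans with ((cubic_cst s * l1norm a ^ 4 * energy s a) * energy s a); [|right; unfold Rsqr; ring].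
    apply Rmult_le_compat.
    - apply zsum_nonneg; intro; apply Rle_0_sqr.
    - apply zsum_nonneg; intro; apply Rle_0_sqr.
    - eapply Rle_trans; [|apply (HNL K)]. right. apply zsum_ext. intro n. unfold Hs_terms.
      rewrite <- Hh2. unfold Rsqr. ring.
    - eapply Rle_trans; [|apply (hs_bound_energy _ _ _ Hss K)]. right. apply zsum_ext. intro n. unfold Hs_terms.
      rewrite <- Hh2. unfold Rsqr. ring. }
  (* h is small enough for the energy (s + 1) term to be absorbed by the dissipation *)
  set (h := / (1 + 20 * k * R2)).
  assert (P20 : 0 <= 20 * k * R2) by (apply Rmult_le_pos; lra).
  assert (Hh : 0 < h <= 1).
  { unfold h. split; [apply Rinv_0_lt_compat; lra|]. rewrite <- Rinv_1. apply Rinv_le_contravar; lra. }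
  pose proof (l1norm_interp h a B Hh H1) as HI.
  pose proof (energy_interp s a B Hs HsS) as HI2.
  pose proof (energy_ge0 _ _ _ HsS) as ES0.
  assert (E00 : 0 <= energy 0 a) by (apply energy_ge0 with B; apply hs_bound_le with (2 := H); lra).
  assert (Q1 : (l1norm a)² * energy s a <= 5 / h * R2 * energy s a + 10 * h * R2 * energy (s + 1) a).
  { apply Rle_trans with ((5 / h * energy 0 a + 5 * h * energy 1 a) * energy s a); [apply Rmult_le_compat_r; lra|].
    rewrite Rmult_plus_distr_r. apply Rplus_le_compat.
    - apply Rmult_le_compat_r; [exact Es0|]. apply Rmult_le_compat_l; [|exact HE0].
      left; apply Rdiv_lt_0_compat; lra.
    - apply Rle_trans with (5 * h * (2 * energy 0 a * energy (s + 1) a)).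
      + rewrite (Rmult_assoc (5 * h)). apply Rmult_le_compat_l; lra.
      + replace (10 * h * R2 * energy (s + 1) a) with (5 * h * (2 * R2 * energy (s + 1) a)) by ring.
        apply Rmult_le_compat_l; [lra|]. apply Rmult_le_compat_r; lra. }
  apply Rle_trans with (2 * k * ((l1norm a)² * energy s a)).
  { unfold k. replace (2 * (omega_bd * sqrt (cubic_cst s)) * ((l1norm a)² * energy s a)) with (2 * omega_bd * (sqrt (cubic_cst s) * (l1norm a)² * energy s a)) by ring.
    apply Rmult_le_compat_l; lra. }
  apply Rle_trans with (2 * k * (5 / h * R2 * energy s a + 10 * h * R2 * energy (s + 1) a)).
  { apply Rmult_le_compat_l; lra. }
  assert (Q2 : 20 * k * R2 * h <= 1).
  { unfold h. apply Rmult_le_reg_r with (1 + 20 * k * R2); [lra|].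
    rewrite Rmult_assoc, Rinv_l by lra. lra. }
  replace (5 / h) with (5 * (1 + 20 * k * R2)) by (unfold h; field; lra).
  assert (Q3 : 20 * k * R2 * h * energy (s + 1) a <= 1 * energy (s + 1) a) by (apply Rmult_le_compat_r; lra).
  lra.
Qed.

(** The cubic pairing is bounded by full energies of orders s and s + 1; converting them back to
    sums over |n| <= K by [energy_tail] uses H^(s+2) and produces the last term. *)
Lemma Hs_inequality a t0 T s R2 B K t : 0 <= s -> 0 <= R2 -> seq_eq a t0 T -> t0 <= t <= T ->
  hs_bound (s + 2) (a t) B -> energy 0 (a t) <= R2 ->
  zsum K (fun n => Hs_weight s n * (2 * fst (Cmult (rhs (a t) n) (Cconj (a t n)))))
  <= - zsum K (Hs_terms (s + 1) (a t)) + growth_rate s R2 * zsum K (Hs_terms s (a t))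
     + (growth_rate s R2 + 1) * (B / W (Z.of_nat K)).
Proof.
  intros Hs HR H Ht HB HE.
  pose proof (weighted_pairing s (a t) K R2 B Hs HR HB HE) as P.
  pose proof (re_beta_ge0 beta) as Hb. pose proof (growth_rate_pos s R2 HR) as PC.
  assert (HB1 : hs_bound (s + 1) (a t) B) by (apply hs_bound_le with (2 := HB); lra).
  assert (HB2 : hs_bound (s + 1 + 1) (a t) B) by (replace (s + 1 + 1) with (s + 2) by ring; exact HB).
  pose proof (energy_tail s _ _ K HB1) as T1. pose proof (energy_tail (s + 1) _ _ K HB2) as T2.
  assert (Q : zsum K (fun n => Hs_weight s n * (2 * fst (Cmult (rhs (a t) n) (Cconj (a t n)))))
    <= zsum K (fun n => 2 * (1 + re_beta) * Hs_terms s (a t) n - 2 * Hs_terms (s + 1) (a t) n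
        + 2 * omega_bd * (Hs_weight s n * (Cmod (cubic_coef (a t) n) * Cmod (a t n))))).
  { apply zsum_le. intro n. rewrite rhs_re, Hs_terms_S. unfold Hs_terms.
    pose proof (Hs_weight_pos s n) as Pw. pose proof (lam_re_le gamma beta L n) as HL.
    pose proof (pow2_ge_0 (Cmod (a t n))) as P2.
    assert (Q1 : - fst (Cmult (1, omega) (Cmult (cubic_coef (a t) n) (Cconj (a t n)))) <= omega_bd * (Cmod (cubic_coef (a t) n) * Cmod (a t n))).
    { eapply Rle_trans; [apply Rle_abs|]. rewrite Rabs_Ropp. eapply Rle_trans; [apply Rabs_fst_le|].
      rewrite !Cmod_mult, Cmod_conj. apply Rmult_le_compat_r; [|apply Cmod_1omega].
      apply Rmult_le_pos; apply Cmod_ge_0. }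
    apply (Rmult_le_compat_r _ _ _ P2) in HL.
    replace (2 * (1 + re_beta) * (Hs_weight s n * Cmod (a t n) ^ 2) - 2 * (W n * (Hs_weight s n * Cmod (a t n) ^ 2))
       + 2 * omega_bd * (Hs_weight s n * (Cmod (cubic_coef (a t) n) * Cmod (a t n))))
      with (Hs_weight s n * (2 * ((1 + re_beta - W n) * Cmod (a t n) ^ 2 + omega_bd * (Cmod (cubic_coef (a t) n) * Cmod (a t n))))) by ring.
    apply Rmult_le_compat_l; [lra|]. lra. }
  eapply Rle_trans; [exact Q|].
  rewrite zsum_plus, zsum_minus, !zsum_scal.
  set (eps := B / W (Z.of_nat K)) in *.
  assert (growth_rate s R2 - 2 * (1 + re_beta) >= 0).
  { unfold growth_rate. pose proof (ok_pos s) as Pk. set (k := omega_bd * sqrt (cubic_cst s)) in *.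
    assert (0 <= 10 * k * R2) by (apply Rmult_le_pos; lra).
    assert (0 <= 20 * k * R2) by (apply Rmult_le_pos; lra). nra. }
  assert (0 <= eps).
  { unfold eps. apply Rdiv_le_0_compat; [eapply hs_bound_ge0; eauto|apply W_pos]. }
  assert (X1 : (growth_rate s R2 - 2 * (1 + re_beta)) * energy s (a t) <= (growth_rate s R2 - 2 * (1 + re_beta)) * (zsum K (Hs_terms s (a t)) + eps))
    by (apply Rmult_le_compat_l; lra).
  nra.
Qed.

Lemma is_derive_EM a t0 T K s t : seq_eq a t0 T -> t0 <= t <= T ->
  is_derive (fun r => zsum K (Hs_terms s (a r))) t
    (zsum K (fun n => Hs_weight s n * (2 * fst (Cmult (rhs (a t) n) (Cconj (a t n)))))).
Proof. intros H Ht. exact (is_derive_weighted _ _ _ _ a t0 T K (Hs_weight s) t H Ht). Qed.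

Lemma Hs_growth a t0 T s R2 : 0 <= s -> 0 <= R2 -> seq_eq a t0 T -> smooth_on a t0 T ->
  (forall t, t0 <= t <= T -> energy 0 (a t) <= R2) ->
  forall t, t0 <= t <= T -> energy s (a t) <= exp (growth_rate s R2 * (t - t0)) * energy s (a t0).
Proof.
  intros Hs HR H HS HE t Ht. destruct (HS (s + 2)) as [B HB]; [lra|].
  pose proof (growth_rate_pos s R2 HR) as PC.
  assert (HBs : forall r, t0 <= r <= T -> hs_bound s (a r) B).
  { intros r Hr. eapply hs_bound_le; [|apply HB, Hr]. lra. }
  set (eps := fun K => (growth_rate s R2 + 1) * (B / W (Z.of_nat K))).
  assert (eps0 : forall K, 0 <= eps K).
  { intro K. unfold eps. apply Rmult_le_pos; [lra|].
    apply Rdiv_le_0_compat; [eapply hs_bound_ge0, HB, Ht|apply W_pos]. }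
  apply lim_le_eps with (u := fun K => zsum K (Hs_terms s (a t)))
    (v := fun K => exp (growth_rate s R2 * (t - t0)) * (t - t0) * eps K).
  - intro K.
    pose proof (gronwall_growth (fun r => zsum K (Hs_terms s (a r))) _ t0 T (growth_rate s R2) (eps K) (Rlt_le _ _ PC) (eps0 K)
      (fun r Hr => is_derive_EM a t0 T K s r H Hr)) as G. cbv beta in G.
    eapply Rle_trans; [apply G; [|exact Ht]|].
    + intros r Hr. pose proof (Hs_inequality a t0 T s R2 B K r Hs HR H Hr (HB r Hr) (HE r Hr)) as Q.
      fold (eps K) in Q. pose proof (zsum_nonneg K _ (nonneg_Hs (s + 1) (a r))). lra.
    + pose proof (hs_bound_energy _ _ _ (HBs t0 ltac:(lra)) K). pose proof (exp_pos (growth_rate s R2 * (t - t0))). nra.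
  - eapply energy_lim, HBs, Ht.
  - apply is_lim_seq_scal0. unfold eps. apply is_lim_seq_scal0. apply is_lim_inv_W.
Qed.

(** With k = S (S j): if r W >= k, the left side is dominated by the dissipation r^k W^(s+1).
    Otherwise r <= 1 and s <= k - 1 give r^(k-1) W^s <= (r W)^s <= k^s, which costs only the H
    norm. *)
Lemma smoothing_weight (s : R) (j : nat) r n : 0 <= s <= INR (S j) -> 0 <= r <= 1 ->
  INR (S (S j)) * r ^ S j * Hs_weight s n
  <= r ^ S (S j) * Hs_weight (s + 1) n + INR (S (S j)) * Rpower (INR (S (S j))) s.
Proof.
  intros Hs Hr. set (k := INR (S (S j))).
  assert (Hk : 1 <= k) by (unfold k; rewrite !S_INR; pose proof (pos_INR j); lra).
  pose proof (Hs_weight_pos s n) as Pw. pose proof (W_pos n) as PW.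
  rewrite Hs_weight_S.
  assert (Pr : forall m, 0 <= r ^ m) by (intro; apply pow_le; lra).
  assert (Pk : 0 < Rpower k s) by apply exp_pos.
  destruct (Rle_dec k (r * W n)) as [Q|Q].
  - apply Rle_trans with (r * W n * r ^ S j * Hs_weight s n).
    + apply Rmult_le_compat_r; [lra|]. apply Rmult_le_compat_r; [apply Pr|exact Q].
    + change (r ^ S (S j)) with (r * r ^ S j).
      assert (0 <= k * Rpower k s) by nra. lra.
  - assert (P2 : 0 <= r ^ S (S j) * (W n * Hs_weight s n)).
    { apply Rmult_le_pos; [apply Pr|]. nra. }
    assert (Q2 : r ^ S j * Hs_weight s n <= Rpower k s).
    { destruct (Req_dec r 0) as [->|Hr0]; [rewrite pow_i by lia; lra|].
      assert (Hr' : 0 < r) by lra.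
      apply Rle_trans with (Rpower r s * Rpower (W n) s).
      - apply Rmult_le_compat_r; [left; apply exp_pos|]. rewrite <- Rpower_pow by exact Hr'.
        unfold Rpower. apply exp_mono.
        assert (ln r <= 0).
        { rewrite <- ln_1. apply ln_le; lra. }
        nra.
      - rewrite Rpower_mult_distr by lra. apply Rle_Rpower_l; nra. }
    assert (k * r ^ S j * Hs_weight s n <= k * Rpower k s) by (rewrite Rmult_assoc; apply Rmult_le_compat_l; lra).
    lra.
Qed.

(** Gronwall for (t - t0)^k E_s with k = S (S j), a quantity that vanishes at t0, so the data enter
    only through the H bound. [smoothing_weight] pays for the derivative of the time factor, and T -
    t0 <= 1 keeps all powers of time below 1. *)
Lemma Hs_smoothing a t0 T s R2 (j : nat) : 0 <= s <= INR (S j) -> 0 <= R2 -> T - t0 <= 1 ->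
  seq_eq a t0 T -> smooth_on a t0 T -> (forall t, t0 <= t <= T -> energy 0 (a t) <= R2) ->
  forall t, t0 <= t <= T ->
    (t - t0) ^ S (S j) * energy s (a t) <= exp (growth_rate s R2) * (INR (S (S j)) * Rpower (INR (S (S j))) s * R2).
Proof.
  intros Hs HR HT H HS HE t Ht. destruct (HS (s + 2)) as [B HB]; [lra|].
  pose proof (growth_rate_pos s R2 HR) as PC. set (k := S (S j)).
  set (G := INR k * Rpower (INR k) s * R2).
  assert (Pk : 0 <= INR k * Rpower (INR k) s).
  { apply Rmult_le_pos; [apply pos_INR|left; apply exp_pos]. }
  assert (HG : 0 <= G) by (unfold G; apply Rmult_le_pos; lra).
  assert (HB0 : forall r, t0 <= r <= T -> 0 <= B) by (intros r Hr; eapply hs_bound_ge0, HB, Hr).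
  assert (HBs : forall s' r, s' <= s + 2 -> t0 <= r <= T -> hs_bound s' (a r) B).
  { intros s' r ? Hr. eapply hs_bound_le; [|apply HB, Hr]. lra. }
  set (eps := fun K => (growth_rate s R2 + 1) * (B / W (Z.of_nat K))).
  assert (eps0 : forall K, 0 <= eps K).
  { intro K. unfold eps. apply Rmult_le_pos; [lra|].
    apply Rdiv_le_0_compat; [eapply HB0, Ht|apply W_pos]. }
  apply lim_le_eps with (u := fun K => (t - t0) ^ k * zsum K (Hs_terms s (a t)))
    (v := fun K => exp (growth_rate s R2) * eps K).
  - intro K.
    set (y := fun r => zsum K (Hs_terms s (a r))).
    set (dy := fun r => zsum K (fun n => Hs_weight s n * (2 * fst (Cmult (rhs (a r) n) (Cconj (a r n)))))).
    pose proof (gronwall_growth (fun r => (r - t0) ^ k * y r)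
      (fun r => INR k * (r - t0) ^ S j * y r + (r - t0) ^ k * dy r) t0 T (growth_rate s R2) (G + eps K)
      (Rlt_le _ _ PC) ltac:(specialize (eps0 K); lra)) as Q.
    assert (Q' : (t - t0) ^ k * y t <= exp (growth_rate s R2 * (t - t0)) * ((t0 - t0) ^ k * y t0 + (G + eps K) * (t - t0))).
    { apply Q; [| |exact Ht]; clear Q.
      - intros r Hr.
        apply (is_derive_mult (fun r => (r - t0) ^ k) y r (INR k * (r - t0) ^ S j) (dy r)).
        + replace (INR k * (r - t0) ^ S j) with (INR k * 1 * (r - t0) ^ pred k) by (unfold k; cbn [pred]; ring).
          apply (is_derive_pow (fun r => r - t0)). auto_derive; [exact I|ring].
        + exact (is_derive_EM a t0 T K s r H Hr).
        + intros; apply Rmult_comm.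
      - intros r Hr. assert (Hr1 : 0 <= r - t0 <= 1) by lra.
        pose proof (Hs_inequality a t0 T s R2 B K r ltac:(lra) HR H Hr (HB r Hr) (HE r Hr)) as I1.
        fold (eps K) (dy r) (y r) in I1.
        assert (Pr : 0 <= (r - t0) ^ k <= 1).
        { split; [apply pow_le; lra|]. rewrite <- (pow1 k). apply pow_incr; lra. }
        assert (I2 : INR k * (r - t0) ^ S j * y r
          <= (r - t0) ^ k * zsum K (Hs_terms (s + 1) (a r)) + G).
        { unfold y. rewrite <- zsum_scal.
          apply Rle_trans with (zsum K (fun n => (r - t0) ^ k * Hs_terms (s + 1) (a r) n + INR k * Rpower (INR k) s * Hs_terms 0 (a r) n)).
          - apply zsum_le. intro n. rewrite Hs_terms_0. unfold Hs_terms, cmod_seq.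
            pose proof (smoothing_weight s j (r - t0) n Hs Hr1) as Wn. fold k in Wn.
            apply (Rmult_le_compat_r _ _ _ (pow2_ge_0 (Cmod (a r n)))) in Wn. lra.
          - rewrite zsum_plus, !zsum_scal. apply Rplus_le_compat_l. unfold G.
            apply Rmult_le_compat_l; [exact Pk|].
            eapply Rle_trans; [|apply (HE r Hr)]. apply (hs_bound_energy 0 (a r) B). apply HBs; [lra|exact Hr]. }
        apply (Rmult_le_compat_l _ _ _ (proj1 Pr)) in I1.
        specialize (eps0 K). assert ((r - t0) ^ k * eps K <= 1 * eps K) by (apply Rmult_le_compat_r; lra).
        lra. }
    fold (y t). eapply Rle_trans; [exact Q'|].
    rewrite Rminus_diag, pow_i, Rmult_0_l, Rplus_0_l by (unfold k; lia).
    specialize (eps0 K).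
    apply Rle_trans with (exp (growth_rate s R2) * (G + eps K)); [|right; unfold G; ring].
    apply Rmult_le_compat; [left; apply exp_pos| | |].
    + apply Rmult_le_pos; lra.
    + apply exp_mono. nra.
    + nra.
  - apply (is_lim_seq_scal_l _ ((t - t0) ^ k) (energy s (a t))). apply energy_lim with B. apply HBs; [lra|exact Ht].
  - apply is_lim_seq_scal0. unfold eps. apply is_lim_seq_scal0. apply is_lim_inv_W.
Qed.

(** The cubic difference contributes 8 [omega_bd] R2 times the squared l1 norm of the difference.
    Interpolated with h = 1 / (1 + 20 [omega_bd] R2), its part with 5 h has coefficient at most 2
    and is absorbed by the dissipation; the part with 5 / h remains. *)
Definition lip_rate (R2 : R) : R := 2 + 2 * re_beta + 40 * omega_bd * R2 * (1 + 20 * omega_bd * R2).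

Lemma lip_rate_pos R2 : 0 <= R2 -> 0 < lip_rate R2.
Proof.
  intros H. unfold lip_rate. pose proof (omega_bd_ge1 omega). pose proof (re_beta_ge0 beta).
  assert (0 <= 40 * omega_bd * R2) by (apply Rmult_le_pos; lra).
  assert (0 <= 20 * omega_bd * R2) by (apply Rmult_le_pos; lra). nra.
Qed.

Lemma energy0_mean a X : l1_bound a X -> energy 0 a = avg (fun x => Cmod (synth a x) ^ 2).
Proof.
  intros H. rewrite (parseval a _ H). unfold energy, zseries. apply Series_ext.
  intros [|k]; cbn [zfold]; now rewrite !Hs_terms_0.
Qed.

Lemma trig_bound K a X x : l1_bound a X -> Cmod (trig K a x) <= l1norm a.
Proof.
  intros H. unfold trig. eapply Rle_trans; [apply Cmod_czsum|].
  eapply Rle_trans; [|apply (l1_bound_l1norm a X H K)]. apply zsum_le. intro n.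
  rewrite Cmod_mult, Cmod_expi, Rmult_1_r. apply Rle_refl.
Qed.

(** The difference v occurs twice, as its series and as its truncation; both are bounded uniformly
    by the l1 norm, and what remains is the mean of the squares of the two solutions. Hence only
    their H norms enter the constant. *)
Lemma difference_pairing a b X Y K : l1_bound a X -> l1_bound b Y ->
  Cmod (czsum K (fun n => Cmult (Cminus (cubic_coef a n) (cubic_coef b n)) (Cconj (seq_sub a b n))))
  <= 2 * (energy 0 a + energy 0 b) * (l1norm (seq_sub a b))².
Proof.
  intros Ha Hb. pose proof (ccont_synth _ _ Ha) as Ca. pose proof (ccont_synth _ _ Hb) as Cb.
  pose proof (l1_bound_sub _ _ _ _ Ha Hb) as Hv. set (v := seq_sub a b) in *.
  rewrite (czsum_ext K _ (fun n => Cmult (fcoef (fun x => Cminus (cubic (synth a x)) (cubic (synth b x))) n) (Cconj (v n)))).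
  2: { intro n. unfold cubic_coef. now rewrite <- fcoef_minus by auto with contdb. }
  rewrite <- cavg_conj_trig by auto with contdb.
  eapply Rle_trans; [apply Cmod_cavg; auto with contdb|].
  rewrite (energy0_mean a X Ha), (energy0_mean b Y Hb).
  rewrite <- avg_plus by auto with contdb.
  replace (2 * avg (fun x => Cmod (synth a x) ^ 2 + Cmod (synth b x) ^ 2) * (l1norm v)²)
    with ((2 * (l1norm v)²) * avg (fun x => Cmod (synth a x) ^ 2 + Cmod (synth b x) ^ 2)) by ring.
  rewrite <- avg_scal by auto with contdb.
  apply avg_le; auto 7 with contdb. intros x _.
  rewrite Cmod_mult, Cmod_conj.
  pose proof (cubic_lip (synth a x) (synth b x)) as Q1. rewrite <- (synth_minus a b X Y x Ha Hb) in Q1. fold v in Q1.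
  pose proof (synth_bound v _ x Hv) as Q2. pose proof (trig_bound K v _ x Hv) as Q3.
  pose proof (Cmod_ge_0 (synth v x)). pose proof (Cmod_ge_0 (trig K v x)).
  pose proof (pow2_ge_0 (Cmod (synth a x))). pose proof (pow2_ge_0 (Cmod (synth b x))).
  set (w := Cmod (synth a x) ^ 2 + Cmod (synth b x) ^ 2) in *.
  assert (0 <= w) by (unfold w; lra).
  apply Rle_trans with (2 * w * l1norm v * l1norm v); [|right; unfold Rsqr; ring].
  apply Rmult_le_compat; [apply Cmod_ge_0|assumption| |exact Q3].
  eapply Rle_trans; [exact Q1|]. apply Rmult_le_compat_l; lra.
Qed.

Lemma is_derive_EM_sub a b t0 T K t : seq_eq a t0 T -> seq_eq b t0 T -> t0 <= t <= T ->
  is_derive (fun r => zsum K (Hs_terms 0 (seq_sub (a r) (b r)))) t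
    (zsum K (fun n => 2 * fst (Cmult (Cminus (rhs (a t) n) (rhs (b t) n)) (Cconj (seq_sub (a t) (b t) n))))).
Proof.
  intros Ha Hb Ht.
  apply (is_derive_zsum K (fun n r => Hs_terms 0 (seq_sub (a r) (b r)) n)). intro n.
  apply (is_derive_ext (fun r => Cmod (Cminus (a r n) (b r n)) ^ 2)).
  { intro r. rewrite Hs_terms_0. reflexivity. }
  apply (cderive_Cmod_sq (fun r => Cminus (a r n) (b r n))).
  destruct (Ha t n Ht) as [A1 A2]. destruct (Hb t n Ht) as [B1 B2]. split.
  - exact (is_derive_minus _ _ _ _ _ A1 B1).
  - exact (is_derive_minus _ _ _ _ _ A2 B2).
Qed.

Lemma hs_bound_sub s a b A B : hs_bound s a A -> hs_bound s b B -> hs_bound s (seq_sub a b) (2 * A + 2 * B).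
Proof.
  intros Ha Hb. eapply sum_bound_le; [|exact (sum_bound_plus _ _ _ _ (sum_bound_scal _ 2 _ ltac:(lra) Ha) (sum_bound_scal _ 2 _ ltac:(lra) Hb))].
  intro n. unfold Hs_terms, seq_sub.
  pose proof (Hs_weight_pos s n). pose proof (Cmod_ge_0 (Cminus (a n) (b n))).
  assert (Cmod (Cminus (a n) (b n)) <= Cmod (a n) + Cmod (b n)).
  { unfold Cminus. rewrite <- (Cmod_opp (b n)). apply Cmod_triangle. }
  pose proof (pow2_ge_0 (Cmod (a n) - Cmod (b n))).
  assert (Cmod (Cminus (a n) (b n)) ^ 2 <= 2 * Cmod (a n) ^ 2 + 2 * Cmod (b n) ^ 2) by nra.
  nra.
Qed.

Lemma L2_lipschitz a b t0 T R2 : 0 <= R2 -> seq_eq a t0 T -> seq_eq b t0 T ->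
  smooth_on a t0 T -> smooth_on b t0 T ->
  (forall t, t0 <= t <= T -> energy 0 (a t) <= R2 /\ energy 0 (b t) <= R2) ->
  forall t, t0 <= t <= T ->
    energy 0 (seq_sub (a t) (b t)) <= exp (lip_rate R2 * (t - t0)) * energy 0 (seq_sub (a t0) (b t0)).
Proof.
  intros HR Ha Hb Sa Sb HE t Ht.
  destruct (Sa 2) as [A HA]; [lra|]. destruct (Sb 2) as [B HB]; [lra|].
  set (D := 2 * A + 2 * B).
  assert (HD : forall s r, s <= 2 -> t0 <= r <= T -> hs_bound s (seq_sub (a r) (b r)) D).
  { intros s r Hs Hr. apply hs_bound_le with 2; [exact Hs|]. apply hs_bound_sub; auto. }
  pose proof (lip_rate_pos R2 HR) as PC. pose proof (omega_bd_ge1 omega) as Ho. pose proof (re_beta_ge0 beta) as Hb0.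
  set (eps := fun K => (lip_rate R2 + 2) * (D / W (Z.of_nat K))).
  assert (eps0 : forall K, 0 <= eps K).
  { intro K. unfold eps. apply Rmult_le_pos; [lra|].
    apply Rdiv_le_0_compat; [eapply hs_bound_ge0, (HD 0 t); lra|apply W_pos]. }
  apply lim_le_eps with (u := fun K => zsum K (Hs_terms 0 (seq_sub (a t) (b t))))
    (v := fun K => exp (lip_rate R2 * (t - t0)) * (t - t0) * eps K).
  - intro K.
    pose proof (gronwall_growth (fun r => zsum K (Hs_terms 0 (seq_sub (a r) (b r)))) _ t0 T (lip_rate R2) (eps K) (Rlt_le _ _ PC) (eps0 K)
      (fun r Hr => is_derive_EM_sub a b t0 T K r Ha Hb Hr)) as G. cbv beta in G.
    eapply Rle_trans; [apply G; [|exact Ht]|].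
    + clear G. intros r Hr. set (v := seq_sub (a r) (b r)).
      destruct (HE r Hr) as [HEa HEb].
      assert (La : l1_bound (a r) (sqrt (5 * A))) by (apply hs_bound_l1_bound; apply hs_bound_le with 2; [lra|auto]).
      assert (Lb : l1_bound (b r) (sqrt (5 * B))) by (apply hs_bound_l1_bound; apply hs_bound_le with 2; [lra|auto]).
      pose proof (difference_pairing (a r) (b r) _ _ K La Lb) as P. fold v in P.
      set (Z := czsum K (fun n => Cmult (Cminus (cubic_coef (a r) n) (cubic_coef (b r) n)) (Cconj (v n)))) in *.
      set (h := / (1 + 20 * omega_bd * R2)).
      assert (P20 : 0 <= 20 * omega_bd * R2) by (apply Rmult_le_pos; lra).
      assert (Hh : 0 < h <= 1).
      { unfold h. split; [apply Rinv_0_lt_compat; lra|]. rewrite <- Rinv_1. apply Rinv_le_contravar; lra. }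
      pose proof (l1norm_interp h v D Hh (HD 1 r ltac:(lra) Hr)) as NI.
      assert (T0 : energy 0 v <= zsum K (Hs_terms 0 v) + D / W (Z.of_nat K)) by (apply energy_tail, HD; [lra|exact Hr]).
      assert (T1 : energy 1 v <= zsum K (Hs_terms 1 v) + D / W (Z.of_nat K)) by (apply energy_tail, HD; [lra|exact Hr]).
      set (ek := D / W (Z.of_nat K)) in *.
      assert (ek0 : 0 <= ek).
      { unfold ek. apply Rdiv_le_0_compat; [eapply hs_bound_ge0, (HD 0 t); lra|apply W_pos]. }
      pose proof (zsum_nonneg K _ (nonneg_Hs 0 v)) as y0. pose proof (zsum_nonneg K _ (nonneg_Hs 1 v)) as y1.
      assert (I1 : zsum K (fun n => 2 * fst (Cmult (Cminus (rhs (a r) n) (rhs (b r) n)) (Cconj (v n))))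
        <= 2 * (1 + re_beta) * zsum K (Hs_terms 0 v) - 2 * zsum K (Hs_terms 1 v) - 2 * fst (Cmult (1, omega) Z)).
      { rewrite <- !zsum_scal, <- zsum_minus. unfold Z. rewrite <- czsum_mult_l. unfold czsum; cbn [fst].
        rewrite <- zsum_scal, <- zsum_minus. apply zsum_le. intro n.
        rewrite Hs_terms_1, Hs_terms_0.
        assert (Ev : forall n, Cminus (a r n) (b r n) = v n) by reflexivity.
        replace (Cminus (rhs (a r) n) (rhs (b r) n))
          with (Cminus (Cmult (lam n) (v n)) (Cmult (1, omega) (Cminus (cubic_coef (a r) n) (cubic_coef (b r) n))))
          by (unfold vfield; rewrite <- Ev; ring).
        replace (Cmult (Cminus (Cmult (lam n) (v n)) (Cmult (1, omega) (Cminus (cubic_coef (a r) n) (cubic_coef (b r) n)))) (Cconj (v n)))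
          with (Cminus (Cmult (lam n) (Cmult (v n) (Cconj (v n)))) (Cmult (1, omega) (Cmult (Cminus (cubic_coef (a r) n) (cubic_coef (b r) n)) (Cconj (v n))))) by ring.
        rewrite Cmult_conj_self. fold (cmod_seq v n).
        set (z := Cmult (1, omega) _).
        pose proof (lam_re_le gamma beta L n) as HL.
        apply (Rmult_le_compat_r _ _ _ (pow2_ge_0 (cmod_seq v n))) in HL.
        unfold Cminus, RtoC. cbn [fst snd Cplus Cmult Copp]. rewrite Rmult_0_r, Rminus_0_r. lra. }
      assert (I2 : - (2 * fst (Cmult (1, omega) Z)) <= 2 * omega_bd * (2 * (R2 + R2) * (l1norm v)²)).
      { assert (Q : Rabs (fst (Cmult (1, omega) Z)) <= omega_bd * (2 * (energy 0 (a r) + energy 0 (b r)) * (l1norm v)²)).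
        { eapply Rle_trans; [apply Rabs_fst_le|]. rewrite Cmod_mult.
          apply Rmult_le_compat; try apply Cmod_ge_0; [apply Cmod_1omega|exact P]. }
        apply Rabs_le_between in Q. pose proof (Rle_0_sqr (l1norm v)).
        assert ((energy 0 (a r) + energy 0 (b r)) * (l1norm v)² <= (R2 + R2) * (l1norm v)²) by (apply Rmult_le_compat_r; lra).
        assert (omega_bd * ((energy 0 (a r) + energy 0 (b r)) * (l1norm v)²) <= omega_bd * ((R2 + R2) * (l1norm v)²)) by (apply Rmult_le_compat_l; lra).
        lra. }
      assert (I3 : (l1norm v)² <= 5 * (1 + 20 * omega_bd * R2) * (zsum K (Hs_terms 0 v) + ek) + 5 * h * (zsum K (Hs_terms 1 v) + ek)).
      { replace (5 / h) with (5 * (1 + 20 * omega_bd * R2)) in NI by (unfold h; field; lra).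
        assert (5 * (1 + 20 * omega_bd * R2) * energy 0 v <= 5 * (1 + 20 * omega_bd * R2) * (zsum K (Hs_terms 0 v) + ek)) by (apply Rmult_le_compat_l; lra).
        assert (5 * h * energy 1 v <= 5 * h * (zsum K (Hs_terms 1 v) + ek)) by (apply Rmult_le_compat_l; lra). lra. }
      assert (Q2 : 20 * omega_bd * R2 * h <= 1).
      { unfold h. apply Rmult_le_reg_r with (1 + 20 * omega_bd * R2); [lra|].
        rewrite Rmult_assoc, Rinv_l by lra. lra. }
      apply (Rmult_le_compat_l (8 * omega_bd * R2)) in I3; [|lra].
      assert (I4 : 8 * omega_bd * R2 * (5 * h * (zsum K (Hs_terms 1 v) + ek)) <= 2 * (zsum K (Hs_terms 1 v) + ek)).
      { replace (8 * omega_bd * R2 * (5 * h * (zsum K (Hs_terms 1 v) + ek))) with (20 * omega_bd * R2 * h * (2 * (zsum K (Hs_terms 1 v) + ek))) by ring.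
        apply Rle_trans with (1 * (2 * (zsum K (Hs_terms 1 v) + ek))); [|lra].
        apply Rmult_le_compat_r; lra. }
      unfold eps. fold ek. unfold lip_rate in *.
      assert (0 <= re_beta * ek) by (apply Rmult_le_pos; lra).
      lra.
    + pose proof (hs_bound_energy _ _ _ (HD 0 t0 ltac:(lra) ltac:(lra)) K). pose proof (exp_pos (lip_rate R2 * (t - t0))). nra.
  - eapply energy_lim, HD; [|exact Ht]; lra.
  - apply is_lim_seq_scal0. unfold eps. apply is_lim_seq_scal0. apply is_lim_inv_W.
Qed.

End Equation.

(** * Global solvability for smooth data *)

Definition ccont_at (f : R -> C) (t : R) : Prop :=
  continuous (fun s => fst (f s)) t /\ continuous (fun s => snd (f s)) t.

Lemma cderive_ccont_at f t l : cderive f t l -> ccont_at f t.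
Proof.
  intros [H1 H2]. split.
  - apply (ex_derive_continuous (fun s => fst (f s))). now exists (fst l).
  - apply (ex_derive_continuous (fun s => snd (f s))). now exists (snd l).
Qed.

Lemma continuous_eps (f : R -> R) t :
  (forall eps, 0 < eps -> exists d, 0 < d /\ forall s, Rabs (s - t) < d -> Rabs (f s - f t) < eps) ->
  continuous f t.
Proof.
  intros H. apply filterlim_locally. intros [eps He]. destruct (H eps He) as [d [Hd Hs]].
  exists (mkposreal d Hd). intros s Bs. apply Hs, Bs.
Qed.

Lemma eps_continuous (f : R -> R) t : continuous f t ->
  forall eps, 0 < eps -> exists d, 0 < d /\ forall s, Rabs (s - t) < d -> Rabs (f s - f t) < eps.
Proof.
  intros H eps He. apply (proj1 (filterlim_locally f (f t))) with (eps := mkposreal eps He) in H.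
  destruct H as [[d Hd] Hs]. exists d. split; [exact Hd|]. intros s Bs. apply (Hs s Bs).
Qed.

Lemma ccont_at_eps f t :
  (forall eps, 0 < eps -> exists d, 0 < d /\ forall s, Rabs (s - t) < d -> Cmod (Cminus (f s) (f t)) < eps) <->
  ccont_at f t.
Proof.
  split.
  - intros H. split; apply continuous_eps; intros eps He; destruct (H eps He) as [d [Hd Hs]];
      exists d; split; auto; intros s Bs; specialize (Hs s Bs); eapply Rle_lt_trans; try exact Hs.
    + apply (Rabs_fst_le (Cminus (f s) (f t))).
    + apply (Rabs_snd_le (Cminus (f s) (f t))).
  - intros [H1 H2] eps He.
    destruct (eps_continuous _ _ H1 (eps / 2)) as [d1 [Hd1 Q1]]; [lra|].
    destruct (eps_continuous _ _ H2 (eps / 2)) as [d2 [Hd2 Q2]]; [lra|].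
    exists (Rmin d1 d2). split; [now apply Rmin_glb_lt|]. intros s Bs.
    eapply Rle_lt_trans; [apply Cmod_le_abs|].
    specialize (Q1 s (Rlt_le_trans _ _ _ Bs (Rmin_l _ _))).
    specialize (Q2 s (Rlt_le_trans _ _ _ Bs (Rmin_r _ _))).
    unfold Cminus; simpl fst; simpl snd. unfold Rminus in *. lra.
Qed.

Lemma ccont_ccont_at f : ccont f <-> forall t, ccont_at f t.
Proof.
  split; [intros [H1 H2] t; split; auto|]. intros H; split; intro t; apply (H t).
Qed.

Lemma zsum_small_cont (a : R -> Z -> C) t K :
  (forall n, ccont_at (fun s => a s n) t) -> forall eps, 0 < eps ->
  exists d, 0 < d /\ forall s, Rabs (s - t) < d -> zsum K (fun n => Cmod (Cminus (a s n) (a t n))) < eps.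
Proof.
  intros H. induction K as [|K IH]; intros eps He.
  - apply (proj2 (ccont_at_eps _ t) (H 0%Z) eps He).
  - destruct (IH (eps / 3)) as [d0 [Hd0 Q0]]; [lra|].
    destruct (proj2 (ccont_at_eps _ t) (H (Z.of_nat (S K))) (eps / 3)) as [d1 [Hd1 Q1]]; [lra|].
    destruct (proj2 (ccont_at_eps _ t) (H (- Z.of_nat (S K))%Z) (eps / 3)) as [d2 [Hd2 Q2]]; [lra|].
    exists (Rmin d0 (Rmin d1 d2)). split; [repeat apply Rmin_glb_lt; auto|].
    intros s Bs. cbn [zsum].
    pose proof (Rmin_l d0 (Rmin d1 d2)). pose proof (Rmin_r d0 (Rmin d1 d2)).
    pose proof (Rmin_l d1 d2). pose proof (Rmin_r d1 d2).
    specialize (Q0 s ltac:(lra)). specialize (Q1 s ltac:(lra)). specialize (Q2 s ltac:(lra)). lra.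
Qed.

Lemma l1norm_split a A K : decay2 a A -> l1norm a <= zsum K (cmod_seq a) + A * W_tail K.
Proof. intros H. pose proof (l1_tail_Y a A K H). unfold l1_tail in *. lra. Qed.

(** Continuity of each coefficient handles |n| <= K, and the common decay makes the remaining tail
    uniformly small. *)
Lemma l1norm_small_cont (a : R -> Z -> C) t d0 A :
  (forall n, ccont_at (fun s => a s n) t) -> 0 < d0 -> (forall s, Rabs (s - t) < d0 -> decay2 (a s) A) ->
  forall eps, 0 < eps ->
  exists d, 0 < d /\ d <= d0 /\ forall s, Rabs (s - t) < d -> l1norm (seq_sub (a s) (a t)) < eps.
Proof.
  intros H Hd0 HY eps He.
  assert (HYt : decay2 (a t) A) by (apply HY; rewrite Rminus_diag, Rabs_R0; exact Hd0).
  pose proof (decay2_ge0 _ _ HYt) as A0.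
  destruct (is_lim_seq_0_eps (fun K => (2 * A) * W_tail K) (eps / 2)) as [K HK];
    [apply is_lim_seq_scal0, W_tail_lim|lra|].
  specialize (HK K (le_n _)). apply Rabs_lt_between in HK.
  destruct (zsum_small_cont a t K H (eps / 2)) as [d [Hd Q]]; [lra|].
  exists (Rmin d d0). split; [now apply Rmin_glb_lt|]. split; [apply Rmin_r|]. intros s Bs.
  pose proof (Rmin_l d d0). pose proof (Rmin_r d d0).
  pose proof (l1norm_split _ _ K (decay2_sub _ _ _ _ (HY s ltac:(lra)) HYt)) as N.
  specialize (Q s ltac:(lra)). unfold cmod_seq, seq_sub in *. lra.
Qed.

Lemma cubic_coef_diff_bound a b X Y n : l1_bound a X -> l1_bound b Y ->
  Cmod (Cminus (cubic_coef a n) (cubic_coef b n)) <= 2 * (X ^ 2 + Y ^ 2) * l1norm (seq_sub a b).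
Proof.
  intros Ha Hb. pose proof (ccont_synth _ _ Ha) as Ca. pose proof (ccont_synth _ _ Hb) as Cb.
  unfold cubic_coef. rewrite <- fcoef_minus by auto with contdb.
  apply Cmod_fcoef; [auto with contdb|]. intro x.
  eapply Rle_trans; [apply cubic_lip|].
  rewrite <- (synth_minus a b X Y x Ha Hb).
  pose proof (l1_bound_sub _ _ _ _ Ha Hb) as Hv.
  assert (Cmod (synth a x) ^ 2 <= X ^ 2).
  { apply pow_incr. split; [apply Cmod_ge_0|]. eapply Rle_trans; [eapply synth_bound, Ha|eapply l1norm_le, Ha]. }
  assert (Cmod (synth b x) ^ 2 <= Y ^ 2).
  { apply pow_incr. split; [apply Cmod_ge_0|]. eapply Rle_trans; [eapply synth_bound, Hb|eapply l1norm_le, Hb]. }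
  apply Rmult_le_compat; [|apply Cmod_ge_0| |eapply synth_bound, Hv].
  - pose proof (pow2_ge_0 (Cmod (synth a x))). pose proof (pow2_ge_0 (Cmod (synth b x))). lra.
  - lra.
Qed.

Lemma cubic_coef_cont (a : R -> Z -> C) t d0 A n :
  (forall n, ccont_at (fun s => a s n) t) -> 0 < d0 -> (forall s, Rabs (s - t) < d0 -> decay2 (a s) A) ->
  ccont_at (fun s => cubic_coef (a s) n) t.
Proof.
  intros H Hd0 HY. apply ccont_at_eps. intros eps He.
  assert (HYt : decay2 (a t) A) by (apply HY; rewrite Rminus_diag, Rabs_R0; exact Hd0).
  pose proof (decay2_ge0 _ _ HYt) as A0.
  set (c := 2 * ((A * 5) ^ 2 + (A * 5) ^ 2)).
  assert (Hc : 0 <= c) by (unfold c; pose proof (pow2_ge_0 (A * 5)); lra).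
  destruct (l1norm_small_cont a t d0 A H Hd0 HY (eps / (c + 1))) as [d [Hd [Hdd Q]]];
    [apply Rdiv_lt_0_compat; lra|].
  exists d. split; [exact Hd|]. intros s Bs. specialize (Q s Bs).
  pose proof (cubic_coef_diff_bound _ _ _ _ n (decay2_l1_bound _ _ (HY s ltac:(lra))) (decay2_l1_bound _ _ HYt)) as D. fold c in D.
  eapply Rle_lt_trans; [exact D|].
  pose proof (l1norm_ge0 _ _ (l1_bound_sub _ _ _ _ (decay2_l1_bound _ _ (HY s ltac:(lra))) (decay2_l1_bound _ _ HYt))) as P.
  apply Rle_lt_trans with ((c + 1) * l1norm (seq_sub (a s) (a t))); [nra|].
  apply (Rmult_lt_compat_l (c + 1)) in Q; [|lra].
  replace ((c + 1) * (eps / (c + 1))) with eps in Q by (field; lra). exact Q.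
Qed.

(** * Variation of constants *)

Definition cexp (l : C) (t : R) : C := (exp (fst l * t) * cos (snd l * t), exp (fst l * t) * sin (snd l * t)).
(** The exponential is factored out of the integral, so that differentiation needs only the product
    rule and the fundamental theorem of calculus. *)
Definition duhamel (l z0 : C) (h : R -> C) (t : R) : C :=
  Cmult (cexp l t)
    (Cplus z0 (RInt (fun s => fst (Cmult (cexp (Copp l) s) (h s))) 0 t,
               RInt (fun s => snd (Cmult (cexp (Copp l) s) (h s))) 0 t)).

Lemma cexp_der l t : cderive (cexp l) t (Cmult l (cexp l t)).
Proof. unfold cexp. split; simpl; auto_derive; auto; ring. Qed.

Lemma cexp_opp l t : Cmult (cexp l t) (cexp (Copp l) t) = RtoC 1.
Proof.
  unfold cexp, Cmult, Copp, RtoC; simpl.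
  rewrite !Ropp_mult_distr_l_reverse, cos_neg, sin_neg.
  pose proof (sin2_cos2 (snd l * t)) as S. unfold Rsqr in S.
  assert (Ee : exp (fst l * t) * exp (- (fst l * t)) = 1) by (rewrite <- exp_plus, <- exp_0; f_equal; ring).
  f_equal.
  - transitivity ((exp (fst l * t) * exp (- (fst l * t))) * (sin (snd l * t) * sin (snd l * t) + cos (snd l * t) * cos (snd l * t))); [ring|].
    rewrite Ee, S. ring.
  - ring.
Qed.

Lemma cderive_mult f g t df dg : cderive f t df -> cderive g t dg ->
  cderive (fun s => Cmult (f s) (g s)) t (Cplus (Cmult df (g t)) (Cmult (f t) dg)).
Proof.
  intros [F1 F2] [G1 G2].
  assert (M : forall (p q : R -> R) dp dq, is_derive p t dp -> is_derive q t dq ->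
     is_derive (fun s => p s * q s) t (dp * q t + p t * dq)).
  { intros p q dp dq Hp Hq. apply (is_derive_mult p q t dp dq Hp Hq). intros; apply Rmult_comm. }
  split; simpl.
  - replace (fst df * fst (g t) - snd df * snd (g t) + (fst (f t) * fst dg - snd (f t) * snd dg))
      with ((fst df * fst (g t) + fst (f t) * fst dg) - (snd df * snd (g t) + snd (f t) * snd dg)) by ring.
    apply (is_derive_minus (fun s => fst (f s) * fst (g s)) (fun s => snd (f s) * snd (g s)));
      [apply (M (fun s => fst (f s)) (fun s => fst (g s)))|apply (M (fun s => snd (f s)) (fun s => snd (g s)))];
      assumption.
  - replace (fst df * snd (g t) + snd df * fst (g t) + (fst (f t) * snd dg + snd (f t) * fst dg))
      with ((fst df * snd (g t) + fst (f t) * snd dg) + (snd df * fst (g t) + snd (f t) * fst dg)) by ring.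
    apply (is_derive_plus (fun s => fst (f s) * snd (g s)) (fun s => snd (f s) * fst (g s)));
      [apply (M (fun s => fst (f s)) (fun s => snd (g s)))|apply (M (fun s => snd (f s)) (fun s => fst (g s)))];
      assumption.
Qed.

Lemma cderive_plus f g t df dg : cderive f t df -> cderive g t dg ->
  cderive (fun s => Cplus (f s) (g s)) t (Cplus df dg).
Proof.
  intros [F1 F2] [G1 G2]. split; simpl.
  - apply (is_derive_plus (fun s => fst (f s)) (fun s => fst (g s))); assumption.
  - apply (is_derive_plus (fun s => snd (f s)) (fun s => snd (g s))); assumption.
Qed.

Lemma cderive_minus f g t df dg : cderive f t df -> cderive g t dg ->
  cderive (fun s => Cminus (f s) (g s)) t (Cminus df dg).
Proof.
  intros [F1 F2] [G1 G2]. split.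
  - exact (is_derive_minus (fun s => fst (f s)) (fun s => fst (g s)) _ _ _ F1 G1).
  - exact (is_derive_minus (fun s => snd (f s)) (fun s => snd (g s)) _ _ _ F2 G2).
Qed.

Lemma cderive_const z t : cderive (fun _ => z) t (RtoC 0).
Proof. split; [apply (is_derive_const (fst z))|apply (is_derive_const (snd z))]. Qed.

Lemma RInt_der (g : R -> R) t : rcont g -> is_derive (fun s => RInt g 0 s) t (g t).
Proof.
  intros Hg. apply (is_derive_RInt g (fun s => RInt g 0 s) 0 t); [|apply Hg].
  exists (mkposreal 1 Rlt_0_1). intros y _.
  apply (RInt_correct (V := R_CompleteNormedModule)). now apply rcont_ex_RInt.
Qed.

Lemma ccont_cexp l : ccont (cexp l).
Proof. apply ccont_ccont_at. intro t. eapply cderive_ccont_at, cexp_der. Qed.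

Lemma duhamel_der l z0 h t : ccont h ->
  cderive (duhamel l z0 h) t (Cplus (Cmult l (duhamel l z0 h t)) (h t)).
Proof.
  intros Hh.
  assert (Hg : ccont (fun s => Cmult (cexp (Copp l) s) (h s))) by (apply ccont_mult; [apply ccont_cexp|exact Hh]).
  unfold duhamel.
  set (I := fun t => (RInt (fun s => fst (Cmult (cexp (Copp l) s) (h s))) 0 t,
               RInt (fun s => snd (Cmult (cexp (Copp l) s) (h s))) 0 t) : C).
  assert (DI : cderive I t (Cmult (cexp (Copp l) t) (h t))).
  { split.
    - exact (RInt_der (fun s => fst (Cmult (cexp (Copp l) s) (h s))) t (proj1 Hg)).
    - exact (RInt_der (fun s => snd (Cmult (cexp (Copp l) s) (h s))) t (proj2 Hg)). }
  pose proof (cderive_mult _ _ _ _ _ (cexp_der l t) (cderive_plus _ _ _ _ _ (cderive_const z0 t) DI)) as D.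
  cbv beta in D.
  change (cderive (fun s => Cmult (cexp l s) (Cplus z0 (I s))) t (Cplus (Cmult l (Cmult (cexp l t) (Cplus z0 (I t)))) (h t))).
  replace (Cplus (Cmult l (Cmult (cexp l t) (Cplus z0 (I t)))) (h t))
    with (Cplus (Cmult (Cmult l (cexp l t)) (Cplus z0 (I t))) (Cmult (cexp l t) (Cplus (RtoC 0) (Cmult (cexp (Copp l) t) (h t))))).
  - exact D.
  - replace (Cmult (cexp l t) (Cplus (RtoC 0) (Cmult (cexp (Copp l) t) (h t)))) with (Cmult (Cmult (cexp l t) (cexp (Copp l) t)) (h t)) by ring.
    rewrite cexp_opp. ring.
Qed.

Lemma duhamel_0 l z0 h : duhamel l z0 h 0 = z0.
Proof.
  unfold duhamel. rewrite !RInt_point. unfold cexp, zero; simpl.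
  rewrite !Rmult_0_r, exp_0, cos_0, sin_0. destruct z0. unfold Cmult, Cplus; simpl. f_equal; ring.
Qed.

(** * The clamped equation and its Picard iteration *)

Definition clampR (r x : R) : R := Rmax (- r) (Rmin r x).

Lemma clampR_le r x : 0 <= r -> Rabs (clampR r x) <= r.
Proof.
  intros. apply Rabs_le_between. unfold clampR, Rmax, Rmin. repeat destruct (Rle_dec _ _); lra.
Qed.

Lemma clampR_id r x : Rabs x <= r -> clampR r x = x.
Proof.
  intros H. apply Rabs_le_between in H. unfold clampR, Rmax, Rmin. repeat destruct (Rle_dec _ _); lra.
Qed.

Lemma clampR_lip r x y : 0 <= r -> Rabs (clampR r x - clampR r y) <= Rabs (x - y).
Proof.
  intros. unfold clampR, Rmax, Rmin, Rabs.
  repeat destruct (Rle_dec _ _); repeat destruct (Rcase_abs _); lra.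
Qed.

(** Cutting off each component separately preserves continuity and Lipschitz bounds coefficient by
    coefficient. The map is the identity on the [decay2] ball of radius A and sends everything into
    that of radius 2 A, so the cubic term becomes globally bounded and Lipschitz. *)
Definition clamp_seq (A : R) (a : Z -> C) : Z -> C :=
  fun n => (clampR (A / W n) (fst (a n)), clampR (A / W n) (snd (a n))).

Lemma rad_ge0 A n : 0 <= A -> 0 <= A / W n.
Proof. intros. apply Rdiv_le_0_compat; [assumption|apply W_pos]. Qed.

Lemma clamp_seq_decay2 A a : 0 <= A -> decay2 (clamp_seq A a) (2 * A).
Proof.
  intros HA n. pose proof (W_pos n). unfold clamp_seq.
  eapply Rle_trans; [apply Rmult_le_compat_r; [lra|apply Cmod_le_abs]|]. simpl.
  pose proof (clampR_le (A / W n) (fst (a n)) (rad_ge0 A n HA)).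
  pose proof (clampR_le (A / W n) (snd (a n)) (rad_ge0 A n HA)).
  apply Rle_trans with ((A / W n + A / W n) * W n); [apply Rmult_le_compat_r; lra|].
  right. field. lra.
Qed.

Lemma clamp_seq_id A a : decay2 a A -> clamp_seq A a = a.
Proof.
  intros H. apply functional_extensionality. intro n. unfold clamp_seq.
  pose proof (decay2_le _ _ n H) as Q.
  rewrite !clampR_id.
  - now destruct (a n).
  - eapply Rle_trans; [apply Rabs_snd_le|exact Q].
  - eapply Rle_trans; [apply Rabs_fst_le|exact Q].
Qed.

Lemma clamp_seq_lip A a b D : 0 <= A -> decay2 (seq_sub a b) D -> decay2 (seq_sub (clamp_seq A a) (clamp_seq A b)) (2 * D).
Proof.
  intros HA H n. pose proof (W_pos n). specialize (H n).
  apply Rle_trans with (2 * Cmod (seq_sub a b n) * W n); [|lra].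
  apply Rmult_le_compat_r; [lra|].
  eapply Rle_trans; [apply Cmod_le_abs|].
  pose proof (clampR_lip (A / W n) (fst (a n)) (fst (b n)) (rad_ge0 A n HA)).
  pose proof (clampR_lip (A / W n) (snd (a n)) (snd (b n)) (rad_ge0 A n HA)).
  pose proof (Rabs_fst_le (seq_sub a b n)). pose proof (Rabs_snd_le (seq_sub a b n)).
  unfold seq_sub, clamp_seq, Cminus in *; simpl in *. unfold Rminus in *. lra.
Qed.

Lemma clamp_seq_ccont_at A a t n : 0 <= A -> ccont_at (fun s => a s n) t -> ccont_at (fun s => clamp_seq A (a s) n) t.
Proof.
  intros HA [H1 H2]. unfold clamp_seq.
  split; apply continuous_eps; intros eps He;
    [destruct (eps_continuous _ _ H1 eps He) as [d [Hd Q]]|destruct (eps_continuous _ _ H2 eps He) as [d [Hd Q]]];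
    exists d; (split; [exact Hd|]); intros s Bs; (eapply Rle_lt_trans; [|apply (Q s Bs)]);
    simpl; apply clampR_lip, rad_ge0, HA.
Qed.

Lemma geometric_limit (u : nat -> R) C : 0 <= C ->
  (forall k, Rabs (u (S k) - u k) <= C * (/ 2) ^ k) ->
  forall k, Rabs (real (Lim_seq u) - u k) <= 2 * C * (/ 2) ^ k.
Proof.
  intros HC H.
  assert (P : forall k j, Rabs (u (k + j)%nat - u k) <= 2 * C * (/ 2) ^ k).
  { intros k j.
    (* The subtracted term makes the geometric bound inductive in j. *)
    assert (Q : Rabs (u (k + j)%nat - u k) <= 2 * C * (/ 2) ^ k - 2 * C * (/ 2) ^ (k + j)).
    { induction j as [|j IH].
      - rewrite Nat.add_0_r, !Rminus_diag, Rabs_R0. lra.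
      - replace (k + S j)%nat with (S (k + j)) by lia.
        specialize (H (k + j)%nat).
        replace (u (S (k + j)) - u k) with ((u (S (k + j)) - u (k + j)%nat) + (u (k + j)%nat - u k)) by ring.
        eapply Rle_trans; [apply Rabs_triang|]. simpl pow. lra. }
    assert (0 <= 2 * C * (/ 2) ^ (k + j)).
    { apply Rmult_le_pos; [lra|]. apply pow_le; lra. }
    lra. }
  assert (L : ex_finite_lim_seq u).
  { apply ex_lim_seq_cauchy_corr. intros [eps He].
    assert (G : is_lim_seq (fun k => (4 * C) * (/ 2) ^ k) 0).
    { apply is_lim_seq_scal0, is_lim_seq_geom. rewrite Rabs_pos_eq; lra. }
    destruct (is_lim_seq_0_eps _ eps G He) as [N HN].
    exists N. intros n m Hn Hm. simpl. specialize (HN N (le_n _)).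
    assert (0 <= (/ 2) ^ N) by (apply pow_le; lra).
    rewrite Rabs_pos_eq in HN by nra.
    pose proof (P N (n - N)%nat) as P1. pose proof (P N (m - N)%nat) as P2.
    replace (N + (n - N))%nat with n in P1 by lia. replace (N + (m - N))%nat with m in P2 by lia.
    replace (u n - u m) with ((u n - u N) - (u m - u N)) by ring.
    eapply Rle_lt_trans; [apply Rabs_triang|]. rewrite Rabs_Ropp. lra. }
  apply Lim_seq_correct' in L. intro k.
  apply (lim_le (fun j => Rabs (u (j + k)%nat - u k))).
  - intro j. rewrite Nat.add_comm. apply P.
  - apply (is_lim_seq_abs (fun j => u (j + k)%nat - u k) (real (Lim_seq u) - u k)).
    apply is_lim_seq_minus'; [|apply is_lim_seq_const].
    now apply (is_lim_seq_incr_n u k).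
Qed.

Section Equation.
Variables (gamma omega : R) (beta : C) (L : R).
Local Notation lam := (symbol gamma beta L).
Local Notation seq_eq := (seq_eq gamma omega beta L).
Local Notation re_beta := (re_beta beta).
Local Notation omega_bd := (omega_bd omega).

Definition forcing (A : R) (a : Z -> C) (n : Z) : C := Copp (Cmult (1, omega) (cubic_coef (clamp_seq A a) n)).

Lemma forcing_bound A a n : 0 <= A -> Cmod (forcing A a n) * W n <= omega_bd * (400 * (2 * A) ^ 3).
Proof.
  intros HA. unfold forcing. rewrite Cmod_opp, Cmod_mult, Rmult_assoc.
  apply Rmult_le_compat; [apply Cmod_ge_0| |apply Cmod_1omega|apply cubic_coef_Y, clamp_seq_decay2, HA].
  apply Rmult_le_pos; [apply Cmod_ge_0|left; apply W_pos].
Qed.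

Definition forcing_lip_cst (A : R) : R := omega_bd * (1200 * (2 * A) ^ 2 * 2).

Lemma forcing_lip_cst_ge0 A : 0 <= forcing_lip_cst A.
Proof. unfold forcing_lip_cst. pose proof (omega_bd_ge1 omega). pose proof (pow2_ge_0 (2 * A)). nra. Qed.

Lemma forcing_lip A a b D n : 0 <= A -> decay2 (seq_sub a b) D ->
  Cmod (Cminus (forcing A a n) (forcing A b n)) * W n <= forcing_lip_cst A * D.
Proof.
  intros HA H. unfold forcing.
  replace (Cminus (Copp (Cmult (1, omega) (cubic_coef (clamp_seq A a) n))) (Copp (Cmult (1, omega) (cubic_coef (clamp_seq A b) n))))
    with (Copp (Cmult (1, omega) (seq_sub (cubic_coef (clamp_seq A a)) (cubic_coef (clamp_seq A b)) n))) by (unfold seq_sub; ring).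
  rewrite Cmod_opp, Cmod_mult, Rmult_assoc. unfold forcing_lip_cst. rewrite (Rmult_assoc omega_bd).
  apply Rmult_le_compat; [apply Cmod_ge_0| |apply Cmod_1omega|].
  - apply Rmult_le_pos; [apply Cmod_ge_0|left; apply W_pos].
  - rewrite (Rmult_assoc (1200 * _)).
    apply cubic_coef_lip_Y; [now apply clamp_seq_decay2|now apply clamp_seq_decay2|now apply clamp_seq_lip].
Qed.

Lemma forcing_ccont A (a : R -> Z -> C) n : 0 <= A -> (forall m, ccont (fun t => a t m)) -> ccont (fun t => forcing A (a t) n).
Proof.
  intros HA H. unfold forcing.
  assert (Q : ccont (fun t => cubic_coef (clamp_seq A (a t)) n)).
  { apply ccont_ccont_at. intro t. apply (cubic_coef_cont (fun s => clamp_seq A (a s)) t 1 (2 * A)).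
    - intro m. apply clamp_seq_ccont_at; [exact HA|]. apply ccont_ccont_at, H.
    - lra.
    - intros; now apply clamp_seq_decay2. }
  auto with contdb.
Qed.

Definition clamp_time (T t : R) : R := Rmax 0 (Rmin T t).

Lemma clamp_time_in T t : 0 <= T -> 0 <= clamp_time T t <= T.
Proof. intros. unfold clamp_time, Rmax, Rmin. repeat destruct (Rle_dec _ _); lra. Qed.

Lemma clamp_time_id T t : 0 <= t <= T -> clamp_time T t = t.
Proof. intros. unfold clamp_time, Rmax, Rmin. repeat destruct (Rle_dec _ _); lra. Qed.

Lemma ccont_clamp_time T (f : R -> C) : 0 <= T -> (forall t, 0 <= t <= T -> ccont_at f t) -> ccont (fun t => f (clamp_time T t)).
Proof.
  intros HT H. split; unfold clamp_time.
  - apply (clamp_rcont (fun t => fst (f t)) 0 T HT). intros; now apply H.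
  - apply (clamp_rcont (fun t => snd (f t)) 0 T HT). intros; now apply H.
Qed.

(** Time is clamped because [duhamel_der] asks for a forcing continuous on the whole line, while the
    iterates are controlled on [0, T] only. *)
Definition picard (A T : R) (a0 : Z -> C) (a : R -> Z -> C) : R -> Z -> C :=
  fun t n => duhamel (lam n) (a0 n) (fun s => forcing A (a (clamp_time T s)) n) t.

Lemma picard_der A T a0 a t n : 0 <= A -> 0 <= T ->
  (forall s m, 0 <= s <= T -> ccont_at (fun r => a r m) s) ->
  0 <= t <= T ->
  cderive (fun s => picard A T a0 a s n) t (Cplus (Cmult (lam n) (picard A T a0 a t n)) (forcing A (a t) n)).
Proof.
  intros HA HT H Ht. unfold picard.
  rewrite <- (clamp_time_id T t Ht) at 3.
  apply (duhamel_der (lam n) (a0 n) (fun s => forcing A (a (clamp_time T s)) n)).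
  apply (forcing_ccont A (fun s => a (clamp_time T s)) n HA). intro m. apply (ccont_clamp_time T (fun t => a t m)); auto.
Qed.

Fixpoint iter (A T : R) (a0 : Z -> C) (k : nat) : R -> Z -> C :=
  match k with
  | O => fun _ _ => RtoC 0
  | S k => picard A T a0 (iter A T a0 k)
  end.

Lemma iter_ccont_at A T a0 k : 0 <= A -> 0 <= T -> forall t n, 0 <= t <= T -> ccont_at (fun s => iter A T a0 k s n) t.
Proof.
  intros HA HT. induction k as [|k IH]; intros t n Ht.
  - exact (proj1 (ccont_ccont_at (fun _ : R => RtoC 0)) (ccont_const (RtoC 0)) t).
  - simpl. eapply cderive_ccont_at. apply picard_der; auto.
Qed.

Lemma lam_re_le_re_beta n : fst (lam n) <= re_beta.
Proof. pose proof (lam_re_le gamma beta L n). pose proof (W_ge1 n). lra. Qed.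

(** Exponent of a time-weighted norm: the distance from [rate] to the real part of the symbol is at
    least twice [forcing_lip_cst], so the Picard map contracts by 1/2 on all of [0, T] with no
    smallness of T. *)
Definition rate (A : R) : R := re_beta + 1 + 2 * forcing_lip_cst A.

Lemma sq_le_Cmod (z : C) x y : 0 <= x -> 0 <= y -> Cmod z ^ 2 <= x ^ 2 * y ^ 2 -> Cmod z <= x * y.
Proof.
  intros Hx Hy H. apply Rsqr_incr_0_var; [|now apply Rmult_le_pos].
  rewrite !Rsqr_pow2. replace ((x * y) ^ 2) with (x ^ 2 * y ^ 2) by ring. exact H.
Qed.

(** Both images start at a0 n, so their difference solves a scalar linear equation with zero data.
    Treating each n separately suffices because [decay2] is a supremum. *)
Lemma picard_contract A T a0 a b D : 0 <= A -> 0 <= T -> 0 <= D ->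
  (forall s m, 0 <= s <= T -> ccont_at (fun r => a r m) s) ->
  (forall s m, 0 <= s <= T -> ccont_at (fun r => b r m) s) ->
  (forall t, 0 <= t <= T -> decay2 (seq_sub (a t) (b t)) (D * exp (rate A * t))) ->
  forall t, 0 <= t <= T -> decay2 (seq_sub (picard A T a0 a t) (picard A T a0 b t)) (/ 2 * D * exp (rate A * t)).
Proof.
  intros HA HT HD Ca Cb H t Ht n. pose proof (W_pos n) as PW. pose proof (forcing_lip_cst_ge0 A) as PK.
  pose proof (lam_re_le_re_beta n) as HL.
  pose proof (linear_ode_bound (fun t => seq_sub (picard A T a0 a t) (picard A T a0 b t) n) (lam n)
    (fun t => Cminus (forcing A (a t) n) (forcing A (b t) n)) 0 T (rate A) (forcing_lip_cst A * D / W n)) as Q.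
  assert (Q' := Q ltac:(unfold rate; lra) ltac:(apply Rdiv_le_0_compat; [nra|lra])). clear Q.
  assert (Q : Cmod (seq_sub (picard A T a0 a t) (picard A T a0 b t) n) ^ 2 <=
    exp (2 * rate A * (t - 0)) * (exp (- (rate A - fst (lam n)) * (t - 0)) *
      Cmod (seq_sub (picard A T a0 a 0) (picard A T a0 b 0) n) ^ 2 + (forcing_lip_cst A * D / W n / (rate A - fst (lam n))) ^ 2)).
  { apply Q'; [| |exact Ht]; clear Q'.
    - intros s Hs. unfold seq_sub.
      pose proof (cderive_minus _ _ _ _ _ (picard_der A T a0 a s n HA HT Ca Hs) (picard_der A T a0 b s n HA HT Cb Hs)) as Dd.
      replace (Cplus (Cmult (lam n) (Cminus (picard A T a0 a s n) (picard A T a0 b s n))) (Cminus (forcing A (a s) n) (forcing A (b s) n)))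
        with (Cminus (Cplus (Cmult (lam n) (picard A T a0 a s n)) (forcing A (a s) n)) (Cplus (Cmult (lam n) (picard A T a0 b s n)) (forcing A (b s) n))) by ring.
      exact Dd.
    - intros s Hs. rewrite Rminus_0_r. pose proof (forcing_lip A _ _ _ n HA (H s Hs)) as G.
      apply Rmult_le_reg_r with (1 := PW). eapply Rle_trans; [exact G|]. right. field. lra. }
  unfold seq_sub in Q at 2. unfold picard in Q at 3 4. rewrite !duhamel_0 in Q.
  replace (Cminus (a0 n) (a0 n)) with (RtoC 0) in Q by ring.
  rewrite Cmod_0, pow_i, Rmult_0_r, Rplus_0_l, Rminus_0_r in Q by lia.
  assert (Q2 : Cmod (seq_sub (picard A T a0 a t) (picard A T a0 b t) n) <= exp (rate A * t) * (/ 2 * D / W n)).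
  { apply sq_le_Cmod; [left; apply exp_pos|apply Rdiv_le_0_compat; lra|].
    eapply Rle_trans; [exact Q|].
    replace (exp (2 * rate A * t)) with (exp (rate A * t) ^ 2)
      by (simpl; rewrite Rmult_1_r, <- exp_plus; f_equal; ring).
    apply Rmult_le_compat_l; [apply pow2_ge_0|]. apply pow_incr. split.
    - apply Rdiv_le_0_compat; [apply Rdiv_le_0_compat; [nra|lra]|unfold rate; lra].
    - apply Rmult_le_reg_r with (rate A - fst (lam n)); [unfold rate; lra|].
      replace (forcing_lip_cst A * D / W n / (rate A - fst (lam n)) * (rate A - fst (lam n))) with (forcing_lip_cst A * (D / W n))
        by (field; repeat split; unfold rate; lra).
      replace (/ 2 * D / W n * (rate A - fst (lam n))) with (/ 2 * (rate A - fst (lam n)) * (D / W n)) by (field; lra).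
      apply Rmult_le_compat_r; [apply Rdiv_le_0_compat; lra|unfold rate; lra]. }
  apply Rle_trans with (exp (rate A * t) * (/ 2 * D / W n) * W n); [apply Rmult_le_compat_r; lra|].
  right. field. lra.
Qed.

Lemma iter_1_bound A T a0 : 0 <= A -> 0 <= T -> decay2 a0 A -> forall t, 0 <= t <= T ->
  decay2 (seq_sub (iter A T a0 1 t) (iter A T a0 0 t)) ((A + omega_bd * (400 * (2 * A) ^ 3)) * exp (rate A * t)).
Proof.
  intros HA HT H0 t Ht n. set (GG := omega_bd * (400 * (2 * A) ^ 3)).
  pose proof (omega_bd_ge1 omega) as Ho.
  assert (HGG : 0 <= GG).
  { unfold GG. apply Rmult_le_pos; [lra|]. apply Rmult_le_pos; [lra|]. apply pow_le; lra. }
  pose proof (W_pos n) as PW. pose proof (forcing_lip_cst_ge0 A) as PK.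
  pose proof (lam_re_le_re_beta n) as HL. pose proof (re_beta_ge0 beta) as Hb.
  replace (seq_sub (iter A T a0 1 t) (iter A T a0 0 t) n) with (iter A T a0 1 t n)
    by (unfold seq_sub; simpl; ring).
  pose proof (linear_ode_bound (fun t => iter A T a0 1 t n) (lam n)
    (fun t => forcing A (iter A T a0 0 t) n) 0 T (rate A) (GG / W n) ltac:(unfold rate; lra) ltac:(apply Rdiv_le_0_compat; lra)) as Q.
  specialize (Q (fun s Hs => picard_der A T a0 (iter A T a0 0) s n HA HT (fun s m => iter_ccont_at A T a0 0 HA HT s m) Hs)).
  assert (Q' := Q (fun s Hs => ltac:(
    rewrite Rminus_0_r; apply Rmult_le_reg_r with (1 := PW);
    eapply Rle_trans; [apply forcing_bound, HA|]; fold GG;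
    replace (GG / W n * exp (rate A * s) * W n) with (GG * exp (rate A * s)) by (field; lra);
    assert (1 <= exp (rate A * s)) by (rewrite <- exp_0; apply exp_mono; apply Rmult_le_pos; [unfold rate; lra|lra]);
    nra)) t Ht). clear Q. cbv beta in Q'.
  assert (E0 : iter A T a0 1 0 n = a0 n) by apply duhamel_0. rewrite E0, Rminus_0_r in Q'.
  assert (Q2 : Cmod (iter A T a0 1 t n) <= exp (rate A * t) * ((A + GG) / W n)).
  { apply sq_le_Cmod; [left; apply exp_pos|apply Rdiv_le_0_compat; lra|].
    eapply Rle_trans; [exact Q'|].
    replace (exp (2 * rate A * t)) with (exp (rate A * t) ^ 2)
      by (simpl; rewrite Rmult_1_r, <- exp_plus; f_equal; ring).
    apply Rmult_le_compat_l; [apply pow2_ge_0|].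
    assert (I1 : exp (- (rate A - fst (lam n)) * t) <= 1).
    { rewrite <- exp_0. apply exp_mono. assert (0 <= rate A - fst (lam n)) by (unfold rate; lra). nra. }
    assert (I2 : Cmod (a0 n) ^ 2 <= (A / W n) ^ 2).
    { apply pow_incr. split; [apply Cmod_ge_0|]. apply decay2_le, H0. }
    assert (I3 : (GG / W n / (rate A - fst (lam n))) ^ 2 <= (GG / W n) ^ 2).
    { apply pow_incr. split.
      - apply Rdiv_le_0_compat; [apply Rdiv_le_0_compat; lra|unfold rate; lra].
      - rewrite <- (Rdiv_1_r (GG / W n)) at 2. apply Rmult_le_compat_l; [apply Rdiv_le_0_compat; lra|].
        apply Rinv_le_contravar; unfold rate; lra. }
    assert (0 <= A / W n) by (apply Rdiv_le_0_compat; lra).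
    assert (0 <= GG / W n) by (apply Rdiv_le_0_compat; lra).
    replace ((A + GG) / W n) with (A / W n + GG / W n) by (field; lra).
    pose proof (exp_pos (- (rate A - fst (lam n)) * t)). pose proof (pow2_ge_0 (Cmod (a0 n))).
    set (p := A / W n) in *. set (q := GG / W n) in *.
    assert (exp (- (rate A - fst (lam n)) * t) * Cmod (a0 n) ^ 2 <= 1 * p ^ 2) by (apply Rmult_le_compat; lra).
    nra. }
  apply Rle_trans with (exp (rate A * t) * ((A + GG) / W n) * W n); [apply Rmult_le_compat_r; lra|].
  right. field. lra.
Qed.

Lemma iter_cauchy A T a0 k : 0 <= A -> 0 <= T -> decay2 a0 A -> forall t, 0 <= t <= T ->
  decay2 (seq_sub (iter A T a0 (S k) t) (iter A T a0 k t)) ((A + omega_bd * (400 * (2 * A) ^ 3)) * (/ 2) ^ k * exp (rate A * t)).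
Proof.
  intros HA HT H0. induction k as [|k IH]; intros t Ht.
  - rewrite pow_O, Rmult_1_r. now apply iter_1_bound.
  - set (D0 := A + omega_bd * (400 * (2 * A) ^ 3)) in *.
    assert (HD : 0 <= D0 * (/ 2) ^ k).
    { apply Rmult_le_pos; [|apply pow_le; lra]. unfold D0. pose proof (omega_bd_ge1 omega).
      assert (0 <= (2 * A) ^ 3) by (apply pow_le; lra). nra. }
    replace (D0 * (/ 2) ^ S k * exp (rate A * t)) with (/ 2 * (D0 * (/ 2) ^ k) * exp (rate A * t)) by (simpl; ring).
    apply (picard_contract A T a0 (iter A T a0 (S k)) (iter A T a0 k)); auto.
    + intros; now apply iter_ccont_at.
    + intros; now apply iter_ccont_at.
Qed.

Lemma truncated_solution A T a0 : 0 <= A -> 0 <= T -> decay2 a0 A ->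
  exists a : R -> Z -> C, (forall n, a 0 n = a0 n) /\
    forall t n, 0 <= t <= T -> cderive (fun s => a s n) t (Cplus (Cmult (lam n) (a t n)) (forcing A (a t) n)).
Proof.
  intros HA HT H0. set (D0 := A + omega_bd * (400 * (2 * A) ^ 3)).
  assert (HD : 0 <= D0).
  { unfold D0. pose proof (omega_bd_ge1 omega). assert (0 <= (2 * A) ^ 3) by (apply pow_le; lra). nra. }
  set (l := fun t n => (real (Lim_seq (fun k => fst (iter A T a0 k t n))), real (Lim_seq (fun k => snd (iter A T a0 k t n)))) : C).
  assert (Hl : forall t k, 0 <= t <= T -> decay2 (seq_sub (l t) (iter A T a0 k t)) (4 * D0 * (/ 2) ^ k * exp (rate A * t))).
  { intros t k Ht n. pose proof (W_pos n) as PW.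
    set (C0 := D0 * exp (rate A * t) / W n).
    assert (HC0 : 0 <= C0).
    { unfold C0. apply Rdiv_le_0_compat; [|lra]. pose proof (exp_pos (rate A * t)). nra. }
    assert (St : forall j, Cmod (Cminus (iter A T a0 (S j) t n) (iter A T a0 j t n)) <= C0 * (/ 2) ^ j).
    { intro j. pose proof (iter_cauchy A T a0 j HA HT H0 t Ht n) as Q. fold D0 in Q.
      apply Rmult_le_reg_r with (1 := PW). eapply Rle_trans; [exact Q|]. unfold C0. right. field. lra. }
    assert (S1 := geometric_limit (fun k => fst (iter A T a0 k t n)) C0 HC0
      (fun j => Rle_trans _ _ _ (Rabs_fst_le (Cminus (iter A T a0 (S j) t n) (iter A T a0 j t n))) (St j)) k).
    assert (S2 := geometric_limit (fun k => snd (iter A T a0 k t n)) C0 HC0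
      (fun j => Rle_trans _ _ _ (Rabs_snd_le (Cminus (iter A T a0 (S j) t n) (iter A T a0 j t n))) (St j)) k).
    apply Rle_trans with ((2 * C0 * (/ 2) ^ k + 2 * C0 * (/ 2) ^ k) * W n).
    - apply Rmult_le_compat_r; [lra|]. eapply Rle_trans; [apply Cmod_le_abs|].
      unfold seq_sub, l, Cminus; simpl. apply Rplus_le_compat; assumption.
    - unfold C0. right. field. lra. }
  assert (Hmu : 0 <= rate A) by (unfold rate; pose proof (re_beta_ge0 beta); pose proof (forcing_lip_cst_ge0 A); lra).
  assert (Cl : forall n, ccont (fun t => l (clamp_time T t) n)).
  { intro n.
    assert (Q : forall eps, 0 < eps -> exists g : R -> C, ccont g /\ forall t, Cmod (Cminus (l (clamp_time T t) n) (g t)) <= eps).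
    { intros eps He.
      destruct (is_lim_seq_0_eps (fun k => (4 * D0 * exp (rate A * T)) * (/ 2) ^ k) eps) as [k Hk]; auto.
      { apply is_lim_seq_scal0, is_lim_seq_geom. rewrite Rabs_pos_eq; lra. }
      specialize (Hk k (le_n _)). apply Rabs_lt_between in Hk.
      exists (fun t => iter A T a0 k (clamp_time T t) n). split.
      - apply (ccont_clamp_time T (fun t => iter A T a0 k t n)); auto. intros; now apply iter_ccont_at.
      - intro t. pose proof (clamp_time_in T t HT) as Th. pose proof (Hl (clamp_time T t) k Th n) as Q.
        pose proof (W_ge1 n). pose proof (Cmod_ge_0 (seq_sub (l (clamp_time T t)) (iter A T a0 k (clamp_time T t)) n)).
        assert (exp (rate A * clamp_time T t) <= exp (rate A * T)) by (apply exp_mono, Rmult_le_compat_l; lra).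
        assert (0 <= 4 * D0 * (/ 2) ^ k) by (apply Rmult_le_pos; [lra|apply pow_le; lra]).
        unfold seq_sub in *. nra. }
    split; apply rcont_unif; intros eps He; destruct (Q eps He) as [g [Hg Q2]].
    - exists (fun t => fst (g t)). split; [exact (proj1 Hg)|]. intro t.
      eapply Rle_trans; [|apply (Q2 t)]. apply (Rabs_fst_le (Cminus (l (clamp_time T t) n) (g t))).
    - exists (fun t => snd (g t)). split; [exact (proj2 Hg)|]. intro t.
      eapply Rle_trans; [|apply (Q2 t)]. apply (Rabs_snd_le (Cminus (l (clamp_time T t) n) (g t))). }
  set (l' := fun t n => l (clamp_time T t) n).
  assert (Cl' : forall s m, 0 <= s <= T -> ccont_at (fun r => l' r m) s).
  { intros s m _. apply ccont_ccont_at, Cl. }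
  (* The solution is the Picard image of the limit instead of the limit itself: it is then
     differentiable by construction, on both sides of 0 and T as [cderive] demands. *)
  set (a := picard A T a0 l').
  (* Image and limit are both within a multiple of (1/2)^k of the iterate S k, hence equal. *)
  assert (Ea : forall t n, 0 <= t <= T -> a t n = l t n).
  { intros t n Ht. apply Cminus_eq0.
    apply (Cmod_eq0_lim _ (fun k => (4 * D0 * exp (rate A * t)) * (/ 2) ^ k)).
    2: { apply is_lim_seq_scal0, is_lim_seq_geom. rewrite Rabs_pos_eq; lra. }
    exists 0%nat. intros k _.
    assert (HDk : 0 <= 4 * D0 * (/ 2) ^ k) by (apply Rmult_le_pos; [lra|apply pow_le; lra]).
    assert (P1 : decay2 (seq_sub (a t) (iter A T a0 (S k) t)) (/ 2 * (4 * D0 * (/ 2) ^ k) * exp (rate A * t))).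
    { apply (picard_contract A T a0 l' (iter A T a0 k)); auto.
      - intros; now apply iter_ccont_at.
      - intros s Hs. unfold l'. rewrite (clamp_time_id T s Hs). now apply Hl. }
    pose proof (Hl t (S k) Ht) as P2. specialize (P1 n). specialize (P2 n). pose proof (W_ge1 n).
    unfold seq_sub in P1, P2.
    replace (Cminus (a t n) (l t n)) with (Cminus (Cminus (a t n) (iter A T a0 (S k) t n)) (Cminus (l t n) (iter A T a0 (S k) t n))) by ring.
    set (z1 := Cminus (a t n) (iter A T a0 (S k) t n)) in *. set (z2 := Cminus (l t n) (iter A T a0 (S k) t n)) in *.
    pose proof (Cmod_triangle z1 (Copp z2)) as Tr. rewrite Cmod_opp in Tr. unfold Cminus.
    pose proof (Cmod_ge_0 z1). pose proof (Cmod_ge_0 z2).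
    change ((/ 2) ^ S k) with (/ 2 * (/ 2) ^ k) in P2. nra. }
  exists a. split.
  - intro n. apply duhamel_0.
  - intros t n Ht.
    pose proof (picard_der A T a0 l' t n HA HT Cl' Ht) as Dd. fold a in Dd.
    assert (El : l' t = a t); [|rewrite El in Dd; exact Dd].
    apply functional_extensionality. intro m. unfold l'. rewrite (clamp_time_id T t Ht). symmetry. now apply Ea.
Qed.

(* While it stays in the ball of radius A, a solution of the truncated equation solves the
   full one, whose a priori bound A/2 keeps it in that ball for a further time independent of n. *)
Lemma smooth_data_solution a0 T : 0 <= T -> (forall s, exists B, hs_bound s a0 B) ->
  exists a : R -> Z -> C, (forall n, a 0 n = a0 n) /\ seq_eq a 0 T /\ smooth_on a 0 T.
Proof.
  intros HT H0. destruct (H0 2) as [B2 HB2].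
  destruct (H0 0) as [B00 HB00].
  set (R2 := energy 0 a0 + absorb_cst beta).
  assert (HR2 : 0 <= R2) by (unfold R2; pose proof (energy_ge0 _ _ _ HB00); pose proof (absorb_cst_ge0 beta); lra).
  set (M := exp (growth_rate omega beta 2 R2 * T) * energy 2 a0).
  pose proof (energy_ge0 _ _ _ HB2) as HE2.
  assert (HM : energy 2 a0 <= M).
  { unfold M. pose proof (growth_rate_pos omega beta 2 R2 HR2).
    assert (1 <= exp (growth_rate omega beta 2 R2 * T)) by (rewrite <- exp_0; apply exp_mono; nra). nra. }
  (* M will bound the squared H^2 norm on [0, T] a priori, hence W |a| <= sqrt M <= A / 2, half of
     the clamping radius. Adding 1 keeps A positive. *)
  set (A := 2 * (sqrt M + 1)).
  pose proof (sqrt_pos M) as HsM.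
  assert (HA : 0 < A) by (unfold A; lra).
  assert (Y0 : decay2 a0 (A / 2)).
  { intro n. eapply Rle_trans; [apply (hs_bound_decay2 _ _ (hs_bound_energy _ _ _ HB2) n)|].
    unfold A. pose proof (sqrt_le_1_alt _ _ HM). lra. }
  destruct (truncated_solution A T a0) as [a [Ha0 Ha]]; [lra|exact HT| |].
  { intro n. specialize (Y0 n). lra. }
  assert (Ea0 : a 0 = a0) by (apply functional_extensionality; exact Ha0).
  exists a. split; [exact Ha0|].
  assert (True_eq : forall t1, t1 <= T -> (forall t, 0 <= t <= t1 -> decay2 (a t) A) -> seq_eq a 0 t1).
  { intros t1 Ht1 HY t n Ht. pose proof (Ha t n ltac:(lra)) as D. unfold forcing in D.
    rewrite (clamp_seq_id A (a t) (HY t Ht)) in D. exact D. }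
  assert (Sm : forall t1, t1 <= T -> (forall t, 0 <= t <= t1 -> decay2 (a t) A) -> smooth_on a 0 t1).
  { intros t1 Ht1 HY. apply (smooth_closed gamma omega beta L a 0 t1 A); auto.
    rewrite Ea0. exact H0. }
  assert (Apriori : forall t1, t1 <= T -> (forall t, 0 <= t <= t1 -> decay2 (a t) A) ->
    forall t, 0 <= t <= t1 -> decay2 (a t) (A / 2)).
  { intros t1 Ht1 HY t Ht. pose proof (True_eq t1 Ht1 HY) as He. pose proof (Sm t1 Ht1 HY) as Hs.
    assert (HE : forall r, 0 <= r <= t1 -> energy 0 (a r) <= R2).
    { intros r Hr. pose proof (L2_decay gamma omega beta L a 0 t1 He Hs r Hr) as Q. rewrite Ea0 in Q.
      assert (exp (- (r - 0)) <= 1) by (rewrite <- exp_0; apply exp_mono; lra).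
      pose proof (energy_ge0 _ _ _ HB00). unfold R2. nra. }
    pose proof (Hs_growth gamma omega beta L a 0 t1 2 R2 ltac:(lra) HR2 He Hs HE t Ht) as Q. rewrite Ea0 in Q.
    assert (QM : energy 2 (a t) <= M).
    { eapply Rle_trans; [exact Q|]. unfold M. apply Rmult_le_compat_r; [exact HE2|].
      apply exp_mono. pose proof (growth_rate_pos omega beta 2 R2 HR2). nra. }
    destruct (Hs 2 ltac:(lra)) as [B HB].
    intro n. eapply Rle_trans; [apply (hs_bound_decay2 _ _ (hs_bound_energy _ _ _ (HB t Ht)) n)|].
    unfold A. pose proof (sqrt_le_1_alt _ _ QM). lra. }
  set (GG := omega_bd * (400 * (2 * A) ^ 3)).
  assert (HGG : 0 <= GG).
  { unfold GG. pose proof (omega_bd_ge1 omega). apply Rmult_le_pos; [lra|]. apply Rmult_le_pos; [lra|]. apply pow_le; lra. }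
  (* Dividing the forcing bound by [kap] leaves at most A / 4, and T0 below satisfies exp (2 mu T0)
     = 2. From radius A / 2 the squared radius then stays below 2 (1/4 + 1/16) A^2 < A^2. *)
  set (kap := 4 * GG / A + 1). set (mu := re_beta + kap).
  pose proof (re_beta_ge0 beta) as Hb.
  assert (Hkap : 1 <= kap).
  { unfold kap. assert (0 <= 4 * GG / A) by (apply Rdiv_le_0_compat; lra). lra. }
  set (T0 := ln 2 / (2 * mu)).
  assert (Hmu : 0 < mu) by (unfold mu; lra).
  assert (Hln2 : 0 < ln 2) by (rewrite <- ln_1; apply ln_increasing; lra).
  assert (HT0 : 0 < T0) by (unfold T0; apply Rdiv_lt_0_compat; lra).
  assert (Step : forall ts, 0 <= ts -> decay2 (a ts) (A / 2) -> forall t, ts <= t <= T -> t <= ts + T0 -> decay2 (a t) A).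
  { intros ts Hts HY t Ht Ht2 n. pose proof (W_pos n) as PW. pose proof (lam_re_le_re_beta n) as HL.
    pose proof (linear_ode_bound (fun t => a t n) (lam n) (fun t => forcing A (a t) n) ts T mu (GG / W n)
      ltac:(unfold mu; lra) ltac:(apply Rdiv_le_0_compat; lra)
      (fun s Hs => Ha s n ltac:(lra))) as Q.
    assert (Q' : Cmod (a t n) ^ 2 <= exp (2 * mu * (t - ts)) * (exp (- (mu - fst (lam n)) * (t - ts)) * Cmod (a ts n) ^ 2 + (GG / W n / (mu - fst (lam n))) ^ 2)).
    { apply Q; [|exact Ht]. intros s Hs. apply Rmult_le_reg_r with (1 := PW).
      eapply Rle_trans; [apply (forcing_bound A (a s) n); lra|]. fold GG.
      replace (GG / W n * exp (mu * (s - ts)) * W n) with (GG * exp (mu * (s - ts))) by (field; lra).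
      assert (1 <= exp (mu * (s - ts))) by (rewrite <- exp_0; apply exp_mono; apply Rmult_le_pos; lra). nra. }
    clear Q.
    assert (I0 : exp (2 * mu * (t - ts)) <= 2).
    { apply Rle_trans with (exp (ln 2)); [|rewrite exp_ln; lra]. apply exp_mono.
      apply Rle_trans with (2 * mu * T0); [apply Rmult_le_compat_l; lra|]. right. unfold T0. field. lra. }
    assert (I1 : exp (- (mu - fst (lam n)) * (t - ts)) <= 1).
    { rewrite <- exp_0. apply exp_mono. assert (0 <= mu - fst (lam n)) by (unfold mu; lra). nra. }
    set (q := A / W n).
    assert (Hq : 0 <= q) by (apply Rdiv_le_0_compat; lra).
    assert (I2 : Cmod (a ts n) ^ 2 <= (q / 2) ^ 2).
    { apply pow_incr. split; [apply Cmod_ge_0|]. eapply Rle_trans; [apply (decay2_le _ _ n HY)|].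
      unfold q. right. field. lra. }
    assert (I3 : (GG / W n / (mu - fst (lam n))) ^ 2 <= (q / 4) ^ 2).
    { apply pow_incr. split.
      - apply Rdiv_le_0_compat; [apply Rdiv_le_0_compat; lra|unfold mu; lra].
      - apply Rle_trans with (GG / W n / kap).
        + apply Rmult_le_compat_l; [apply Rdiv_le_0_compat; lra|]. apply Rinv_le_contravar; [lra|unfold mu; lra].
        + apply Rmult_le_reg_r with kap; [lra|]. apply Rmult_le_reg_r with (1 := PW).
          replace (GG / W n / kap * kap * W n) with GG by (field; lra).
          replace (q / 4 * kap * W n) with (GG + A / 4) by (unfold q, kap; field; lra). lra. }
    assert (Q2 : Cmod (a t n) <= 1 * q).
    { apply sq_le_Cmod; [lra|exact Hq|].
      pose proof (exp_pos (2 * mu * (t - ts))). pose proof (exp_pos (- (mu - fst (lam n)) * (t - ts))).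
      pose proof (pow2_ge_0 (Cmod (a ts n))).
      pose proof (pow2_ge_0 (GG / W n / (mu - fst (lam n)))).
      assert (X1 : exp (- (mu - fst (lam n)) * (t - ts)) * Cmod (a ts n) ^ 2 <= 1 * (q / 2) ^ 2) by (apply Rmult_le_compat; lra).
      assert (X2 : 0 <= exp (- (mu - fst (lam n)) * (t - ts)) * Cmod (a ts n) ^ 2) by (apply Rmult_le_pos; lra).
      set (y := exp (- (mu - fst (lam n)) * (t - ts)) * Cmod (a ts n) ^ 2 + (GG / W n / (mu - fst (lam n))) ^ 2) in *.
      assert (0 <= y) by (unfold y; lra).
      assert (exp (2 * mu * (t - ts)) * y <= 2 * y) by (apply Rmult_le_compat_r; lra).
      pose proof (pow2_ge_0 q). unfold y in *. nra. }
    apply Rle_trans with (1 * q * W n); [apply Rmult_le_compat_r; lra|]. right. unfold q. field. lra. }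
  (* Continuation over intervals of length T0: [Apriori] restores the radius A / 2 before each use
     of [Step]. *)
  assert (All : forall k t, 0 <= t <= T -> t <= INR k * T0 -> decay2 (a t) A).
  { induction k as [|k IH]; intros t Ht Htk.
    - simpl in Htk. replace t with 0 by lra. rewrite Ea0. intro n. specialize (Y0 n). lra.
    - rewrite S_INR in Htk. destruct (Rle_dec t (INR k * T0)) as [|Hn]; [now apply IH|].
      pose proof (pos_INR k) as Pk.
      apply (Step (INR k * T0)); [nra| |lra|lra].
      apply (Apriori (INR k * T0)); [lra| |split; [nra|lra]].
      intros r Hr. apply IH; lra. }
  assert (YA : forall t, 0 <= t <= T -> decay2 (a t) A).
  { intros t Ht. destruct (nat_above (t / T0)) as [k Hk]. apply (All k); [exact Ht|].
    apply (Rmult_le_compat_r T0) in Hk; [|lra]. replace (t / T0 * T0) with t in Hk by (field; lra). exact Hk. }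
  split; [apply True_eq; auto; lra|apply Sm; auto; lra].
Qed.

End Equation.

(** * Classical solutions and coefficient sequences *)

Lemma is_derive_cderive f t l : is_derive (V := C_R_NormedModule) f t l -> cderive f t l.
Proof.
  intros H. split.
  - apply (filterdiff_comp f (fun z : C_R_NormedModule => fst z) (fun y => scal y l) fst) in H.
    + exact H.
    + apply (filterdiff_linear (fst : prod_NormedModule R_AbsRing R_NormedModule R_NormedModule -> R_NormedModule)).
      apply is_linear_fst.
  - apply (filterdiff_comp f (fun z : C_R_NormedModule => snd z) (fun y => scal y l) snd) in H.
    + exact H.
    + apply (filterdiff_linear (snd : prod_NormedModule R_AbsRing R_NormedModule R_NormedModule -> R_NormedModule)).
      apply is_linear_snd.
Qed.

Lemma cderive_is_derive f t l : cderive f t l -> is_derive (V := C_R_NormedModule) f t l.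
Proof.
  intros [H1 H2].
  assert (Q : filterdiff (fun s => (fst (f s), snd (f s)) : C_R_NormedModule) (locally t)
    (fun y => (scal y (fst l), scal y (snd l)) : C_R_NormedModule)).
  { apply (filterdiff_comp'_2 (U := R_NormedModule) (V := R_NormedModule) (W := C_R_NormedModule)
      (fun s => fst (f s)) (fun s => snd (f s)) (fun a b => (a, b)) t (fun y => scal y (fst l)) (fun y => scal y (snd l)) (fun a b => (a, b)));
      [exact H1|exact H2|].
    apply (filterdiff_linear (U := prod_NormedModule R_AbsRing R_NormedModule R_NormedModule)
      (V := prod_NormedModule R_AbsRing R_NormedModule R_NormedModule) (fun t => (fst t, snd t))).
    apply (is_linear_prod (T := prod_NormedModule R_AbsRing R_NormedModule R_NormedModule) fst snd);
      [apply is_linear_fst|apply is_linear_snd]. }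
  eapply (filterdiff_ext (fun s => (fst (f s), snd (f s)) : C_R_NormedModule)).
  - intro y. now destruct (f y).
  - exact Q.
Qed.

Definition cont2 (u : R -> R -> C) (t x : R) : Prop :=
  continuity_2d_pt (fun t x => fst (u t x)) t x /\ continuity_2d_pt (fun t x => snd (u t x)) t x.

Lemma continuous_cont2 (u : R -> R -> C) t x :
  continuous (fun p : R * R => u (fst p) (snd p)) (t, x) -> cont2 u t x.
Proof.
  intros H. split; apply continuity_2d_pt_filterlim.
  - exact (continuous_comp (fun p : R * R => u (fst p) (snd p)) (fst : R * R -> R) (t, x) H (continuous_fst _ _)).
  - exact (continuous_comp (fun p : R * R => u (fst p) (snd p)) (snd : R * R -> R) (t, x) H (continuous_snd _ _)).
Qed.

Lemma cont2_continuous (u : R -> R -> C) t x :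
  cont2 u t x -> continuous (fun p : R * R => u (fst p) (snd p)) (t, x).
Proof.
  intros [H1 H2]. apply continuity_2d_pt_filterlim in H1. apply continuity_2d_pt_filterlim in H2.
  apply filterlim_locally. intros eps.
  pose proof (proj1 (filterlim_locally _ _) H1 eps) as Q1. pose proof (proj1 (filterlim_locally _ _) H2 eps) as Q2.
  generalize (filter_and _ _ Q1 Q2). apply filter_imp. intros [s y] [B1 B2]. split; assumption.
Qed.

Lemma cont2_eps (u : R -> R -> C) t x :
  (forall eps, 0 < eps -> exists d, 0 < d /\ forall s y, Rabs (s - t) < d -> Rabs (y - x) < d ->
     Cmod (Cminus (u s y) (u t x)) < eps) -> cont2 u t x.
Proof.
  intros H. split; intros [eps He]; destruct (H eps He) as [d [Hd Q]]; exists (mkposreal d Hd);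
    intros s y Hs Hy; simpl in *; (eapply Rle_lt_trans; [|apply (Q s y Hs Hy)]).
  - apply (Rabs_fst_le (Cminus (u s y) (u t x))).
  - apply (Rabs_snd_le (Cminus (u s y) (u t x))).
Qed.

Lemma cont2_ccont u t : (forall x, cont2 u t x) -> ccont (u t).
Proof.
  intros H. split; intro x; destruct (H x) as [H1 H2]; apply continuous_eps; intros eps He.
  - destruct (H1 (mkposreal eps He)) as [[d Hd] Q]. exists d. split; [exact Hd|]. intros y Hy.
    apply (Q t y); [rewrite Rminus_diag, Rabs_R0; exact Hd|exact Hy].
  - destruct (H2 (mkposreal eps He)) as [[d Hd] Q]. exists d. split; [exact Hd|]. intros y Hy.
    apply (Q t y); [rewrite Rminus_diag, Rabs_R0; exact Hd|exact Hy].
Qed.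

Lemma cont2_mult_snd u f t x : cont2 u t x -> ccont_at f x -> cont2 (fun s y => Cmult (u s y) (f y)) t x.
Proof.
  intros [H1 H2] [F1 F2].
  assert (S : forall g : R -> R, continuous g x -> continuity_2d_pt (fun _ y => g y) t x).
  { intros g Hg [eps He]. destruct (eps_continuous _ _ Hg eps He) as [d [Hd Q]].
    exists (mkposreal d Hd). intros s y _ Hy. now apply Q. }
  pose proof (S (fun y => fst (f y)) F1) as G1. pose proof (S (fun y => snd (f y)) F2) as G2.
  split; simpl.
  - apply (continuity_2d_pt_minus (fun s y => fst (u s y) * fst (f y)) (fun s y => snd (u s y) * snd (f y))).
    + apply (continuity_2d_pt_mult (fun s y => fst (u s y)) (fun _ y => fst (f y))); assumption.
    + apply (continuity_2d_pt_mult (fun s y => snd (u s y)) (fun _ y => snd (f y))); assumption.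
  - apply (continuity_2d_pt_plus (fun s y => fst (u s y) * snd (f y)) (fun s y => snd (u s y) * fst (f y))).
    + apply (continuity_2d_pt_mult (fun s y => fst (u s y)) (fun _ y => snd (f y))); assumption.
    + apply (continuity_2d_pt_mult (fun s y => snd (u s y)) (fun _ y => fst (f y))); assumption.
Qed.

(** The assumptions are restricted to positive times, the only ones where a classical solution is
    regular; a neighbourhood of t suffices for differentiation under the integral. *)
Lemma avg_param_derive (g gt : R -> R -> R) t :
  (forall s x, 0 < s -> is_derive (fun r => g r x) s (gt s x)) ->
  (forall s, 0 < s -> rcont (g s)) ->
  (forall x, continuity_2d_pt gt t x) -> 0 < t ->
  is_derive (fun s => avg (g s)) t (avg (gt t)).
Proof.
  intros Hd Hc Hgt Ht. unfold avg.
  apply (is_derive_scal (fun s => RInt (g s) (- PI) PI)).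
  assert (Pos : locally t (fun s => 0 < s)).
  { exists (mkposreal t Ht). intros s Bs.
    unfold ball in Bs; simpl in Bs; unfold AbsRing_ball, abs, minus, plus, opp in Bs; simpl in Bs.
    apply Rabs_lt_between in Bs. lra. }
  rewrite <- (RInt_ext (fun x => Derive (fun r => g r x) t)).
  2: { intros x _. apply is_derive_unique, Hd, Ht. }
  apply (is_derive_RInt_param g (- PI) PI t).
  - revert Pos. apply filter_imp. intros s Hs x _. eexists. now apply Hd.
  - intros x _. apply continuity_2d_pt_ext_loc with gt; [|apply Hgt].
    exists (mkposreal t Ht). intros s y Hs _. simpl in Hs. apply Rabs_lt_between in Hs.
    symmetry. apply is_derive_unique, Hd. lra.
  - revert Pos. apply filter_imp. intros s Hs. apply rcont_ex_RInt, Hc, Hs.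
Qed.

Lemma cavg_param_derive (U Ut : R -> R -> C) t :
  (forall s x, 0 < s -> cderive (fun r => U r x) s (Ut s x)) ->
  (forall s, 0 < s -> ccont (U s)) ->
  (forall x, cont2 Ut t x) -> 0 < t ->
  cderive (fun s => cavg (U s)) t (cavg (Ut t)).
Proof.
  intros Hd Hc HUt Ht. split.
  - apply (avg_param_derive (fun s x => fst (U s x)) (fun s x => fst (Ut s x))); auto.
    + intros; now apply Hd.
    + intros; now apply Hc.
    + intro; apply HUt.
  - apply (avg_param_derive (fun s x => snd (U s x)) (fun s x => snd (Ut s x))); auto.
    + intros; now apply Hd.
    + intros; now apply Hc.
    + intro; apply HUt.
Qed.

Lemma expi_period n x : expi n (x + 2 * PI) = expi n x.
Proof.
  unfold expi. rewrite Rmult_plus_distr_l. replace (IZR n * (2 * PI)) with (2 * (IZR n * PI)) by ring.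
  rewrite cos_plus, sin_plus, cos_2a_sin, sin_2a, sin_kPI. f_equal; ring.
Qed.

Lemma expi_cderive n x : cderive (expi n) x (Cmult (0, IZR n) (expi n x)).
Proof. unfold expi. split; simpl; auto_derive; auto; ring. Qed.

Lemma cderive_periodic f df : periodic f -> (forall x, cderive f x (df x)) -> periodic df.
Proof.
  intros Hp Hd x.
  assert (S : forall (g dg : R -> R), (forall y, g (y + 2 * PI) = g y) -> (forall y, is_derive g y (dg y)) -> dg (x + 2 * PI) = dg x).
  { intros g dg Hg Hdg.
    assert (Q : is_derive g x (dg (x + 2 * PI))).
    { apply (is_derive_ext (fun y => g (y + 2 * PI))); [exact Hg|].
      replace (dg (x + 2 * PI)) with (1 * dg (x + 2 * PI)) by ring.
      apply (is_derive_comp g (fun y => y + 2 * PI)); [apply Hdg|]. auto_derive; [exact I|ring]. }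
    rewrite <- (is_derive_unique _ _ _ Q). apply is_derive_unique, Hdg. }
  apply injective_projections.
  - apply (S (fun y => fst (f y)) (fun y => fst (df y))); [intro; now rewrite Hp|intro; apply Hd].
  - apply (S (fun y => snd (f y)) (fun y => snd (df y))); [intro; now rewrite Hp|intro; apply Hd].
Qed.

Lemma cavg_derivative h dh : periodic h -> (forall x, cderive h x (dh x)) -> ccont dh -> cavg dh = RtoC 0.
Proof.
  intros Hp Hd Hc.
  assert (S : forall (g dg : R -> R), (forall y, g (y + 2 * PI) = g y) -> (forall y, is_derive g y (dg y)) -> rcont dg -> avg dg = 0).
  { intros g dg Hg Hdg Hr. unfold avg.
    rewrite (is_RInt_unique dg (- PI) PI (minus (g PI) (g (- PI)))).
    - replace PI with (- PI + 2 * PI) at 2 by ring. rewrite Hg. unfold minus, plus, opp; simpl. ring.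
    - apply (is_RInt_derive g dg); [intros; apply Hdg|intros; apply Hr]. }
  unfold cavg, RtoC. f_equal.
  - apply (S (fun y => fst (h y))); [intro; now rewrite Hp|intro; apply Hd|apply Hc].
  - apply (S (fun y => snd (h y))); [intro; now rewrite Hp|intro; apply Hd|apply Hc].
Qed.

Lemma cderive_conj f t l : cderive f t l -> cderive (fun s => Cconj (f s)) t (Cconj l).
Proof.
  intros [H1 H2]. split; simpl; [exact H1|]. apply (is_derive_opp (fun s => snd (f s))). exact H2.
Qed.

Lemma cderive_ccont f df : (forall x, cderive f x (df x)) -> ccont f.
Proof. intros H. apply ccont_ccont_at. intro x. eapply cderive_ccont_at, H. Qed.

(** Integration by parts: the derivative of f times the conjugate exponential has mean 0 by
    periodicity. *)
Lemma fcoef_derivative f df n : periodic f -> (forall x, cderive f x (df x)) -> ccont df ->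
  fcoef df n = Cmult (0, IZR n) (fcoef f n).
Proof.
  intros Hp Hd Hc. pose proof (cderive_ccont _ _ Hd) as Hf.
  set (dh := fun x => Cplus (Cmult (df x) (Cconj (expi n x))) (Cmult (f x) (Cconj (Cmult (0, IZR n) (expi n x))))).
  assert (Hdh : ccont dh) by (unfold dh; auto 7 with contdb).
  assert (Q : cavg dh = RtoC 0).
  { apply (cavg_derivative (fun x => Cmult (f x) (Cconj (expi n x)))); [| |exact Hdh].
    - intro x. rewrite Hp, expi_period. reflexivity.
    - intro x. apply (cderive_mult f (fun x => Cconj (expi n x))); [apply Hd|]. apply cderive_conj, expi_cderive. }
  unfold dh in Q. rewrite cavg_plus in Q by auto 7 with contdb.
  rewrite <- fcoef_cavg in Q by exact Hc.
  rewrite (cavg_ext (fun x => Cmult (f x) (Cconj (Cmult (0, IZR n) (expi n x))))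
    (fun x => Cmult (Copp (0, IZR n)) (Cmult (f x) (Cconj (expi n x))))) in Q.
  - rewrite cavg_mult_l, <- fcoef_cavg in Q by auto with contdb.
    apply Cminus_eq0. rewrite <- Q. ring.
  - intro x. rewrite Cmult_conj.
    replace (Cconj (0, IZR n)) with (Copp (0, IZR n)) by (unfold Cconj, Copp; simpl; f_equal; ring). ring.
Qed.

(** Uniform continuity gives a distance de within which g varies by less than 1. Counting steps of
    length de / 2, first in t along the edge x = c and then in x, bounds g. *)
Lemma rectangle_bound (g : R -> R -> R) a b c d : a <= b -> c <= d ->
  (forall t x, a <= t <= b -> c <= x <= d -> continuity_2d_pt g t x) ->
  exists M, forall t x, a <= t <= b -> c <= x <= d -> Rabs (g t x) <= M.
Proof.
  intros Hab Hcd H.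
  destruct (uniform_continuity_2d g a b c d H (mkposreal 1 Rlt_0_1)) as [[de Hde] Q]. simpl in Q.
  assert (S1 : forall k t, a <= t <= b -> t <= a + INR k * (de / 2) -> Rabs (g t c) <= Rabs (g a c) + INR k).
  { induction k as [|k IH]; intros t Ht Hk.
    - simpl in *. replace t with a by lra. lra.
    - rewrite S_INR in *. pose proof (pos_INR k).
      destruct (Rle_dec t (a + INR k * (de / 2))) as [L|L]; [specialize (IH t Ht L); lra|].
      set (s := a + INR k * (de / 2)) in *.
      assert (Hs : a <= s <= b) by (unfold s in *; split; nra).
      specialize (IH s Hs ltac:(lra)).
      assert (Q1 : Rabs (g t c - g s c) < 1).
      { assert (Z1 : Rabs (t - s) < de) by (apply Rabs_def1; unfold s in *; lra).
        assert (Z2 : Rabs (c - c) < de) by (rewrite Rminus_diag, Rabs_R0; exact Hde).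
        apply Q; auto; lra. }
      pose proof (Rabs_triang (g t c - g s c) (g s c)). replace (g t c - g s c + g s c) with (g t c) in H1 by ring. lra. }
  assert (S2 : forall k t x, a <= t <= b -> c <= x <= d -> x <= c + INR k * (de / 2) -> Rabs (g t x) <= Rabs (g t c) + INR k).
  { induction k as [|k IH]; intros t x Ht Hx Hk.
    - simpl in *. replace x with c by lra. lra.
    - rewrite S_INR in *. pose proof (pos_INR k).
      destruct (Rle_dec x (c + INR k * (de / 2))) as [L|L]; [specialize (IH t x Ht Hx L); lra|].
      set (y := c + INR k * (de / 2)) in *.
      assert (Hy : c <= y <= d) by (unfold y in *; split; nra).
      specialize (IH t y Ht Hy ltac:(lra)).
      assert (Q1 : Rabs (g t x - g t y) < 1).
      { assert (Z1 : Rabs (x - y) < de) by (apply Rabs_def1; unfold y in *; lra).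
        assert (Z2 : Rabs (t - t) < de) by (rewrite Rminus_diag, Rabs_R0; exact Hde).
        apply Q; auto; lra. }
      pose proof (Rabs_triang (g t x - g t y) (g t y)). replace (g t x - g t y + g t y) with (g t x) in H1 by ring. lra. }
  destruct (nat_above ((b - a) / (de / 2))) as [k1 Hk1]. destruct (nat_above ((d - c) / (de / 2))) as [k2 Hk2].
  assert (E1 : b - a <= INR k1 * (de / 2)).
  { apply (Rmult_le_compat_r (de / 2)) in Hk1; [|lra]. replace ((b - a) / (de / 2) * (de / 2)) with (b - a) in Hk1 by (field; lra). lra. }
  assert (E2 : d - c <= INR k2 * (de / 2)).
  { apply (Rmult_le_compat_r (de / 2)) in Hk2; [|lra]. replace ((d - c) / (de / 2) * (de / 2)) with (d - c) in Hk2 by (field; lra). lra. }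
  exists (Rabs (g a c) + INR k1 + INR k2). intros t x Ht Hx.
  specialize (S1 k1 t Ht ltac:(lra)). specialize (S2 k2 t x Ht Hx ltac:(lra)). lra.
Qed.

Lemma Cmod_fcoef_bound f n M1 M2 : ccont f ->
  (forall x, - PI <= x <= PI -> Rabs (fst (f x)) <= M1 /\ Rabs (snd (f x)) <= M2) -> Cmod (fcoef f n) <= M1 + M2.
Proof.
  intros Hf H. rewrite fcoef_cavg by exact Hf. eapply Rle_trans; [apply Cmod_cavg; auto with contdb|].
  rewrite <- (avg_const (M1 + M2)). apply avg_le; auto 7 with contdb.
  intros x Hx. rewrite Cmod_mult, Cmod_conj, Cmod_expi, Rmult_1_r.
  eapply Rle_trans; [apply Cmod_le_abs|]. destruct (H x Hx). lra.
Qed.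

Section Equation.
Variables (gamma omega : R) (beta : C) (L : R).
Local Notation rhs := (vfield gamma omega beta L).
Local Notation seq_eq := (seq_eq gamma omega beta L).

(** Bounds for u and u_xx on a rectangle give the [decay2] bound. The series is then absolutely
    convergent and reproduces u, so the cubic term can be expressed through the coefficients. The
    start t0 is positive because nothing is assumed pointwise near t = 0. *)
Lemma classical_coefficients u : classical_solution gamma omega beta L u ->
  forall t0 T, 0 < t0 ->
    seq_eq (fun t => fcoef (u t)) t0 T /\
    (exists A, forall t, t0 <= t <= T -> decay2 (fcoef (u t)) A) /\
    (forall t x, t0 <= t <= T -> synth (fcoef (u t)) x = u t x).
Proof.
  intros (ut & ux & uxx & uxxx & H) t0 T Ht0.
  assert (Cu : forall t, 0 < t -> forall x, cont2 u t x).
  { intros t Ht x. destruct (H t x Ht) as (_ & _ & _ & _ & _ & Q & _). now apply continuous_cont2. }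
  assert (Cut : forall t, 0 < t -> forall x, cont2 ut t x).
  { intros t Ht x. destruct (H t x Ht) as (_ & _ & _ & _ & _ & _ & Q & _). now apply continuous_cont2. }
  assert (Cux : forall t, 0 < t -> forall x, cont2 ux t x).
  { intros t Ht x. destruct (H t x Ht) as (_ & _ & _ & _ & _ & _ & _ & Q & _). now apply continuous_cont2. }
  assert (Cuxx : forall t, 0 < t -> forall x, cont2 uxx t x).
  { intros t Ht x. destruct (H t x Ht) as (_ & _ & _ & _ & _ & _ & _ & _ & Q & _). now apply continuous_cont2. }
  assert (Cuxxx : forall t, 0 < t -> forall x, cont2 uxxx t x).
  { intros t Ht x. destruct (H t x Ht) as (_ & _ & _ & _ & _ & _ & _ & _ & _ & Q & _). now apply continuous_cont2. }
  assert (Dt : forall t x, 0 < t -> cderive (fun s => u s x) t (ut t x)).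
  { intros t x Ht. destruct (H t x Ht) as (_ & Q & _). now apply is_derive_cderive. }
  assert (Dx : forall t x, 0 < t -> cderive (fun y => u t y) x (ux t x)).
  { intros t x Ht. destruct (H t x Ht) as (_ & _ & Q & _). now apply is_derive_cderive. }
  assert (Dxx : forall t x, 0 < t -> cderive (fun y => ux t y) x (uxx t x)).
  { intros t x Ht. destruct (H t x Ht) as (_ & _ & _ & Q & _). now apply is_derive_cderive. }
  assert (Dxxx : forall t x, 0 < t -> cderive (fun y => uxx t y) x (uxxx t x)).
  { intros t x Ht. destruct (H t x Ht) as (_ & _ & _ & _ & Q & _). now apply is_derive_cderive. }
  assert (Pu : forall t, 0 < t -> periodic (u t)).
  { intros t Ht x. now destruct (H t x Ht) as (Q & _). }
  assert (Eq : forall t x, 0 < t -> ut t x = Cplus (Cplus (Cplus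
      (Cmult (1, gamma) (uxx t x)) (Cmult beta (u t x)))
      (Copp (Cmult (1, omega) (cubic (u t x))))) (Cmult (RtoC L) (uxxx t x))).
  { intros t x Ht. destruct (H t x Ht) as (_ & _ & _ & _ & _ & _ & _ & _ & _ & _ & Q). exact Q. }
  clear H.
  assert (Pux : forall t, 0 < t -> periodic (ux t)) by (intros t Ht; exact (cderive_periodic _ _ (Pu t Ht) (fun x => Dx t x Ht))).
  assert (Puxx : forall t, 0 < t -> periodic (uxx t)) by (intros t Ht; exact (cderive_periodic _ _ (Pux t Ht) (fun x => Dxx t x Ht))).
  assert (cu : forall t, 0 < t -> ccont (u t)) by (intros; now apply cont2_ccont, Cu).
  assert (cut : forall t, 0 < t -> ccont (ut t)) by (intros; now apply cont2_ccont, Cut).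
  assert (cux : forall t, 0 < t -> ccont (ux t)) by (intros; now apply cont2_ccont, Cux).
  assert (cuxx : forall t, 0 < t -> ccont (uxx t)) by (intros; now apply cont2_ccont, Cuxx).
  assert (cuxxx : forall t, 0 < t -> ccont (uxxx t)) by (intros; now apply cont2_ccont, Cuxxx).
  assert (F1 : forall t n, 0 < t -> fcoef (ux t) n = Cmult (0, IZR n) (fcoef (u t) n)).
  { intros t n Ht. exact (fcoef_derivative _ _ n (Pu t Ht) (fun x => Dx t x Ht) (cux t Ht)). }
  assert (F2 : forall t n, 0 < t -> fcoef (uxx t) n = Cmult (0, IZR n) (fcoef (ux t) n)).
  { intros t n Ht. exact (fcoef_derivative _ _ n (Pux t Ht) (fun x => Dxx t x Ht) (cuxx t Ht)). }
  assert (F3 : forall t n, 0 < t -> fcoef (uxxx t) n = Cmult (0, IZR n) (fcoef (uxx t) n)).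
  { intros t n Ht. exact (fcoef_derivative _ _ n (Puxx t Ht) (fun x => Dxxx t x Ht) (cuxxx t Ht)). }
  assert (HY : exists A, forall t, t0 <= t <= T -> decay2 (fcoef (u t)) A).
  { destruct (Rle_dec t0 T) as [HT|HT].
    2: { exists 0. intros; lra. }
    pose proof PI_RGT_0 as Ppi.
    assert (Bd : forall v, (forall t, 0 < t -> forall x, cont2 v t x) -> (forall t, 0 < t -> ccont (v t)) ->
      exists M, forall t n, t0 <= t <= T -> Cmod (fcoef (v t) n) <= M).
    { intros v Cv cv.
      destruct (rectangle_bound (fun t x => fst (v t x)) t0 T (- PI) PI) as [M1 Q1];
        [exact HT|lra|intros; apply Cv; lra|].
      destruct (rectangle_bound (fun t x => snd (v t x)) t0 T (- PI) PI) as [M2 Q2];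
        [exact HT|lra|intros; apply Cv; lra|].
      exists (M1 + M2). intros t n Ht. apply Cmod_fcoef_bound; [apply cv; lra|].
      intros x Hx. split; [now apply Q1|now apply Q2]. }
    destruct (Bd u Cu cu) as [M0 Q0]. destruct (Bd uxx Cuxx cuxx) as [M2 Q2].
    exists (M2 + M0). intros t Ht n. specialize (Q0 t n Ht). specialize (Q2 t n Ht).
    rewrite F2, F1, !Cmod_mult in Q2 by lra.
    assert (energy : Cmod (0, IZR n) = Rabs (IZR n)).
    { unfold Cmod; simpl. rewrite Rmult_0_l, Rplus_0_l, Rmult_1_r. apply sqrt_Rsqr_abs. }
    rewrite energy in Q2. unfold W. rewrite <- (pow2_abs (IZR n)). simpl. rewrite Rmult_1_r.
    simpl in Q2. lra. }
  split; [|split; [exact HY|]].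
  2: { intros t x Ht. destruct HY as [A HA].
    apply (synth_inversion (u t) (A * 5)); [apply cu; lra|apply Pu; lra|apply decay2_l1_bound, HA, Ht|].
    intro y. destruct (Dx t y ltac:(lra)) as [D1 D2]. split; eexists; eassumption. }
  intros t n Ht. assert (Hp : 0 < t) by lra.
  assert (D : cderive (fun s => cavg (fun x => Cmult (u s x) (Cconj (expi n x)))) t (cavg (fun x => Cmult (ut t x) (Cconj (expi n x))))).
  { apply (cavg_param_derive (fun s x => Cmult (u s x) (Cconj (expi n x))) (fun s x => Cmult (ut s x) (Cconj (expi n x)))).
    - intros s x Hs.
      replace (Cmult (ut s x) (Cconj (expi n x))) with (Cplus (Cmult (ut s x) (Cconj (expi n x))) (Cmult (u s x) (RtoC 0))) by ring.
      apply (cderive_mult (fun r => u r x) (fun _ => Cconj (expi n x))); [now apply Dt|apply cderive_const].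
    - intros s Hs. auto with contdb.
    - intro x. apply cont2_mult_snd; [now apply Cut|]. apply ccont_ccont_at. auto with contdb.
    - exact Hp. }
  rewrite <- (fcoef_cavg (ut t) n (cut t Hp)) in D.
  assert (Er : fcoef (ut t) n = rhs (fcoef (u t)) n).
  { rewrite (fcoef_ext (ut t) (fun x => Cplus (Cplus (Cplus
        (Cmult (1, gamma) (uxx t x)) (Cmult beta (u t x)))
        (Cmult (Copp (1, omega)) (cubic (u t x)))) (Cmult (RtoC L) (uxxx t x)))).
    2: { auto. }
    2: { intro x. rewrite (Eq t x Hp). ring. }
    pose proof (cu t Hp). pose proof (cuxx t Hp). pose proof (cuxxx t Hp).
    rewrite !fcoef_plus, !fcoef_mult_l by auto 8 with contdb.
    rewrite F3, F2, F1 by exact Hp.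
    assert (EN : fcoef (fun x => cubic (u t x)) n = cubic_coef (fcoef (u t)) n).
    { destruct HY as [A HA]. unfold cubic_coef. apply fcoef_ext; [auto with contdb|].
      intro x. f_equal. symmetry.
      apply (synth_inversion (u t) (A * 5)); [auto|auto|apply decay2_l1_bound, HA, Ht|].
      intro y. destruct (Dx t y Hp) as [D1 D2]. split; eexists; eassumption. }
    rewrite EN. unfold vfield. set (z := fcoef (u t) n). set (w := cubic_coef (fcoef (u t)) n).
    destruct z as [z1 z2]. destruct w as [w1 w2]. destruct beta as [b1 b2].
    unfold symbol, Cminus, Cmult, Cplus, Copp, RtoC; simpl. f_equal; ring. }
  rewrite <- Er. destruct D as [D1 D2]. split.
  (* The identity between [fcoef] and the mean uses continuity of u in x, which holds at positive
     times; hence the local form of extensionality. *)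
  - eapply is_derive_ext_loc; [|exact D1].
    exists (mkposreal t Hp). intros s Bs.
    unfold ball in Bs; simpl in Bs; unfold AbsRing_ball, abs, minus, plus, opp in Bs; simpl in Bs.
    apply Rabs_lt_between in Bs. rewrite fcoef_cavg by (apply cu; lra). reflexivity.
  - eapply is_derive_ext_loc; [|exact D2].
    exists (mkposreal t Hp). intros s Bs.
    unfold ball in Bs; simpl in Bs; unfold AbsRing_ball, abs, minus, plus, opp in Bs; simpl in Bs.
    apply Rabs_lt_between in Bs. rewrite fcoef_cavg by (apply cu; lra). reflexivity.
Qed.
End Equation.

(** * From coefficient sequences to classical solutions *)

Lemma derive_unif_limit (g g' : nat -> R -> R) (f f' : R -> R) t d (eps : nat -> R) : 0 < d ->
  (forall k s, Rabs (s - t) < d -> is_derive (g k) s (g' k s)) ->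
  (forall s, Rabs (s - t) < d -> is_lim_seq (fun k => g k s) (f s)) ->
  (forall k s, Rabs (s - t) < d -> Rabs (g' k s - f' s) <= eps k) ->
  is_lim_seq eps 0 -> continuous f' t -> is_derive f t (f' t).
Proof.
  intros Hd Hg Hf Hg' He Hc. apply is_derive_Reals. intros ep Hep.
  destruct (eps_continuous _ _ Hc (ep / 2)) as [d1 [Hd1 Q1]]; [lra|].
  assert (Hm : 0 < Rmin d d1) by now apply Rmin_glb_lt.
  exists (mkposreal _ Hm). intros h Hh Hhd. simpl in Hhd.
  pose proof (Rmin_l d d1). pose proof (Rmin_r d d1).
  assert (Hph : 0 < Rabs h) by now apply Rabs_pos_lt.
  assert (Hb : forall s, Rmin t (t + h) <= s <= Rmax t (t + h) -> Rabs (s - t) <= Rabs h).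
  { intros s Hs. unfold Rmin, Rmax in Hs. destruct (Rle_dec t (t + h)).
    - rewrite !Rabs_pos_eq; lra.
    - rewrite (Rabs_left1 (s - t)), (Rabs_left1 h); lra. }
  (* Mean value theorem for each k, then comparison of f' at the intermediate point with its value
     at t; the estimate does not depend on that point and passes to the limit. *)
  assert (Q : forall k, Rabs (g k (t + h) - g k t - f' t * h) <= (eps k + ep / 2) * Rabs h).
  { intro k. destruct (MVT_gen (g k) t (t + h) (g' k)) as [c [Hc1 Ec]].
    - intros s Hs. apply Hg. pose proof (Hb s ltac:(lra)). lra.
    - intros s Hs. apply continuity_pt_filterlim, (ex_derive_continuous (g k)). exists (g' k s).
      apply Hg. pose proof (Hb s Hs). lra.
    - rewrite Ec. replace (g' k c * (t + h - t) - f' t * h) with ((g' k c - f' t) * h) by ring.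
      rewrite Rabs_mult. apply Rmult_le_compat_r; [lra|]. pose proof (Hb c Hc1) as Hcb.
      replace (g' k c - f' t) with ((g' k c - f' c) + (f' c - f' t)) by ring.
      eapply Rle_trans; [apply Rabs_triang|].
      apply Rplus_le_compat; [apply Hg'; lra|]. left. apply Q1. lra. }
  assert (Ql : Rabs (f (t + h) - f t - f' t * h) <= (0 + ep / 2) * Rabs h).
  { pose proof (is_lim_seq_abs _ _ (is_lim_seq_minus' _ _ _ _ (is_lim_seq_minus' _ _ _ _
      (Hf (t + h) ltac:(replace (t + h - t) with h by ring; lra))
      (Hf t ltac:(rewrite Rminus_diag, Rabs_R0; lra))) (is_lim_seq_const (f' t * h)))) as l1_bound.
    pose proof (is_lim_seq_mult' _ _ _ _ (is_lim_seq_plus' _ _ _ _ He (is_lim_seq_const (ep / 2))) (is_lim_seq_const (Rabs h))) as L2.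
    exact (is_lim_seq_le _ _ _ _ Q l1_bound L2). }
  replace ((f (t + h) - f t) / h - f' t) with ((f (t + h) - f t - f' t * h) / h) by (field; exact Hh).
  unfold Rdiv at 1. rewrite Rabs_mult, Rabs_inv.
  apply Rle_lt_trans with ((0 + ep / 2) * Rabs h * / Rabs h).
  - apply Rmult_le_compat_r; [left; now apply Rinv_0_lt_compat|exact Ql].
  - rewrite Rmult_assoc, Rinv_r by lra. lra.
Qed.

Lemma cderive_unif_limit (g g' : nat -> R -> C) (f f' : R -> C) t d (eps : nat -> R) : 0 < d ->
  (forall k s, Rabs (s - t) < d -> cderive (g k) s (g' k s)) ->
  (forall s, Rabs (s - t) < d -> is_lim_seq (fun k => fst (g k s)) (fst (f s)) /\ is_lim_seq (fun k => snd (g k s)) (snd (f s))) ->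
  (forall k s, Rabs (s - t) < d -> Cmod (Cminus (g' k s) (f' s)) <= eps k) ->
  is_lim_seq eps 0 -> ccont_at f' t -> cderive f t (f' t).
Proof.
  intros Hd Hg Hf Hg' He [C1 C2]. split.
  - apply (derive_unif_limit (fun k s => fst (g k s)) (fun k s => fst (g' k s)) (fun s => fst (f s)) (fun s => fst (f' s)) t d eps); auto.
    + intros; now apply Hg.
    + intros; now apply Hf.
    + intros k s Hs. eapply Rle_trans; [|apply (Hg' k s Hs)]. apply (Rabs_fst_le (Cminus (g' k s) (f' s))).
  - apply (derive_unif_limit (fun k s => snd (g k s)) (fun k s => snd (g' k s)) (fun s => snd (f s)) (fun s => snd (f' s)) t d eps); auto.
    + intros; now apply Hg.
    + intros; now apply Hf.
    + intros k s Hs. eapply Rle_trans; [|apply (Hg' k s Hs)]. apply (Rabs_snd_le (Cminus (g' k s) (f' s))).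
Qed.

Definition mulc (m a : Z -> C) : Z -> C := fun n => Cmult (m n) (a n).
Definition in_symbol (n : Z) : C := (0, IZR n).

Lemma cderive_czsum K (f : Z -> R -> C) (df : Z -> C) t :
  (forall n, cderive (f n) t (df n)) -> cderive (fun s => czsum K (fun n => f n s)) t (czsum K df).
Proof.
  intros H. split.
  - apply (is_derive_zsum K (fun n s => fst (f n s)) (fun n => fst (df n))). intro; apply H.
  - apply (is_derive_zsum K (fun n s => snd (f n s)) (fun n => snd (df n))). intro; apply H.
Qed.

Lemma cderive_scal c f t l : cderive f t l -> cderive (fun s => Cmult c (f s)) t (Cmult c l).
Proof.
  intros H. replace (Cmult c l) with (Cplus (Cmult (RtoC 0) (f t)) (Cmult c l)) by ring.
  apply (cderive_mult (fun _ => c) f); [apply cderive_const|exact H].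
Qed.

Lemma synth_cderive c X Y x : l1_bound c X -> l1_bound (mulc in_symbol c) Y -> cderive (synth c) x (synth (mulc in_symbol c) x).
Proof.
  intros HX HY.
  apply (cderive_unif_limit (fun K y => trig K c y) (fun K y => trig K (mulc in_symbol c) y) (synth c) (synth (mulc in_symbol c)) x 1 (fun K => 2 * l1_tail (mulc in_symbol c) K)).
  - lra.
  - intros K y _. unfold trig. apply cderive_czsum. intro n.
    replace (Cmult (mulc in_symbol c n) (expi n y)) with (Cmult (c n) (Cmult (in_symbol n) (expi n y))) by (unfold mulc; ring).
    apply cderive_scal, expi_cderive.
  - intros y _. eapply synth_lim, HX.
  - intros K y _. replace (Cminus (trig K (mulc in_symbol c) y) (synth (mulc in_symbol c) y)) with (Copp (Cminus (synth (mulc in_symbol c) y) (trig K (mulc in_symbol c) y))) by ring.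
    rewrite Cmod_opp. eapply synth_tail, HY.
  - apply is_lim_seq_scal0. eapply l1_tail_lim, HY.
  - apply ccont_ccont_at. eapply ccont_synth, HY.
Qed.

Lemma synth_periodic c X : l1_bound c X -> periodic (synth c).
Proof.
  intros H x. unfold synth. f_equal; unfold zseries; apply Series_ext; intros [|k]; cbn [zfold]; now rewrite !expi_period.
Qed.

Lemma synth_add a b X Y x : l1_bound a X -> l1_bound b Y -> synth (fun n => Cplus (a n) (b n)) x = Cplus (synth a x) (synth b x).
Proof.
  intros H H'. destruct (synth_lim _ _ x H) as [A1 A2]. destruct (synth_lim _ _ x H') as [B1 B2].
  assert (HS : l1_bound (fun n => Cplus (a n) (b n)) (X + Y)).
  { eapply sum_bound_le; [|apply (sum_bound_plus _ _ _ _ H H')]. intro n. apply Cmod_triangle. }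
  destruct (synth_lim _ _ x HS) as [S1 S2].
  assert (energy : forall K, trig K (fun n => Cplus (a n) (b n)) x = Cplus (trig K a x) (trig K b x)).
  { intro K. unfold trig. rewrite <- czsum_plus. apply czsum_ext. intro; ring. }
  apply injective_projections.
  - eapply is_lim_eq; [|exact S1|exact (is_lim_seq_plus' _ _ _ _ A1 B1)]. intro K. cbv beta. now rewrite energy.
  - eapply is_lim_eq; [|exact S2|exact (is_lim_seq_plus' _ _ _ _ A2 B2)]. intro K. cbv beta. now rewrite energy.
Qed.

Lemma l1_bound_scal a X c : l1_bound a X -> l1_bound (fun n => Cmult c (a n)) (Cmod c * X).
Proof.
  intros H. eapply sum_bound_le; [|apply (sum_bound_scal _ (Cmod c) _ (Cmod_ge_0 c) H)].
  intro n. unfold cmod_seq. rewrite Cmod_mult. apply Rle_refl.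
Qed.

Lemma synth_scal a X c x : l1_bound a X -> synth (fun n => Cmult c (a n)) x = Cmult c (synth a x).
Proof.
  intros H. destruct (synth_lim _ _ x H) as [A1 A2]. destruct (synth_lim _ _ x (l1_bound_scal _ _ c H)) as [S1 S2].
  assert (energy : forall K, trig K (fun n => Cmult c (a n)) x = Cmult c (trig K a x)).
  { intro K. unfold trig. rewrite <- czsum_mult_l. apply czsum_ext. intro; ring. }
  apply injective_projections.
  - eapply is_lim_eq; [|exact S1|exact (is_lim_seq_minus' _ _ _ _ (is_lim_seq_scal_l _ (fst c) _ A1) (is_lim_seq_scal_l _ (snd c) _ A2))].
    intro K. cbv beta. rewrite energy. reflexivity.
  - eapply is_lim_eq; [|exact S2|exact (is_lim_seq_plus' _ _ _ _ (is_lim_seq_scal_l _ (fst c) _ A2) (is_lim_seq_scal_l _ (snd c) _ A1))].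
    intro K. cbv beta. rewrite energy. simpl. ring.
Qed.

Lemma synth_cont2 (c : R -> Z -> C) t d0 A x : (forall n, ccont_at (fun s => c s n) t) -> 0 < d0 ->
  (forall s, Rabs (s - t) < d0 -> decay2 (c s) A) -> cont2 (fun s y => synth (c s) y) t x.
Proof.
  intros Hc Hd0 HY. apply cont2_eps. intros eps He.
  assert (HYt : decay2 (c t) A) by (apply HY; rewrite Rminus_diag, Rabs_R0; exact Hd0).
  destruct (l1norm_small_cont c t d0 A Hc Hd0 HY (eps / 2)) as [d1 [Hd1 [Hle Q1]]]; [lra|].
  pose proof (proj1 (ccont_ccont_at _) (ccont_synth _ _ (decay2_l1_bound _ _ HYt)) x) as Cx.
  destruct (proj2 (ccont_at_eps _ _) Cx (eps / 2)) as [d2 [Hd2 Q2]]; [lra|].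
  exists (Rmin d1 d2). split; [now apply Rmin_glb_lt|]. intros s y Hs Hy.
  pose proof (Rmin_l d1 d2). pose proof (Rmin_r d1 d2).
  specialize (Q1 s ltac:(lra)). specialize (Q2 y ltac:(lra)).
  pose proof (HY s ltac:(lra)) as HYs.
  replace (Cminus (synth (c s) y) (synth (c t) x)) with (Cplus (synth (seq_sub (c s) (c t)) y) (Cminus (synth (c t) y) (synth (c t) x))).
  - eapply Rle_lt_trans; [apply Cmod_triangle|].
    pose proof (synth_bound _ _ y (l1_bound_sub _ _ _ _ (decay2_l1_bound _ _ HYs) (decay2_l1_bound _ _ HYt))). lra.
  - rewrite (synth_minus _ _ _ _ y (decay2_l1_bound _ _ HYs) (decay2_l1_bound _ _ HYt)). ring.
Qed.

(** H^6 bounds W^3 |a|: two powers of W pay for any multiplier up to third order, and the last one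
    is the decay asked of the result. *)
Lemma hs_bound_decay2_mulc m a B c : 0 <= c -> (forall n, Cmod (m n) <= c * W n ^ 2) -> hs_bound 6 a B -> decay2 (mulc m a) (c * sqrt B).
Proof.
  intros Hc Hm H n. pose proof (hs_bound_sup _ _ _ n H) as Q. pose proof (W_pos n) as PW.
  rewrite Hs_weight_W in Q. replace 6 with (INR 6) in Q by (simpl; ring). rewrite Rpower_pow in Q by exact PW.
  assert (Q2 : W n ^ 3 * Cmod (a n) <= sqrt B).
  { apply Rsqr_incr_0_var; [|apply sqrt_pos]. rewrite Rsqr_sqrt by (eapply hs_bound_ge0, H).
    unfold Rsqr. replace (W n ^ 3 * Cmod (a n) * (W n ^ 3 * Cmod (a n))) with (W n ^ 6 * Cmod (a n) ^ 2) by ring. exact Q. }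
  unfold mulc. rewrite Cmod_mult. specialize (Hm n). pose proof (Cmod_ge_0 (a n)).
  apply Rle_trans with (c * W n ^ 2 * Cmod (a n) * W n).
  - apply Rmult_le_compat_r; [lra|]. apply Rmult_le_compat_r; lra.
  - replace (c * W n ^ 2 * Cmod (a n) * W n) with (c * (W n ^ 3 * Cmod (a n))) by ring.
    apply Rmult_le_compat_l; lra.
Qed.

Lemma Cmod_in_symbol n : Cmod (in_symbol n) = Rabs (IZR n).
Proof.
  unfold in_symbol, Cmod; simpl. rewrite Rmult_0_l, Rplus_0_l, Rmult_1_r. apply sqrt_Rsqr_abs.
Qed.

Lemma abs_le_W n : Rabs (IZR n) <= W n.
Proof.
  unfold W. rewrite <- pow2_abs. pose proof (Rabs_pos (IZR n)). pose proof (pow2_ge_0 (Rabs (IZR n) - 1)). nra.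
Qed.

Lemma abs_sq_le_W n : Rabs (IZR n) * Rabs (IZR n) <= W n.
Proof. unfold W. rewrite <- (pow2_abs (IZR n)). lra. Qed.

Lemma W_sq_ge n : 1 <= W n /\ W n <= W n ^ 2.
Proof. pose proof (W_ge1 n). split; [exact H|]. nra. Qed.

Lemma mi1_bound n : Cmod (in_symbol n) <= 1 * W n ^ 2.
Proof. rewrite Cmod_in_symbol. pose proof (abs_le_W n). pose proof (W_sq_ge n). lra. Qed.

Lemma mi2_bound n : Cmod (Cmult (in_symbol n) (in_symbol n)) <= 1 * W n ^ 2.
Proof. rewrite Cmod_mult, Cmod_in_symbol. pose proof (abs_sq_le_W n). pose proof (W_sq_ge n). lra. Qed.

Lemma mi3_bound n : Cmod (Cmult (in_symbol n) (Cmult (in_symbol n) (in_symbol n))) <= 1 * W n ^ 2.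
Proof.
  rewrite !Cmod_mult, Cmod_in_symbol. pose proof (abs_sq_le_W n). pose proof (abs_le_W n). pose proof (W_ge1 n).
  pose proof (Rabs_pos (IZR n)).
  apply Rle_trans with (W n * W n); [|right; ring]. apply Rmult_le_compat; try lra. nra.
Qed.

Section Equation.
Variables (gamma omega : R) (beta : C) (L : R).
Local Notation lam := (symbol gamma beta L).
Local Notation rhs := (vfield gamma omega beta L).
Local Notation seq_eq := (seq_eq gamma omega beta L).

Lemma lam_alt n : lam n = Cplus (Cplus (Cmult (1, gamma) (Cmult (in_symbol n) (in_symbol n))) beta) (Cmult (RtoC L) (Cmult (in_symbol n) (Cmult (in_symbol n) (in_symbol n)))).
Proof. destruct beta. unfold symbol, in_symbol, RtoC, Cmult, Cplus; simpl. f_equal; ring. Qed.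

Definition symbol_cst : R := Cmod (1, gamma) + Cmod beta + Cmod (RtoC L).

Lemma lam_bound n : Cmod (lam n) <= symbol_cst * W n ^ 2.
Proof.
  rewrite lam_alt. eapply Rle_trans; [apply Cmod_triangle|].
  pose proof (Cmod_triangle (Cmult (1, gamma) (Cmult (in_symbol n) (in_symbol n))) beta) as Q.
  rewrite (Cmod_mult (1, gamma)) in Q. rewrite (Cmod_mult (RtoC L)).
  pose proof (mi2_bound n). pose proof (mi3_bound n). pose proof (W_sq_ge n).
  pose proof (Cmod_ge_0 (1, gamma)) as P1. pose proof (Cmod_ge_0 beta) as P2. pose proof (Cmod_ge_0 (RtoC L)) as P3.
  unfold symbol_cst.
  assert (Cmod (1, gamma) * Cmod (Cmult (in_symbol n) (in_symbol n)) <= Cmod (1, gamma) * W n ^ 2) by (apply Rmult_le_compat_l; lra).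
  assert (Cmod (RtoC L) * Cmod (Cmult (in_symbol n) (Cmult (in_symbol n) (in_symbol n))) <= Cmod (RtoC L) * W n ^ 2) by (apply Rmult_le_compat_l; lra).
  assert (Cmod beta * 1 <= Cmod beta * W n ^ 2) by (apply Rmult_le_compat_l; lra).
  lra.
Qed.

Lemma symbol_cst_ge0 : 0 <= symbol_cst.
Proof. unfold symbol_cst. pose proof (Cmod_ge_0 (1, gamma)). pose proof (Cmod_ge_0 beta). pose proof (Cmod_ge_0 (RtoC L)). lra. Qed.

Lemma rhs_Y a B : hs_bound 6 a B -> decay2 (rhs a) (symbol_cst * sqrt B + omega_bd omega * (400 * sqrt B ^ 3)).
Proof.
  intros H n. unfold vfield, Cminus.
  assert (HY : decay2 a (sqrt B)) by (apply hs_bound_decay2; apply hs_bound_le with 6; [lra|exact H]).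
  pose proof (hs_bound_decay2_mulc lam a B symbol_cst symbol_cst_ge0 lam_bound H n) as Q1. unfold mulc in Q1.
  pose proof (cubic_coef_Y _ _ HY n) as Q2. pose proof (W_pos n).
  assert (Q3 : Cmod (Cmult (1, omega) (cubic_coef a n)) * W n <= omega_bd omega * (400 * sqrt B ^ 3)).
  { rewrite Cmod_mult, Rmult_assoc. apply Rmult_le_compat; [apply Cmod_ge_0| |apply Cmod_1omega|exact Q2].
    apply Rmult_le_pos; [apply Cmod_ge_0|lra]. }
  eapply Rle_trans; [apply Rmult_le_compat_r; [lra|apply Cmod_triangle]|]. rewrite Cmod_opp. lra.
Qed.

(** The cubic of the series is again periodic and differentiable with summable coefficients, so
    inversion applies to it directly; no convolution of infinite sums is needed. *)
Lemma synth_cubic_coef a A x : decay2 a A -> l1_bound (mulc in_symbol a) A -> synth (cubic_coef a) x = cubic (synth a x).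
Proof.
  intros H H1. pose proof (decay2_l1_bound _ _ H) as HL. pose proof (ccont_synth _ _ HL) as Hc.
  change (cubic_coef a) with (fcoef (fun x => cubic (synth a x))).
  apply (synth_inversion (fun x => cubic (synth a x)) (400 * A ^ 3 * 5)).
  - auto with contdb.
  - intro y. now rewrite (synth_periodic a _ HL).
  - apply decay2_l1_bound. exact (cubic_coef_Y a A H).
  - intro y. pose proof (synth_cderive a _ _ y HL H1) as D.
    pose proof (cderive_mult _ _ _ _ _ D (cderive_mult _ _ _ _ _ (cderive_conj _ _ _ D) D)) as [D1 D2].
    split.
    + eexists. eapply is_derive_ext; [|exact D1]. intro z. now rewrite cubic_alt.
    + eexists. eapply is_derive_ext; [|exact D2]. intro z. now rewrite cubic_alt.
Qed.

Lemma ccont_at_scal c f t : ccont_at f t -> ccont_at (fun s => Cmult c (f s)) t.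
Proof.
  intros H. apply ccont_at_eps. intros eps He. pose proof (Cmod_ge_0 c).
  destruct (proj2 (ccont_at_eps _ _) H (eps / (Cmod c + 1))) as [d [Hd Q]]; [apply Rdiv_lt_0_compat; lra|].
  exists d. split; [exact Hd|]. intros s Hs. specialize (Q s Hs).
  replace (Cminus (Cmult c (f s)) (Cmult c (f t))) with (Cmult c (Cminus (f s) (f t))) by ring.
  rewrite Cmod_mult. pose proof (Cmod_ge_0 (Cminus (f s) (f t))).
  apply (Rmult_lt_compat_l (Cmod c + 1)) in Q; [|lra].
  replace ((Cmod c + 1) * (eps / (Cmod c + 1))) with eps in Q by (field; lra). nra.
Qed.

Lemma ccont_at_minus f g t : ccont_at f t -> ccont_at g t -> ccont_at (fun s => Cminus (f s) (g s)) t.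
Proof.
  intros [A1 A2] [B1 B2]. split.
  - exact (continuous_minus (fun s => fst (f s)) (fun s => fst (g s)) t A1 B1).
  - exact (continuous_minus (fun s => snd (f s)) (fun s => snd (g s)) t A2 B2).
Qed.

Lemma rhs_ccont_at (a : R -> Z -> C) t d0 A n : (forall n, ccont_at (fun s => a s n) t) -> 0 < d0 ->
  (forall s, Rabs (s - t) < d0 -> decay2 (a s) A) -> ccont_at (fun s => rhs (a s) n) t.
Proof.
  intros H Hd HY. unfold vfield. apply ccont_at_minus; apply ccont_at_scal; [apply H|]. eapply cubic_coef_cont; eauto.
Qed.

(** Every derivative is the series of a multiplied sequence, and the time derivative that of the
    right-hand side. Local H^6 bounds give each of them a [decay2] bound near t, which with
    continuity of the coefficients yields joint continuity in t and x. *)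
Lemma sequence_classical (a : R -> Z -> C) :
  (forall t0 T, 0 < t0 -> seq_eq a t0 T /\ smooth_on a t0 T) ->
  classical_solution gamma omega beta L (fun t x => synth (a t) x).
Proof.
  intros H.
  set (m2 := fun n => Cmult (in_symbol n) (in_symbol n)). set (m3 := fun n => Cmult (in_symbol n) (Cmult (in_symbol n) (in_symbol n))).
  assert (Loc : forall t, 0 < t -> exists B, forall s, Rabs (s - t) < t / 2 -> hs_bound 6 (a s) B).
  { intros t Ht. destruct (H (t / 2) (2 * t)) as [_ HS]; [lra|]. destruct (HS 6) as [B HB]; [lra|].
    exists B. intros s Hs. apply Rabs_lt_between in Hs. apply HB. lra. }
  assert (Hcc : forall t n, 0 < t -> ccont_at (fun s => a s n) t).
  { intros t n Ht. destruct (H t t Ht) as [He _]. eapply cderive_ccont_at, He. lra. }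
  assert (Y1 : forall m, (forall n, Cmod (m n) <= 1 * W n ^ 2) -> forall t, 0 < t -> exists A, forall s, Rabs (s - t) < t / 2 -> decay2 (mulc m (a s)) A).
  { intros m Hm t Ht. destruct (Loc t Ht) as [B HB]. exists (1 * sqrt B). intros s Hs.
    apply hs_bound_decay2_mulc; [lra|exact Hm|now apply HB]. }
  assert (Self : forall t, 0 < t -> Rabs (t - t) < t / 2) by (intros; rewrite Rminus_diag, Rabs_R0; lra).
  assert (Cm : forall m, (forall n, Cmod (m n) <= 1 * W n ^ 2) -> forall t x, 0 < t -> cont2 (fun s y => synth (mulc m (a s)) y) t x).
  { intros m Hm t x Ht. destruct (Y1 m Hm t Ht) as [A HA].
    apply (synth_cont2 (fun s => mulc m (a s)) t (t / 2) A x); [|lra|exact HA].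
    intro n. apply ccont_at_scal. now apply Hcc. }
  assert (L1m : forall m, (forall n, Cmod (m n) <= 1 * W n ^ 2) -> forall t, 0 < t -> exists X, l1_bound (mulc m (a t)) X).
  { intros m Hm t Ht. destruct (Y1 m Hm t Ht) as [A HA]. eexists. apply decay2_l1_bound, HA, Self, Ht. }
  assert (L1a : forall t, 0 < t -> exists X, l1_bound (a t) X).
  { intros t Ht. destruct (Loc t Ht) as [B HB]. eexists. apply decay2_l1_bound, hs_bound_decay2.
    apply hs_bound_le with 6; [lra|]. apply HB, Self, Ht. }
  (* The multiplier 1 lets u itself be treated like its derivatives. *)
  assert (Ea : forall s, mulc (fun _ => RtoC 1) (a s) = a s).
  { intro s. apply functional_extensionality. intro n. unfold mulc. ring. }
  assert (B1 : forall n : Z, Cmod (RtoC 1) <= 1 * W n ^ 2).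
  { intro n. rewrite Cmod_1. pose proof (W_sq_ge n). lra. }
  assert (E12 : forall s, mulc in_symbol (mulc in_symbol (a s)) = mulc m2 (a s)).
  { intro s. apply functional_extensionality. intro n. unfold mulc, m2. ring. }
  assert (E23 : forall s, mulc in_symbol (mulc m2 (a s)) = mulc m3 (a s)).
  { intro s. apply functional_extensionality. intro n. unfold mulc, m2, m3. ring. }
  assert (Yr : forall t, 0 < t -> exists A, forall s, Rabs (s - t) < t / 2 -> decay2 (rhs (a s)) A).
  { intros t Ht. destruct (Loc t Ht) as [B HB]. eexists. intros s Hs. apply rhs_Y, HB, Hs. }
  assert (Cr : forall t n, 0 < t -> ccont_at (fun s => rhs (a s) n) t).
  { intros t n Ht. destruct (Loc t Ht) as [B HB].
    apply (rhs_ccont_at a t (t / 2) (sqrt B) n); [intro; now apply Hcc|lra|].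
    intros s Hs. apply hs_bound_decay2. apply hs_bound_le with 6; [lra|]. now apply HB. }
  exists (fun t x => synth (rhs (a t)) x), (fun t x => synth (mulc in_symbol (a t)) x), (fun t x => synth (mulc m2 (a t)) x), (fun t x => synth (mulc m3 (a t)) x).
  intros t x Ht.
  destruct (L1a t Ht) as [X0 HX0]. destruct (L1m in_symbol mi1_bound t Ht) as [X1 HX1].
  destruct (L1m m2 mi2_bound t Ht) as [X2 HX2]. destruct (L1m m3 mi3_bound t Ht) as [X3 HX3].
  destruct (Yr t Ht) as [Ar HAr].
  assert (Cu : cont2 (fun s y => synth (a s) y) t x).
  { pose proof (Cm (fun _ => RtoC 1) B1 t x Ht) as Q.
    assert (Eu : (fun s y => synth (mulc (fun _ => RtoC 1) (a s)) y) = (fun s y => synth (a s) y)).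
    { apply functional_extensionality. intro s. now rewrite Ea. }
    rewrite Eu in Q. exact Q. }
  assert (Cut : cont2 (fun s y => synth (rhs (a s)) y) t x).
  { apply (synth_cont2 (fun s => rhs (a s)) t (t / 2) Ar x); [intro; now apply Cr|lra|exact HAr]. }
  split; [exact (synth_periodic _ _ HX0 x)|].
  split.
  { apply cderive_is_derive.
    apply (cderive_unif_limit (fun K s => trig K (a s) x) (fun K s => trig K (rhs (a s)) x)
      (fun s => synth (a s) x) (fun s => synth (rhs (a s)) x) t (t / 2) (fun K => (2 * Ar) * W_tail K)).
    - lra.
    - intros K s Hs. apply Rabs_lt_between in Hs. unfold trig.
      apply (cderive_czsum K (fun n s => Cmult (a s n) (expi n x))). intro n.
      replace (Cmult (rhs (a s) n) (expi n x)) with (Cplus (Cmult (rhs (a s) n) (expi n x)) (Cmult (a s n) (RtoC 0))) by ring.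
      apply (cderive_mult (fun s => a s n) (fun _ => expi n x)); [|apply cderive_const].
      destruct (H s s ltac:(lra)) as [He _]. apply He. lra.
    - intros s Hs. apply Rabs_lt_between in Hs. destruct (L1a s ltac:(lra)) as [Xs HXs]. eapply synth_lim, HXs.
    - intros K s Hs. replace (Cminus (trig K (rhs (a s)) x) (synth (rhs (a s)) x)) with (Copp (Cminus (synth (rhs (a s)) x) (trig K (rhs (a s)) x))) by ring.
      rewrite Cmod_opp. eapply Rle_trans; [eapply synth_tail, decay2_l1_bound, HAr, Hs|].
      pose proof (l1_tail_Y _ _ K (HAr s Hs)). lra.
    - apply is_lim_seq_scal0, W_tail_lim.
    - destruct Cut as [C1 C2]. split; apply continuous_eps; intros eps He.
      + destruct (C1 (mkposreal eps He)) as [[d Hd] Q]. exists d. split; [exact Hd|]. intros s Hs.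
        apply (Q s x Hs). rewrite Rminus_diag, Rabs_R0. exact Hd.
      + destruct (C2 (mkposreal eps He)) as [[d Hd] Q]. exists d. split; [exact Hd|]. intros s Hs.
        apply (Q s x Hs). rewrite Rminus_diag, Rabs_R0. exact Hd. }
  split; [apply cderive_is_derive; exact (synth_cderive _ _ _ x HX0 HX1)|].
  split.
  { apply cderive_is_derive. rewrite <- (E12 t). apply (synth_cderive _ X1 X2 x HX1). rewrite E12. exact HX2. }
  split.
  { apply cderive_is_derive. rewrite <- (E23 t). apply (synth_cderive _ X2 X3 x HX2). rewrite E23. exact HX3. }
  split; [exact (cont2_continuous _ _ _ Cu)|].
  split; [exact (cont2_continuous _ _ _ Cut)|].
  split; [exact (cont2_continuous _ _ _ (Cm in_symbol mi1_bound t x Ht))|].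
  split; [exact (cont2_continuous _ _ _ (Cm m2 mi2_bound t x Ht))|].
  split; [exact (cont2_continuous _ _ _ (Cm m3 mi3_bound t x Ht))|].
  destruct (Loc t Ht) as [B HB]. pose proof (HB t (Self t Ht)) as HBt.
  assert (HYt : decay2 (a t) (sqrt B)) by (apply hs_bound_decay2; apply hs_bound_le with 6; [lra|exact HBt]).
  assert (HN : l1_bound (cubic_coef (a t)) (400 * sqrt B ^ 3 * 5)) by (apply decay2_l1_bound, cubic_coef_Y, HYt).
  assert (Er : rhs (a t) = (fun n => Cplus (Cplus (Cplus (Cmult (1, gamma) (mulc m2 (a t) n)) (Cmult beta (a t n)))
       (Cmult (Copp (1, omega)) (cubic_coef (a t) n))) (Cmult (RtoC L) (mulc m3 (a t) n)))).
  { apply functional_extensionality. intro n. unfold vfield. rewrite lam_alt. unfold mulc, m2, m3. ring. }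
  assert (Lp : forall p q X Y, l1_bound p X -> l1_bound q Y -> l1_bound (fun n => Cplus (p n) (q n)) (X + Y)).
  { intros p q X Y Hp Hq. eapply sum_bound_le; [|apply (sum_bound_plus _ _ _ _ Hp Hq)]. intro n. apply Cmod_triangle. }
  rewrite Er.
  pose proof (l1_bound_scal _ _ (1, gamma) HX2) as S2. pose proof (l1_bound_scal _ _ beta HX0) as S0.
  pose proof (l1_bound_scal _ _ (Copp (1, omega)) HN) as SN. pose proof (l1_bound_scal _ _ (RtoC L) HX3) as S3.
  rewrite (synth_add _ _ _ _ x (Lp _ _ _ _ (Lp _ _ _ _ S2 S0) SN) S3).
  rewrite (synth_add _ _ _ _ x (Lp _ _ _ _ S2 S0) SN), (synth_add _ _ _ _ x S2 S0).
  rewrite (synth_scal _ _ (1, gamma) x HX2), (synth_scal _ _ beta x HX0), (synth_scal _ _ (Copp (1, omega)) x HN), (synth_scal _ _ (RtoC L) x HX3).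
  assert (EN : synth (cubic_coef (a t)) x = cubic (synth (a t) x)).
  { set (A := Rmax (sqrt B) X1).
    apply (synth_cubic_coef (a t) A).
    - intro n. eapply Rle_trans; [apply HYt|apply Rmax_l].
    - eapply sum_bound_weaken; [exact HX1|apply Rmax_r]. }
  rewrite EN. unfold cubic. ring.
Qed.

End Equation.

(** * Solutions with data in H *)

Lemma in_Hs_hs_bound s v : in_Hs s v -> hs_bound s v (energy s v).
Proof. intros H. apply ex_series_sum_bound; [apply nonneg_Hs|exact H]. Qed.

Lemma hs_bound_in_Hs s v B : hs_bound s v B -> in_Hs s v.
Proof. intros H. eapply sum_bound_ex_series; [apply nonneg_Hs|exact H]. Qed.

Lemma Hs_norm_sq s v B : hs_bound s v B -> Hs_norm s v * Hs_norm s v = energy s v.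
Proof. intros H. apply sqrt_sqrt. eapply energy_ge0, H. Qed.

Lemma Hs_norm_ge0 s v : 0 <= Hs_norm s v.
Proof. apply sqrt_pos. Qed.

Lemma Hs_norm_le s v B c : hs_bound s v B -> 0 <= c -> energy s v <= c * c -> Hs_norm s v <= c.
Proof.
  intros H Hc HE. rewrite <- (sqrt_square c Hc). apply sqrt_le_1_alt. exact HE.
Qed.

Lemma Hs_norm_energy_le s v B c : hs_bound s v B -> Hs_norm s v <= c -> energy s v <= c * c.
Proof.
  intros H Hc. rewrite <- (Hs_norm_sq s v B H). pose proof (Hs_norm_ge0 s v). nra.
Qed.

Lemma Hs_norm_mono s s' v B : s <= s' -> hs_bound s' v B -> Hs_norm s v <= Hs_norm s' v.
Proof. intros Hs H. apply sqrt_le_1_alt. eapply energy_mono; eauto. Qed.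

(** Domination of z in place of an equation covers sums, differences and chains of differences at
    once. *)
Lemma Hs_triangle s (x y z : Z -> C) :
  (forall n, Cmod (z n) <= Cmod (x n) + Cmod (y n)) -> in_Hs s x -> in_Hs s y ->
  in_Hs s z /\ Hs_norm s z <= Hs_norm s x + Hs_norm s y.
Proof.
  intros H Hx Hy. apply in_Hs_hs_bound in Hx. apply in_Hs_hs_bound in Hy.
  set (p := Hs_norm s x). set (q := Hs_norm s y).
  assert (p0 : 0 <= p) by apply Hs_norm_ge0. assert (q0 : 0 <= q) by apply Hs_norm_ge0.
  assert (Q : hs_bound s z ((p + q) * (p + q))).
  { intro K.
    set (h := fun n => Rpower (W n) (s / 2)).
    assert (Hh : forall n, 0 < h n) by (intro; apply exp_pos).
    assert (Hh2 : forall n, h n * h n = Hs_weight s n).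
    { intro n. rewrite Hs_weight_W. apply Rpower_half_sq, W_pos. }
    set (cross := zsum K (fun n => (h n * Cmod (x n)) * (h n * Cmod (y n)))).
    assert (I1 : zsum K (Hs_terms s z) <= zsum K (Hs_terms s x) + zsum K (Hs_terms s y) + 2 * cross).
    { unfold cross. rewrite <- zsum_scal, <- !zsum_plus. apply zsum_le. intro n. unfold Hs_terms.
      specialize (H n). pose proof (Cmod_ge_0 (z n)). rewrite <- Hh2.
      assert (Cmod (z n) ^ 2 <= (Cmod (x n) + Cmod (y n)) ^ 2) by (apply pow_incr; lra).
      assert (0 <= h n * h n) by (pose proof (Hh n); nra).
      apply Rle_trans with (h n * h n * (Cmod (x n) + Cmod (y n)) ^ 2); [apply Rmult_le_compat_l; assumption|]. right; ring. }
    assert (I2 : cross <= p * q).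
    { apply Rsqr_incr_0_var; [|nra]. eapply Rle_trans; [apply zsum_CS|].
      rewrite Rsqr_mult. apply Rmult_le_compat; try (apply zsum_nonneg; intro; apply Rle_0_sqr).
      - unfold Rsqr at 2. unfold p. rewrite (Hs_norm_sq s x _ Hx). eapply Rle_trans; [|apply (Hx K)].
        right. apply zsum_ext. intro n. unfold Hs_terms. rewrite <- Hh2. unfold Rsqr. ring.
      - unfold Rsqr at 2. unfold q. rewrite (Hs_norm_sq s y _ Hy). eapply Rle_trans; [|apply (Hy K)].
        right. apply zsum_ext. intro n. unfold Hs_terms. rewrite <- Hh2. unfold Rsqr. ring. }
    pose proof (Hx K) as X1. pose proof (Hy K) as Y1.
    rewrite <- (Hs_norm_sq s x _ Hx) in X1. rewrite <- (Hs_norm_sq s y _ Hy) in Y1.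
    fold p in X1. fold q in Y1. nra. }
  split; [eapply hs_bound_in_Hs, Q|]. eapply Hs_norm_le; [exact Q|lra|]. eapply energy_le, Q.
Qed.

Lemma Cmod_sub_triangle a b c : Cmod (Cminus a c) <= Cmod (Cminus a b) + Cmod (Cminus b c).
Proof.
  replace (Cminus a c) with (Cplus (Cminus a b) (Cminus b c)) by ring. apply Cmod_triangle.
Qed.

Lemma Hs_sub_triangle s a b c : in_Hs s (seq_sub a b) -> in_Hs s (seq_sub b c) ->
  in_Hs s (seq_sub a c) /\ Hs_norm s (seq_sub a c) <= Hs_norm s (seq_sub a b) + Hs_norm s (seq_sub b c).
Proof. intros. apply Hs_triangle; auto. intro n. apply Cmod_sub_triangle. Qed.

Lemma Hs_of_sub s a b : in_Hs s (seq_sub a b) -> in_Hs s b ->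
  in_Hs s a /\ Hs_norm s a <= Hs_norm s (seq_sub a b) + Hs_norm s b.
Proof.
  intros. apply Hs_triangle; auto. intro n. unfold seq_sub.
  replace (a n) with (Cplus (Cminus (a n) (b n)) (b n)) at 1 by ring. apply Cmod_triangle.
Qed.

Lemma Hs_sub s a b : in_Hs s a -> in_Hs s b -> in_Hs s (seq_sub a b).
Proof.
  intros Ha Hb. eapply hs_bound_in_Hs, hs_bound_sub; apply in_Hs_hs_bound; assumption.
Qed.

Lemma Hs_sub_sym s a b : in_Hs s (seq_sub a b) ->
  in_Hs s (seq_sub b a) /\ Hs_norm s (seq_sub b a) = Hs_norm s (seq_sub a b).
Proof.
  intros H. assert (E1 : Hs_terms s (seq_sub b a) = Hs_terms s (seq_sub a b)).
  { apply functional_extensionality. intro n. unfold Hs_terms, seq_sub.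
    replace (Cminus (b n) (a n)) with (Copp (Cminus (a n) (b n))) by ring. now rewrite Cmod_opp. }
  unfold in_Hs, Hs_norm. rewrite E1. split; [exact H|reflexivity].
Qed.

Lemma Hs_self s a : in_Hs s (seq_sub a a) /\ Hs_norm s (seq_sub a a) = 0.
Proof.
  assert (Q : hs_bound s (seq_sub a a) 0).
  { intro K. rewrite (zsum_ext K _ (fun _ => 0)), zsum_zero; [lra|]. intro n. unfold Hs_terms, seq_sub.
    replace (Cminus (a n) (a n)) with (RtoC 0) by ring. rewrite Cmod_0. ring. }
  split; [eapply hs_bound_in_Hs, Q|]. apply Rle_antisym; [|apply Hs_norm_ge0].
  eapply Hs_norm_le; [exact Q|lra|]. rewrite Rmult_0_l. eapply energy_le, Q.
Qed.

Lemma coef_le_norm s v n : 0 <= s -> in_Hs s v -> Cmod (v n) <= Hs_norm s v.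
Proof.
  intros Hs H. apply in_Hs_hs_bound in H.
  assert (H0 : hs_bound 0 v (energy s v)) by (apply hs_bound_le with s; [exact Hs|exact H]).
  apply Rle_trans with (Hs_norm 0 v); [|eapply Hs_norm_mono; eauto].
  apply Rsqr_incr_0_var; [|apply Hs_norm_ge0]. unfold Rsqr. rewrite (Hs_norm_sq 0 v _ H0).
  pose proof (sum_bound_term _ _ n (nonneg_Hs 0 v) (hs_bound_energy _ _ _ H0)) as Q. rewrite Hs_terms_0 in Q.
  unfold cmod_seq in Q. simpl in Q. lra.
Qed.

(** Modes with eta W >= 1 are paid for by the higher norm; in the others W^s <= eta^(-s). This
    upgrades smallness in H to smallness in H^s under an H^(s+1) bound. *)
Lemma energy_interp_eps s v B eta : 0 <= s -> 0 < eta -> hs_bound (s + 1) v B ->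
  energy s v <= eta * energy (s + 1) v + Rpower eta (- s) * energy 0 v.
Proof.
  intros Hs He H. assert (H0 : hs_bound 0 v B) by (apply hs_bound_le with (2 := H); lra).
  apply energy_le with (B := eta * energy (s + 1) v + Rpower eta (- s) * energy 0 v). intro K.
  apply Rle_trans with (eta * zsum K (Hs_terms (s + 1) v) + Rpower eta (- s) * zsum K (Hs_terms 0 v)).
  - rewrite <- !zsum_scal, <- zsum_plus. apply zsum_le. intro n. rewrite Hs_terms_S, Hs_terms_0. unfold Hs_terms, cmod_seq.
    assert (Q : Hs_weight s n <= eta * (W n * Hs_weight s n) + Rpower eta (- s)).
    { rewrite Hs_weight_W. pose proof (W_pos n) as PW.
      assert (P1 : 0 < Rpower (W n) s) by apply exp_pos. assert (P2 : 0 < Rpower eta (- s)) by apply exp_pos.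
      destruct (Rle_dec 1 (eta * W n)) as [Q|Q]; [nra|].
      assert (Rpower (W n) s <= Rpower eta (- s)).
      { rewrite Rpower_Ropp. apply Rmult_le_reg_r with (Rpower eta s); [apply exp_pos|].
        rewrite Rinv_l by (apply Rgt_not_eq, exp_pos). rewrite Rpower_mult_distr by lra.
        apply Rle_trans with (Rpower 1 s); [|unfold Rpower; rewrite ln_1, Rmult_0_r, exp_0; lra].
        rewrite (Rmult_comm (W n)). apply Rle_Rpower_l; [exact Hs|]. split; nra. }
      assert (0 <= eta * (W n * Rpower (W n) s)) by (apply Rmult_le_pos; [lra|apply Rmult_le_pos; lra]). lra. }
    pose proof (pow2_ge_0 (Cmod (v n))) as P2. apply (Rmult_le_compat_r _ _ _ P2) in Q. lra.
  - apply Rplus_le_compat; apply Rmult_le_compat_l.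
    + lra.
    + eapply hs_bound_energy, H.
    + left; apply exp_pos.
    + eapply hs_bound_energy, H0.
Qed.

(** The low modes of v are close to those of u, and its total energy exceeds that of u by at most
    eta, so little is left for the high modes. It serves near t = 0, where no H^(s+1) bound is
    available for interpolation. *)
Lemma radon_riesz s u eps : 0 < eps -> in_Hs s u ->
  exists eta M, 0 < eta /\ forall v, in_Hs s v ->
    (forall n, (Z.abs n <= Z.of_nat M)%Z -> Cmod (Cminus (v n) (u n)) <= eta) ->
    energy s v <= energy s u + eta -> energy s (seq_sub v u) <= eps.
Proof.
  intros He Hu. apply in_Hs_hs_bound in Hu.
  assert (Lt : is_lim_seq (fun M => energy s u - zsum M (Hs_terms s u)) 0).
  { replace (Finite 0) with (Finite (energy s u - energy s u)) by (f_equal; ring).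
    apply is_lim_seq_minus'; [apply is_lim_seq_const|eapply energy_lim, Hu]. }
  destruct (is_lim_seq_0_eps _ (eps / 8) Lt) as [M HM]; [lra|].
  specialize (HM M (le_n _)). apply Rabs_lt_between in HM.
  set (S1 := zsum M (Hs_weight s)). set (S2 := zsum M (fun n => Hs_weight s n * Cmod (u n))).
  assert (HS1 : 0 <= S1) by (apply zsum_nonneg; intro; left; apply Hs_weight_pos).
  assert (HS2 : 0 <= S2).
  { apply zsum_nonneg; intro; apply Rmult_le_pos; [left; apply Hs_weight_pos|apply Cmod_ge_0]. }
  (* In the final count the terms in eta sum to eta (S1 + 2 + 4 S2) = eta q / 2 <= eps / 2; the tail
     of u, counted four times at eps / 8, gives the other half. *)
  set (q := 2 * (S1 + 2 + 4 * S2)). assert (Hq : 0 < q) by (unfold q; lra).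
  exists (Rmin 1 (eps / q)), M. assert (Heq : 0 < eps / q) by (apply Rdiv_lt_0_compat; lra).
  split; [apply Rmin_glb_lt; lra|]. set (eta := Rmin 1 (eps / q)).
  assert (eta1 : eta <= 1) by apply Rmin_l. assert (eta2 : eta <= eps / q) by apply Rmin_r.
  assert (eta0 : 0 < eta) by (apply Rmin_glb_lt; lra).
  assert (eta3 : eta * q <= eps).
  { apply (Rmult_le_compat_r q) in eta2; [|lra]. replace (eps / q * q) with eps in eta2 by (field; lra). exact eta2. }
  intros v Hv Hc HE. apply in_Hs_hs_bound in Hv.
  assert (I1 : zsum M (Hs_terms s (seq_sub v u)) <= eta * S1).
  { unfold S1. rewrite <- zsum_scal. apply zsum_le_in. intros n Hn. unfold Hs_terms, seq_sub.
    rewrite Rmult_comm. apply Rmult_le_compat_r; [left; apply Hs_weight_pos|].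
    specialize (Hc n Hn). pose proof (Cmod_ge_0 (Cminus (v n) (u n))). nra. }
  assert (I2 : zsum M (Hs_terms s u) - 2 * eta * S2 <= zsum M (Hs_terms s v)).
  { unfold S2. rewrite <- zsum_scal, <- zsum_minus. apply zsum_le_in. intros n Hn. unfold Hs_terms.
    specialize (Hc n Hn). pose proof (Hs_weight_pos s n).
    assert (T : Cmod (u n) <= Cmod (v n) + eta).
    { pose proof (Cmod_triangle (v n) (Copp (Cminus (v n) (u n)))) as T.
      replace (Cplus (v n) (Copp (Cminus (v n) (u n)))) with (u n) in T by ring. rewrite Cmod_opp in T. lra. }
    assert (Cmod (u n) ^ 2 - 2 * eta * Cmod (u n) <= Cmod (v n) ^ 2).
    { pose proof (Cmod_ge_0 (u n)). pose proof (Cmod_ge_0 (v n)).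
      destruct (Rle_dec (Cmod (u n)) eta); [nra|].
      assert ((Cmod (u n) - eta) ^ 2 <= Cmod (v n) ^ 2) by (apply pow_incr; lra). nra. }
    nra. }
  apply energy_le with (B := eps). intro K0.
  apply Rle_trans with (zsum (M + K0) (Hs_terms s (seq_sub v u))); [apply zsum_mono; [apply nonneg_Hs|lia]|].
  assert (I3 : zsum (M + K0) (Hs_terms s (seq_sub v u)) - zsum M (Hs_terms s (seq_sub v u))
     <= 2 * (zsum (M + K0) (Hs_terms s v) - zsum M (Hs_terms s v)) + 2 * (zsum (M + K0) (Hs_terms s u) - zsum M (Hs_terms s u))).
  { assert (Pt : forall n, Hs_terms s (seq_sub v u) n <= 2 * Hs_terms s v n + 2 * Hs_terms s u n).
    { intro n. unfold Hs_terms, seq_sub. pose proof (Hs_weight_pos s n).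
      assert (T : Cmod (Cminus (v n) (u n)) <= Cmod (v n) + Cmod (u n)).
      { unfold Cminus. rewrite <- (Cmod_opp (u n)). apply Cmod_triangle. }
      pose proof (Cmod_ge_0 (Cminus (v n) (u n))). pose proof (pow2_ge_0 (Cmod (v n) - Cmod (u n))).
      assert (Cmod (Cminus (v n) (u n)) ^ 2 <= 2 * Cmod (v n) ^ 2 + 2 * Cmod (u n) ^ 2) by nra. nra. }
    induction K0 as [|K0 IH]; [rewrite Nat.add_0_r; lra|].
    replace (M + S K0)%nat with (S (M + K0)) by lia. cbn [zsum].
    pose proof (Pt (Z.of_nat (S (M + K0)))). pose proof (Pt (- Z.of_nat (S (M + K0)))%Z). lra. }
  pose proof (Hv (M + K0)%nat) as B1. pose proof (Hu (M + K0)%nat) as B2.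
  unfold q in eta3. nra.
Qed.

(** h = sqrt (P / D) balances the two terms of [l1norm_interp]; 0 < P <= D makes it admissible. *)
Lemma l1norm_small v P D : 0 < P -> P <= D -> hs_bound 1 v D -> energy 0 v <= P -> l1norm v <= sqrt (10 * sqrt (P * D)).
Proof.
  intros HP HPD H HE. set (h := sqrt (P / D)).
  assert (PD : 0 < P / D) by (apply Rdiv_lt_0_compat; lra).
  assert (h0 : 0 < h) by (apply sqrt_lt_R0; exact PD).
  assert (h1 : h <= 1).
  { unfold h. rewrite <- sqrt_1. apply sqrt_le_1_alt. apply Rmult_le_reg_r with D; [lra|].
    unfold Rdiv. rewrite Rmult_assoc, Rinv_l by lra. lra. }
  assert (hh : h * h = P / D) by (apply sqrt_sqrt; lra).
  assert (hD : h * D = sqrt (P * D)).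
  { replace (P * D) with (P / D * (D * D)) by (field; lra).
    rewrite sqrt_mult_alt by lra. rewrite sqrt_square by lra. reflexivity. }
  assert (hP : P / h = sqrt (P * D)).
  { rewrite <- hD. apply Rmult_eq_reg_r with h; [|lra].
    replace (P / h * h) with P by (field; lra). replace (h * D * h) with (h * h * D) by ring. rewrite hh. field. lra. }
  pose proof (l1norm_interp h v D (conj h0 h1) H) as Q.
  apply Rsqr_incr_0_var; [|apply sqrt_pos].
  rewrite Rsqr_sqrt by (apply Rmult_le_pos; [lra|apply sqrt_pos]).
  eapply Rle_trans; [exact Q|].
  assert (5 / h * energy 0 v <= 5 * sqrt (P * D)).
  { rewrite <- hP. replace (5 * (P / h)) with (5 / h * P) by (field; lra).
    apply Rmult_le_compat_l; [left; apply Rdiv_lt_0_compat; lra|exact HE]. }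
  assert (5 * h * energy 1 v <= 5 * sqrt (P * D)).
  { rewrite <- hD. rewrite Rmult_assoc. apply Rmult_le_compat_l; [lra|]. apply Rmult_le_compat_l; [lra|]. eapply energy_le, H. }
  lra.
Qed.

(** * Truncated data and passage to the limit *)

Definition proj (k : nat) (u : Z -> C) : Z -> C :=
  fun n => if Z_le_dec (Z.abs n) (Z.of_nat k) then u n else RtoC 0.

Lemma proj_hs_bound s k u : hs_bound s (proj k u) (zsum k (Hs_terms s u)).
Proof.
  assert (E1 : forall K, (K <= k)%nat -> zsum K (Hs_terms s (proj k u)) = zsum K (Hs_terms s u)).
  { intros K HK. apply zsum_ext_le. intros n Hn. unfold Hs_terms, proj.
    destruct (Z_le_dec _ _); [reflexivity|lia]. }
  intro K. destruct (le_ge_dec K k) as [HK|HK].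
  - rewrite (E1 K HK). apply zsum_mono; [apply nonneg_Hs|exact HK].
  - induction HK as [|K HK IH]; [rewrite E1 by lia; lra|].
    cbn [zsum]. eapply Rle_trans; [|exact IH]. right.
    assert (Z0 : forall n, (Z.of_nat k < Z.abs n)%Z -> Hs_terms s (proj k u) n = 0).
    { intros n Hn. unfold Hs_terms, proj. destruct (Z_le_dec _ _); [lia|]. rewrite Cmod_0. ring. }
    rewrite !Z0 by lia. ring.
Qed.

Lemma proj_tail k j u B : hs_bound 0 u B -> (k <= j)%nat ->
  hs_bound 0 (seq_sub (proj k u) (proj j u)) (energy 0 u - zsum k (Hs_terms 0 u)).
Proof.
  intros H Hkj. intro K. apply Rle_trans with (zsum (k + K) (Hs_terms 0 (seq_sub (proj k u) (proj j u)))).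
  { apply zsum_mono; [apply nonneg_Hs|lia]. }
  pose proof (hs_bound_energy _ _ _ H (k + K)%nat) as Q.
  assert (I1 : zsum (k + K) (Hs_terms 0 (seq_sub (proj k u) (proj j u))) <= zsum (k + K) (Hs_terms 0 u) - zsum k (Hs_terms 0 u)).
  { clear Q. induction K as [|K IH].
    - rewrite Nat.add_0_r, Rminus_diag. right. apply eq_trans with (zsum k (fun _ => 0)); [|apply zsum_zero]. apply zsum_ext_le. intros n Hn.
      rewrite Hs_terms_0. unfold cmod_seq, seq_sub, proj.
      destruct (Z_le_dec (Z.abs n) (Z.of_nat k)); [|lia]. destruct (Z_le_dec (Z.abs n) (Z.of_nat j)); [|lia].
      replace (Cminus (u n) (u n)) with (RtoC 0) by ring. rewrite Cmod_0. ring.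
    - replace (k + S K)%nat with (S (k + K)) by lia. cbn [zsum].
      assert (Pt : forall n, Hs_terms 0 (seq_sub (proj k u) (proj j u)) n <= Hs_terms 0 u n).
      { intro n. rewrite !Hs_terms_0. apply pow_incr. split; [apply nonneg_cmod_seq|].
        unfold cmod_seq, seq_sub, proj. pose proof (Cmod_ge_0 (u n)).
        destruct (Z_le_dec (Z.abs n) (Z.of_nat k)), (Z_le_dec (Z.abs n) (Z.of_nat j)).
        - replace (Cminus (u n) (u n)) with (RtoC 0) by ring. rewrite Cmod_0. lra.
        - replace (Cminus (u n) (RtoC 0)) with (u n) by ring. lra.
        - replace (Cminus (RtoC 0) (u n)) with (Copp (u n)) by ring. rewrite Cmod_opp. lra.
        - replace (Cminus (RtoC 0) (RtoC 0)) with (RtoC 0) by ring. rewrite Cmod_0. lra. }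
      pose proof (Pt (Z.of_nat (S (k + K)))). pose proof (Pt (- Z.of_nat (S (k + K)))%Z). lra. }
  lra.
Qed.

(** Lower semicontinuity, as in Fatou's lemma: each finite sum passes to the limit. *)
Lemma hs_bound_lim s (v : nat -> Z -> C) (w : Z -> C) B N :
  (forall k, (N <= k)%nat -> hs_bound s (v k) B) -> (forall n, is_lim_seq (fun k => Cmod (v k n)) (Cmod (w n))) -> hs_bound s w B.
Proof.
  intros H Hl K.
  apply (is_lim_seq_le_loc (fun k => zsum K (Hs_terms s (v k))) (fun _ => B) (zsum K (Hs_terms s w)) B).
  - exists N. intros k Hk. now apply H.
  - apply (is_lim_zsum_pointwise K (fun k => Hs_terms s (v k))). intro n. unfold Hs_terms.
    apply (is_lim_seq_scal_l _ _ (Cmod (w n) ^ 2)).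
    apply (is_lim_seq_continuous (fun x => x ^ 2)); [|apply Hl].
    apply continuity_pt_filterlim, (rcont_pow (fun x => x) 2 rcont_id).
  - apply is_lim_seq_const.
Qed.

Lemma ccont_at_unif_limit (g : nat -> R -> C) (f : R -> C) t d (eps : nat -> R) : 0 < d ->
  (forall k, ccont_at (g k) t) -> (forall k s, Rabs (s - t) < d -> Cmod (Cminus (g k s) (f s)) <= eps k) ->
  is_lim_seq eps 0 -> ccont_at f t.
Proof.
  intros Hd Hg He Hl. apply ccont_at_eps. intros ep Hep.
  destruct (is_lim_seq_0_eps _ (ep / 4) Hl) as [k Hk]; [lra|]. specialize (Hk k (le_n _)).
  apply Rabs_lt_between in Hk.
  destruct (proj2 (ccont_at_eps _ _) (Hg k) (ep / 4)) as [d1 [Hd1 Q]]; [lra|].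
  exists (Rmin d d1). split; [now apply Rmin_glb_lt|]. intros s Hs.
  pose proof (Rmin_l d d1). pose proof (Rmin_r d d1).
  pose proof (He k s ltac:(lra)) as Q1. pose proof (He k t ltac:(rewrite Rminus_diag, Rabs_R0; exact Hd)) as Q2.
  specialize (Q s ltac:(lra)).
  replace (Cminus (f s) (f t)) with (Cplus (Copp (Cminus (g k s) (f s))) (Cplus (Cminus (g k s) (g k t)) (Cminus (g k t) (f t)))) by ring.
  pose proof (Cmod_triangle (Copp (Cminus (g k s) (f s))) (Cplus (Cminus (g k s) (g k t)) (Cminus (g k t) (f t)))) as T1.
  pose proof (Cmod_triangle (Cminus (g k s) (g k t)) (Cminus (g k t) (f t))) as T2.
  rewrite Cmod_opp in T1. lra.
Qed.

Section Equation.
Variables (gamma omega : R) (beta : C) (L : R).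
Local Notation lam := (symbol gamma beta L).
Local Notation rhs := (vfield gamma omega beta L).
Local Notation seq_eq := (seq_eq gamma omega beta L).
Local Notation growth_rate := (growth_rate omega beta).
Local Notation Cl := (lip_rate omega beta).

Definition smooth_cst (s : R) (j : nat) (R2 : R) : R :=
  exp (growth_rate s R2) * (INR (S (S j)) * Rpower (INR (S (S j))) s * R2).

Lemma smooth_cst_ge0 s j R2 : 0 <= R2 -> 0 <= smooth_cst s j R2.
Proof.
  intros H. unfold smooth_cst. apply Rmult_le_pos; [left; apply exp_pos|]. apply Rmult_le_pos; [|exact H].
  apply Rmult_le_pos; [apply pos_INR|left; apply exp_pos].
Qed.

Lemma smooth_cst_mono s j R2 R2' : 0 <= R2 <= R2' -> smooth_cst s j R2 <= smooth_cst s j R2'.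
Proof.
  intros H. unfold smooth_cst. pose proof (growth_rate_mono omega beta s _ _ H).
  assert (0 <= INR (S (S j)) * Rpower (INR (S (S j))) s).
  { apply Rmult_le_pos; [apply pos_INR|left; apply exp_pos]. }
  apply Rmult_le_compat; [left; apply exp_pos| |now apply exp_mono|].
  - apply Rmult_le_pos; lra.
  - apply Rmult_le_compat_l; lra.
Qed.

(** Smoothing over a window of length r ending at t, instead of from the initial time, keeps the
    bound uniform for large t. *)
Lemma smoothing_window a t r s j R2 : 0 <= s <= INR (S j) -> 0 <= R2 -> 0 < r <= 1 ->
  seq_eq a (t - r) t -> smooth_on a (t - r) t -> (forall t', t - r <= t' <= t -> energy 0 (a t') <= R2) ->
  energy s (a t) <= smooth_cst s j R2 / r ^ S (S j).
Proof.
  intros Hs HR Hr H HS HE.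
  pose proof (Hs_smoothing gamma omega beta L a (t - r) t s R2 j Hs HR ltac:(lra) H HS HE t ltac:(lra)) as Q.
  replace (t - (t - r)) with r in Q by ring. fold (smooth_cst s j R2) in Q.
  assert (0 < r ^ S (S j)) by (apply pow_lt; lra).
  apply Rmult_le_reg_l with (r ^ S (S j)); [assumption|].
  replace (r ^ S (S j) * (smooth_cst s j R2 / r ^ S (S j))) with (smooth_cst s j R2) by (field; lra). exact Q.
Qed.

(** [smooth_data_solution] works on bounded intervals; letting the horizon grow with the cutoff
    makes one sequence reach every time eventually. *)
Lemma approximations u0 : exists a : nat -> R -> Z -> C, forall k,
  (forall n, a k 0 n = proj k u0 n) /\ seq_eq (a k) 0 (INR k) /\ smooth_on (a k) 0 (INR k).
Proof.
  assert (Q : forall k, exists a : R -> Z -> C, (forall n, a 0 n = proj k u0 n) /\ seq_eq a 0 (INR k) /\ smooth_on a 0 (INR k)).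
  { intro k. apply smooth_data_solution; [apply pos_INR|]. intro s. eexists. apply proj_hs_bound. }
  exists (fun k => proj1_sig (constructive_indefinite_description _ (Q k))).
  intro k. exact (proj2_sig (constructive_indefinite_description _ (Q k))).
Qed.

(** It matters that the factor in front of the initial energy tends to 1 as t -> 0: a larger
    constant would not give continuity in H^s at 0. *)
Definition grows (a : R -> Z -> C) (u0 : Z -> C) : Prop :=
  forall s, 0 <= s -> in_Hs s u0 -> forall t, 0 < t ->
    hs_bound s (a t) (exp (growth_rate s (energy 0 u0 + absorb_cst beta) * t) * energy s u0).

(* The approximations solve the equation on [0, k] with data truncated to |n| <= k; the Lipschitz
   estimate makes them Cauchy in H and the smoothing estimate upgrades the convergence for t > 0. *)
Lemma sequence_solution u0 : in_Hs 0 u0 ->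
  exists a : R -> Z -> C,
    (forall t0 T, 0 < t0 -> seq_eq a t0 T /\ smooth_on a t0 T) /\ grows a u0 /\
    (forall n eps, 0 < eps -> exists d, 0 < d /\ forall t, 0 < t < d -> Cmod (Cminus (a t n) (u0 n)) < eps).
Proof.
  intros Hu0. apply in_Hs_hs_bound in Hu0. destruct (approximations u0) as [a Ha].
  set (R2 := energy 0 u0 + absorb_cst beta).
  pose proof (energy_ge0 _ _ _ Hu0) as HE0. pose proof (absorb_cst_ge0 beta) as HCd.
  assert (HR2 : 0 <= R2) by (unfold R2; lra).
  assert (Ea0 : forall k, a k 0 = proj k u0) by (intro k; apply functional_extensionality; apply Ha).
  (* Squared H error of the k-th truncated data; it drives all convergence rates below. *)
  set (tau := fun k => energy 0 u0 - zsum k (Hs_terms 0 u0)).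
  assert (Htau : forall k, 0 <= tau k) by (intro k; unfold tau; pose proof (Hu0 k); lra).
  assert (Ltau : is_lim_seq tau 0).
  { unfold tau. replace (Finite 0) with (Finite (energy 0 u0 - energy 0 u0)) by (f_equal; ring).
    apply is_lim_seq_minus'; [apply is_lim_seq_const|eapply energy_lim, Hu0]. }
  assert (HEk : forall k t, 0 <= t <= INR k -> energy 0 (a k t) <= R2).
  { intros k t Ht. destruct (Ha k) as (_ & He & Hs).
    pose proof (L2_decay gamma omega beta L (a k) 0 (INR k) He Hs t Ht) as Q. rewrite Ea0 in Q.
    assert (exp (- (t - 0)) <= 1) by (rewrite <- exp_0; apply exp_mono; lra).
    assert (Q2 : energy 0 (proj k u0) <= energy 0 u0).
    { apply energy_le with (B := energy 0 u0). eapply sum_bound_weaken; [apply proj_hs_bound|apply Hu0]. }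
    pose proof (energy_ge0 _ _ _ (proj_hs_bound 0 k u0)). unfold R2. nra. }
  set (G := fun t => exp (Cl R2 * t)).
  pose proof (lip_rate_pos omega beta R2 HR2) as PCl.
  assert (HG : forall t, 0 < G t) by (intro; apply exp_pos).
  assert (HGm : forall t t', t <= t' -> G t <= G t') by (intros; apply exp_mono; nra).
  assert (Cauchy : forall k j t, (k <= j)%nat -> 0 <= t <= INR k -> hs_bound 0 (seq_sub (a k t) (a j t)) (G t * tau k)).
  { intros k j t Hkj Ht. destruct (Ha k) as (_ & He & Hs). destruct (Ha j) as (_ & Hej & Hsj).
    pose proof (le_INR _ _ Hkj) as Hle.
    assert (Hej' : seq_eq (a j) 0 (INR k)) by (eapply seq_eq_sub; [| |exact Hej]; lra).
    assert (Hsj' : smooth_on (a j) 0 (INR k)) by (eapply smooth_on_sub; [| |exact Hsj]; lra).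
    pose proof (L2_lipschitz gamma omega beta L (a k) (a j) 0 (INR k) R2 HR2 He Hej' Hs Hsj'
      (fun r Hr => conj (HEk k r Hr) (HEk j r ltac:(lra))) t Ht) as Q.
    rewrite !Ea0, Rminus_0_r in Q. fold (G t) in Q.
    destruct (Hs 0 ltac:(lra)) as [B1 HB1]. destruct (Hsj' 0 ltac:(lra)) as [B2 HB2].
    eapply sum_bound_weaken; [eapply hs_bound_energy, hs_bound_sub; [apply HB1, Ht|apply HB2, Ht]|].
    eapply Rle_trans; [exact Q|]. apply Rmult_le_compat_l; [left; apply HG|].
    eapply energy_le, proj_tail; eauto. }
  assert (CauchyC : forall k j t n, (k <= j)%nat -> 0 <= t <= INR k -> Cmod (Cminus (a k t n) (a j t n)) <= sqrt (G t * tau k)).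
  { intros k j t n Hkj Ht. pose proof (sum_bound_term _ _ n (nonneg_Hs 0 _) (Cauchy k j t Hkj Ht)) as Q. rewrite Hs_terms_0 in Q.
    apply Rsqr_incr_0_var; [|apply sqrt_pos]. rewrite Rsqr_sqrt by (pose proof (HG t); pose proof (Htau k); nra).
    rewrite Rsqr_pow2. exact Q. }
  assert (Lsq : forall c, 0 <= c -> is_lim_seq (fun k => sqrt (c * tau k)) 0).
  { intros c Hc. rewrite <- sqrt_0. apply (is_lim_seq_continuous sqrt (fun k => c * tau k) 0); [apply continuity_pt_sqrt; lra|].
    now apply is_lim_seq_scal0. }
  set (b := fun t n => (real (Lim_seq (fun k => fst (a k t n))), real (Lim_seq (fun k => snd (a k t n)))) : C).
  assert (Lim : forall t n, 0 <= t -> is_lim_seq (fun k => fst (a k t n)) (fst (b t n)) /\ is_lim_seq (fun k => snd (a k t n)) (snd (b t n))).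
  { intros t n Ht.
    assert (Cy : forall pr : C -> R, (forall z w, Rabs (pr z - pr w) <= Cmod (Cminus z w)) -> ex_finite_lim_seq (fun k => pr (a k t n))).
    { intros pr Hpr. apply ex_lim_seq_cauchy_corr. intros [ep Hep].
      destruct (is_lim_seq_0_eps _ (ep / 2) (Lsq (G t) (Rlt_le _ _ (HG t)))) as [N1' HN1]; [lra|].
      destruct (nat_above t) as [N2 HN2]. set (N := Nat.max N1' N2).
      exists N. intros n' m' Hn' Hm'. simpl.
      assert (HtN : 0 <= t <= INR N) by (split; [exact Ht|]; apply Rle_trans with (1 := HN2), le_INR; lia).
      specialize (HN1 N ltac:(lia)). apply Rabs_lt_between in HN1.
      pose proof (CauchyC N n' t n Hn' HtN) as Q1. pose proof (CauchyC N m' t n Hm' HtN) as Q2.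
      pose proof (Hpr (a N t n) (a n' t n)) as P1. pose proof (Hpr (a N t n) (a m' t n)) as P2.
      replace (pr (a n' t n) - pr (a m' t n)) with (- (pr (a N t n) - pr (a n' t n)) + (pr (a N t n) - pr (a m' t n))) by ring.
      eapply Rle_lt_trans; [apply Rabs_triang|]. rewrite Rabs_Ropp. lra. }
    split; apply Lim_seq_correct'.
    - apply (Cy fst). intros z w. apply (Rabs_fst_le (Cminus z w)).
    - apply (Cy snd). intros z w. apply (Rabs_snd_le (Cminus z w)). }
  assert (LimC : forall t n c, 0 <= t -> is_lim_seq (fun k => Cmod (Cminus c (a k t n))) (Cmod (Cminus c (b t n)))).
  { intros t n c Ht. destruct (Lim t n Ht) as [L1' L2'].
    apply is_lim_Cmod with (fun k => Rabs (fst (a k t n) - fst (b t n)) + Rabs (snd (a k t n) - snd (b t n))).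
    - intro k. replace (Cminus (Cminus c (b t n)) (Cminus c (a k t n))) with (Cminus (a k t n) (b t n)) by ring.
      apply (Cmod_le_abs (Cminus (a k t n) (b t n))).
    - replace (Finite 0) with (Finite (Rabs (fst (b t n) - fst (b t n)) + Rabs (snd (b t n) - snd (b t n))))
        by (rewrite !Rminus_diag, Rabs_R0; f_equal; ring).
      apply is_lim_seq_plus'.
      + apply (is_lim_seq_abs (fun k => fst (a k t n) - fst (b t n)) (fst (b t n) - fst (b t n))).
        apply is_lim_seq_minus'; [exact L1'|apply is_lim_seq_const].
      + apply (is_lim_seq_abs (fun k => snd (a k t n) - snd (b t n)) (snd (b t n) - snd (b t n))).
        apply is_lim_seq_minus'; [exact L2'|apply is_lim_seq_const]. }
  assert (LimC0 : forall t n, 0 <= t -> is_lim_seq (fun k => Cmod (a k t n)) (Cmod (b t n))).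
  { intros t n Ht. pose proof (LimC t n (RtoC 0) Ht) as Q.
    replace (Cminus (RtoC 0) (b t n)) with (Copp (b t n)) in Q by ring. rewrite Cmod_opp in Q.
    eapply is_lim_seq_ext; [|exact Q]. intro k. cbv beta.
    replace (Cminus (RtoC 0) (a k t n)) with (Copp (a k t n)) by ring. apply Cmod_opp. }
  assert (ErrC : forall k t n, 0 <= t <= INR k -> Cmod (Cminus (a k t n) (b t n)) <= sqrt (G t * tau k)).
  { intros k t n Ht.
    apply (is_lim_seq_le_loc (fun j => Cmod (Cminus (a k t n) (a j t n))) (fun _ => sqrt (G t * tau k)) (Cmod (Cminus (a k t n) (b t n))) (sqrt (G t * tau k))).
    - exists k. intros j Hj. now apply CauchyC.
    - apply LimC. lra.
    - apply is_lim_seq_const. }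
  assert (Err0 : forall k t, 0 <= t <= INR k -> hs_bound 0 (seq_sub (a k t) (b t)) (G t * tau k)).
  { intros k t Ht. apply (hs_bound_lim 0 (fun j => seq_sub (a k t) (a j t)) _ _ k).
    - intros j Hj. now apply Cauchy.
    - intro n. apply (LimC t n (a k t n)). lra. }
  (* The bound is uniform in k because smoothing sees the data only through R2. *)
  assert (Smooth_k : forall s t0 T, 0 <= s -> 0 < t0 -> exists B, forall k t, t0 <= t <= T -> T <= INR k -> hs_bound s (a k t) B).
  { intros s t0 T Hs Ht0. destruct (nat_above s) as [j Hj].
    set (r := Rmin t0 1). assert (Hr : 0 < r <= 1) by (split; [apply Rmin_glb_lt; lra|apply Rmin_r]).
    pose proof (Rmin_l t0 1) as Hr2. fold r in Hr2.
    exists (smooth_cst s j R2 / r ^ S (S j)). intros k t Ht HT. destruct (Ha k) as (_ & He & Hsm).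
    destruct (Hsm s Hs) as [B HB].
    eapply sum_bound_weaken; [eapply hs_bound_energy, HB; lra|].
    apply smoothing_window.
    - split; [exact Hs|]. rewrite S_INR. lra.
    - exact HR2.
    - exact Hr.
    - eapply seq_eq_sub; [| |exact He]; lra.
    - eapply smooth_on_sub; [| |exact Hsm]; lra.
    - intros t' Ht'. apply HEk. lra. }
  assert (Smooth_b : forall t0 T, 0 < t0 -> smooth_on b t0 T).
  { intros t0 T Ht0 s Hs. destruct (Smooth_k s t0 T Hs Ht0) as [B HB]. exists B. intros t Ht.
    destruct (nat_above T) as [N HN].
    apply (hs_bound_lim s (fun k => a k t) (b t) B N).
    - intros k Hk. apply HB; [exact Ht|]. apply Rle_trans with (1 := HN), le_INR, Hk.
    - intro n. apply LimC0. lra. }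
  exists b. split; [|split].
  - intros t0 T Ht0. split; [|now apply Smooth_b].
    intros t n Ht. assert (Htp : 0 < t) by lra.
    destruct (nat_above (2 * t)) as [N HN].
    destruct (Smooth_k 2 (t / 2) (2 * t) ltac:(lra) ltac:(lra)) as [B HB].
    assert (Hloc : forall s, Rabs (s - t) < t / 2 -> t / 2 <= s <= 2 * t) by (intros s Hs; apply Rabs_lt_between in Hs; lra).
    assert (HNk : forall k, 2 * t <= INR (k + N)) by (intro k; apply Rle_trans with (1 := HN), le_INR; lia).
    destruct (Smooth_b (t / 2) (2 * t) ltac:(lra) 2 ltac:(lra)) as [B' HB'].
    assert (B0 : 0 <= B) by (eapply hs_bound_ge0, (HB N t); lra).
    assert (B0' : 0 <= B') by (eapply hs_bound_ge0, (HB' t); lra).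
    set (Gt := G (2 * t)).
    (* The summand 1 / (k + 1) makes Pk strictly positive, as [l1norm_small] requires; likewise the
       last part of D below ensures Pk <= D. *)
    set (Pk := fun k => Gt * tau (k + N)%nat + / (INR k + 1)).
    assert (Linv : is_lim_seq (fun k => / (INR k + 1)) 0).
    { assert (LI : is_lim_seq (fun K => INR K + 1) p_infty).
      { apply is_lim_seq_plus with p_infty 1; [apply is_lim_seq_INR|apply is_lim_seq_const|reflexivity]. }
      apply is_lim_seq_inv with (l := p_infty) in LI; [exact LI|discriminate]. }
    assert (LPk : is_lim_seq Pk 0).
    { unfold Pk. replace (Finite 0) with (Finite (0 + 0)) by (f_equal; ring).
      apply is_lim_seq_plus'; [|exact Linv]. apply is_lim_seq_scal0. now apply (is_lim_seq_incr_n tau N). }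
    assert (HPk : forall k, 0 < Pk k <= Gt * energy 0 u0 + 1).
    { intro k. unfold Pk. pose proof (Htau (k + N)%nat). pose proof (HG (2 * t)) as HGt. fold Gt in HGt.
      pose proof (pos_INR k). assert (0 < / (INR k + 1)) by (apply Rinv_0_lt_compat; lra).
      assert (/ (INR k + 1) <= 1) by (rewrite <- Rinv_1; apply Rinv_le_contravar; lra).
      assert (tau (k + N)%nat <= energy 0 u0).
      { unfold tau. pose proof (zsum_nonneg (k + N) _ (nonneg_Hs 0 u0)). lra. }
      split; nra. }
    set (D := 2 * B + 2 * B' + (Gt * energy 0 u0 + 1)).
    assert (Err_loc : forall k s, Rabs (s - t) < t / 2 -> energy 0 (seq_sub (a (k + N)%nat s) (b s)) <= Pk k).
    { intros k s Hs. specialize (Hloc s Hs). specialize (HNk k).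
      eapply Rle_trans; [eapply energy_le, Err0; lra|]. unfold Pk.
      pose proof (pos_INR k). assert (0 < / (INR k + 1)) by (apply Rinv_0_lt_compat; lra).
      pose proof (HGm s (2 * t) ltac:(lra)). fold Gt in H1. pose proof (Htau (k + N)%nat). nra. }
    assert (Err_locC : forall k s m, Rabs (s - t) < t / 2 -> Cmod (Cminus (a (k + N)%nat s m) (b s m)) <= sqrt (Pk k)).
    { intros k s m Hs. pose proof (Hloc s Hs) as Hs2. specialize (HNk k).
      pose proof (hs_bound_energy _ _ _ (Err0 (k + N)%nat s ltac:(lra))) as Q.
      pose proof (sum_bound_term _ _ m (nonneg_Hs 0 _) Q) as Q2. rewrite Hs_terms_0 in Q2.
      apply Rsqr_incr_0_var; [|apply sqrt_pos]. rewrite Rsqr_sqrt by (left; apply HPk). rewrite Rsqr_pow2.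
      eapply Rle_trans; [exact Q2|]. now apply Err_loc. }
    assert (LsP : is_lim_seq (fun k => sqrt (Pk k)) 0).
    { rewrite <- sqrt_0. apply (is_lim_seq_continuous sqrt Pk 0); [apply continuity_pt_sqrt; lra|exact LPk]. }
    assert (Cb : forall m, ccont_at (fun s => b s m) t).
    { intro m. apply (ccont_at_unif_limit (fun k s => a (k + N)%nat s m) (fun s => b s m) t (t / 2) (fun k => sqrt (Pk k))).
      - lra.
      - intro k. destruct (Ha (k + N)%nat) as (_ & He & _). eapply cderive_ccont_at, He. specialize (HNk k). lra.
      - intros k s Hs. now apply Err_locC.
      - exact LsP. }
    assert (HYb : forall s, Rabs (s - t) < t / 2 -> decay2 (b s) (sqrt B')).
    { intros s Hs. apply hs_bound_decay2, HB', Hloc, Hs. }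
    (* For fixed n the linear term converges with the coefficient and the cubic one with the l1
       norm, both uniformly near t. The index shift N makes all approximations exist there. *)
    apply (cderive_unif_limit (fun k s => a (k + N)%nat s n) (fun k s => rhs (a (k + N)%nat s) n) (fun s => b s n) (fun s => rhs (b s) n) t (t / 2)
      (fun k => Cmod (lam n) * sqrt (Pk k) + omega_bd omega * (2 * ((sqrt B * 5) ^ 2 + (sqrt B' * 5) ^ 2)) * sqrt (10 * sqrt (Pk k * D)))).
    + lra.
    + intros k s Hs. specialize (Hloc s Hs). specialize (HNk k). destruct (Ha (k + N)%nat) as (_ & He & _). apply He. lra.
    + intros s Hs. specialize (Hloc s Hs). destruct (Lim s n ltac:(lra)) as [L1' L2'].
      split; [now apply (is_lim_seq_incr_n (fun k => fst (a k s n)) N)|now apply (is_lim_seq_incr_n (fun k => snd (a k s n)) N)].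
    + intros k s Hs. pose proof (Hloc s Hs) as Hs2. specialize (HNk k).
      assert (HBa : hs_bound 2 (a (k + N)%nat s) B) by (apply HB; lra).
      assert (HBb : hs_bound 2 (b s) B') by (apply HB'; lra).
      replace (Cminus (rhs (a (k + N)%nat s) n) (rhs (b s) n))
        with (Cplus (Cmult (lam n) (Cminus (a (k + N)%nat s n) (b s n))) (Copp (Cmult (1, omega) (Cminus (cubic_coef (a (k + N)%nat s) n) (cubic_coef (b s) n)))))
        by (unfold vfield; ring).
      eapply Rle_trans; [apply Cmod_triangle|]. rewrite Cmod_opp, !Cmod_mult. apply Rplus_le_compat.
      * apply Rmult_le_compat_l; [apply Cmod_ge_0|]. now apply Err_locC.
      * rewrite Rmult_assoc. apply Rmult_le_compat; [apply Cmod_ge_0|apply Cmod_ge_0|apply Cmod_1omega|].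
        eapply Rle_trans; [apply (cubic_coef_diff_bound _ _ _ _ n (decay2_l1_bound _ _ (hs_bound_decay2 _ _ HBa)) (decay2_l1_bound _ _ (hs_bound_decay2 _ _ HBb)))|].
        apply Rmult_le_compat_l; [pose proof (pow2_ge_0 (sqrt B * 5)); pose proof (pow2_ge_0 (sqrt B' * 5)); lra|].
        apply l1norm_small; [apply HPk|unfold D; pose proof (HPk k); lra| |now apply Err_loc].
        apply hs_bound_le with 2; [lra|]. eapply sum_bound_weaken; [apply hs_bound_sub; [exact HBa|exact HBb]|].
        unfold D. pose proof (HPk k). lra.
    + assert (D0 : 0 <= D) by (unfold D; pose proof (HPk 0%nat); lra).
      assert (Ls2 : is_lim_seq (fun k => sqrt (10 * sqrt (Pk k * D))) 0).
      { assert (Q1 : is_lim_seq (fun k => sqrt (Pk k * D)) 0).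
        { rewrite <- sqrt_0. apply (is_lim_seq_continuous sqrt (fun k => Pk k * D) 0); [apply continuity_pt_sqrt; lra|].
          apply is_lim_seq_ext with (fun k => D * Pk k); [intro; ring|]. now apply is_lim_seq_scal0. }
        rewrite <- sqrt_0. apply (is_lim_seq_continuous sqrt (fun k => 10 * sqrt (Pk k * D)) 0); [apply continuity_pt_sqrt; lra|].
        now apply is_lim_seq_scal0. }
      replace (Finite 0) with (Finite (0 + 0)) by (f_equal; ring).
      apply is_lim_seq_plus'; now apply is_lim_seq_scal0.
    + apply (rhs_ccont_at gamma omega beta L b t (t / 2) (sqrt B') n Cb); [lra|exact HYb].
  - intros s Hs Hu t Ht. destruct (nat_above t) as [N HN].
    apply in_Hs_hs_bound in Hu.
    apply (hs_bound_lim s (fun k => a k t) (b t) _ N).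
    + intros k Hk. pose proof (le_INR _ _ Hk) as Hk2. destruct (Ha k) as (_ & He & Hsm).
      pose proof (Hs_growth gamma omega beta L (a k) 0 (INR k) s R2 Hs HR2 He Hsm (HEk k) t ltac:(lra)) as Q.
      rewrite Ea0, Rminus_0_r in Q. destruct (Hsm s Hs) as [B HB].
      eapply sum_bound_weaken; [eapply hs_bound_energy, HB; lra|]. eapply Rle_trans; [exact Q|].
      apply Rmult_le_compat_l; [left; apply exp_pos|]. apply energy_le.
      eapply sum_bound_weaken; [apply proj_hs_bound|apply Hu].
    + intro n. apply LimC0. lra.
  (* Near t = 0 the limit stays within sqrt (G 1 tau k) of the k-th approximation, which is
     continuous at 0 and starts at exactly u0 n once k >= |n|. *)
  - intros n eps He.
    destruct (is_lim_seq_0_eps _ (eps / 2) (Lsq (G 1) (Rlt_le _ _ (HG 1)))) as [N1' HN1]; [lra|].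
    set (k := Nat.max (Nat.max N1' 1) (Z.abs_nat n)).
    specialize (HN1 k ltac:(lia)). apply Rabs_lt_between in HN1.
    assert (Hk1 : 1 <= INR k) by (change 1 with (INR 1); apply le_INR; lia).
    destruct (Ha k) as (_ & Hek & _).
    assert (C0 : ccont_at (fun s => a k s n) 0) by (eapply cderive_ccont_at, Hek; lra).
    destruct (proj2 (ccont_at_eps _ _) C0 (eps / 2)) as [d [Hd Q]]; [lra|].
    exists (Rmin d 1). split; [apply Rmin_glb_lt; lra|]. intros t Ht.
    pose proof (Rmin_l d 1). pose proof (Rmin_r d 1).
    specialize (Q t ltac:(rewrite Rminus_0_r, Rabs_pos_eq; lra)). rewrite Ea0 in Q.
    assert (Eu : proj k u0 n = u0 n) by (unfold proj; destruct (Z_le_dec _ _); [reflexivity|lia]).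
    rewrite Eu in Q. pose proof (ErrC k t n ltac:(lra)) as Q2.
    assert (sqrt (G t * tau k) <= sqrt (G 1 * tau k)).
    { apply sqrt_le_1_alt, Rmult_le_compat_r; [apply Htau|]. apply HGm. lra. }
    replace (Cminus (b t n) (u0 n)) with (Cplus (Copp (Cminus (a k t n) (b t n))) (Cminus (a k t n) (u0 n))) by ring.
    eapply Rle_lt_trans; [apply Cmod_triangle|]. rewrite Cmod_opp. lra.
Qed.

End Equation.

(** * Estimates for arbitrary solutions *)

Lemma energy0_le_l1norm v X : l1_bound v X -> hs_bound 0 v (l1norm v * l1norm v).
Proof.
  intros H. pose proof (l1_bound_l1norm _ _ H) as HN. pose proof (l1norm_ge0 _ _ H) as N0.
  eapply sum_bound_le; [|apply (sum_bound_scal _ (l1norm v) _ N0 HN)].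
  intro n. rewrite Hs_terms_0. pose proof (sum_bound_term _ _ n (nonneg_cmod_seq v) HN). pose proof (nonneg_cmod_seq v n).
  simpl. nra.
Qed.

Lemma uniform_on_block (P : Z -> R -> Prop) M :
  (forall n, exists d, 0 < d /\ forall t, 0 < t < d -> P n t) ->
  exists d, 0 < d /\ forall t, 0 < t < d -> forall n, (Z.abs n <= Z.of_nat M)%Z -> P n t.
Proof.
  intros H. induction M as [|M [d [Hd Q]]].
  - destruct (H 0%Z) as [d [Hd Q]]. exists d. split; [exact Hd|]. intros t Ht n Hn.
    replace n with 0%Z by lia. now apply Q.
  - destruct (H (Z.of_nat (S M))) as [d1 [Hd1 Q1]]. destruct (H (- Z.of_nat (S M))%Z) as [d2 [Hd2 Q2]].
    exists (Rmin d (Rmin d1 d2)). split; [repeat apply Rmin_glb_lt; auto|]. intros t Ht n Hn.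
    pose proof (Rmin_l d (Rmin d1 d2)). pose proof (Rmin_r d (Rmin d1 d2)).
    pose proof (Rmin_l d1 d2). pose proof (Rmin_r d1 d2).
    destruct (Z.eq_dec n (Z.of_nat (S M))) as [->|]; [apply Q1; lra|].
    destruct (Z.eq_dec n (- Z.of_nat (S M))) as [->|]; [apply Q2; lra|].
    apply Q; [lra|lia].
Qed.

Lemma exp_ge_1 x : 0 <= x -> 1 <= exp x.
Proof. intros H. rewrite <- exp_0. now apply exp_mono. Qed.

Lemma exp_near_1 c eps : 0 <= c -> 0 < eps -> exists d, 0 < d /\ forall t, 0 <= t < d -> exp (c * t) <= 1 + eps.
Proof.
  intros Hc He.
  assert (C0 : continuous (fun t => exp (c * t)) 0).
  { apply (ex_derive_continuous (fun t => exp (c * t))). auto_derive. exact I. }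
  destruct (eps_continuous _ _ C0 eps He) as [d [Hd Q]]. exists d. split; [exact Hd|].
  intros t Ht. specialize (Q t ltac:(rewrite Rminus_0_r, Rabs_pos_eq; lra)).
  rewrite Rmult_0_r, exp_0 in Q. apply Rabs_lt_between in Q. lra.
Qed.

Section Equation.
Variables (gamma omega : R) (beta : C) (L : R).
Local Notation seq_eq := (seq_eq gamma omega beta L).
Local Notation growth_rate := (growth_rate omega beta).
Local Notation Cl := (lip_rate omega beta).
Local Notation solution := (solution gamma omega beta L).
Local Notation grows := (grows omega beta).
Local Notation smooth_cst := (smooth_cst omega beta).

(** The time from t0 / 2 to t0 is spent on turning the [decay2] bound of a classical solution into
    bounds in every H^s. *)
Lemma solution_sequence u u0 : solution u u0 -> forall t0 T, 0 < t0 ->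
  seq_eq (fun t => fcoef (u t)) t0 T /\ smooth_on (fun t => fcoef (u t)) t0 T.
Proof.
  intros (_ & Hc & _) t0 T Ht0.
  destruct (classical_coefficients _ _ _ _ u Hc (t0 / 2) T ltac:(lra)) as (He & [A HA] & _).
  split; [eapply seq_eq_sub; [| |exact He]; lra|].
  apply (smooth_later gamma omega beta L _ (t0 / 2) T A); [lra|exact He|exact HA].
Qed.

Lemma solution_in_H u u0 t : solution u u0 -> 0 < t -> forall s, 0 <= s -> in_Hs s (fcoef (u t)).
Proof.
  intros Hu Ht s Hs. destruct (solution_sequence u u0 Hu t t Ht) as [_ HS].
  destruct (HS s Hs) as [B HB]. eapply hs_bound_in_Hs, HB. lra.
Qed.

(** The decay estimate cannot start at 0, where only the H trace is known. It starts at t0 with a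
    trace error below 1 / (r + 1), which raises the energy by at most 2, and with t0 <= ln 2, so
    that exp t0 <= 2; hence the factor 2 and the constant 4. *)
Lemma solution_L2 u u0 : solution u u0 -> forall t, 0 < t ->
  energy 0 (fcoef (u t)) <= 2 * exp (- t) * energy 0 u0 + (4 + absorb_cst beta).
Proof.
  intros Hu t Ht. destruct Hu as (H0 & Hc & Htr). pose proof (conj H0 (conj Hc Htr) : solution u u0) as Hu.
  set (r := Hs_norm 0 u0). assert (r0 : 0 <= r) by apply Hs_norm_ge0.
  pose proof (in_Hs_hs_bound _ _ H0) as HB0. pose proof (Hs_norm_sq 0 u0 _ HB0) as Er. fold r in Er.
  assert (Hinv : 0 < / (r + 1)) by (apply Rinv_0_lt_compat; lra).
  destruct (Htr (/ (r + 1)) Hinv) as [d [Hd Q]].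
  assert (ln2 : 0 < ln 2) by (rewrite <- ln_1; apply ln_increasing; lra).
  set (t0 := Rmin (Rmin (d / 2) (ln 2)) t).
  assert (Ht0 : 0 < t0) by (unfold t0; repeat apply Rmin_glb_lt; lra).
  assert (B1 : t0 <= t) by apply Rmin_r.
  assert (B2 : t0 <= d / 2) by (eapply Rle_trans; [apply Rmin_l|apply Rmin_l]).
  assert (B3 : t0 <= ln 2) by (eapply Rle_trans; [apply Rmin_l|apply Rmin_r]).
  destruct (Q t0 ltac:(lra)) as [I1 I2].
  destruct (Hs_of_sub 0 _ _ I1 H0) as [I3 I4]. fold r in I4.
  assert (I5 : energy 0 (fcoef (u t0)) <= energy 0 u0 + 2).
  { rewrite <- Er. eapply Rle_trans; [apply (Hs_norm_energy_le 0 _ _ (r + / (r + 1)) (in_Hs_hs_bound _ _ I3)); lra|].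
    assert (r * / (r + 1) <= / 2 * 1 + / 2 * 1).
    { apply Rmult_le_reg_r with (r + 1); [lra|]. rewrite Rmult_assoc, Rinv_l by lra. lra. }
    assert (/ (r + 1) <= 1) by (rewrite <- Rinv_1; apply Rinv_le_contravar; lra).
    assert (r * / (r + 1) <= 1) by lra.
    assert (/ (r + 1) * / (r + 1) + 2 * (r * / (r + 1)) <= 2).
    { replace (/ (r + 1) * / (r + 1) + 2 * (r * / (r + 1))) with ((2 * r * (r + 1) + 1) * (/ (r + 1) * / (r + 1))) by (field; lra).
      apply Rmult_le_reg_r with ((r + 1) * (r + 1)); [nra|].
      replace ((2 * r * (r + 1) + 1) * (/ (r + 1) * / (r + 1)) * ((r + 1) * (r + 1))) with (2 * r * (r + 1) + 1) by (field; lra).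
      nra. }
    nra. }
  destruct (solution_sequence u u0 Hu t0 t Ht0) as [He HS].
  pose proof (L2_decay gamma omega beta L _ t0 t He HS t ltac:(lra)) as D. cbv beta in D.
  replace (- (t - t0)) with (- t + t0) in D by ring. rewrite exp_plus in D.
  assert (J1 : exp t0 <= 2) by (rewrite <- (exp_ln 2) by lra; apply exp_mono; lra).
  pose proof (exp_pos (- t)) as J2. assert (J3 : exp (- t) <= 1) by (rewrite <- exp_0; apply exp_mono; lra).
  pose proof (energy_ge0 _ _ _ HB0). pose proof (energy_ge0 _ _ _ (in_Hs_hs_bound _ _ I3)). pose proof (exp_pos t0).
  assert (exp (- t) * exp t0 * energy 0 (fcoef (u t0)) <= exp (- t) * 2 * (energy 0 u0 + 2)).
  { apply Rmult_le_compat; [nra|lra| |lra]. apply Rmult_le_compat_l; lra. }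
  nra.
Qed.

Definition H_cst (r : R) : R := 2 * (r * r) + (4 + absorb_cst beta).

Lemma H_cst_ge0 r : 4 <= H_cst r.
Proof. unfold H_cst. pose proof (absorb_cst_ge0 beta). nra. Qed.

Lemma H_cst_mono r r' : 0 <= r <= r' -> H_cst r <= H_cst r'.
Proof. intros. unfold H_cst. nra. Qed.

Lemma solution_bound u u0 : solution u u0 -> forall t, 0 < t -> energy 0 (fcoef (u t)) <= H_cst (Hs_norm 0 u0).
Proof.
  intros Hu t Ht. pose proof (solution_L2 u u0 Hu t Ht) as Q. destruct Hu as (H0 & _).
  unfold H_cst. rewrite (Hs_norm_sq 0 u0 _ (in_Hs_hs_bound _ _ H0)).
  pose proof (energy_ge0 _ _ _ (in_Hs_hs_bound _ _ H0)).
  assert (exp (- t) <= 1) by (rewrite <- exp_0; apply exp_mono; lra). nra.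
Qed.

(** Half of the rate, because [lip_rate] governs the square of the norm. The sum of the two
    constants bounds both energies. *)
Definition lip_cst (r1 r2 : R) : R := Cl (H_cst r1 + H_cst r2) / 2.

Lemma lip_cst_pos r1 r2 : 0 < lip_cst r1 r2.
Proof.
  unfold lip_cst. pose proof (H_cst_ge0 r1). pose proof (H_cst_ge0 r2).
  pose proof (lip_rate_pos omega beta (H_cst r1 + H_cst r2) ltac:(lra)). lra.
Qed.

Lemma solution_lipschitz u1 u2 u10 u20 : solution u1 u10 -> solution u2 u20 -> forall t, 0 < t ->
  in_Hs 0 (seq_sub (fcoef (u1 t)) (fcoef (u2 t))) /\
  Hs_norm 0 (seq_sub (fcoef (u1 t)) (fcoef (u2 t)))
    <= exp (lip_cst (Hs_norm 0 u10) (Hs_norm 0 u20) * t) * Hs_norm 0 (seq_sub u10 u20).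
Proof.
  intros S1 S2 t Ht. set (K := lip_cst (Hs_norm 0 u10) (Hs_norm 0 u20)).
  assert (HK : 0 < K) by apply lip_cst_pos.
  pose proof (Hs_sub 0 _ _ (solution_in_H u1 u10 t S1 Ht 0 (Rle_refl 0)) (solution_in_H u2 u20 t S2 Ht 0 (Rle_refl 0))) as Hin.
  split; [exact Hin|].
  set (N := Hs_norm 0 (seq_sub u10 u20)). assert (HN : 0 <= N) by apply Hs_norm_ge0.
  apply le_epsilon. intros eps He.
  set (G := exp (K * t)). assert (HG : 0 < G) by apply exp_pos.
  (* Trace error allowed to each solution: two of them, amplified by G, add up to eps. *)
  set (ep := eps / G / 2). assert (Hep : 0 < ep) by (unfold ep; apply Rdiv_lt_0_compat; [apply Rdiv_lt_0_compat; lra|lra]).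
  pose proof S1 as (H10 & _ & T1). pose proof S2 as (H20 & _ & T2).
  destruct (T1 ep Hep) as [d1 [Hd1 Q1]]. destruct (T2 ep Hep) as [d2 [Hd2 Q2]].
  set (t0 := Rmin t (Rmin (d1 / 2) (d2 / 2))).
  assert (Ht0 : 0 < t0) by (unfold t0; repeat apply Rmin_glb_lt; lra).
  assert (B1 : t0 <= t) by apply Rmin_l.
  assert (B2 : t0 <= d1 / 2) by (eapply Rle_trans; [apply Rmin_r|apply Rmin_l]).
  assert (B3 : t0 <= d2 / 2) by (eapply Rle_trans; [apply Rmin_r|apply Rmin_r]).
  destruct (Q1 t0 ltac:(lra)) as [I1 I2]. destruct (Q2 t0 ltac:(lra)) as [J1 J2].
  destruct (Hs_sub_sym _ _ _ J1) as [J1' J2'].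
  destruct (Hs_sub_triangle 0 _ _ _ I1 (Hs_sub 0 _ _ H10 H20)) as [X1 X2].
  destruct (Hs_sub_triangle 0 _ _ _ X1 J1') as [Y1 Y2]. fold N in X2.
  destruct (solution_sequence u1 u10 S1 t0 t Ht0) as [He1 Hs1]. destruct (solution_sequence u2 u20 S2 t0 t Ht0) as [He2 Hs2].
  set (R2 := H_cst (Hs_norm 0 u10) + H_cst (Hs_norm 0 u20)).
  pose proof (H_cst_ge0 (Hs_norm 0 u10)). pose proof (H_cst_ge0 (Hs_norm 0 u20)).
  pose proof (L2_lipschitz gamma omega beta L _ _ t0 t R2 ltac:(unfold R2; lra) He1 He2 Hs1 Hs2) as V.
  assert (V2 : energy 0 (seq_sub (fcoef (u1 t)) (fcoef (u2 t))) <= exp (Cl R2 * (t - t0)) * energy 0 (seq_sub (fcoef (u1 t0)) (fcoef (u2 t0)))).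
  { apply V; [|lra]. intros r Hr. unfold R2. split.
    - pose proof (solution_bound u1 u10 S1 r ltac:(lra)). lra.
    - pose proof (solution_bound u2 u20 S2 r ltac:(lra)). lra. }
  apply Rle_trans with (G * (N + 2 * ep)).
  - eapply Hs_norm_le; [apply in_Hs_hs_bound, Hin|nra|].
    eapply Rle_trans; [exact V2|].
    replace (G * (N + 2 * ep) * (G * (N + 2 * ep))) with ((G * G) * ((N + 2 * ep) * (N + 2 * ep))) by ring.
    apply Rmult_le_compat; [left; apply exp_pos|eapply energy_ge0, in_Hs_hs_bound, Y1| |].
    + unfold G. rewrite <- exp_plus. apply exp_mono.
      replace (K * t + K * t) with (Cl R2 * t) by (unfold K, lip_cst; fold R2; field).
      pose proof (lip_rate_pos omega beta R2 ltac:(unfold R2; lra)). nra.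
    + eapply Hs_norm_energy_le; [apply in_Hs_hs_bound, Y1|]. lra.
  - unfold ep. right. field. lra.
Qed.

Lemma solution_unique_coef u v u0 : solution u u0 -> solution v u0 -> forall t n, 0 < t -> fcoef (u t) n = fcoef (v t) n.
Proof.
  intros Su Sv t n Ht. destruct (solution_lipschitz u v u0 u0 Su Sv t Ht) as [Hin Hn].
  rewrite (proj2 (Hs_self 0 u0)), Rmult_0_r in Hn.
  pose proof (coef_le_norm 0 _ n (Rle_refl 0) Hin) as Q. unfold seq_sub in Q at 1.
  apply Cminus_eq0, Cmod_eq_0. apply Rle_antisym; [lra|apply Cmod_ge_0].
Qed.

Lemma solution_unique u v u0 : solution u u0 -> solution v u0 -> forall t x, 0 < t -> u t x = v t x.
Proof.
  intros Su Sv t x Ht. pose proof Su as (_ & Cu & _). pose proof Sv as (_ & Cv & _).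
  destruct (classical_coefficients _ _ _ _ u Cu t t Ht) as (_ & _ & Fu).
  destruct (classical_coefficients _ _ _ _ v Cv t t Ht) as (_ & _ & Fv).
  rewrite <- (Fu t x), <- (Fv t x) by lra. f_equal. apply functional_extensionality.
  intro n. now apply (solution_unique_coef u v u0).
Qed.

(** For small t the growth bound keeps the energy of a t below that of u0 plus eta; with convergence
    of the coefficients these are the hypotheses of [radon_riesz]. *)
Lemma continuous_at_0 a u0 s : 0 <= s -> in_Hs s u0 -> in_Hs 0 u0 -> grows a u0 ->
  (forall n eps, 0 < eps -> exists d, 0 < d /\ forall t, 0 < t < d -> Cmod (Cminus (a t n) (u0 n)) < eps) ->
  forall eps, 0 < eps -> exists d, 0 < d /\ forall t, 0 < t < d ->
    in_Hs s (seq_sub (a t) u0) /\ Hs_norm s (seq_sub (a t) u0) < eps.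
Proof.
  intros Hs H H00 Hg Hc eps He.
  destruct (radon_riesz s u0 (eps / 2 * (eps / 2)) ltac:(nra) H) as (eta & M & Heta & Q).
  destruct (uniform_on_block (fun n t => Cmod (Cminus (a t n) (u0 n)) < eta) M) as [d1 [Hd1 Q1]];
    [intro n; now apply Hc|].
  pose proof (energy_ge0 _ _ _ (in_Hs_hs_bound _ _ H)) as E0. pose proof (energy_ge0 _ _ _ (in_Hs_hs_bound _ _ H00)) as E00.
  set (c := growth_rate s (energy 0 u0 + absorb_cst beta)).
  assert (Pc : 0 < c) by (apply growth_rate_pos; pose proof (absorb_cst_ge0 beta); lra).
  destruct (exp_near_1 c (eta / (energy s u0 + 1)) ltac:(lra) ltac:(apply Rdiv_lt_0_compat; lra)) as [d2 [Hd2 Q2]].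
  exists (Rmin d1 d2). split; [now apply Rmin_glb_lt|]. intros t Ht.
  pose proof (Rmin_l d1 d2). pose proof (Rmin_r d1 d2).
  pose proof (Hg s Hs H t ltac:(lra)) as HB. fold c in HB.
  assert (Hin : in_Hs s (seq_sub (a t) u0)) by (apply Hs_sub; [eapply hs_bound_in_Hs, HB|exact H]).
  split; [exact Hin|].
  apply Rle_lt_trans with (eps / 2); [|lra].
  eapply Hs_norm_le; [apply in_Hs_hs_bound, Hin|lra|].
  apply Q.
  - eapply hs_bound_in_Hs, HB.
  - intros n Hn. left. apply Q1; [lra|exact Hn].
  - eapply Rle_trans; [eapply energy_le, HB|]. specialize (Q2 t ltac:(lra)).
    apply Rle_trans with ((1 + eta / (energy s u0 + 1)) * energy s u0); [apply Rmult_le_compat_r; lra|].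
    rewrite Rmult_plus_distr_r, Rmult_1_l. apply Rplus_le_compat_l.
    apply Rle_trans with (eta / (energy s u0 + 1) * (energy s u0 + 1)).
    + apply Rmult_le_compat_l; [left; apply Rdiv_lt_0_compat; lra|lra].
    + right. field. lra.
Qed.

(** Away from 0 a local H^(s+1) bound exists, so l1 continuity, which implies continuity in H, is
    interpolated up to H^s. *)
Lemma continuous_at_pos a s t : 0 <= s -> 0 < t ->
  (forall t0 T, 0 < t0 -> seq_eq a t0 T /\ smooth_on a t0 T) ->
  forall eps, 0 < eps -> exists d, 0 < d /\ d <= t / 2 /\ forall t', Rabs (t' - t) < d ->
    in_Hs s (seq_sub (a t') (a t)) /\ Hs_norm s (seq_sub (a t') (a t)) < eps.
Proof.
  intros Hs Ht H eps He.
  destruct (H (t / 2) (2 * t) ltac:(lra)) as [Heq HS].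
  destruct (HS (s + 1) ltac:(lra)) as [B HB]. destruct (HS 2 ltac:(lra)) as [B2 HB2].
  assert (Hloc : forall r, Rabs (r - t) < t / 2 -> t / 2 <= r <= 2 * t) by (intros r Hr; apply Rabs_lt_between in Hr; lra).
  assert (B0 : 0 <= B) by (eapply hs_bound_ge0, (HB t); lra).
  set (D := 2 * B + 2 * B). set (e2 := eps / 2 * (eps / 2)). assert (He2 : 0 < e2) by (unfold e2; nra).
  set (eta := e2 / 2 / (D + 1)). assert (HD : 0 <= D) by (unfold D; lra).
  assert (Heta : 0 < eta) by (unfold eta; apply Rdiv_lt_0_compat; lra).
  set (c := Rpower eta (- s)). assert (Hc : 0 < c) by apply exp_pos.
  assert (Cc : forall n, ccont_at (fun r => a r n) t) by (intro n; eapply cderive_ccont_at, Heq; lra).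
  assert (HY : forall r, Rabs (r - t) < t / 2 -> decay2 (a r) (sqrt B2)) by (intros r Hr; apply hs_bound_decay2, HB2, Hloc, Hr).
  destruct (l1norm_small_cont a t (t / 2) (sqrt B2) Cc ltac:(lra) HY (sqrt (e2 / 2 / c))) as [d [Hd [Hdt Q]]].
  { apply sqrt_lt_R0. apply Rdiv_lt_0_compat; lra. }
  exists d. split; [exact Hd|]. split; [exact Hdt|]. intros t' Ht'.
  pose proof (Hloc t' ltac:(lra)) as Hl.
  assert (HBv : hs_bound (s + 1) (seq_sub (a t') (a t)) D) by (apply hs_bound_sub; apply HB; lra).
  assert (Hin : hs_bound s (seq_sub (a t') (a t)) D) by (apply hs_bound_le with (s + 1); [lra|exact HBv]).
  split; [eapply hs_bound_in_Hs, Hin|].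
  apply Rle_lt_trans with (eps / 2); [|lra].
  eapply Hs_norm_le; [exact Hin|lra|]. fold e2.
  eapply Rle_trans; [apply (energy_interp_eps s _ _ eta Hs Heta HBv)|]. fold c.
  assert (J1 : eta * energy (s + 1) (seq_sub (a t') (a t)) <= e2 / 2).
  { apply Rle_trans with (eta * (D + 1)); [apply Rmult_le_compat_l; [lra|]; pose proof (energy_le _ _ _ HBv); lra|].
    unfold eta. right. field. lra. }
  assert (Lv : l1_bound (seq_sub (a t') (a t)) (sqrt B2 * 5 + sqrt B2 * 5)).
  { apply l1_bound_sub; apply decay2_l1_bound, HY; [lra|rewrite Rminus_diag, Rabs_R0; lra]. }
  assert (J2 : c * energy 0 (seq_sub (a t') (a t)) <= e2 / 2).
  { apply Rle_trans with (c * (e2 / 2 / c)); [|right; field; lra]. apply Rmult_le_compat_l; [lra|].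
    eapply Rle_trans; [eapply energy_le, energy0_le_l1norm, Lv|]. specialize (Q t' Ht'). pose proof (l1norm_ge0 _ _ Lv).
    rewrite <- (sqrt_sqrt (e2 / 2 / c)) by (left; apply Rdiv_lt_0_compat; lra). nra. }
  lra.
Qed.

Lemma existence u0 : in_Hs 0 u0 -> exists u, solution u u0 /\ grows (fun t => fcoef (u t)) u0.
Proof.
  intros H0. destruct (sequence_solution gamma omega beta L u0 H0) as (a & Ha & Hg & Hc).
  exists (fun t x => synth (a t) x).
  assert (Ef : forall t, 0 < t -> fcoef (synth (a t)) = a t).
  { intros t Ht. apply functional_extensionality. intro n. destruct (Ha t t Ht) as [_ HS].
    destruct (HS 1 ltac:(lra)) as [B HB]. eapply fcoef_synth, hs_bound_l1_bound, HB. lra. }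
  split.
  - split; [exact H0|]. split; [now apply sequence_classical|].
    intros eps He. destruct (continuous_at_0 a u0 0 (Rle_refl 0) H0 H0 Hg Hc eps He) as [d [Hd Q]].
    exists d. split; [exact Hd|]. intros t Ht.
    change (fcoef ((fun t x => synth (a t) x) t)) with (fcoef (synth (a t))). rewrite Ef by lra. now apply Q.
  - intros s Hs H t Ht. change (fcoef ((fun t x => synth (a t) x) t)) with (fcoef (synth (a t))). rewrite Ef by exact Ht. now apply Hg.
Qed.

Lemma solution_grows u u0 : solution u u0 -> grows (fun t => fcoef (u t)) u0.
Proof.
  intros Su. pose proof Su as (H0 & _). destruct (existence u0 H0) as (v & Sv & Hg).
  intros s Hs H t Ht. apply (hs_bound_ext s (fcoef (v t))); [|now apply Hg].
  intro n. now apply (solution_unique_coef v u u0).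
Qed.

Lemma solution_trace_Hs u u0 s : solution u u0 -> 0 <= s -> in_Hs s u0 ->
  forall eps, 0 < eps -> exists d, 0 < d /\ forall t, 0 < t < d ->
    in_Hs s (seq_sub (fcoef (u t)) u0) /\ Hs_norm s (seq_sub (fcoef (u t)) u0) < eps.
Proof.
  intros Su Hs H. pose proof Su as (H0 & _ & Htr).
  apply (continuous_at_0 (fun t => fcoef (u t))); auto.
  - now apply solution_grows.
  - intros n eps He. destruct (Htr eps He) as [d [Hd Q]]. exists d. split; [exact Hd|]. intros t Ht.
    destruct (Q t Ht) as [Q1 Q2]. eapply Rle_lt_trans; [|exact Q2].
    exact (coef_le_norm 0 _ n (Rle_refl 0) Q1).
Qed.

Lemma traj_pos u u0 t : 0 < t -> traj u u0 t = fcoef (u t).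
Proof. intros. unfold traj. destruct (Rle_dec t 0); [lra|reflexivity]. Qed.

Lemma traj_0 u u0 : traj u u0 0 = u0.
Proof. unfold traj. destruct (Rle_dec 0 0); [reflexivity|lra]. Qed.

Lemma solution_cont_Hs u u0 s : solution u u0 -> 0 <= s -> in_Hs s u0 -> cont_Hs s u u0.
Proof.
  intros Su Hs H t0 Ht0 eps He.
  destruct (Req_dec t0 0) as [->|Hn].
  - destruct (solution_trace_Hs u u0 s Su Hs H eps He) as [d [Hd Q]]. exists d. split; [exact Hd|].
    intros t Ht Htd. rewrite traj_0. rewrite Rminus_0_r, Rabs_pos_eq in Htd by exact Ht.
    destruct (Req_dec t 0) as [->|Htn].
    + rewrite traj_0. destruct (Hs_self s u0) as [Q1 Q2]. split; [exact Q1|]. rewrite Q2. exact He.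
    + rewrite traj_pos by lra. apply Q. lra.
  - destruct (continuous_at_pos (fun t => fcoef (u t)) s t0 Hs ltac:(lra) (solution_sequence u u0 Su) eps He) as [d [Hd [Hdt Q]]].
    exists d. split; [exact Hd|]. intros t Ht Htd. pose proof Htd as Htd2. apply Rabs_lt_between in Htd2.
    rewrite !traj_pos by lra. now apply Q.
Qed.

(** The halved window keeps its left end positive, where the coefficient equation holds. *)
Lemma solution_smoothing u u0 s j : solution u u0 -> 0 <= s <= INR (S j) -> forall t R2, 0 < t -> 0 <= R2 ->
  (forall t', t - Rmin t 1 / 2 <= t' <= t -> energy 0 (fcoef (u t')) <= R2) ->
  energy s (fcoef (u t)) <= smooth_cst s j R2 / (Rmin t 1 / 2) ^ S (S j).
Proof.
  intros Su Hs t R2 Ht HR HE. set (r := Rmin t 1 / 2) in *.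
  assert (Hr : 0 < r <= / 2).
  { unfold r. split; [apply Rdiv_lt_0_compat; [apply Rmin_glb_lt; lra|lra]|]. pose proof (Rmin_r t 1). lra. }
  assert (Hr2 : r < t) by (pose proof (Rmin_l t 1); unfold r in *; lra).
  destruct (solution_sequence u u0 Su (t - r) t ltac:(lra)) as [He HS].
  apply (smoothing_window gamma omega beta L (fun t => fcoef (u t)) t r s j R2); auto; lra.
Qed.

Lemma inv_min_pow t k : 0 < t -> / (Rmin t 1 / 2) ^ k <= 2 ^ k * (1 + Rpower t (- INR k)).
Proof.
  intros Ht. rewrite Rpower_Ropp, Rpower_pow by exact Ht.
  assert (P : 0 < t ^ k) by (apply pow_lt, Ht). assert (P2 : 0 < 2 ^ k) by (apply pow_lt; lra).
  assert (0 < / t ^ k) by (apply Rinv_0_lt_compat, P).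
  unfold Rmin. destruct (Rle_dec t 1) as [H1|H1].
  - unfold Rdiv. rewrite Rpow_mult_distr, Rinv_mult, pow_inv, Rinv_inv. nra.
  - unfold Rdiv. rewrite Rpow_mult_distr, pow1, Rmult_1_l, pow_inv, Rinv_inv. nra.
Qed.


Lemma lip_cst_mono r r' r2 : 0 <= r <= r' -> lip_cst r r2 <= lip_cst r' r2.
Proof.
  intros H. unfold lip_cst, lip_rate. pose proof (H_cst_mono r r' H). pose proof (H_cst_ge0 r). pose proof (H_cst_ge0 r2).
  pose proof (omega_bd_ge1 omega). set (x := H_cst r + H_cst r2). set (y := H_cst r' + H_cst r2).
  assert (Hxy : omega_bd omega * x <= omega_bd omega * y) by (unfold x, y; apply Rmult_le_compat_l; lra).
  assert (0 <= omega_bd omega * x) by (unfold x; apply Rmult_le_pos; lra). nra.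
Qed.

(** Two regimes. Before a small time tau, chosen before w0, both solutions are compared with u0, and
    [radon_riesz] applies uniformly to all nearby w0. After tau both are bounded in H^(s+1), and the
    Lipschitz estimate in H is interpolated. *)
Lemma continuous_dependence s u0 u T eps : 0 <= s -> in_Hs s u0 -> solution u u0 -> 0 < T -> 0 < eps ->
  exists delta, 0 < delta /\ forall w0 w, in_Hs s w0 -> solution w w0 -> Hs_norm s (seq_sub w0 u0) < delta ->
    forall t, 0 <= t <= T ->
      in_Hs s (seq_sub (traj w w0 t) (traj u u0 t)) /\
      Hs_norm s (seq_sub (traj w w0 t) (traj u u0 t)) < eps.
Proof.
  intros Hs H Su HT He. pose proof Su as (H0 & _).
  set (r0 := Hs_norm 0 u0). set (S0 := Hs_norm s u0).
  assert (Hr0 : 0 <= r0) by apply Hs_norm_ge0. assert (HS0 : 0 <= S0) by apply Hs_norm_ge0.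
  set (e2 := eps / 4). assert (He2 : 0 < e2) by (unfold e2; lra).
  destruct (radon_riesz s u0 (e2 * e2) ltac:(nra) H) as (eta & M & Heta & QR).
  set (G := exp (lip_cst (r0 + 1) r0 * T)).
  assert (HG : 0 < G) by apply exp_pos.
  pose proof (absorb_cst_ge0 beta) as HCd.
  (* The radius r0 + 1 admits every w0 within distance 1 of u0, so the growth rate c serves all of
     them. *)
  set (Rw := (r0 + 1) * (r0 + 1) + absorb_cst beta). assert (HRw : 0 <= Rw) by (unfold Rw; nra).
  set (c := growth_rate s Rw). assert (Hc : 0 < c) by (apply growth_rate_pos; exact HRw).
  set (eta1 := Rmin 1 (eta / (2 * (S0 * S0 + 1)))).
  assert (Heta1 : 0 < eta1).
  { unfold eta1. apply Rmin_glb_lt; [lra|]. apply Rdiv_lt_0_compat; nra. }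
  destruct (exp_near_1 c eta1 ltac:(lra) Heta1) as [t1 [Ht1 Q1]].
  destruct (solution_trace_Hs u u0 0 Su (Rle_refl 0) H0 (eta / 2) ltac:(lra)) as [t2 [Ht2 Q2]].
  destruct (solution_trace_Hs u u0 s Su Hs H e2 He2) as [t3 [Ht3 Q3]].
  set (tau := Rmin t1 (Rmin t2 t3)).
  assert (Htau : 0 < tau) by (unfold tau; repeat apply Rmin_glb_lt; lra).
  assert (Tau1 : tau <= t1) by apply Rmin_l.
  assert (Tau2 : tau <= t2) by (eapply Rle_trans; [apply Rmin_r|apply Rmin_l]).
  assert (Tau3 : tau <= t3) by (eapply Rle_trans; [apply Rmin_r|apply Rmin_r]).
  destruct (nat_above (s + 1)) as [j Hj].
  assert (Hj2 : 0 <= s + 1 <= INR (S j)) by (rewrite S_INR; lra).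
  pose proof (H_cst_ge0 (r0 + 1)) as HRb.
  set (D1 := smooth_cst (s + 1) j (H_cst (r0 + 1)) / (Rmin tau 1 / 2) ^ S (S j)).
  pose proof (smooth_cst_ge0 omega beta (s + 1) j (H_cst (r0 + 1)) ltac:(lra)) as Hsm.
  assert (Hrt : 0 < Rmin tau 1 / 2) by (apply Rdiv_lt_0_compat; [apply Rmin_glb_lt; lra|lra]).
  assert (HD1 : 0 <= D1) by (unfold D1; apply Rdiv_le_0_compat; [exact Hsm|now apply pow_lt]).
  set (D := 2 * D1 + 2 * D1). set (eta2 := e2 * e2 / 2 / (D + 1)).
  assert (HD : 0 <= D) by (unfold D; lra).
  assert (Heta2 : 0 < eta2) by (unfold eta2; apply Rdiv_lt_0_compat; nra).
  set (c2 := Rpower eta2 (- s)). assert (Hc2 : 0 < c2) by apply exp_pos.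
  set (q := sqrt (e2 * e2 / 2 / c2)).
  assert (Hq0 : 0 < e2 * e2 / 2 / c2) by (apply Rdiv_lt_0_compat; nra).
  assert (Hq : 0 < q) by (apply sqrt_lt_R0; exact Hq0).
  (* In order: radius r0 + 1 for w0 and the case t = 0; energy of w0 at most eta / 4 above that of
     u0; coefficients of the two solutions within eta / 2; H distance at most q for t >= tau. *)
  set (dl := Rmin (Rmin 1 e2) (Rmin (eta / (4 * (2 * S0 + 1))) (Rmin (eta / (2 * G)) (q / G)))).
  assert (P1 : 0 < eta / (4 * (2 * S0 + 1))) by (apply Rdiv_lt_0_compat; lra).
  assert (P2 : 0 < eta / (2 * G)) by (apply Rdiv_lt_0_compat; lra).
  assert (P3 : 0 < q / G) by (apply Rdiv_lt_0_compat; lra).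
  assert (Hdl : 0 < dl) by (unfold dl; repeat apply Rmin_glb_lt; lra).
  assert (dl1 : dl <= 1) by (eapply Rle_trans; [apply Rmin_l|apply Rmin_l]).
  assert (dl2 : dl <= e2) by (eapply Rle_trans; [apply Rmin_l|apply Rmin_r]).
  assert (dl3 : dl <= eta / (4 * (2 * S0 + 1))) by (eapply Rle_trans; [apply Rmin_r|apply Rmin_l]).
  assert (dl4 : dl <= eta / (2 * G)) by (eapply Rle_trans; [apply Rmin_r|eapply Rle_trans; [apply Rmin_r|apply Rmin_l]]).
  assert (dl5 : dl <= q / G) by (eapply Rle_trans; [apply Rmin_r|eapply Rle_trans; [apply Rmin_r|apply Rmin_r]]).
  assert (dl3' : dl * (2 * S0 + 1) <= eta / 4).
  { apply (Rmult_le_compat_r (2 * S0 + 1)) in dl3; [|lra]. eapply Rle_trans; [exact dl3|]. right. field. lra. }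
  assert (dl4' : G * dl <= eta / 2).
  { apply (Rmult_le_compat_l G) in dl4; [|lra]. eapply Rle_trans; [exact dl4|]. right. field. lra. }
  assert (dl5' : G * dl <= q).
  { apply (Rmult_le_compat_l G) in dl5; [|lra]. eapply Rle_trans; [exact dl5|]. right. field. lra. }
  exists dl. split; [exact Hdl|]. intros w0 w Hw0 Sw Hdist t Ht.
  pose proof Sw as (Hw00 & _).
  assert (Hd : in_Hs s (seq_sub w0 u0)) by now apply Hs_sub.
  destruct (Hs_of_sub s w0 u0 Hd H) as [_ Nw]. fold S0 in Nw.
  assert (Hd0 : in_Hs 0 (seq_sub w0 u0)) by now apply Hs_sub.
  assert (Nd0 : Hs_norm 0 (seq_sub w0 u0) <= dl).
  { eapply Rle_trans; [eapply (Hs_norm_mono 0 s); [exact Hs|apply in_Hs_hs_bound, Hd]|lra]. }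
  destruct (Hs_of_sub 0 w0 u0 Hd0 H0) as [_ Nw0]. fold r0 in Nw0.
  pose proof (Hs_norm_ge0 0 w0) as Pw0.
  destruct (Req_dec t 0) as [->|Htn].
  { rewrite !traj_0. split; [exact Hd|]. unfold e2 in dl2. lra. }
  assert (Htp : 0 < t) by lra. rewrite !traj_pos by exact Htp.
  assert (Iw : forall s', 0 <= s' -> in_Hs s' (fcoef (w t))) by (intros; now apply (solution_in_H w w0 t Sw Htp)).
  assert (Iu : forall s', 0 <= s' -> in_Hs s' (fcoef (u t))) by (intros; now apply (solution_in_H u u0 t Su Htp)).
  assert (Hv : in_Hs s (seq_sub (fcoef (w t)) (fcoef (u t)))) by (apply Hs_sub; auto).
  split; [exact Hv|].
  destruct (solution_lipschitz w u w0 u0 Sw Su t Htp) as [V1 V2].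
  assert (V3 : Hs_norm 0 (seq_sub (fcoef (w t)) (fcoef (u t))) <= G * dl).
  { eapply Rle_trans; [exact V2|]. apply Rmult_le_compat; [left; apply exp_pos|apply Hs_norm_ge0| |exact Nd0].
    unfold G. apply exp_mono. fold r0.
    pose proof (lip_cst_mono (Hs_norm 0 w0) (r0 + 1) r0 ltac:(lra)) as KM. pose proof (lip_cst_pos (Hs_norm 0 w0) r0) as KP.
    nra. }
  destruct (Rlt_dec t tau) as [Hsmall|Hlarge].
  - assert (W1 : Hs_norm s (seq_sub (fcoef (w t)) u0) <= e2).
    { assert (Hin : in_Hs s (seq_sub (fcoef (w t)) u0)) by (apply Hs_sub; auto).
      eapply Hs_norm_le; [apply in_Hs_hs_bound, Hin|lra|]. apply QR; [auto| |].
      - intros n _. eapply Rle_trans; [apply (Cmod_sub_triangle _ (fcoef (u t) n))|].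
        destruct (Q2 t ltac:(lra)) as [T1 T2].
        pose proof (coef_le_norm 0 _ n (Rle_refl 0) V1) as X1. pose proof (coef_le_norm 0 _ n (Rle_refl 0) T1) as X2.
        unfold seq_sub in X1 at 1. unfold seq_sub in X2 at 1. lra.
      - pose proof (solution_grows w w0 Sw s Hs Hw0 t Htp) as HB. eapply Rle_trans; [eapply energy_le, HB|].
        assert (X1 : exp (growth_rate s (energy 0 w0 + absorb_cst beta) * t) <= 1 + eta1).
        { eapply Rle_trans; [|apply (Q1 t); lra]. apply exp_mono. apply Rmult_le_compat_r; [lra|].
          apply growth_rate_mono. pose proof (energy_ge0 _ _ _ (in_Hs_hs_bound _ _ Hw00)). split; [lra|]. unfold Rw.
          pose proof (Hs_norm_energy_le 0 w0 _ (r0 + 1) (in_Hs_hs_bound _ _ Hw00) ltac:(lra)). lra. }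
        pose proof (Hs_norm_energy_le s w0 _ (S0 + dl) (in_Hs_hs_bound _ _ Hw0) ltac:(lra)) as X2.
        pose proof (Hs_norm_sq s u0 _ (in_Hs_hs_bound _ _ H)) as X3. fold S0 in X3. rewrite <- X3.
        pose proof (energy_ge0 _ _ _ (in_Hs_hs_bound _ _ Hw0)) as X4.
        assert (e11 : eta1 <= 1) by apply Rmin_l.
        assert (e12 : eta1 * (S0 * S0) <= eta / 2).
        { apply Rle_trans with (eta / (2 * (S0 * S0 + 1)) * (S0 * S0 + 1)).
          - apply Rmult_le_compat; [lra|nra|apply Rmin_r|lra].
          - right. field. nra. }
        assert (X5 : energy s w0 <= S0 * S0 + eta / 4) by nra.
        apply Rle_trans with ((1 + eta1) * (S0 * S0 + eta / 4)).
        + apply Rmult_le_compat; try lra. left; apply exp_pos.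
        + nra. }
    destruct (Q3 t ltac:(lra)) as [T1 T2]. destruct (Hs_sub_sym _ _ _ T1) as [trilinear T4].
    assert (Hin : in_Hs s (seq_sub (fcoef (w t)) u0)) by (apply Hs_sub; auto).
    destruct (Hs_sub_triangle s _ _ _ Hin trilinear) as [_ Tr]. unfold e2 in *. lra.
  - assert (Sm : forall z z0, solution z z0 -> Hs_norm 0 z0 <= r0 + 1 -> hs_bound (s + 1) (fcoef (z t)) D1).
    { intros z z0 Sz Hz. pose proof Sz as (Hz0 & _).
      eapply sum_bound_weaken; [apply in_Hs_hs_bound, (solution_in_H z z0 t Sz Htp); lra|].
      eapply Rle_trans; [apply (solution_smoothing z z0 (s + 1) j Sz Hj2 t (H_cst (r0 + 1)) Htp); [lra|]|].
      - intros t' Ht'. assert (Htp' : 0 < t') by (pose proof (Rmin_l t 1); lra).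
        eapply Rle_trans; [apply (solution_bound z z0 Sz t' Htp')|]. apply H_cst_mono.
        split; [apply Hs_norm_ge0|exact Hz].
      - unfold D1. apply Rmult_le_compat_l; [exact Hsm|]. apply Rinv_le_contravar; [now apply pow_lt|].
        apply pow_incr. split; [lra|].
        assert (Rmin tau 1 <= Rmin t 1) by (apply Rle_min_compat_r; lra). lra. }
    assert (HBv : hs_bound (s + 1) (seq_sub (fcoef (w t)) (fcoef (u t))) D).
    { apply hs_bound_sub; [apply (Sm w w0 Sw); lra|apply (Sm u u0 Su); fold r0; lra]. }
    apply Rle_lt_trans with e2; [|unfold e2; lra].
    eapply Hs_norm_le; [apply in_Hs_hs_bound, Hv|lra|].
    eapply Rle_trans; [apply (energy_interp_eps s _ _ eta2 Hs Heta2 HBv)|]. fold c2.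
    assert (J1 : eta2 * energy (s + 1) (seq_sub (fcoef (w t)) (fcoef (u t))) <= e2 * e2 / 2).
    { apply Rle_trans with (eta2 * (D + 1)); [apply Rmult_le_compat_l; [lra|]; pose proof (energy_le _ _ _ HBv); lra|].
      unfold eta2. right. field. lra. }
    assert (J2 : c2 * energy 0 (seq_sub (fcoef (w t)) (fcoef (u t))) <= e2 * e2 / 2).
    { apply Rle_trans with (c2 * (e2 * e2 / 2 / c2)); [|right; field; lra]. apply Rmult_le_compat_l; [lra|].
      rewrite <- (sqrt_sqrt (e2 * e2 / 2 / c2)) by lra. fold q.
      eapply Rle_trans; [eapply Hs_norm_energy_le; [apply in_Hs_hs_bound, V1|exact V3]|].
      assert (0 <= G * dl) by (apply Rmult_le_pos; lra). nra. }
    lra.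
Qed.

(** * Smoothing and dissipative bounds for the norm *)

Definition smooth_bd (s : R) (j : nat) (r : R) : R := sqrt (2 ^ S (S j) * smooth_cst s j (H_cst r)).

Lemma smooth_bd_nondecr s j : nondecr (smooth_bd s j).
Proof.
  intros a b H. unfold smooth_bd. apply sqrt_le_1_alt. apply Rmult_le_compat_l; [apply pow_le; lra|].
  apply smooth_cst_mono. pose proof (H_cst_ge0 a). split; [lra|]. now apply H_cst_mono.
Qed.

(** The energy carries one factor p = 1 + t^(-k), the square of the claimed bound two; as p >= 1,
    this gives away only a square root. The power 2^k in [smooth_bd] comes from the halved
    window. *)
Lemma smoothing_norm u u0 s j : solution u u0 -> 0 <= s <= INR (S j) -> forall t r, 0 < t ->
  (forall t', t - Rmin t 1 / 2 <= t' <= t -> energy 0 (fcoef (u t')) <= H_cst r) ->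
  Hs_norm s (fcoef (u t)) <= (1 + Rpower t (- INR (S (S j)))) * smooth_bd s j r.
Proof.
  intros Su Hs t r Ht HE. pose proof (H_cst_ge0 r) as HRb.
  pose proof (smooth_cst_ge0 omega beta s j (H_cst r) ltac:(lra)) as Hsm.
  pose proof (solution_smoothing u u0 s j Su Hs t (H_cst r) Ht ltac:(lra) HE) as Q.
  set (p := 1 + Rpower t (- INR (S (S j)))).
  assert (Hp : 1 <= p) by (unfold p; pose proof (exp_pos (- INR (S (S j)) * ln t)); unfold Rpower; lra).
  assert (Hm : 0 <= 2 ^ S (S j) * smooth_cst s j (H_cst r)) by (apply Rmult_le_pos; [apply pow_le; lra|exact Hsm]).
  eapply Hs_norm_le; [apply in_Hs_hs_bound, (solution_in_H u u0 t Su Ht); lra| |].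
  - apply Rmult_le_pos; [lra|apply sqrt_pos].
  - eapply Rle_trans; [exact Q|].
    pose proof (inv_min_pow t (S (S j)) Ht) as Q2. fold p in Q2.
    apply (Rmult_le_compat_l _ _ _ Hsm) in Q2.
    unfold smooth_bd. replace (p * sqrt (2 ^ S (S j) * smooth_cst s j (H_cst r)) * (p * sqrt (2 ^ S (S j) * smooth_cst s j (H_cst r))))
      with (p * p * (sqrt (2 ^ S (S j) * smooth_cst s j (H_cst r)) * sqrt (2 ^ S (S j) * smooth_cst s j (H_cst r)))) by ring.
    rewrite sqrt_sqrt by exact Hm. unfold Rdiv.
    apply Rle_trans with (p * (2 ^ S (S j) * smooth_cst s j (H_cst r))); [lra|]. apply Rmult_le_compat_r; [exact Hm|]. nra.
Qed.

(** One summand per regime in which the data still matter: growth for t <= 1, and smoothing for t >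
    1 while exp (- (t - 1/2)) r^2 exceeds 1. Each bound is multiplied by a factor at least 1
    containing exp (- t), namely e exp (- t) or e r^2 exp (- t). *)
Definition dissip_bd (s : R) (j : nat) (r : R) : R :=
  exp 1 * (exp (growth_rate s (H_cst r)) * r) + exp 1 * (2 * smooth_bd s j r * (r * r)).

Lemma dissip_bd_nondecr s j : nondecr (dissip_bd s j).
Proof.
  intros a b H. unfold dissip_bd. pose proof (H_cst_ge0 a). pose proof (H_cst_mono a b H).
  pose proof (smooth_bd_nondecr s j a b H) as Q. pose proof (sqrt_pos (2 ^ S (S j) * smooth_cst s j (H_cst a))) as Q0. fold (smooth_bd s j a) in Q0.
  pose proof (exp_pos 1). pose proof (exp_mono _ _ (growth_rate_mono omega beta s (H_cst a) (H_cst b) ltac:(lra))) as Q1.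
  pose proof (exp_pos (growth_rate s (H_cst a))).
  apply Rplus_le_compat; apply Rmult_le_compat_l; try lra.
  - apply Rmult_le_compat; lra.
  - apply Rmult_le_compat; nra.
Qed.

Lemma dissipative u u0 s j : solution u u0 -> in_Hs s u0 -> 0 <= s <= INR (S j) -> forall t, 0 < t ->
  Hs_norm s (fcoef (u t)) <= dissip_bd s j (Hs_norm s u0) * exp (- 1 * t) + (2 * smooth_bd s j 1 + 1).
Proof.
  intros Su H Hs t Ht. pose proof Su as (H0 & _). set (r := Hs_norm s u0).
  assert (Hr : 0 <= r) by apply Hs_norm_ge0.
  assert (Hr0 : Hs_norm 0 u0 <= r) by (apply (Hs_norm_mono 0 s u0 _ ltac:(lra) (in_Hs_hs_bound _ _ H))).
  pose proof (Hs_norm_ge0 0 u0) as Hr00.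
  pose proof (exp_pos (- 1 * t)) as Pe. pose proof (exp_pos 1) as P1.
  pose proof (sqrt_pos (2 ^ S (S j) * smooth_cst s j (H_cst r))) as Q0. fold (smooth_bd s j r) in Q0.
  pose proof (sqrt_pos (2 ^ S (S j) * smooth_cst s j (H_cst 1))) as Q01. fold (smooth_bd s j 1) in Q01.
  pose proof (exp_pos (growth_rate s (H_cst r))) as PC.
  assert (X1 : 0 <= exp 1 * (exp (growth_rate s (H_cst r)) * r)) by (apply Rmult_le_pos; [lra|apply Rmult_le_pos; lra]).
  assert (X2 : 0 <= exp 1 * (2 * smooth_bd s j r * (r * r))) by (apply Rmult_le_pos; [lra|nra]).
  unfold dissip_bd. rewrite Rmult_plus_distr_r.
  assert (Y1 : 0 <= exp 1 * (exp (growth_rate s (H_cst r)) * r) * exp (- 1 * t)) by (apply Rmult_le_pos; lra).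
  assert (Y2 : 0 <= exp 1 * (2 * smooth_bd s j r * (r * r)) * exp (- 1 * t)) by (apply Rmult_le_pos; lra).
  destruct (Rle_dec t 1) as [Ht1|Ht1].
  - assert (Q : Hs_norm s (fcoef (u t)) <= exp (growth_rate s (H_cst r)) * r).
    { pose proof (solution_grows u u0 Su s ltac:(lra) H t Ht) as HB.
      pose proof (energy_ge0 _ _ _ (in_Hs_hs_bound _ _ H0)) as HE0. pose proof (absorb_cst_ge0 beta) as HCd.
      pose proof (Hs_norm_energy_le 0 u0 _ r (in_Hs_hs_bound _ _ H0) Hr0) as HE0r.
      assert (HR : 0 <= energy 0 u0 + absorb_cst beta <= H_cst r) by (unfold H_cst; nra).
      pose proof (growth_rate_mono omega beta s _ _ HR) as CM. pose proof (growth_rate_pos omega beta s (energy 0 u0 + absorb_cst beta) (proj1 HR)) as CP.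
      eapply Hs_norm_le; [exact HB|apply Rmult_le_pos; lra|].
      eapply Rle_trans; [eapply energy_le, HB|]. rewrite <- (Hs_norm_sq s u0 _ (in_Hs_hs_bound _ _ H)). fold r.
      replace (exp (growth_rate s (H_cst r)) * r * (exp (growth_rate s (H_cst r)) * r)) with (exp (growth_rate s (H_cst r)) * exp (growth_rate s (H_cst r)) * (r * r)) by ring.
      apply Rmult_le_compat_r; [nra|]. rewrite <- exp_plus. apply exp_mono.
      assert (growth_rate s (energy 0 u0 + absorb_cst beta) * t <= growth_rate s (energy 0 u0 + absorb_cst beta) * 1) by (apply Rmult_le_compat_l; lra). lra. }
    assert (Z : 1 <= exp 1 * exp (- 1 * t)) by (rewrite <- exp_plus; apply exp_ge_1; lra).
    assert (exp (growth_rate s (H_cst r)) * r * 1 <= exp (growth_rate s (H_cst r)) * r * (exp 1 * exp (- 1 * t))).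
    { apply Rmult_le_compat_l; [apply Rmult_le_pos; lra|exact Z]. }
    lra.
  - assert (Hmin : Rmin t 1 = 1) by (apply Rmin_right; lra).
    assert (Rp : 1 + Rpower t (- INR (S (S j))) <= 2).
    { assert (Rpower t (- INR (S (S j))) <= 1); [|lra].
      unfold Rpower. rewrite <- exp_0. apply exp_mono.
      assert (0 <= ln t) by (rewrite <- ln_1; apply ln_le; lra). pose proof (pos_INR (S (S j))). nra. }
    (* If the decaying part is at most 1 already at the start t - 1/2 of the window, the bound is
       independent of the data. If not, e r^2 exp (- t) > 1 turns any bound in r into a decaying
       one. *)
    destruct (Rle_dec (exp (- (t - / 2)) * (r * r)) 1) as [Hsm|Hbig].
    + assert (Q : Hs_norm s (fcoef (u t)) <= (1 + Rpower t (- INR (S (S j)))) * smooth_bd s j 1).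
      { apply (smoothing_norm u u0 s j Su Hs t 1 Ht). intros t' Ht'. rewrite Hmin in Ht'.
        eapply Rle_trans; [apply (solution_L2 u u0 Su t'); lra|]. unfold H_cst.
        pose proof (Hs_norm_energy_le 0 u0 _ r (in_Hs_hs_bound _ _ H0) Hr0) as HE0.
        pose proof (energy_ge0 _ _ _ (in_Hs_hs_bound _ _ H0)) as HE00.
        assert (exp (- t') * energy 0 u0 <= exp (- (t - / 2)) * (r * r)).
        { apply Rmult_le_compat; [left; apply exp_pos|exact HE00| |exact HE0]. apply exp_mono. lra. }
        lra. }
      assert ((1 + Rpower t (- INR (S (S j)))) * smooth_bd s j 1 <= 2 * smooth_bd s j 1) by (apply Rmult_le_compat_r; lra).
      lra.
    + assert (Q : Hs_norm s (fcoef (u t)) <= (1 + Rpower t (- INR (S (S j)))) * smooth_bd s j r).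
      { apply (smoothing_norm u u0 s j Su Hs t r Ht). intros t' Ht'. rewrite Hmin in Ht'.
        eapply Rle_trans; [apply (solution_bound u u0 Su t'); lra|]. apply H_cst_mono. lra. }
      assert (Q2 : (1 + Rpower t (- INR (S (S j)))) * smooth_bd s j r <= 2 * smooth_bd s j r * 1) by nra.
      assert (Z : 1 <= exp 1 * (r * r) * exp (- 1 * t)).
      { apply Rle_trans with (exp (- (t - / 2)) * (r * r)); [lra|].
        replace (exp 1 * (r * r) * exp (-1 * t)) with (exp 1 * exp (- 1 * t) * (r * r)) by ring.
        apply Rmult_le_compat_r; [nra|]. rewrite <- exp_plus. apply exp_mono. lra. }
      assert (2 * smooth_bd s j r * 1 <= 2 * smooth_bd s j r * (exp 1 * (r * r) * exp (- 1 * t))) by (apply Rmult_le_compat_l; lra).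
      lra.
Qed.

End Equation.

Theorem theorem3p1 (gamma omega : R) (beta : C) :
  (* well-posedness in every H^s, s >= 0, for every L *)
  (forall (s L : R), 0 <= s ->
     (forall u0, in_Hs s u0 ->
        exists u, solution gamma omega beta L u u0 /\ cont_Hs s u u0) /\
     (forall u v u0, solution gamma omega beta L u u0 ->
        solution gamma omega beta L v u0 -> forall t x, 0 < t -> u t x = v t x) /\
     (forall u0 u, in_Hs s u0 -> solution gamma omega beta L u u0 ->
        forall T eps, 0 < T -> 0 < eps -> exists delta, 0 < delta /\
          forall w0 w, in_Hs s w0 -> solution gamma omega beta L w w0 ->
            Hs_norm s (seq_sub w0 u0) < delta ->
            forall t, 0 <= t <= T ->
              in_Hs s (seq_sub (traj w w0 t) (traj u u0 t)) /\
              Hs_norm s (seq_sub (traj w w0 t) (traj u u0 t)) < eps)) /\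
  (* dissipative estimate, constants uniform in L *)
  (forall s, 0 <= s ->
     exists (Q : R -> R) (kappa Cst : R), nondecr Q /\ 0 < kappa /\ 0 < Cst /\
       forall L u u0, in_Hs s u0 -> solution gamma omega beta L u u0 ->
         forall t, 0 <= t ->
           in_Hs s (traj u u0 t) /\
           Hs_norm s (traj u u0 t) <= Q (Hs_norm s u0) * exp (- kappa * t) + Cst) /\
  (* smoothing property, uniform in L *)
  (forall s, 0 <= s ->
     exists (Qt : R -> R) (N : R), nondecr Qt /\
       forall L u u0, solution gamma omega beta L u u0 ->
         forall t, 0 < t ->
           in_Hs s (traj u u0 t) /\
           Hs_norm s (traj u u0 t) <= (1 + Rpower t (- N)) * Qt (Hs_norm 0 u0)) /\
  (* Lipschitz continuity in H, K independent of L and t *)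
  (exists K : R -> R -> R,
     forall L u1 u2 u10 u20,
       solution gamma omega beta L u1 u10 -> solution gamma omega beta L u2 u20 ->
       forall t, 0 <= t ->
         in_Hs 0 (seq_sub (traj u1 u10 t) (traj u2 u20 t)) /\
         Hs_norm 0 (seq_sub (traj u1 u10 t) (traj u2 u20 t))
           <= exp (K (Hs_norm 0 u10) (Hs_norm 0 u20) * t) * Hs_norm 0 (seq_sub u10 u20)).
Proof.
  split; [|split; [|split]].
  - intros s L Hs. split; [|split].
    + intros u0 H.
      assert (H0 : in_Hs 0 u0) by (eapply hs_bound_in_Hs, hs_bound_le with (1 := Hs), in_Hs_hs_bound, H).
      destruct (existence gamma omega beta L u0 H0) as (u & Su & _). exists u. split; [exact Su|].
      exact (solution_cont_Hs gamma omega beta L u u0 s Su Hs H).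
    + intros u v u0. apply solution_unique.
    + intros u0 u H Su T eps HT He. exact (continuous_dependence gamma omega beta L s u0 u T eps Hs H Su HT He).
  (* Smoothing uses the power k = j + 2 of time, and s <= j + 1 is the condition s <= k - 1 of
     [smoothing_weight]. *)
  - intros s Hs. destruct (nat_above s) as [j Hj].
    assert (Hj2 : 0 <= s <= INR (S j)) by (rewrite S_INR; lra).
    exists (dissip_bd omega beta s j), 1, (2 * smooth_bd omega beta s j 1 + 1).
    pose proof (sqrt_pos (2 ^ S (S j) * smooth_cst omega beta s j (H_cst beta 1))) as Q01. fold (smooth_bd omega beta s j 1) in Q01.
    split; [apply dissip_bd_nondecr|]. split; [lra|]. split; [lra|].
    intros L u u0 H Su t Ht. destruct (Req_dec t 0) as [->|Htn].
    (* At t = 0 the trajectory is u0 itself, so Q must dominate the identity; its growth part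
       does. *)
    + rewrite traj_0. split; [exact H|]. rewrite Rmult_0_r, exp_0, Rmult_1_r.
      pose proof (Hs_norm_ge0 s u0) as Hr. set (r := Hs_norm s u0) in *. unfold dissip_bd.
      pose proof (H_cst_ge0 beta r) as HRb. pose proof (growth_rate_pos omega beta s (H_cst beta r) ltac:(lra)) as HC.
      pose proof (sqrt_pos (2 ^ S (S j) * smooth_cst omega beta s j (H_cst beta r))) as Q0. fold (smooth_bd omega beta s j r) in Q0.
      assert (E1 : 1 <= exp 1) by (apply exp_ge_1; lra).
      assert (E2 : 1 <= exp (growth_rate omega beta s (H_cst beta r))) by (apply exp_ge_1; lra).
      assert (0 <= exp 1 * (2 * smooth_bd omega beta s j r * (r * r))) by (apply Rmult_le_pos; [lra|nra]).
      assert (r <= exp (growth_rate omega beta s (H_cst beta r)) * r) by nra.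
      nra.
    + rewrite traj_pos by lra. split.
      * apply (solution_in_H gamma omega beta L u u0 t Su); lra.
      * apply (dissipative gamma omega beta L u u0 s j Su H Hj2 t). lra.
  - intros s Hs. destruct (nat_above s) as [j Hj].
    assert (Hj2 : 0 <= s <= INR (S j)) by (rewrite S_INR; lra).
    exists (smooth_bd omega beta s j), (INR (S (S j))). split; [apply smooth_bd_nondecr|].
    intros L u u0 Su t Ht. rewrite traj_pos by exact Ht. split.
    + now apply (solution_in_H gamma omega beta L u u0 t Su).
    + apply (smoothing_norm gamma omega beta L u u0 s j Su Hj2 t _ Ht). intros t' Ht'.
      apply (solution_bound gamma omega beta L u u0 Su). pose proof (Rmin_l t 1). lra.
  - exists (lip_cst omega beta). intros L u1 u2 u10 u20 S1 S2 t Ht.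
    destruct (Req_dec t 0) as [->|Htn].
    + rewrite !traj_0, Rmult_0_r, exp_0, Rmult_1_l. split; [|lra].
      destruct S1 as (H1 & _). destruct S2 as (H2 & _). now apply Hs_sub.
    + rewrite !traj_pos by lra. apply (solution_lipschitz gamma omega beta L); auto. lra.
Qed.
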